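(* Let $m,n\in\mathbb{N}$. There are a function $\varepsilon(d)$, independent of $N$, with $\varepsilon(d)\to0$ as $d\to\infty$, and a constant $K_{m+n}$ such that the following holds. For all $N$, all $d>0$, and all points $z_1,\ldots,z_{m+n},z'_1,\ldots,z'_{m+n}\in\mathcal{Z}$ such that the cloud $\{z_j,z'_j:1\le j\le m\}$ has distance $\ge d$ from the cloud $\{z_j,z'_j:m+1\le j\le m+n\}$, $$\bigl|\rho_{m+n}^{N,\mathcal{Z}}(z_1,\ldots,z_{m+n};z'_1,\ldots,z'_{m+n})-\rho_m^{N,\mathcal{Z}}(z_1,\ldots,z_m;z'_1,\ldots,z'_m)\,\rho_n^{N,\mathcal{Z}}(z_{m+1},\ldots,z_{m+n};z'_{m+1},\ldots,z'_{m+n})\bigr|\le K_{m+n}\varepsilon(d).$$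
   Context: Setting. $\mathcal{Z}=\mathbb{R}\times[0,2\pi R]$ is a cylinder of radius $R>0$, with points $z=x+iy$ and measure $dx\,dy$. Fix $\ell>0$ and $p\in\mathbb{N}$. Laughlin's function. For $N\in\mathbb{N}$, $$\Psi_N(z_1,\ldots,z_N)=\kappa_N\prod_{j<k}\bigl(e^{z_k/R}-e^{z_j/R}\bigr)^p\exp\Bigl(-\frac{1}{2\ell^2}\sum_k x_k^2\Bigr),$$ with $\kappa_N>0$ a constant. Correlation functions. For $k\le N$, $$\rho_k^{N,\mathcal{Z}}(z_1,\ldots,z_k;z'_1,\ldots,z'_k)=\frac{N!}{(N-k)!\,\|\Psi_N\|^2}\int_{\mathcal{Z}^{N-k}}\Psi_N(z_1,\ldots,z_k,z_{k+1},\ldots,z_N)\,\overline{\Psi_N(z'_1,\ldots,z'_k,z_{k+1},\ldots,z_N)}\,\prod_{j>k}dx_j\,dy_j .$$ The norm $\|\cdot\|$ is the $L^2(\mathcal{Z}^N)$ norm. *)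

(* Defs.v *)
(* R : realType, complex numbers R[i] from
   mathcomp-real-closed, Lebesgue measure and Rintegral from mathcomp-analysis. *)
From mathcomp Require Import all_boot all_order all_algebra.
From mathcomp Require Import all_classical all_reals all_analysis.
From mathcomp Require Import complex.
Import GRing.Theory Num.Theory.
Import numFieldNormedType.Exports.
Local Open Scope classical_set_scope.
Local Open Scope ring_scope.

Set Implicit Arguments.
Unset Strict Implicit.
Unset Printing Implicit Defensive.

Section Laughlin.
Variable R : realType.

(* Points z = x + i y of the plane are represented as pairs (x, y) : R * R. *)

(* The cylinder Z = R x [0, 2 pi Rc] of radius Rc. *)
Definition cylZ (Rc : R) : set (R * R) :=
  [set z | 0 <= z.2 /\ z.2 <= 2 * pi * Rc].

(* Lebesgue measure dx dy on R^2 (product measure). *)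
Definition leb2 := ((@lebesgue_measure R) \x (@lebesgue_measure R))%E.

(* e^{z/Rc} for z = x + i y. *)
Definition expz (Rc : R) (z : R * R) : R[i] :=
  Complex (expR (z.1 / Rc) * cos (z.2 / Rc)) (expR (z.1 / Rc) * sin (z.2 / Rc)).

(* Laughlin's function Psi_N(z_1,...,z_N), N = size zs, with normalising
   constant kappa N. *)
Definition laughlin (Rc ell : R) (p : nat) (kappa : nat -> R)
    (zs : seq (R * R)) : R[i] :=
  let N := size zs in
  (kappa N)%:C%C *
  (\prod_(k < N) \prod_(j < k)
      (expz Rc (nth (0, 0) zs k) - expz Rc (nth (0, 0) zs j)) ^+ p) *
  (expR (- (1 / (2 * ell ^+ 2)) * \sum_(k < N) (nth (0, 0) zs k).1 ^+ 2))%:C%C.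

(* Integral over Z^M (w.r.t. prod dx_j dy_j) of F : seq (R*R) -> R applied to
   the list of the M integration variables, computed as an iterated integral. *)
Fixpoint intZ (Rc : R) (M : nat) (F : seq (R * R) -> R) : R :=
  match M with
  | 0 => F [::]
  | M'.+1 => Rintegral leb2 (cylZ Rc)
               (fun w => intZ Rc M' (fun ws => F (w :: ws)))
  end.

(* Complex-valued version: integrate real and imaginary parts. *)
Definition intZc (Rc : R) (M : nat) (F : seq (R * R) -> R[i]) : R[i] :=
  Complex (intZ Rc M (fun ws => complex.Re (F ws)))
          (intZ Rc M (fun ws => complex.Im (F ws))).

(* ||Psi_N||^2 in L^2(Z^N). *)
Definition laughlin_norm2 (Rc ell : R) (p : nat) (kappa : nat -> R) (N : nat) : R :=
  intZ Rc N (fun ws => (ComplexField.Normc.normc (laughlin Rc ell p kappa ws)) ^+ 2).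

(* k-particle correlation function rho_k^{N,Z}(zs ; zs'), k = size zs
   (= size zs'), meaningful for k <= N. *)
Definition rho (Rc ell : R) (p : nat) (kappa : nat -> R) (N : nat)
    (zs zs' : seq (R * R)) : R[i] :=
  let k := size zs in
  (((N`!)%:R / ((N - k)`!)%:R / laughlin_norm2 Rc ell p kappa N)%:C%C) *
  intZc Rc (N - k)
    (fun ws => laughlin Rc ell p kappa (zs ++ ws) *
               ((laughlin Rc ell p kappa (zs' ++ ws))^*)%C).

(* Intrinsic (geodesic) distance on the cylinder, for points with
   y-coordinates in [0, 2 pi Rc]. *)
Definition dcyl (Rc : R) (a b : R * R) : R :=
  Num.sqrt ((a.1 - b.1) ^+ 2 +
            (Num.min `|a.2 - b.2| (2 * pi * Rc - `|a.2 - b.2|)) ^+ 2).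

(* The list of points [z a; z (a+1); ...; z (a+len-1)]. *)
Definition pts (z : nat -> R * R) (a len : nat) : seq (R * R) :=
  [seq z i | i <- iota a len].

End Laughlin.

(* Main.v *)
Require Import Defs.
From mathcomp Require Import all_boot all_order all_algebra.
From mathcomp Require Import all_classical all_reals all_analysis.
From mathcomp Require Import measurable_realfun complex.
From mathcomp Require Import zify ring lra.
Import Order.TTheory GRing.Theory Num.Theory.
Import numFieldNormedType.Exports.

Set Implicit Arguments.
Unset Strict Implicit.
Unset Printing Implicit Defensive.

Local Open Scope classical_set_scope.
Local Open Scope ring_scope.

(* Expanding the power of the Vandermonde product in monomials turns Psi_N into a sum over
   occupation configurations s of Landau orbitals, with real amplitudes bw s. The phases make
   the orbitals orthogonal, so rho_k is a Gaussian-weighted sum of the lattice correlations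
   QQ N m m'. Dominance (any k particles of a configuration with non-zero amplitude have
   total momentum at least p k(k-1)/2) singles out cuts, sites where it is sharp and where
   the amplitude factorises into a left and a right part. Comparing with a lattice plasma
   one finds C_N <= K C_k C_(N-k) for the partition function, so cuts have a positive
   density, all moments of occupation numbers are bounded, and by a renewal argument two
   independent configurations have a common cut in any long window, up to a small
   probability. Taking two independent copies and exchanging their tails at the first common
   cut shows that correlations factorise across long windows, while dominance shows that
   QQ N m m' is small when m and m' have different numbers of marks left of the window.
   Gaussian decay carries both facts over to rho, for clouds separated along the axis of the
   cylinder. Interleaved clouds are treated by splitting off leftmost groups of points; a
   large geodesic distance forces a large distance along the axis. *)

(** * Sums over configurations *)

(** The ratio [ell / Rc] is arbitrary and the amplitudes have no closed form, so sums over
    configurations have to be compared as a whole. The analytic input is Parseval's identity on a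
    finite grid of angles: it turns a sum of squared amplitudes into a mean of the squared modulus
    of the Vandermonde power, whose factors can be split between blocks of particles. Splitting
    costs exp(2p I), where I is the sum of e^(-g|x-y|) over the pairs across the split. This is
    unbounded when particles pile up, and the largest piece of work is to show that crowded runs are
    exponentially rare. A second obstacle is that the two amplitudes in a correlation share the
    unmarked particles but carry different marks, so a cut of one need not be a cut of the other.
    Convexity of the minimal momentum shows that long windows force the cuts to agree, or else force
    unequal numbers of marks into the small remainder. The gap between common cuts is only known to
    have a finite mean, so smallness comes from the tail of a convergent series, without an explicit
    rate. *)

Section Seqs.
Variables (T : eqType).

(** Plain lists instead of tuples over a finite type, so that configurations can be concatenated,
    masked and filtered without casts while the set of sites varies. *)
Fixpoint seqs (r : seq T) (M : nat) : seq (seq T) :=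
  if M is M'.+1 then [seq i :: s | i <- r, s <- seqs r M'] else [:: [::]].

Arguments seqs : simpl never.

Lemma mem_seqs r M s : (s \in seqs r M) = (size s == M) && all (mem r) s.
Proof.
elim: M s => [|M IH] s; first by case: s.
apply/allpairsP/idP => [[[i t] /= [ir]]|].
  by rewrite IH => /andP[/eqP st al] ->; rewrite /= st eqxx ir.
case: s => [|i s] //=; rewrite eqSS => /and3P[ss ir al].
by exists (i, s); rewrite /= IH ss al.
Qed.

Lemma uniq_seqs r M : uniq r -> uniq (seqs r M).
Proof.
move=> ur; elim: M => //= M IH.
by apply: allpairs_uniq => // -[i s] [j t] _ _ /= [-> ->].
Qed.

Lemma size_seqs_mem r M s : s \in seqs r M -> size s = M.
Proof. by rewrite mem_seqs => /andP[/eqP]. Qed.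

Section Sums.
Variable V : nmodType.
Implicit Types F : seq T -> V.

Lemma sum_seqs0 r F : \sum_(s <- seqs r 0) F s = F [::].
Proof. by rewrite big_seq1. Qed.

Lemma sum_seqsS r M F :
  \sum_(s <- seqs r M.+1) F s = \sum_(i <- r) \sum_(s <- seqs r M) F (i :: s).
Proof. by rewrite big_allpairs_dep. Qed.

Lemma eq_sum_seqs r M F G :
  (forall s, size s = M -> all (mem r) s -> F s = G s) ->
  \sum_(s <- seqs r M) F s = \sum_(s <- seqs r M) G s.
Proof.
move=> FG; apply: eq_big_seq => s; rewrite mem_seqs => /andP[/eqP ss al].
exact: FG.
Qed.

Lemma sum_seqs_cat r M N F :
  \sum_(s <- seqs r (M + N)) F s =
  \sum_(s <- seqs r M) \sum_(t <- seqs r N) F (s ++ t).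
Proof.
elim: M F => [|M IH] F; first by rewrite sum_seqs0.
by rewrite addSn !sum_seqsS; apply: eq_bigr => i _; rewrite IH.
Qed.

(** Fubini along a mask: entries at marked and at unmarked positions range independently. *)
Lemma sum_seqs_mask r (b : bitseq) (F : seq T -> seq T -> V) :
  \sum_(s <- seqs r (size b)) F (mask b s) (mask (map negb b) s) =
  \sum_(s <- seqs r (count id b)) \sum_(t <- seqs r (count negb b)) F s t.
Proof.
elim: b F => [|[] b IH] F; rewrite /= ?add0n ?add1n; first by rewrite !sum_seqs0.
  by rewrite !sum_seqsS; apply: eq_bigr => i _; rewrite -IH.
rewrite [LHS]sum_seqsS (eq_bigr _ (fun i _ => IH (fun u v => F u (i :: v)))).
by rewrite exchange_big; apply: eq_bigr => s _; rewrite sum_seqsS.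
Qed.

(** The binomial coefficient counts the interleavings of the two sublists; splitting on the first
    entry turns the induction into Pascal's rule. *)
Lemma sum_seqs_filter (P : pred T) r M k (F : seq T -> seq T -> V) : (k <= M)%N ->
  \sum_(s <- seqs r M | count P s == k) F (seq.filter P s) (seq.filter (predC P) s) =
  (\sum_(s <- seqs (seq.filter P r) k)
     \sum_(t <- seqs (seq.filter (predC P) r) (M - k)) F s t) *+ 'C(M, k).
Proof.
elim: M k F => [|M IH] k F.
  by rewrite leqn0 => /eqP ->; rewrite subn0 big_mkcond /= !sum_seqs0 /= bin0 mulr1n.
move=> kM; rewrite big_mkcond sum_seqsS.
rewrite (bigID P) /=.
(* A first entry in [P] uses up one of the [k] selected slots: this is the Pascal summand for k - 1,
   absent when k = 0. *)
have -> : \sum_(i <- r | P i) \sum_(s <- seqs r M)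
    (if (P i + count P s)%N == k then
      F (if P i then i :: seq.filter P s else seq.filter P s)
        (if ~~ P i then i :: seq.filter (predC P) s else seq.filter (predC P) s) else 0) =
  (if k is k'.+1 then
   (\sum_(s <- seqs (seq.filter P r) k)
     \sum_(t <- seqs (seq.filter (predC P) r) (M.+1 - k)) F s t) *+ 'C(M, k') else 0).
  case: k kM => [|k] kM.
    by rewrite big1 // => i ->; rewrite big1.
  rewrite sum_seqsS big_filter -sumrMnl; apply: eq_bigr => i Pi.
  rewrite Pi /= subSS -(IH k (fun s t => F (i :: s) t)) // [RHS]big_mkcond.
  by apply: eq_bigr => s _; rewrite add1n eqSS.
have -> : \sum_(i <- r | ~~ P i) \sum_(s <- seqs r M)
    (if (P i + count P s)%N == k then
      F (if P i then i :: seq.filter P s else seq.filter P s)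
        (if ~~ P i then i :: seq.filter (predC P) s else seq.filter (predC P) s) else 0) =
   (\sum_(s <- seqs (seq.filter P r) k)
     \sum_(t <- seqs (seq.filter (predC P) r) (M.+1 - k)) F s t) *+ 'C(M, k).
  case: (ltnP M k) => [Mk|kM'].
    rewrite bin_small // mulr0n big1 // => i /negbTE Pi; rewrite Pi big1_seq // => s.
    case: ifP => // /eqP /= ck; rewrite mem_seqs => /andP[/eqP ss _].
    by move: (count_size P s); rewrite ss -[count P s]add0n ck leqNgt Mk.
  rewrite subSn //; under [X in _ = X *+ _]eq_bigr do rewrite sum_seqsS.
  rewrite [X in _ = X *+ _]exchange_big big_filter -sumrMnl; apply: eq_bigr => i Pi.
  rewrite -(IH k (fun s t => F s (i :: t))) // [RHS]big_mkcond.
  by apply: eq_bigr => s _; rewrite (negbTE Pi).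
case: k kM => [|k] kM; first by rewrite add0r !bin0.
by rewrite -mulrnDr binS addnC.
Qed.

End Sums.

(** Serves changes of variable whose ranges do not match exactly, such as the exponent shift in
    [vand_expand], where the coefficients vanish on the mismatch. *)
Lemma big_reindex_supp (T1 T2 : eqType) (V : nmodType) (A : seq T1) (B : seq T2)
    (h : T1 -> T2) (G : T2 -> V) :
  uniq A -> uniq B -> {in A &, injective h} -> (forall s, s \in A -> h s \in B) ->
  (forall t, t \in B -> G t != 0 -> exists2 s, s \in A & t = h s) ->
  \sum_(t <- B) G t = \sum_(s <- A) G (h s).
Proof.
move=> uA uB hi hB hs.
rewrite -(big_map h xpredT G) (bigID (mem (map h A))) /= [X in _ + X]big1_seq; last first.
  move=> t /andP[tn tB]; apply/eqP; apply: contraR tn => /(hs _ tB)[s sA ->].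
  by rewrite map_f.
rewrite addr0 -big_filter; apply: perm_big.
apply: uniq_perm; first exact: filter_uniq.
  by rewrite map_inj_in_uniq.
move=> t; rewrite mem_filter; case: mapP => //= -[s sA ->].
exact: hB.
Qed.

Lemma ler_sum_mem (R : numDomainType) (T1 : eqType) (r : seq T1) x (F : T1 -> R) :
  (forall y, 0 <= F y) -> x \in r -> F x <= \sum_(y <- r) F y.
Proof. by move=> F0 xr; rewrite (big_rem x xr) /= lerDl sumr_ge0. Qed.

Lemma ler_sum_inj (T1 T2 : eqType) (R : numDomainType) (A : seq T1) (B : seq T2)
    (h : T1 -> T2) (G : T2 -> R) :
  uniq A -> uniq B -> {in A &, injective h} -> (forall s, s \in A -> h s \in B) ->
  (forall t, 0 <= G t) ->
  \sum_(s <- A) G (h s) <= \sum_(t <- B) G t.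
Proof.
move=> uA uB hi hB G0.
rewrite -(big_map h xpredT G) [leRHS](bigID (mem (map h A))) /=.
rewrite -[X in _ <= X + _]big_filter; apply: ler_wpDr; first exact: sumr_ge0.
rewrite le_eqVlt; apply/orP; left; apply/eqP/perm_big/uniq_perm.
- by rewrite map_inj_in_uniq.
- exact: filter_uniq.
- move=> t; rewrite mem_filter; case: mapP => //= -[s sA ->].
  by rewrite hB.
Qed.

Lemma sum_seqs_prod (R : comNzRingType) (r : seq T) M (F : T -> R) :
  \sum_(s <- seqs r M) \prod_(i <- s) F i = (\sum_(i <- r) F i) ^+ M.
Proof.
elim: M => [|M IH]; first by rewrite sum_seqs0 big_nil.
rewrite sum_seqsS exprS -IH big_distrl; apply: eq_bigr => i _.
by rewrite /= big_distrr; apply: eq_bigr => s _; rewrite big_cons.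
Qed.

Lemma sum_seqs_prod2 (S : Type) (R : comNzRingType) (r : seq T) (u : seq S)
    (F : S -> T -> R) :
  \sum_(s <- seqs r (size u)) \prod_(x <- zip u s) F x.1 x.2 =
  \prod_(a <- u) \sum_(i <- r) F a i.
Proof.
elim: u => [|a u IH] /=; first by rewrite sum_seqs0 !big_nil.
rewrite sum_seqsS big_cons -IH big_distrl; apply: eq_bigr => i _.
by rewrite /= big_distrr; apply: eq_bigr => s _; rewrite /= big_cons.
Qed.

(** Adjacent transpositions generate all permutations. The value type is arbitrary so that [F] may
    be a proposition, as in [rho_perm]. *)
Lemma perm_swap_inv (A : Type) (F : seq T -> A) (s t : seq T) :
  (forall u x y v, F (u ++ x :: y :: v) = F (u ++ y :: x :: v)) ->
  perm_eq s t -> F s = F t.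
Proof.
move=> sw; have fr : forall u x v, F (u ++ x :: v) = F (x :: u ++ v).
  move=> u x v; elim/last_ind: u v => // u y IH v.
  by rewrite -cats1 -!catA /= sw IH.
elim: s F t sw fr => [|x s IH] F t sw fr pst.
  by move: (perm_size pst); case: t {pst}.
have xt : x \in t by rewrite -(perm_mem pst) mem_head.
case/splitPr: xt pst => t1 t2; rewrite perm_sym perm_catC /= perm_cons perm_catC => pst.
rewrite fr; apply: (IH (fun s => F (x :: s))); last by rewrite perm_sym.
  by move=> u y z v; rewrite (sw (x :: u)).
by move=> u y v; move: (fr (x :: u) y v) => /= ->; rewrite (sw [::]).
Qed.

(** Double counting: the weight counts the positions that hold [l], and by symmetry each of the
    [M.+1] positions contributes alike. *)
Lemma sum_count_mem (R : comNzRingType) (r : seq T) M (F : seq T -> R) l :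
  uniq r -> l \in r -> (forall s t, perm_eq s t -> F s = F t) ->
  \sum_(s <- seqs r M.+1) F s * (count_mem l s)%:R =
  M.+1%:R * \sum_(n <- seqs r M) F (l :: n).
Proof.
move=> ur lr; elim: M F => [|M IH] F pF.
  rewrite sum_seqsS; under eq_bigr do rewrite sum_seqs0.
  rewrite sum_seqs0 mul1r (bigD1_seq l) //= eqxx mulr1 big1 ?addr0 // => i il.
  by rewrite (negbTE il) mulr0.
rewrite sum_seqsS.
have -> : \sum_(i <- r) \sum_(s <- seqs r M.+1) F (i :: s) * (count_mem l (i :: s))%:R =
  \sum_(i <- r) \sum_(s <- seqs r M.+1) F (i :: s) * (i == l)%:R +
  \sum_(i <- r) \sum_(s <- seqs r M.+1) F (i :: s) * (count_mem l s)%:R.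
  rewrite -big_split; apply: eq_bigr => i _; rewrite -big_split; apply: eq_bigr => s _.
  by rewrite /= natrD mulrDr.
have -> : \sum_(i <- r) \sum_(s <- seqs r M.+1) F (i :: s) * (count_mem l s)%:R =
   M.+1%:R * \sum_(n <- seqs r M.+1) F (l :: n).
  rewrite sum_seqsS mulr_sumr; apply: eq_bigr => i _; rewrite IH; last first.
    by move=> s t st; apply: pF; rewrite perm_cons.
  congr (_ * _); apply: eq_bigr => s _; apply: pF.
  by rewrite (perm_catCA [:: i] [:: l] s).
rewrite -[in RHS]addn1 natrD [in RHS]addrC mulrDl mul1r; congr (_ + _).
rewrite (bigD1_seq l) //= [X in _ + X]big1 ?addr0.
  by apply: eq_bigr => s _; rewrite eqxx mulr1.
by move=> i il; rewrite big1 // => s _; rewrite (negbTE il) mulr0.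
Qed.

End Seqs.

Arguments seqs : simpl never.

Lemma sum_seqs_map (T1 T2 : eqType) (V : nmodType) (h : T1 -> T2) (r : seq T1) M
    (F : seq T2 -> V) :
  \sum_(s <- seqs (map h r) M) F s = \sum_(s <- seqs r M) F (map h s).
Proof.
elim: M F => [|M IH] F; first by rewrite !sum_seqs0.
by rewrite !sum_seqsS big_map; apply: eq_bigr => i _; rewrite IH.
Qed.

(** * Coefficients of powers of the Vandermonde product *)

(* [lia] does not see through the canonical-structure spelling of nat and int, and is slowed
   down by hypotheses about reals. *)
Ltac nlia :=
  repeat match goal with H : context [Real.sort _] |- _ => clear H end;
  repeat match goal with
  | H : context [Equality.sort Datatypes_nat__canonical__eqtype_Equality] |- _ =>
      change (Equality.sort Datatypes_nat__canonical__eqtype_Equality) with nat in H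
  | H : context [Equality.sort ssrint_int__canonical__eqtype_Equality] |- _ =>
      change (Equality.sort ssrint_int__canonical__eqtype_Equality) with int in H
  | |- context [Equality.sort Datatypes_nat__canonical__eqtype_Equality] =>
      change (Equality.sort Datatypes_nat__canonical__eqtype_Equality) with nat
  | |- context [Equality.sort ssrint_int__canonical__eqtype_Equality] =>
      change (Equality.sort ssrint_int__canonical__eqtype_Equality) with int
  | H : context [@size ?T ?s] |- _ =>
      lazymatch T with int => fail | nat => fail | _ => idtac end;
      progress change (@size T s) with (@size int s) in H
  | |- context [@size ?T ?s] =>
      lazymatch T with int => fail | nat => fail | _ => idtac end;
      progress change (@size T s) with (@size int s)
  end; lia.

Section Acoef.
Variables (R : realType) (p : nat).

Definition isum (s : seq int) : int := \sum_(x <- s) x.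

Definition erng : seq nat := iota 0 p.+1.

Lemma mem_erng (x : nat) : (x \in erng) = (x <= p)%N.
Proof. by rewrite mem_iota. Qed.

Lemma uniq_erng : uniq erng.
Proof. exact: iota_uniq. Qed.

(** The coefficient of x^e y^(p-e) in (y - x)^p. *)
Definition cbin (e : nat) : R := (-1) ^+ e * 'C(p, e)%:R.

(** Exponents left for the later variables once w_k has received p - e_k from its factor with w_0;
    [addp] is the inverse change of variables. *)
Definition subp (s : seq int) (e : seq nat) : seq int :=
  [seq x.1 - p%:Z + x.2%:Z | x <- zip s e].

Definition addp (s : seq int) (e : seq nat) : seq int :=
  [seq x.1 + p%:Z - x.2%:Z | x <- zip s e].

Fixpoint acoef_rec (n : nat) (s : seq int) : R :=
  match n, s with
  | n'.+1, i :: s' =>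
      \sum_(e <- seqs erng (size s') | (sumn e)%:Z == i)
        (\prod_(x <- e) cbin x) * acoef_rec n' (subp s' e)
  | _, _ => 1
  end.

(* The coefficient of \prod_j w_j ^ s_j in \prod_(j < k) (w_k - w_j) ^ p:
   in the recursion, e_k is the exponent that w_0 takes in (w_k - w_0) ^ p. *)
Definition acoef (s : seq int) : R := acoef_rec (size s) s.

Lemma size_subp s e : size e = size s -> size (subp s e) = size s.
Proof. by move=> es; rewrite size_map size_zip es minnn. Qed.

Lemma size_addp s e : size e = size s -> size (addp s e) = size s.
Proof. by move=> es; rewrite size_map size_zip es minnn. Qed.

Lemma acoef_nil : acoef [::] = 1.
Proof. by []. Qed.

Lemma acoef_cons i s : acoef (i :: s) =
  \sum_(e <- seqs erng (size s) | (sumn e)%:Z == i)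
    (\prod_(x <- e) cbin x) * acoef (subp s e).
Proof.
rewrite /acoef /= big_mkcond [RHS]big_mkcond; apply: eq_big_seq => e.
by move/size_seqs_mem => es; rewrite size_subp.
Qed.

Lemma isum_cons x s : isum (x :: s) = x + isum s.
Proof. by rewrite /isum big_cons. Qed.

Lemma isum_cat s t : isum (s ++ t) = isum s + isum t.
Proof. by rewrite /isum big_cat. Qed.

Lemma isum_nil : isum [::] = 0.
Proof. by rewrite /isum big_nil. Qed.

Lemma isum_subp s e : size e = size s ->
  isum (subp s e) = isum s - (p * size s)%N%:Z + (sumn e)%:Z.
Proof.
elim: s e => [|x s IH] [|y e] //=; first by rewrite isum_nil muln0.
case=> es.
by rewrite /subp /= !isum_cons (IH _ es); nlia.
Qed.

Lemma subp_mask b s e : size e = size s ->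
  mask b (subp s e) = subp (mask b s) (mask b e).
Proof.
elim: b s e => [|c b IH] [|x s] [|y e] //= [es].
by case: c => /=; rewrite [in LHS]IH.
Qed.

Lemma addpK s e : size e = size s -> subp (addp s e) e = s.
Proof.
elim: s e => [|x s IH] [|y e] //= [es].
by rewrite /subp /addp /= -/(addp _ _) -/(subp _ _) IH //; congr (_ :: _); nlia.
Qed.

Lemma subpK s e : size e = size s -> addp (subp s e) e = s.
Proof.
elim: s e => [|x s IH] [|y e] //= [es].
by rewrite /subp /addp /= -/(subp _ _) -/(addp _ _) IH //; congr (_ :: _); nlia.
Qed.

Lemma sumn_mask b e : size b = size e ->
  sumn e = (sumn (mask b e) + sumn (mask (map negb b) e))%N.
Proof.
elim: b e => [|c b IH] [|x s] //= [sbs].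
by rewrite (IH _ sbs); case: c => /=; nlia.
Qed.

Lemma prod_mask (A : Type) (F : A -> R) b (e : seq A) : size b = size e ->
  \prod_(x <- e) F x = \prod_(x <- mask b e) F x * \prod_(x <- mask (map negb b) e) F x.
Proof.
elim: b e => [|c b IH] [|x s] //=; first by rewrite !big_nil mulr1.
case=> sbs.
by rewrite big_cons (IH _ sbs); case: c => /=; rewrite big_cons; ring.
Qed.

Lemma sumn_le_p e : all (mem erng) e -> (sumn e <= p * size e)%N.
Proof.
elim: e => //= x e IH /andP[xp /IH]; have : x \in erng by []; rewrite mem_erng; nlia.
Qed.

Lemma sumn_eq_p e : all (mem erng) e -> (p * size e <= sumn e)%N ->
  e = nseq (size e) p.
Proof.
elim: e => //= x e IH /andP[xp al] h; have {}xp : x \in erng by []; rewrite mem_erng in xp.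
have := sumn_le_p al => h2.
have xe : x = p by nlia.
by rewrite -IH // ?xe //; nlia.
Qed.

Lemma sumn_eq_0 e : sumn e = 0%N -> e = nseq (size e) 0%N.
Proof. by elim: e => //= x e IH /eqP; rewrite addn_eq0 => /andP[/eqP -> /eqP/IH <-]. Qed.

Lemma size_maskN (A : Type) b (s : seq A) : size b = size s ->
  size (mask (map negb b) s) = count negb b.
Proof. by move=> bs; rewrite size_mask ?size_map // count_map. Qed.

Lemma sum_neq0_ex (A : eqType) (r : seq A) (P : pred A) (F : A -> R) :
  \sum_(e <- r | P e) F e != 0 -> exists e, [/\ e \in r, P e & F e != 0].
Proof.
move=> H; apply: contrapT => nex; move/eqP: H; apply.
rewrite big1_seq // => e /andP[Pe er]; apply/eqP; apply: contrapT => /negP Fe.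
by apply: nex; exists e.
Qed.

Lemma acoef_cons_neq0 i s : acoef (i :: s) != 0 ->
  exists e, [/\ size e = size s, all (mem erng) e, (sumn e)%:Z = i &
    acoef (subp s e) != 0].
Proof.
rewrite acoef_cons => /sum_neq0_ex[e []]; rewrite mem_seqs => /andP[/eqP es al].
by move=> /eqP si; rewrite mulf_eq0 negb_or => /andP[_ H]; exists e.
Qed.

(** The momentum 0 + p + ... + p(k-1) of [k] particles packed as tightly as possible; also the
    degree of the Vandermonde power in [k] variables. *)
Definition tri (k : nat) : nat := (p * 'C(k, 2))%N.

Lemma triS k : tri k.+1 = (tri k + p * k)%N.
Proof. by rewrite /tri binS bin1; nlia. Qed.

Lemma tri0 : tri 0 = 0%N.
Proof. by rewrite /tri muln0. Qed.

Lemma triD j k : tri (j + k) = (tri j + tri k + p * (j * k))%N.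
Proof.
elim: j => [|j IH]; first by rewrite add0n tri0 mul0n muln0 addn0.
by rewrite addSn !triS IH; nlia.
Qed.

(** The pair factors internal to the marked variables already have degree [tri] in them, and all
    other factors can only add to it. In the recursion, an unmarked first variable takes at most [p]
    from each marked one, and a marked one keeps all that it takes. *)
Lemma dominance s b : acoef s != 0 -> size b = size s ->
  (tri (count id b))%:Z <= isum (mask b s).
Proof.
elim: {s}(size s) {-2}s (erefl (size s)) b => [|n IH] [|i s] //= sn b.
  by move=> _ /eqP; rewrite size_eq0 => /eqP -> /=; rewrite isum_nil tri0.
case: sn => sn /acoef_cons_neq0[e [es al si ae]]; case: b => [|c b] //= [bs].
have := IH (subp s e) _ b ae; rewrite size_subp // => /(_ sn bs).
rewrite subp_mask // isum_subp; last by rewrite !size_mask // bs es.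
rewrite (size_mask bs).
have := sumn_mask (etrans bs (esym es)).
have := @sumn_le_p (mask b e) (all_mask b al); rewrite size_mask ?es //.
case: c; rewrite /= ?add0n ?add1n; last by nlia.
by rewrite isum_cons -si triS; nlia.
Qed.

Lemma acoef_total s : acoef s != 0 -> isum s = (tri (size s))%:Z.
Proof.
elim: {s}(size s) {-2}s (erefl (size s)) => [|n IH] [|i s] //= sn.
  by rewrite isum_nil tri0.
case: sn => sn /acoef_cons_neq0[e [es al si ae]].
have := IH (subp s e) _ ae; rewrite size_subp // => /(_ sn).
by rewrite isum_subp // isum_cons triS -si sn; nlia.
Qed.

Definition orb (N : nat) : seq int := [seq i%:Z | i <- iota 0 (p * N)].

Lemma mem_orb N (x : int) : (x \in orb N) = (0 <= x) && (x < (p * N)%N%:Z).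
Proof.
apply/mapP/idP => [[i ir ->]|/andP[x0 xN]].
  by move: ir; rewrite mem_iota; nlia.
by exists (absz x); rewrite ?mem_iota; nlia.
Qed.

Lemma uniq_orb N : uniq (orb N).
Proof. by rewrite map_inj_uniq ?iota_uniq // => i j []. Qed.

(** Dominance for a single particle gives x >= 0; dominance for all the others, subtracted from the
    known total, gives x <= p(N-1). *)
Lemma acoef_supp s : (0 < p)%N -> acoef s != 0 -> all (mem (orb (size s))) s.
Proof.
move=> p0 as0; apply/allP => x xs; have [s1 [s2 E]] : exists s1 s2, s = s1 ++ x :: s2.
  by case/splitPr: xs => s1 s2; exists s1, s2.
rewrite -[mem _ x]/(x \in _) mem_orb.
have tot := acoef_total as0; rewrite E isum_cat isum_cons in tot.
have d1 := @dominance s (nseq (size s1) false ++ true :: nseq (size s2) false) as0.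
have d2 := @dominance s (nseq (size s1) true ++ false :: nseq (size s2) true) as0.
move: d1 d2; rewrite E !size_cat /= !size_nseq => /(_ erefl) + /(_ erefl).
rewrite !mask_cat ?size_nseq //= !mask_false !mask_true // !count_cat /= !count_nseq /=.
rewrite isum_cons isum_cat isum_nil !mul0n !mul1n add0n.
move: tot; rewrite size_cat /= addnS triS => tot d1 d2.
have : (tri (size s1 + (0 + size s2)) = tri (size s1 + size s2))%N by [].
have : (0 <= tri (1 + 0))%N by [].
move: d1 d2 tot; rewrite /= add0n; set u := tri _; set v := tri _; nlia.
Qed.

(** One factor (-1)^p for each unmarked position j that precedes a marked position k: there (w_k -
    w_j)^p has to supply the power of the subtracted variable. *)
Fixpoint sgnm (b : bitseq) : R :=
  match b with
  | [::] => 1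
  | true :: b' => sgnm b'
  | false :: b' => (-1) ^+ (p * count id b') * sgnm b'
  end.

Lemma sgnm_sqr b : sgnm b * sgnm b = 1.
Proof.
elim: b => [|[] b IH] /=; rewrite ?mulr1 //.
by rewrite mulrACA IH mulr1 -expr2 sqrr_sign.
Qed.

Definition shiftz (c : int) (s : seq int) : seq int := [seq x - c | x <- s].

Lemma size_shiftz c s : size (shiftz c s) = size s.
Proof. exact: size_map. Qed.

Lemma isum_shiftz c s : isum (shiftz c s) = isum s - c * (size s)%:Z.
Proof.
elim: s => [|x s IH] /=; first by rewrite isum_nil; nlia.
by rewrite !isum_cons IH; nlia.
Qed.

Lemma shiftz_subp c s e : shiftz c (subp s e) = subp (shiftz c s) e.
Proof.
elim: s e => [|x s IH] [|y e] //=.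
by rewrite /subp /= -!/(subp _ _) IH; congr (_ :: _); nlia.
Qed.

Lemma subp_nseq0 s n : size s = n -> subp s (nseq n 0%N) = shiftz p%:Z s.
Proof.
by move=> <-; elim: s => //= x s IH; rewrite /subp /= -/(subp _ _) IH addr0.
Qed.

Lemma subp_nseqp s n : size s = n -> subp s (nseq n p) = s.
Proof.
by move=> <-; elim: s => //= x s IH; rewrite /subp /= -/(subp _ _) IH subrK.
Qed.

Lemma shiftzD c d s : shiftz c (shiftz d s) = shiftz (c + d) s.
Proof. by rewrite /shiftz -map_comp; apply: eq_map => x /=; nlia. Qed.

Lemma sum_nseq_pick (x : nat) n (F : R) : x \in erng ->
  \sum_(e <- seqs erng n) (e == nseq n x)%:R * F = F.
Proof.
move=> xi; have H1 : nseq n x \in seqs erng n.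
  rewrite mem_seqs size_nseq eqxx /=; apply/allP => y; rewrite mem_nseq => /andP[_ /eqP ->].
  exact: xi.
rewrite (bigD1_seq _ H1 (uniq_seqs _ uniq_erng)) /= eqxx mul1r.
by rewrite big1 ?addr0 // => e /negbTE ->; rewrite mul0r.
Qed.

Lemma prod_nseq (F : nat -> R) n x : \prod_(y <- nseq n x) F y = F x ^+ n.
Proof. by elim: n => [|n IH]; rewrite ?big_nil //= big_cons IH exprS. Qed.

(** When dominance is sharp, marked variables receive nothing from the factors that join them to
    unmarked ones. Each such factor gives its full power [p] to the unmarked variable, which shifts
    the unmarked exponents and leaves a sign. *)
Lemma acoef_cut s b : size b = size s ->
  isum (mask b s) = (tri (count id b))%:Z ->
  acoef s = sgnm b * acoef (mask b s) *
            acoef (shiftz (p * count id b)%N%:Z (mask (map negb b) s)).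
Proof.
elim: {s}(size s) {-2}s (erefl (size s)) b => [|n IH] [|i s] //= sn b.
  by move=> /eqP; rewrite size_eq0 => /eqP -> /=; rewrite !mulr1.
case: sn => sn; case: b => [|c b] //= [bs].
set k := count id b.
have sm (e : seq nat) : size e = size s -> size (mask b e) = k.
  by move=> es; rewrite size_mask // bs es.
have sN (e : seq nat) : size e = size s -> size (mask (map negb b) e) = count negb b.
  by move=> es; rewrite size_maskN // bs es.
have sms : size (mask b s) = k by rewrite size_mask.
have smN : size (mask (map negb b) s) = count negb b by rewrite size_maskN.
have IHe (e : seq nat) : size e = size s -> isum (mask b (subp s e)) = (tri k)%:Z ->
    acoef (subp s e) = sgnm b * acoef (subp (mask b s) (mask b e)) *
      acoef (shiftz (p * k)%N%:Z (subp (mask (map negb b) s) (mask (map negb b) e))).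
  move=> es iz; rewrite -!subp_mask //; apply: IH; rewrite ?size_subp //.
have ism (e : seq nat) : size e = size s ->
    isum (mask b (subp s e)) = isum (mask b s) - (p * k)%N%:Z + (sumn (mask b e))%:Z.
  by move=> es; rewrite subp_mask // isum_subp ?sms ?sm.
rewrite acoef_cons big_mkcond -bs.
case: c => /=.
  rewrite isum_cons add1n triS => hc.
  pose A := acoef (shiftz (p * k.+1)%N%:Z (mask (map negb b) s)).
  (* A marked first variable must take exponent 0 against every unmarked one. *)
  pose F (u v : seq nat) := (v == nseq (count negb b) 0%N)%:R *
    (if (sumn u)%:Z == i then (\prod_(x <- u) cbin x) *
        (sgnm b * acoef (subp (mask b s) u) * A) else 0).
  transitivity (\sum_(e <- seqs erng (size b))
                  F (mask b e) (mask (map negb b) e)).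
    apply: eq_sum_seqs => e; rewrite bs => es al.
    have sme := sumn_mask (etrans bs (esym es)).
    have dm := @dominance (subp s e) b.
    rewrite size_subp // ism // -/k in dm.
    have [ae0|/dm/(_ bs) {}dm] := eqVneq (acoef (subp s e)) 0; last first.
      have F0 : (if (sumn e)%:Z == i then true else false) -> sumn (mask (map negb b) e) = 0%N.
        by case: eqP => // ei _; nlia.
      case: ifP => [ei|ei].
        rewrite ei in F0; have s0 := F0 isT; have n0 := sumn_eq_0 s0; rewrite sN // in n0.
        rewrite /F n0 eqxx mul1r.
        have -> : (sumn (mask b e))%:Z == i by move/eqP: ei; nlia.
        rewrite (prod_mask _ (etrans bs (esym es))) n0 prod_nseq /cbin expr0 bin0 mul1r expr1n mulr1.
        rewrite IHe //; last by rewrite ism //; move/eqP: ei; nlia.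
        rewrite n0 subp_nseq0 // shiftzD; congr (_ * (_ * _)); congr (acoef (shiftz _ _)).
        by nlia.
      rewrite /F; case: eqP => [n0|]; last by rewrite mul0r.
      by rewrite mul1r; move: sme; rewrite n0 sumn_nseq mul0n addn0 => <-; rewrite ei.
    (* Here the left side vanishes, and the factorisation given by the induction hypothesis makes
       the product on the right vanish too. *)
    rewrite ae0 mulr0 if_same /F; case: eqP => [n0|]; last by rewrite mul0r.
    rewrite mul1r; move: sme; rewrite n0 sumn_nseq mul0n addn0 => sme.
    case: ifP => // /eqP ei.
    have iz : isum (mask b (subp s e)) = (tri k)%:Z by rewrite ism //; nlia.
    have := IHe e es iz; rewrite ae0 n0 subp_nseq0 // shiftzD => E.
    rewrite /A (_ : (p * k.+1)%N%:Z = (p * k)%N%:Z + p%:Z); last by nlia.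
    by rewrite -E mulr0.
  rewrite sum_seqs_mask.
  under eq_bigr do rewrite sum_nseq_pick ?mem_erng //.
  rewrite -big_mkcond /= acoef_cons sms mulr_sumr mulr_suml.
  by apply: eq_bigr => u _; rewrite /A; ring.
rewrite add0n => hc.
(* An unmarked first variable takes the full power [p], with sign (-1)^p, from each of the [k]
   marked ones. *)
pose F (u v : seq nat) := (u == nseq k p)%:R *
    (if (sumn v)%:Z == i - (p * k)%N%:Z then (-1) ^+ (p * k) * (\prod_(x <- v) cbin x) *
        (sgnm b * acoef (mask b s) *
         acoef (subp (shiftz (p * k)%N%:Z (mask (map negb b) s)) v)) else 0).
transitivity (\sum_(e <- seqs erng (size b))
                F (mask b e) (mask (map negb b) e)).
  apply: eq_sum_seqs => e; rewrite bs => es al.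
  have sme := sumn_mask (etrans bs (esym es)).
  have dm := @dominance (subp s e) b.
  rewrite size_subp // ism // -/k in dm.
  have alm := all_mask b al.
  have [ae0|/dm/(_ bs) {}dm] := eqVneq (acoef (subp s e)) 0; last first.
    have n0 := sumn_eq_p alm; rewrite sm // in n0.
    have {}n0 : mask b e = nseq k p by apply: n0; nlia.
    rewrite /F n0 eqxx mul1r.
    move: sme; rewrite n0 sumn_nseq => sme.
    have -> : ((sumn e)%:Z == i) = ((sumn (mask [seq ~~ i | i <- b] e))%:Z == i - (p * k)%N%:Z).
      by rewrite sme PoszD addrC -[in RHS](inj_eq (addIr (p * k)%N%:Z)) subrK.
    case: ifP => // ei.
    rewrite (prod_mask _ (etrans bs (esym es))) n0 prod_nseq /cbin binn mulr1 -exprM.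
    rewrite IHe //; last by rewrite ism // n0 sumn_nseq; nlia.
    by rewrite n0 subp_nseqp // shiftz_subp.
  rewrite ae0 mulr0 if_same /F; case: eqP => [n0|]; last by rewrite mul0r.
  rewrite mul1r; move: sme; rewrite n0 sumn_nseq => sme.
  case: ifP => // /eqP ei.
  have iz : isum (mask b (subp s e)) = (tri k)%:Z by rewrite ism // n0 sumn_nseq; nlia.
  have := IHe e es iz; rewrite ae0 n0 subp_nseqp // shiftz_subp => <-.
  by rewrite mulr0.
rewrite sum_seqs_mask exchange_big /=.
under eq_bigr do rewrite sum_nseq_pick ?mem_erng //.
rewrite -big_mkcond /= acoef_cons size_shiftz smN mulr_sumr.
by apply: eq_bigr => u _; rewrite -/k; ring.
Qed.

Lemma cbin_sym e : (e <= p)%N -> cbin (p - e) = (-1) ^+ p * cbin e.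
Proof.
move=> ep; rewrite /cbin bin_sub // mulrA -exprD; congr (_ * _).
by rewrite -signr_odd -[RHS]signr_odd oddB // oddD.
Qed.

Lemma subpC s e e' : size e = size s -> size e' = size s ->
  subp (subp s e) e' = subp (subp s e') e.
Proof.
elim: s e e' => [|x s IH] [|y e] [|y' e'] //= [es] [es'].
by rewrite /subp /= -!/(subp _ _) IH //; congr (_ :: _); nlia.
Qed.

Lemma subp_cat s t e f : size e = size s ->
  subp (s ++ t) (e ++ f) = subp s e ++ subp t f.
Proof. by move=> es; rewrite /subp zip_cat ?es // map_cat. Qed.

Lemma subp_cons x s y e : subp (x :: s) (y :: e) = x - p%:Z + y%:Z :: subp s e.
Proof. by []. Qed.

(** Antisymmetry of the Vandermonde product, to the power [p]. The recursion singles out the first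
    variable, so the exchange of the first two needs an argument of its own; deeper exchanges
    commute with the recursion. *)
Lemma acoef_swap u x y v :
  acoef (u ++ x :: y :: v) = (-1) ^+ p * acoef (u ++ y :: x :: v).
Proof.
elim: {u}(size u) {-2}u (erefl (size u)) x y v => [|n IHn] [|z u] //= un x y v.
  pose I := erng.
  have ex a b : acoef (a :: b :: v) =
    \sum_(f <- I) \sum_(e <- seqs I (size v)) \sum_(e' <- seqs I (size v))
      (if ((f + sumn e)%N%:Z == a) && ((sumn e')%:Z == b - p%:Z + f%:Z) then
        cbin f * (\prod_(i <- e) cbin i) * (\prod_(i <- e') cbin i) *
        acoef (subp (subp v e) e') else 0).
    rewrite acoef_cons big_mkcond sum_seqsS; apply: eq_bigr => f _.
    apply: eq_big_seq => e /size_seqs_mem es /=; case: eqP => fa /=; last by rewrite big1.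
    rewrite /subp /= -/(subp _ _) acoef_cons size_subp // big_cons mulr_sumr big_mkcond.
    by apply: eq_bigr => e' _; case: ifP => // _; rewrite !mulrA.
  rewrite !ex mulr_sumr.
  (* Exchanging the first two variables turns the exponent f taken in their common factor into p - f
     and exchanges the rows [e] and [e']. *)
  have big_rev (F : nat -> R) : \sum_(f <- I) F f = \sum_(f <- I) F (p - f)%N.
    apply: (@big_reindex_supp _ _ _ I I (fun f => (p - f)%N)); rewrite ?uniq_erng //.
    - by move=> a b; rewrite !mem_erng => /= ? ? ?; nlia.
    - by move=> a; rewrite !mem_erng; nlia.
    - by move=> t tI _; exists (p - t)%N; move: tI; rewrite ?mem_erng; nlia.
  rewrite [RHS]big_rev; apply: eq_big_seq => f; rewrite mem_erng => fp.
  rewrite exchange_big mulr_sumr; apply: eq_big_seq => e /size_seqs_mem es.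
  rewrite mulr_sumr; apply: eq_big_seq => e' /size_seqs_mem es'.
  rewrite (_ : ((f + sumn e')%N%:Z == x) && ((sumn e)%:Z == y - p%:Z + f%:Z) =
     ((p - f + sumn e)%N%:Z == y) && ((sumn e')%:Z == x - p%:Z + (p - f)%N%:Z)); last first.
    by apply/andP/andP => -[/eqP ? /eqP ?]; split; apply/eqP; nlia.
  case: ifP => _; last by rewrite mulr0.
  rewrite (subpC es es') cbin_sym; last by nlia.
  have : (-1) ^+ p * (-1) ^+ p = 1 :> R by rewrite -expr2 sqrr_sign.
  by move=> E; rewrite !mulrA E mul1r [cbin f * _ * _]mulrAC.
rewrite !acoef_cons mulr_sumr.
case: un => un.
have e1 : size (u ++ x :: y :: v) = (n + (size v).+2)%N by rewrite size_cat un.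
have e2 : size (u ++ y :: x :: v) = (n + (size v).+2)%N by rewrite size_cat un.
rewrite e1 e2 big_mkcond [RHS]big_mkcond !sum_seqs_cat.
apply: eq_big_seq => e0 /size_seqs_mem e0s.
rewrite !sum_seqsS; under eq_bigr do rewrite sum_seqsS.
under [RHS]eq_bigr do rewrite sum_seqsS.
rewrite [RHS]exchange_big; apply: eq_bigr => a _; apply: eq_bigr => b _.
apply: eq_big_seq => e /size_seqs_mem es.
rewrite !sumn_cat /= [(b + (a + _))%N]addnCA; case: ifP => // _.
have e0u : size e0 = size u by rewrite un.
rewrite !subp_cat // !subp_cons.
have IH' q s' s1 s2 : size q = n -> acoef (q ++ s1 :: s2 :: s') = (-1) ^+ p * acoef (q ++ s2 :: s1 :: s').
  by move=> qn; apply: IHn.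
rewrite IH' ?size_subp // !big_cat !big_cons /=; ring.
Qed.

Lemma acoef_sqr_perm s t : perm_eq s t -> acoef s ^+ 2 = acoef t ^+ 2.
Proof.
apply: (@perm_swap_inv _ _ (fun s => acoef s ^+ 2)) => u x y v.
by rewrite acoef_swap exprMn -exprM mulnC exprM sqrrN !expr1n mul1r.
Qed.

Section Expansion.
Variable K : fieldType.
Variable c : {rmorphism R -> K}.

Fixpoint vand (w : seq K) : K :=
  if w is x :: w' then (\prod_(y <- w') (y - x) ^+ p) * vand w' else 1.

Definition monz (w : seq K) (s : seq int) : K := \prod_(z <- zip w s) z.1 ^ z.2.

Lemma vand_expand (w : seq K) : (0 < p)%N -> all (fun x => x != 0) w ->
  vand w = \sum_(s <- seqs (orb (size w)) (size w)) c (acoef s) * monz w s.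
Proof.
move=> p0; elim: w => [|x w IH].
  by rewrite sum_seqs0 acoef_nil rmorph1 mul1r /monz /= big_nil.
rewrite /= => /andP[x0 w0]; rewrite IH //; set N := size w; pose I := erng.
have bin y : (y - x) ^+ p = \sum_(e <- I) c (cbin e) * (x ^+ e * y ^+ (p - e)).
  rewrite exprBn -{1}(big_mkord xpredT (fun i : nat => ((-1) ^+ i * y ^+ (p - i) * x ^+ i) *+ 'C(p, i))).
  rewrite /index_iota subn0 -/erng; apply: eq_bigr => e _.
  rewrite /cbin rmorphM rmorph_nat rmorphXn rmorphN rmorph1 -mulr_natr; ring.
transitivity (\sum_(e <- seqs I N) (c (\prod_(i <- e) cbin i) * x ^+ (sumn e)) *
   \sum_(t <- seqs (orb N) N) c (acoef t) * monz w (addp t e)).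
  rewrite (eq_bigr _ (fun y _ => bin y)) -(@sum_seqs_prod2 _ _ _ I w
     (fun y e => c (cbin e) * (x ^+ e * y ^+ (p - e)))) -/N mulr_suml.
  apply: eq_big_seq => e; rewrite mem_seqs => /andP[/eqP es al].
  have -> : \prod_(z <- zip w e) (c (cbin z.2) * (x ^+ z.2 * z.1 ^+ (p - z.2))) =
     c (\prod_(i <- e) cbin i) * x ^+ sumn e * \prod_(z <- zip w e) z.1 ^+ (p - z.2).
    move: es; rewrite /N; elim: (w) (e) => [|y w' IHw] [|f e'] //=.
      by rewrite !big_nil rmorph1 !mul1r.
    by case=> /IHw; rewrite !big_cons => ->; rewrite rmorphM exprD; ring.
  rewrite -!mulrA; congr (_ * (_ * _)).
  rewrite mulr_sumr; apply: eq_big_seq => t /size_seqs_mem ts.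
  rewrite mulrCA; congr (_ * _).
  move: es ts al w0; rewrite /N /monz.
  elim: (w) (e) (t) => [|y w' IHw] [|f e'] [|q t'] //=.
    by rewrite !big_nil mulr1.
  case=> es' [ts'] /andP[fI al] /andP[y0 w0].
  rewrite !big_cons /= -(IHw _ _ es' ts' al w0).
  have -> : q + p%:Z - f%:Z = q + (p - f)%N%:Z by have : f \in erng by []; rewrite mem_erng; nlia.
  rewrite expfzDr // -exprnP; move: (y ^ q) => Y; ring.
(* The shifted exponents do not fill [orb N.+1], but off their image the coefficient is zero by
   [acoef_supp]. *)
transitivity (\sum_(e <- seqs I N) (c (\prod_(i <- e) cbin i) * x ^+ (sumn e)) *
   \sum_(s <- seqs (orb N.+1) N) c (acoef (subp s e)) * monz w s).
  apply: eq_big_seq => e; rewrite mem_seqs => /andP[/eqP es al]; congr (_ * _).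
  rewrite (@big_reindex_supp _ _ _ (seqs (orb N) N) (seqs (orb N.+1) N) (fun t => addp t e)).
  - by apply: eq_big_seq => t /size_seqs_mem ts; rewrite addpK // es ts.
  - by rewrite uniq_seqs ?uniq_orb.
  - by rewrite uniq_seqs ?uniq_orb.
  - move=> t t' /size_seqs_mem ts /size_seqs_mem ts' E.
    by rewrite -(@addpK t e) ?es ?ts // E addpK // es ts'.
  - move=> t; rewrite !mem_seqs => /andP[/eqP ts alt].
    rewrite size_addp ?es ?ts // eqxx /=; rewrite {IH bin}; move: es ts al alt.
    move: {1 2}N; elim: (t) (e) => [|q t' IHt] [|f e'] [|m] //= [es'] [ts'].
    move=> /andP[fI al] /andP[qo alt]; rewrite (IHt e' m) // andbT.
    have : f \in erng by []; have : q \in orb N by [].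
    rewrite !mem_orb mem_erng; nlia.
  - move=> s; rewrite !mem_seqs => /andP[/eqP ss _] nz.
    have nz' : acoef (subp s e) != 0.
      by apply: contraNneq nz => ->; rewrite rmorph0 mul0r.
    have sse : size (subp s e) = N by rewrite size_subp ?es ?ss.
    exists (subp s e); last by rewrite subpK // es ss.
    by rewrite mem_seqs sse eqxx /= -{1}sse acoef_supp.
rewrite sum_seqsS exchange_big /=.
under eq_bigr do rewrite mulr_sumr.
rewrite exchange_big /=; apply: eq_big_seq => s /size_seqs_mem ss.
under [RHS]eq_bigr => i _ do rewrite acoef_cons ss rmorph_sum mulr_suml big_mkcond /=.
rewrite exchange_big /=; apply: eq_big_seq => e; rewrite mem_seqs => /andP[/eqP es al].
have se : (sumn e)%:Z \in orb N.+1.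
  have := sumn_le_p al; rewrite es mem_orb mulnS; nlia.
rewrite (bigD1_seq (sumn e)%:Z) ?uniq_orb //= eqxx [X in _ + X]big1 ?addr0.
  by rewrite rmorphM /monz /= big_cons /= -exprnP; ring.
by move=> i /negbTE; rewrite eq_sym => ->.
Qed.

End Expansion.

End Acoef.

(** * Weights and cuts *)

Section Weights.
Variables (R : realType) (p : nat) (g : R).
Hypothesis p0 : (0 < p)%N.

Local Notation acoef := (acoef R p).
Local Notation orb := (orb p).
Local Notation tri := (tri p).

Definition sq2 (s : seq int) : R := \sum_(x <- s) (x%:~R) ^+ 2.
(** The value of [sq2] on the densest configuration 0, p, ..., p(N-1). *)
Definition root2 (N : nat) : R := \sum_(k < N) ((p * k)%N%:R) ^+ 2.

(* The coefficient normalised so that the densest configuration (0, p, 2p, ...) has weight 1. *)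
Definition bw (s : seq int) : R := acoef s * expR (g / 2 * (sq2 s - root2 (size s))).
Definition wt (s : seq int) : R := bw s ^+ 2.
(** The partition function. With the factor 1/N!, the configurations with a cut at [k] contribute
    exactly [CN k * CN (N - k)], see [CN_cut]. *)
Definition CN (N : nat) : R := locked ((\sum_(s <- seqs (orb N) N) wt s) / N`!%:R).

Definition ltk (k : nat) : pred int := fun x => x < (p * k)%N%:Z.
Definition leftk (k : nat) (s : seq int) : seq int := seq.filter (ltk k) s.
Definition rightk (k : nat) (s : seq int) : seq int :=
  shiftz (p * k)%N%:Z (seq.filter (predC (ltk k)) s).
(* The particles below site [p k] are as many and as tightly packed as [dominance] permits;
   the coefficient then factorises ([acoef_cut]). *)
Definition cut (k : nat) (s : seq int) : bool :=
  (count (ltk k) s == k) && (isum (leftk k s) == (tri k)%:Z).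

Lemma CNE N : CN N = (\sum_(s <- seqs (orb N) N) wt s) / N`!%:R.
Proof. by rewrite /CN -lock. Qed.

Lemma wt_ge0 s : 0 <= wt s. Proof. exact: sqr_ge0. Qed.

Lemma sq2_perm s t : perm_eq s t -> sq2 s = sq2 t.
Proof. by move=> st; apply: perm_big. Qed.

Lemma wt_perm s t : perm_eq s t -> wt s = wt t.
Proof.
move=> st; rewrite /wt /bw !exprMn (acoef_sqr_perm _ _ st) (sq2_perm st).
by rewrite (perm_size st).
Qed.

Lemma isum_perm s t : perm_eq s t -> isum s = isum t.
Proof. by move=> st; apply: perm_big. Qed.

Lemma cut_perm k s t : perm_eq s t -> cut k s = cut k t.
Proof.
move=> st; rewrite /cut; congr (_ && _).
  by have /permP -> := st.
by rewrite (@isum_perm (leftk k s) (leftk k t)) // perm_filter.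
Qed.

Lemma bw_neq0 s : (bw s != 0) = (acoef s != 0).
Proof. by rewrite /bw mulf_eq0 negb_or (gt_eqF (expR_gt0 _)) andbT. Qed.

Lemma bw_supp s : bw s != 0 -> all (mem (orb (size s))) s.
Proof. by rewrite bw_neq0; apply: acoef_supp. Qed.

Lemma wt_neq0 s : (wt s != 0) = (bw s != 0).
Proof. by rewrite /wt expf_eq0. Qed.

Lemma sq2_cat s t : sq2 (s ++ t) = sq2 s + sq2 t.
Proof. by rewrite /sq2 big_cat. Qed.

Lemma sq2_cons x s : sq2 (x :: s) = x%:~R ^+ 2 + sq2 s.
Proof. by rewrite /sq2 big_cons. Qed.

Lemma sq2_shiftz c s :
  sq2 (shiftz c s) = sq2 s - 2 * c%:~R * (isum s)%:~R + c%:~R ^+ 2 * (size s)%:R.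
Proof.
elim: s => [|x s IH]; first by rewrite /sq2 /= !big_nil isum_nil; ring.
rewrite /shiftz /= -/(shiftz c s) !sq2_cons IH isum_cons.
by rewrite -[(size s).+1]addn1 natrD !intrD mulrNz; ring.
Qed.

Lemma root2S N : root2 N.+1 = root2 N + ((p * N)%N%:R) ^+ 2.
Proof. by rewrite /root2 big_ord_recr. Qed.

Lemma root20 : root2 0 = 0.
Proof. by rewrite /root2 big_ord0. Qed.

Lemma root2D k m : root2 (k + m) =
  root2 k + root2 m + 2 * (p * k)%N%:R * (tri m)%:R + (p * k)%N%:R ^+ 2 * m%:R.
Proof.
elim: m => [|m IH]; first by rewrite addn0 root20 tri0; ring.
by rewrite addnS !root2S IH triS -natr1 natrD !natrM natrD; ring.
Qed.

Lemma count_id_map (A : Type) (P : pred A) s : count id (map P s) = count P s.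
Proof. by rewrite count_map; apply: eq_count. Qed.

Lemma filterC_mask (A : Type) (P : pred A) s :
  mask (map negb (map P s)) s = seq.filter (predC P) s.
Proof. by rewrite -map_comp -filter_mask. Qed.

Lemma size_leftk k s : size (leftk k s) = count (ltk k) s.
Proof. exact: size_filter. Qed.

Lemma size_rightk k s : size (rightk k s) = (size s - count (ltk k) s)%N.
Proof. by rewrite size_shiftz size_filter -(count_predC (ltk k) s) addKn. Qed.

(** Besides [acoef_cut], the Gaussian exponents have to add up: the total momentum of the right part
    is known, so its shift changes [sq2] by exactly the cross terms of [root2D]. *)
Lemma bw_cut k s : cut k s ->
  bw s = sgnm R p (map (ltk k) s) * (bw (leftk k s) * bw (rightk k s)).
Proof.
move=> /andP[/eqP ck /eqP ik].
have cid : count id (map (ltk k) s) = k by rewrite count_id_map.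
have E : acoef s = sgnm R p (map (ltk k) s) * acoef (leftk k s) * acoef (rightk k s).
  rewrite (@acoef_cut _ _ s (map (ltk k) s)) ?size_map // cid -?filter_mask //.
  by rewrite filterC_mask.
rewrite /bw E; have [->|a0] := eqVneq (acoef (rightk k s)) 0; first by rewrite !(mulr0, mul0r).
have tot := acoef_total a0.
rewrite size_rightk ck in tot.
have ks : (k <= size s)%N by rewrite -ck count_size.
have -> : sq2 s = sq2 (leftk k s) + sq2 (seq.filter (predC (ltk k)) s).
  by rewrite -sq2_cat; apply: sq2_perm; rewrite perm_sym perm_filterC.
rewrite -{1}(subnKC ks) root2D size_leftk size_rightk ck.
move: tot; rewrite /rightk isum_shiftz sq2_shiftz size_filter.
have -> : count (predC (ltk k)) s = (size s - k)%N.
  by rewrite -(count_predC (ltk k) s) ck addKn.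
set u := isum _; set m := (size s - k)%N => tot.
have -> : u = (tri m)%:Z + (p * k)%N%:Z * m%:Z by lia.
rewrite intrD intrM -!pmulrn.
set A := acoef (leftk k s); set B := acoef (shiftz _ _).
by rewrite [A * _ * _]mulrACA -expRD -!mulrA; congr (_ * (_ * (_ * expR _))); ring.
Qed.

Lemma bw_total s : bw s != 0 -> isum s = (tri (size s))%:Z.
Proof. by rewrite bw_neq0 => /acoef_total. Qed.

Lemma ltk_orb k x : x \in orb k -> ltk k x.
Proof. by rewrite mem_orb => /andP[]. Qed.

Lemma orb_cat k N : (k <= N)%N ->
  orb N = orb k ++ map (fun x => x + (p * k)%N%:Z) (orb (N - k)).
Proof.
move=> kN; rewrite /orb -{1}(subnKC kN) mulnDr iotaD map_cat add0n; congr (_ ++ _).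
rewrite -{1}[(p * k)%N]addn0 iotaDl -!map_comp; apply: eq_map => i /=.
by rewrite PoszD addrC.
Qed.

Lemma filter_orb k N : (k <= N)%N ->
  seq.filter (ltk k) (orb N) = orb k /\
  seq.filter (predC (ltk k)) (orb N) = map (fun x => x + (p * k)%N%:Z) (orb (N - k)).
Proof.
move=> kN; rewrite (orb_cat kN) !filter_cat.
have a1 : all (ltk k) (orb k) by apply/allP => x; apply: ltk_orb.
have a2 : all (predC (ltk k)) (map (fun x => x + (p * k)%N%:Z) (orb (N - k))).
  apply/allP => x /mapP[y]; rewrite mem_orb /ltk /= => /andP[y0 _] ->.
  by rewrite -leNgt lerDr.
split.
  rewrite (all_filterP a1) [X in _ ++ X](_ : _ = [::]) ?cats0 //.
  apply/eqP; rewrite -[_ == _]negbK -has_filter -all_predC //.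
rewrite [X in X ++ _](_ : _ = [::]) ?(all_filterP a2) //.
apply/eqP; rewrite -[_ == _]negbK -has_filter -all_predC.
by apply: sub_all a1 => x /= ->.
Qed.

Lemma sum_orb_split (V : nmodType) k N M j (F : seq int -> seq int -> V) :
  (k <= N)%N -> (j <= M)%N ->
  \sum_(n <- seqs (orb N) M | count (ltk k) n == j) F (leftk k n) (rightk k n) =
  (\sum_(s <- seqs (orb k) j) \sum_(t <- seqs (orb (N - k)) (M - j)) F s t) *+ 'C(M, j).
Proof.
move=> kN jM; rewrite /leftk /rightk.
rewrite (@sum_seqs_filter _ _ (ltk k) (orb N) M j
   (fun s t => F s (shiftz (p * k)%N%:Z t))) //.
have [-> ->] := filter_orb kN; congr (_ *+ _); apply: eq_bigr => s _.
rewrite sum_seqs_map; apply: eq_bigr => t _; congr (F _ _).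
by rewrite /shiftz -map_comp -[RHS]map_id; apply: eq_map => x /=; rewrite addrK.
Qed.

Lemma leftk_cat k s t : leftk k (s ++ t) = leftk k s ++ leftk k t.
Proof. exact: filter_cat. Qed.

Lemma rightk_cat k s t : rightk k (s ++ t) = rightk k s ++ rightk k t.
Proof. by rewrite /rightk filter_cat /shiftz map_cat. Qed.

Lemma leftk_lt k a : all (ltk k) a -> leftk k a = a.
Proof. by move/all_filterP. Qed.

Lemma leftk_ge k c : all (predC (ltk k)) c -> leftk k c = [::].
Proof.
by move=> h; apply/eqP; rewrite -[_ == _]negbK -has_filter -all_predC.
Qed.

Lemma rightk_ge k c : all (predC (ltk k)) c -> rightk k c = shiftz (p * k)%N%:Z c.
Proof. by move=> h; rewrite /rightk (all_filterP h). Qed.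

Lemma rightk_lt k a : all (ltk k) a -> rightk k a = [::].
Proof.
move=> h; rewrite /rightk [seq.filter _ _](_ : _ = [::]) //.
apply/eqP; rewrite -[_ == _]negbK -has_filter -all_predC.
by apply: sub_all h => x /= ->.
Qed.

Lemma map_all_true (A : Type) (P : pred A) s : all P s -> map P s = nseq (size s) true.
Proof. by elim: s => //= x s IH /andP[-> /IH ->]. Qed.

Lemma map_all_false (A : Type) (P : pred A) s : all (predC P) s -> map P s = nseq (size s) false.
Proof. by elim: s => //= x s IH /andP[/negbTE -> /IH ->]. Qed.

Lemma count_lt k a c n : all (ltk k) a -> all (predC (ltk k)) c ->
  count (ltk k) (a ++ c ++ n) = (size a + count (ltk k) n)%N.
Proof.
move=> ha hc; rewrite !count_cat; congr addn; first by apply/eqP; rewrite -all_count.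
by rewrite -size_leftk leftk_ge.
Qed.

(** Marks [a], [a'] lie left of the cut and [c], [c'] right of it; the unmarked particles [n] are
    shared by both amplitudes and split at the cut. The indicator in front of the result says that
    the marks fit into the two sides. *)
Lemma cut_sum k N M a c a' c' (F : seq int -> seq int -> R) :
  (k <= N)%N -> (size a + size c + M)%N = N ->
  size a = size a' -> size c = size c' ->
  all (ltk k) a -> all (ltk k) a' ->
  all (predC (ltk k)) c -> all (predC (ltk k)) c' ->
  (\sum_(n <- seqs (orb N) M)
     (cut k (a ++ c ++ n) && cut k (a' ++ c' ++ n))%:R *
     (bw (a ++ c ++ n) * bw (a' ++ c' ++ n) * F (leftk k n) (rightk k n))) / M`!%:R =
  ((size a <= k) && (size c <= N - k))%N%:R *
  ((\sum_(s <- seqs (orb k) (k - size a))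
    \sum_(t <- seqs (orb (N - k)) (N - k - size c))
      (bw (a ++ s) * bw (a' ++ s) *
       (bw (shiftz (p * k)%N%:Z c ++ t) * bw (shiftz (p * k)%N%:Z c' ++ t)) * F s t))
   / ((k - size a)`!%:R * (N - k - size c)`!%:R)).
Proof.
move=> kN aM aa cc ha ha' hc hc'.
have ctn n : cut k (a ++ c ++ n) && cut k (a' ++ c' ++ n) ->
    count (ltk k) n = (k - size a)%N /\ (size a <= k)%N.
  by case/andP=> /andP[/eqP h _] _; rewrite count_lt // in h; split; lia.
case: (boolP ((size a <= k) && (size c <= N - k))%N) => [/andP[ak cNk]|bad]; last first.
  rewrite mul0r big1_seq ?mul0r // => n /= /size_seqs_mem nM.
  case: (boolP (_ && _)) => h; rewrite ?mul0r //; have [cn ak] := ctn _ h.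
  case/negP: bad; rewrite ak /=; move: (count_size (ltk k) n); rewrite nM cn; lia.
rewrite mul1r.
pose j := (k - size a)%N.
have jM : (j <= M)%N by rewrite /j; lia.
have Mj : (M - j = N - k - size c)%N by rewrite /j; lia.
have -> : \sum_(n <- seqs (orb N) M)
     (cut k (a ++ c ++ n) && cut k (a' ++ c' ++ n))%:R *
     (bw (a ++ c ++ n) * bw (a' ++ c' ++ n) * F (leftk k n) (rightk k n)) =
   \sum_(n <- seqs (orb N) M | count (ltk k) n == j)
     (fun s t => bw (a ++ s) * bw (a' ++ s) *
       (bw (shiftz (p * k)%N%:Z c ++ t) * bw (shiftz (p * k)%N%:Z c' ++ t)) * F s t)
     (leftk k n) (rightk k n).
  rewrite [RHS]big_mkcond; apply: eq_big_seq => n /size_seqs_mem nM.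
  case: ifPn => [/eqP cj|cj]; last first.
    case: (boolP (_ && _)) => h; rewrite ?mul0r //; have [cn _] := ctn _ h.
    by rewrite cn eqxx in cj.
  have lft : leftk k (a ++ c ++ n) = a ++ leftk k n.
    by rewrite !leftk_cat leftk_lt // leftk_ge.
  have lft' : leftk k (a' ++ c' ++ n) = a' ++ leftk k n.
    by rewrite !leftk_cat leftk_lt // leftk_ge.
  have rgt : rightk k (a ++ c ++ n) = shiftz (p * k)%N%:Z c ++ rightk k n.
    by rewrite !rightk_cat rightk_lt // rightk_ge.
  have rgt' : rightk k (a' ++ c' ++ n) = shiftz (p * k)%N%:Z c' ++ rightk k n.
    by rewrite !rightk_cat rightk_lt // rightk_ge.
  have sl : size (a ++ leftk k n) = k by rewrite size_cat size_leftk cj /j; lia.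
  have sl' : size (a' ++ leftk k n) = k by rewrite size_cat size_leftk cj -aa /j; lia.
  case: (boolP (_ && _)) => [/andP[h h']|h].
    rewrite mul1r (bw_cut h) (bw_cut h') lft lft' rgt rgt' !map_cat.
    rewrite (map_all_true ha) (map_all_true ha') (map_all_false hc) (map_all_false hc') -aa -cc.
    (* Both amplitudes carry the same sign, which depends only on the positions that lie left; it
       cancels. *)
    set sg := sgnm _ _ _; have := sgnm_sqr R p (nseq (size a) true ++ nseq (size c) false ++ map (ltk k) n).
    rewrite -/sg => ss.
    set x1 := bw _; set x2 := bw _; set y1 := bw _; set y2 := bw _; set f := F _ _.
    transitivity (sg * sg * (x1 * y1 * (x2 * y2) * f)); first by ring.
    by rewrite ss mul1r.
  rewrite mul0r.
  (* The number of particles on the left is right but there is no cut: then a left part has the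
     wrong total momentum and its amplitude is zero. *)
  move: h; rewrite negb_and /cut lft lft' !count_lt // cj -aa.
  have -> : (size a + j = k)%N by rewrite /j; lia.
  rewrite eqxx /=; case/orP => h.
    suff -> : bw (a ++ leftk k n) = 0 by rewrite !mul0r.
    by apply/eqP; apply: contraR h => /bw_total ->; rewrite sl.
  suff -> : bw (a' ++ leftk k n) = 0 by rewrite mulr0 !mul0r.
  by apply/eqP; apply: contraR h => /bw_total ->; rewrite sl'.
rewrite (@sum_orb_split _ k N M j (fun s t => bw (a ++ s) * bw (a' ++ s) *
       (bw (shiftz (p * k)%N%:Z c ++ t) * bw (shiftz (p * k)%N%:Z c' ++ t)) * F s t)) //.
rewrite -/j Mj; set S := \sum_(_ <- _) _.
rewrite -[S *+ _]mulr_natr -mulrA; congr (_ * _).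
have nz m : m`!%:R != 0 :> R by rewrite pnatr_eq0 -lt0n fact_gt0.
have nzb : 'C(M, j)%:R != 0 :> R by rewrite pnatr_eq0 -lt0n bin_gt0.
have := bin_fact jM; rewrite Mj => <-.
by rewrite !natrM; field; rewrite !nz nzb.
Qed.

Lemma cut_sum0 k N (F : seq int -> seq int -> R) : (k <= N)%N ->
  (\sum_(s <- seqs (orb N) N) (cut k s)%:R * (wt s * F (leftk k s) (rightk k s))) / N`!%:R =
  (\sum_(s <- seqs (orb k) k) \sum_(t <- seqs (orb (N - k)) (N - k))
      (wt s * wt t * F s t)) / (k`!%:R * (N - k)`!%:R).
Proof.
move=> kN; have := @cut_sum k N N [::] [::] [::] [::] F kN erefl erefl erefl isT isT isT isT.
rewrite /= !subn0 mul1r => H.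
transitivity ((\sum_(n <- seqs (orb N) N)
      (cut k n && cut k n)%:R * (bw n * bw n * F (leftk k n) (rightk k n))) / N`!%:R).
  by congr (_ / _); apply: eq_bigr => s _; rewrite andbb -expr2.
by rewrite H; congr (_ / _); apply: eq_bigr => s _; apply: eq_bigr => t _; rewrite -!expr2.
Qed.

Lemma sum_wt N : \sum_(s <- seqs (orb N) N) wt s = N`!%:R * CN N.
Proof. by rewrite CNE mulrC divfK // pnatr_eq0 -lt0n fact_gt0. Qed.

Lemma CN_cut k N : (k <= N)%N ->
  \sum_(s <- seqs (orb N) N) (cut k s)%:R * wt s = N`!%:R * (CN k * CN (N - k)).
Proof.
move=> kN; have := @cut_sum0 k N (fun _ _ => 1) kN.
have nz m : m`!%:R != 0 :> R by rewrite pnatr_eq0 -lt0n fact_gt0.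
under eq_bigr do rewrite mulr1.
move=> /(congr1 (fun x => x * N`!%:R)); rewrite divfK // => ->.
under eq_bigr do (under eq_bigr do rewrite mulr1).
under eq_bigr do rewrite -mulr_sumr.
rewrite -mulr_suml !sum_wt; field.
by rewrite !nz.
Qed.

Lemma CN_ge0 N : 0 <= CN N.
Proof. by rewrite CNE divr_ge0 // sumr_ge0 // => s _; apply: wt_ge0. Qed.

(** Keep only the configurations with a cut at [k]. *)
Lemma CN_super k N : (k <= N)%N -> CN k * CN (N - k) <= CN N.
Proof.
move=> kN; rewrite -(@ler_pM2l _ N`!%:R) ?ltr0n ?fact_gt0 // -CN_cut // -sum_wt.
apply: ler_sum => s _; case: (cut k s); rewrite ?mul1r ?mul0r //; exact: wt_ge0.
Qed.

Lemma acoef_seq1 i : acoef [:: i] = (i == 0)%:R.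
Proof.
rewrite acoef_cons big_mkcond sum_seqs0 /= big_nil mul1r acoef_nil eq_sym.
by case: eqP.
Qed.

Lemma CN0 : CN 0 = 1.
Proof.
rewrite CNE sum_seqs0 fact0 divr1 /wt /bw acoef_nil mul1r /sq2 big_nil root20 subrr mulr0.
by rewrite expR0 expr1n.
Qed.

Lemma CN1 : CN 1 = 1.
Proof.
rewrite CNE -[1`!]/1%N divr1 sum_seqsS (bigD1_seq 0) ?uniq_orb //=; last first.
  by rewrite mem_orb lexx /= muln1 ltz_nat.
rewrite [X in _ + X]big1 ?addr0.
  rewrite sum_seqs0 /wt /bw acoef_seq1 eqxx mul1r /sq2 big_seq1 expr0n root2S root20.
  by rewrite muln0 expr0n addr0 subrr mulr0 expR0 expr1n.
by move=> i i0; rewrite sum_seqs0 /wt /bw acoef_seq1 (negbTE i0) mul0r expr0n.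
Qed.

Lemma CN_mono N : CN N <= CN N.+1.
Proof. by have := @CN_super N N.+1 (leqnSn N); rewrite subSnn CN1 mulr1. Qed.

Lemma CN_mono_le m n : (m <= n)%N -> CN m <= CN n.
Proof. by move=> /subnK <-; elim: (n - m)%N => // k IH; apply: le_trans IH (CN_mono _). Qed.

Lemma CN_ge1 N : 1 <= CN N.
Proof. by rewrite -CN0 CN_mono_le. Qed.

Lemma CN_gt0 N : 0 < CN N.
Proof. exact: lt_le_trans ltr01 (CN_ge1 N). Qed.

Lemma ltk_leq j k x : (j <= k)%N -> ltk j x -> ltk k x.
Proof. by rewrite /ltk => jk xj; apply: lt_le_trans xj _; rewrite lez_nat leq_mul2l jk orbT. Qed.

Lemma leftk_leftk j k s : (j <= k)%N -> leftk j (leftk k s) = leftk j s.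
Proof.
move=> jk; rewrite /leftk -filter_predI; apply: eq_filter => x /=.
by case: (boolP (ltk j x)) => // /(ltk_leq jk) ->.
Qed.

Lemma cut_left j k s : (j <= k)%N -> cut j (leftk k s) = cut j s.
Proof. by move=> jk; rewrite /cut -!size_leftk leftk_leftk. Qed.

Lemma count_right j k s : (k <= j)%N ->
  count (ltk j) s = (count (ltk k) s + count (ltk (j - k)) (rightk k s))%N /\
  isum (leftk j s) = isum (leftk k s) + isum (leftk (j - k) (rightk k s)) +
     (p * k)%N%:Z * (count (ltk (j - k)) (rightk k s))%:Z.
Proof.
move=> kj; elim: s => [|x s [IH1 IH2]]; first by split=> //; rewrite /leftk /rightk /= !isum_nil mulr0.
have -> : rightk k (x :: s) = if ltk k x then rightk k s else (x - (p * k)%N%:Z) :: rightk k s.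
  by rewrite /rightk /=; case: (ltk k x).
case: (boolP (ltk k x)) => kx.
  have jx := ltk_leq kj kx.
  have lk i : ltk i x -> leftk i (x :: s) = x :: leftk i s by rewrite /leftk /= => ->.
  by split; [rewrite /= kx jx IH1; lia|rewrite !lk // !isum_cons IH2; lia].
have jx : ltk j x = ltk (j - k) (x - (p * k)%N%:Z).
  by rewrite /ltk mulnBr; apply/idP/idP; nia.
have lk i y t : leftk i (y :: t) = if ltk i y then y :: leftk i t else leftk i t by [].
split; first by rewrite /= (negbTE kx) IH1 jx; lia.
rewrite !lk /= (negbTE kx) jx; case: ifP => hx /=; rewrite ?isum_cons IH2; lia.
Qed.

(** Past a cut at [k], count and momentum below [j] are those of the left part plus those of the
    shifted right part; [triD] is the same identity for sharp momenta. *)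
Lemma cut_right j k s : (k <= j)%N -> cut k s -> cut (j - k) (rightk k s) = cut j s.
Proof.
move=> kj /andP[/eqP c1 /eqP c2]; have [e1 e2] := count_right s kj.
rewrite /cut e1 e2 c1 c2; set c := count _ (rightk _ _).
have -> : ((k + c)%N == j) = (c == (j - k)%N) by apply/eqP/eqP; lia.
case: eqP => //= ->.
have -> : tri j = tri (k + (j - k)) by rewrite subnKC.
rewrite triD; apply/eqP/eqP; nia.
Qed.

Lemma cut_size s : bw s != 0 -> cut (size s) s.
Proof.
move=> b0; have al := bw_supp b0.
have h : all (ltk (size s)) s by apply: sub_all al => x; apply: ltk_orb.
by rewrite /cut leftk_lt // -all_count h /= bw_total.
Qed.

Lemma cut_0 s : bw s != 0 -> cut 0 s.
Proof.
move=> b0; have al := bw_supp b0.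
have h : all (predC (ltk 0)) s.
  apply: sub_all al => x; rewrite -[mem _ _]/(_ \in orb _) mem_orb /= /ltk muln0 => /andP[x0 _].
  by rewrite -leNgt.
by rewrite /cut -size_leftk leftk_ge //= isum_nil tri0.
Qed.

End Weights.

(** * The discretised plasma *)

Section Parseval.
Variables (K : comNzRingType) (T : Type) (L : (T -> K) -> K).
Variables (phi phi' : int -> T -> K) (r : seq int) (c0 : K).
Hypothesis LP : forall B : int -> int -> K,
  L (fun z => \sum_(i <- r) \sum_(j <- r) B i j * (phi i z * phi' j z)) =
  c0 * \sum_(i <- r) B i i.

Fixpoint iterL (M : nat) (F : seq T -> K) : K :=
  if M is M'.+1 then L (fun z => iterL M' (fun zs => F (z :: zs))) else F [::].

Definition prodphi (f : int -> T -> K) (n : seq int) (zs : seq T) : K :=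
  \prod_(x <- zip n zs) f x.1 x.2.

(** Stated for an abstract functional [L] because it serves twice: for the grid of angles in
    [grid_parseval] and for integration over the cylinder in [laughlin_integral]. *)
Lemma iterL_parseval M (A : seq int -> seq int -> K) :
  iterL M (fun zs => \sum_(n <- seqs r M) \sum_(n' <- seqs r M)
     A n n' * (prodphi phi n zs * prodphi phi' n' zs)) =
  c0 ^+ M * \sum_(n <- seqs r M) A n n.
Proof.
elim: M A => [|M IH] A /=.
  by rewrite !sum_seqs0 mul1r /prodphi /= !big_nil !mulr1.
transitivity (L (fun z => \sum_(i <- r) \sum_(j <- r)
    (c0 ^+ M * \sum_(n <- seqs r M) A (i :: n) (j :: n)) * (phi i z * phi' j z))).
  congr (L _); apply/funext => z.
  rewrite (_ : (fun zs => _) = (fun zs => \sum_(n <- seqs r M) \sum_(n' <- seqs r M)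
     (\sum_(i <- r) \sum_(j <- r) A (i :: n) (j :: n') * (phi i z * phi' j z)) *
     (prodphi phi n zs * prodphi phi' n' zs))); last first.
    apply/funext => zs; rewrite sum_seqsS.
    rewrite exchange_big /=; apply: eq_bigr => n _.
    under eq_bigr => i _ do rewrite sum_seqsS exchange_big /=.
    rewrite exchange_big /=; apply: eq_bigr => n' _.
    rewrite mulr_suml; apply: eq_bigr => i _; rewrite mulr_suml; apply: eq_bigr => j _.
    by rewrite /prodphi /= !big_cons /=; ring.
  rewrite IH exchange_big mulr_sumr /=; apply: eq_bigr => i _.
  rewrite exchange_big mulr_sumr; apply: eq_bigr => j _.
  by rewrite -mulrA mulr_suml.
by rewrite LP sum_seqsS -mulr_sumr exprS mulrA.
Qed.

End Parseval.

(** * Unit complex numbers, roots of unity and the modulus *)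

Section Cis.
Variable R : realType.

Definition cis (t : R) : R[i] := Complex (cos t) (sin t).

Lemma cis0 : cis 0 = 1.
Proof. by rewrite /cis cos0 sin0. Qed.

Lemma cisD a b : cis (a + b) = cis a * cis b.
Proof.
rewrite /cis cosD sinD; apply/eqP; rewrite eq_complex /= eqxx /=.
by apply/eqP; ring.
Qed.

Lemma conj_cis a : ((cis a)^*)%C = cis (- a).
Proof. by rewrite /cis cosN sinN. Qed.

Lemma cisMn a n : cis (a * n%:R) = cis a ^+ n.
Proof.
elim: n => [|n IH]; first by rewrite mulr0 cis0.
by rewrite -natr1 mulrDr mulr1 cisD IH exprSr.
Qed.

Lemma cis2pi : cis (2 * pi) = 1.
Proof. by rewrite /cis mulr_natl cos2pi sin2pi. Qed.

Lemma cis2piz (d : int) : cis (2 * pi * d%:~R) = 1.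
Proof.
case: d => n; first by rewrite -pmulrn cisMn cis2pi expr1n.
by rewrite NegzE mulrNz mulrN -conj_cis -pmulrn cisMn cis2pi expr1n conjc1.
Qed.

Lemma cis_neq1 t : 0 < t < 2 * pi -> cis t != 1.
Proof.
move=> /andP[t0 t2]; apply/negP => /eqP[c1 _].
have h : 0 < t / 2 < pi by apply/andP; split; lra.
have s0 := sin_gt0_pi h.
have tt : (t / 2) *+ 2 = t by rewrite mulr2n; lra.
have := cos_mulr2n (t / 2); rewrite tt c1 cos2sin2.
move: s0; set s := sin _ => s0 E.
have : s ^+ 2 = 0 by move: E; rewrite mulr2n; lra.
by move/eqP; rewrite expf_eq0 /= gt_eqF.
Qed.

(** A geometric sum whose ratio is a [Q]-th root of unity; the ratio is 1 only for i = j because |i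
    - j| < Q. *)
Lemma grid_orth (Q : nat) (i j : int) : (0 < Q)%N ->
  0 <= i < Q%:Z -> 0 <= j < Q%:Z ->
  \sum_(th <- iota 0 Q) cis (2 * pi * i%:~R * th%:R / Q%:R) *
     ((cis (2 * pi * j%:~R * th%:R / Q%:R))^*)%C = (if i == j then Q%:R else 0).
Proof.
move=> Q0 iQ jQ; have Qn : Q%:R != 0 :> R by rewrite pnatr_eq0 -lt0n.
pose d := i - j; pose z := cis (2 * pi * d%:~R / Q%:R).
have -> : \sum_(th <- iota 0 Q) cis (2 * pi * i%:~R * th%:R / Q%:R) *
     ((cis (2 * pi * j%:~R * th%:R / Q%:R))^*)%C = \sum_(k < Q) z ^+ k.
  rewrite -(big_mkord xpredT (fun k => z ^+ k)) /index_iota subn0.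
  apply: eq_bigr => k _; rewrite conj_cis -cisD -cisMn; congr cis.
  by rewrite /d intrD mulrNz; ring.
have zQ : z ^+ Q = 1 by rewrite -cisMn divfK // cis2piz.
have := subrX1 z Q; rewrite zQ subrr => /eqP; rewrite eq_sym mulf_eq0 subr_eq0.
case: (eqVneq i j) => [ij|ij].
  move=> _; rewrite /z /d ij subrr mulr0 mul0r cis0.
  by under eq_bigr do rewrite expr1n; rewrite sumr_const card_ord.
case/orP => [/eqP z1|/eqP //]; exfalso.
have Qp : 0 < Q%:R :> R by rewrite ltr0n.
have pp := pi_gt0 R.
have [dp|dn] := ltP 0 d.
  have/eqP := z1; apply/negP; apply: cis_neq1; apply/andP; split.
    by rewrite !divr_gt0 // !mulr_gt0 // ltr0z.
  rewrite ltr_pdivrMr // ltr_pM2l ?mulr_gt0 // -[Q%:R]/(Q%:Z%:~R) ltr_int /d; lia.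
have dn' : 0 < - d by rewrite /d; move/eqP: ij => ij; rewrite /d in dn; lia.
have : cis (2 * pi * (- d)%:~R / Q%:R) = 1.
  by rewrite mulrNz mulrN mulNr -conj_cis -/z z1 conjc1.
move/eqP; apply/negP; apply: cis_neq1; apply/andP; split.
  by rewrite !divr_gt0 // !mulr_gt0 // ltr0z.
rewrite ltr_pdivrMr // ltr_pM2l ?mulr_gt0 // -[Q%:R]/(Q%:Z%:~R) ltr_int /d; lia.
Qed.

Definition nrm (z : R[i]) : R := ComplexField.Normc.normc z.

Lemma nrm_ge0 z : 0 <= nrm z.
Proof. by case: z => a b; apply: sqrtr_ge0. Qed.

Lemma nrmM x y : nrm (x * y) = nrm x * nrm y.
Proof. exact: ComplexField.Normc.normcM. Qed.

Lemma nrm1 : nrm 1 = 1.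
Proof. exact: ComplexField.Normc.normc1. Qed.

Lemma nrm_sqr z : ((nrm z) ^+ 2)%:C%C = z * (z^*)%C.
Proof.
case: z => a b; rewrite /nrm /= sqr_sqrtr ?addr_ge0 ?sqr_ge0 //.
by apply/eqP; rewrite eq_complex /= -!expr2; apply/andP; split; apply/eqP; ring.
Qed.

Lemma nrmD x y : nrm (x + y) <= nrm x + nrm y.
Proof. exact: le_normcD. Qed.

Lemma nrmN x : nrm (- x) = nrm x.
Proof. exact: normcN. Qed.

Lemma nrm_real (a : R) : 0 <= a -> nrm a%:C%C = a.
Proof. by move=> a0; rewrite /nrm /= expr0n addr0 sqrtr_sqr ger0_norm. Qed.

Lemma nrm_cis t : nrm (cis t) = 1.
Proof. by rewrite /nrm /= cos2Dsin2 sqrtr1. Qed.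

Lemma nrmX z n : nrm (z ^+ n) = nrm z ^+ n.
Proof. by elim: n => [|n IH]; rewrite ?nrm1 // !exprS nrmM IH. Qed.

Lemma nrm_prod (A : Type) (s : seq A) (F : A -> R[i]) :
  nrm (\prod_(x <- s) F x) = \prod_(x <- s) nrm (F x).
Proof.
by elim: s => [|x s IH]; rewrite ?big_nil ?nrm1 // !big_cons nrmM IH.
Qed.

Lemma nrm0 : nrm 0 = 0.
Proof. exact: ComplexField.Normc.normc0. Qed.

Lemma cis_neq0 t : cis t != 0.
Proof.
apply/eqP => h; have := nrm_cis t; rewrite h nrm0 => /eqP.
by rewrite eq_sym oner_eq0.
Qed.

Lemma conjM (x y : R[i]) : conjc (x * y) = conjc x * conjc y.
Proof. exact: rmorphM. Qed.

Lemma conj_sum (A : Type) (s : seq A) (F : A -> R[i]) :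
  ((\sum_(x <- s) F x)^*)%C = \sum_(x <- s) ((F x)^*)%C.
Proof. exact: rmorph_sum. Qed.

Lemma conj_prod (A : Type) (s : seq A) (F : A -> R[i]) :
  ((\prod_(x <- s) F x)^*)%C = \prod_(x <- s) ((F x)^*)%C.
Proof. exact: rmorph_prod. Qed.

Lemma conj_real (x : R) : conjc (x%:C%C) = x%:C%C.
Proof. exact: conjc_real. Qed.

Lemma realM (x y : R) : (x * y)%:C%C = x%:C%C * y%:C%C.
Proof. exact: rmorphM. Qed.

Lemma nrm_sum (A : Type) (s : seq A) (P : pred A) (F : A -> R[i]) :
  nrm (\sum_(x <- s | P x) F x) <= \sum_(x <- s | P x) nrm (F x).
Proof.
elim/big_rec2: _ => [|x y z _ h]; first by rewrite nrm0.
by apply: le_trans (nrmD _ _) _; rewrite lerD2l.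
Qed.

End Cis.

(** * Splitting the plasma weight between ordered blocks *)

Section Plasma.
Variables (R : realType) (p : nat) (g : R).
Hypothesis p0 : (0 < p)%N.
Hypothesis g0 : 0 < g.

Local Notation acoef := (acoef R p).
Local Notation orb := (orb p).
Local Notation wt := (wt p g).
Local Notation CN := (CN p g).

Definition dot (s x : seq int) : int := \sum_(z <- zip s x) z.1 * z.2.
Definition gs (t : int) : R := expR (- (g * t%:~R ^+ 2)).

(* The x-marginal of the plasma on the lattice of orbital centres: a
   configuration of orbitals with independent Gaussian noise on each particle. *)
Definition fx (x : seq int) : R :=
  \sum_(s <- seqs (orb (size x)) (size x)) wt s * \prod_(z <- zip s x) gs (z.2 - z.1).

(** The mean over independent angles of the squared modulus of [vand] at points of radius e^(g x_i),
    see [grid_parseval]. *)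
Definition Gx (x : seq int) : R :=
  \sum_(s <- seqs (orb (size x)) (size x)) acoef s ^+ 2 * expR (2 * g * (dot s x)%:~R).

Lemma gs_ge0 t : 0 <= gs t. Proof. exact: expR_ge0. Qed.

Lemma fx_ge0 x : 0 <= fx x.
Proof.
apply: sumr_ge0 => s _; rewrite mulr_ge0 ?wt_ge0 // prodr_ge0 // => z _; exact: gs_ge0.
Qed.

Lemma dot_cons a s b x : dot (a :: s) (b :: x) = a * b + dot s x.
Proof. by rewrite /dot /= big_cons. Qed.

Lemma prod_gs s x : size s = size x ->
  \prod_(z <- zip s x) gs (z.2 - z.1) =
  expR (- g * (sq2 R x + sq2 R s) + 2 * g * (dot s x)%:~R).
Proof.
elim: s x => [|a s IH] [|b x] //=.
  by rewrite big_nil /sq2 !big_nil /dot /= big_nil addr0 !mulr0 addr0 expR0.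
case=> sx; rewrite big_cons (IH _ sx) /gs -expRD dot_cons !sq2_cons; congr expR.
by rewrite /= !intrD intrM mulrNz; ring.
Qed.

(** The growing factor e^(g s^2) of [wt] cancels the decaying one of the noise and leaves an
    exponential linear in s. This dictates the width of the noise. *)
Lemma fxE x : fx x = expR (- g * (sq2 R x + root2 R p (size x))) * Gx x.
Proof.
rewrite /fx /Gx mulr_sumr; apply: eq_big_seq => s /size_seqs_mem ss.
rewrite prod_gs // /wt /bw exprMn ss -expRM_natl -[LHS]mulrA [RHS]mulrCA; congr (_ * _).
by rewrite -!expRD; congr expR; field.
Qed.

Definition wseq (Q : nat) (x : seq int) (th : seq nat) : seq R[i] :=
  [seq (expR (g * z.1%:~R))%:C%C * cis (2 * pi * z.2%:R / Q%:R) | z <- zip x th].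

Lemma wseq_neq0 Q x th : all (fun w => w != 0) (wseq Q x th).
Proof.
apply/allP => w /mapP[z _ ->]; rewrite mulf_neq0 //.
  by rewrite fmorph_eq0 gt_eqF // expR_gt0.
exact: cis_neq0.
Qed.

Lemma size_wseq Q x th : size x = size th -> size (wseq Q x th) = size x.
Proof. by move=> e; rewrite size_map size_zip -e minnn. Qed.

Lemma monz_wseq Q N x th s : size x = N -> size th = N -> size s = N ->
  all (mem (orb N)) s ->
  monz (wseq Q x th) s = (expR (g * (dot s x)%:~R))%:C%C *
    prodphi (fun i (k : nat) => cis (2 * pi * i%:~R * k%:R / Q%:R)) s th.
Proof.
move: {1 2 3}N; elim: x th s => [|b x IH] [|k th] [|a s] [|m] //=.
  by rewrite /monz /prodphi /dot /= !big_nil mulr0 expR0 mulr1.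
move=> [e1] [e2] [e3] /andP[/= ao al]; rewrite /monz /wseq /= big_cons /= -/(wseq Q x th).
rewrite -/(monz (wseq Q x th) s) (IH th s m) // /prodphi /= big_cons dot_cons /=.
move: ao; rewrite mem_orb => /andP[a0 _]; case: a a0 => // a _.
rewrite -exprnP exprMn -rmorphXn /= -expRM_natl -cisMn.
have -> : g * (a%:Z * b + dot s x)%:~R = a%:R * (g * b%:~R) + g * (dot s x)%:~R :> R.
  by rewrite intrD intrM -pmulrn; ring.
rewrite expRD realM -!pmulrn.
have -> : 2 * pi * k%:R / Q%:R * a%:R = 2 * pi * a%:R * k%:R / Q%:R :> R by ring.
by ring.
Qed.

Lemma iterL_sum (M : nat) (r : seq nat) (F : seq nat -> R[i]) :
  iterL (fun h : nat -> R[i] => \sum_(k <- r) h k) M F = \sum_(th <- seqs r M) F th.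
Proof.
elim: M F => [|M IH] F /=; first by rewrite sum_seqs0.
by rewrite sum_seqsS; apply: eq_bigr => k _; rewrite IH.
Qed.

(** With at least [p * N] angles, distinct orbitals stay distinct modulo [Q]. *)
Lemma grid_parseval Q x : (0 < Q)%N -> (p * size x <= Q)%N ->
  \sum_(th <- seqs (iota 0 Q) (size x)) nrm (vand p (wseq Q x th)) ^+ 2 =
  Q%:R ^+ size x * Gx x.
Proof.
move=> Q0 Np; set N := size x.
pose phi (i : int) (k : nat) : R[i] := cis (2 * pi * i%:~R * k%:R / Q%:R).
pose phi' (i : int) (k : nat) : R[i] := ((phi i k)^*)%C.
pose A (s s' : seq int) : R[i] := (acoef s * expR (g * (dot s x)%:~R) *
   (acoef s' * expR (g * (dot s' x)%:~R)))%:C%C.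
apply: complexI; rewrite rmorph_sum /=.
transitivity (\sum_(th <- seqs (iota 0 Q) N)
   \sum_(n <- seqs (orb N) N) \sum_(n' <- seqs (orb N) N)
     A n n' * (prodphi phi n th * prodphi phi' n' th)).
  apply: eq_big_seq => th /size_seqs_mem ths.
  have VE : vand p (wseq Q x th) = \sum_(s <- seqs (orb N) N) (acoef s)%:C%C * monz (wseq Q x th) s.
    have := @vand_expand _ p _ (real_complex R) _ p0 (wseq_neq0 Q x th).
    by rewrite size_wseq ?ths.
  rewrite nrm_sqr VE conj_sum mulr_suml; apply: eq_big_seq => n.
  rewrite mem_seqs => /andP[/eqP nN nal].
  rewrite mulr_sumr; apply: eq_big_seq => n'; rewrite mem_seqs => /andP[/eqP nN' nal'].
  rewrite (@monz_wseq Q N x th n) // (@monz_wseq Q N x th n') //.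
  rewrite 2!conjM 2!conj_real /A !realM.
  rewrite -/phi; have -> : ((prodphi phi n' th)^*)%C = prodphi phi' n' th.
    by rewrite /prodphi conj_prod.
  by ring.
rewrite -iterL_sum (@iterL_parseval _ _ _ phi phi' (orb N) Q%:R).
  rewrite rmorphM rmorphXn rmorph_nat; congr (_ * _).
  rewrite /Gx rmorph_sum; apply: eq_bigr => s _; rewrite /A; congr (_%:C)%C.
  rewrite mulrACA -expr2 -expRD; congr (_ * expR _); ring.
move=> B; rewrite exchange_big /= mulr_sumr; apply: eq_big_seq => i iO.
rewrite exchange_big (bigD1_seq i) ?uniq_orb //= [X in _ + X]big1_seq ?addr0.
- rewrite -mulr_sumr grid_orth ?eqxx 1?mulrC //; move: iO; rewrite mem_orb -/N => /andP[h1 h2].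
    by rewrite h1 /=; apply: lt_le_trans h2 _; rewrite lez_nat.
  by rewrite h1 /=; apply: lt_le_trans h2 _; rewrite lez_nat.
move=> j /andP[ji jO]; rewrite -mulr_sumr grid_orth ?(negbTE ji) ?mulr0 //.
- by rewrite eq_sym (negbTE ji) mulr0.
- by move: iO; rewrite mem_orb => /andP[-> h2] /=; apply: lt_le_trans h2 _; rewrite lez_nat.
- by move: jO; rewrite mem_orb => /andP[-> h2] /=; apply: lt_le_trans h2 _; rewrite lez_nat.
Qed.

Lemma vand_cat (K : fieldType) (u v : seq K) :
  vand p (u ++ v) = vand p u * vand p v * \prod_(x <- u) \prod_(y <- v) (y - x) ^+ p.
Proof.
elim: u => [|x u IH] /=; first by rewrite big_nil mul1r mulr1.
by rewrite big_cat big_cons IH /=; ring.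
Qed.

(** Arises from 1 + e^(-g|x-y|) <= exp(e^(-g|x-y|)) in [nrm_diff]: how far |w_y - w_x| may exceed
    the larger radius, on a logarithmic scale. *)
Definition tk (x y : int) : R := expR (- (g * `|x - y|%:~R)).
Definition Ix (xs ys : seq int) : R := \sum_(x <- xs) \sum_(y <- ys) tk x y.

Lemma tk_ge0 x y : 0 <= tk x y. Proof. exact: expR_ge0. Qed.

Lemma Ix_ge0 xs ys : 0 <= Ix xs ys.
Proof. by apply: sumr_ge0 => x _; apply: sumr_ge0 => y _; apply: tk_ge0. Qed.

Lemma nrm_diff (x y : int) (s t : R) : x <= y ->
  nrm ((expR (g * y%:~R))%:C%C * cis s - (expR (g * x%:~R))%:C%C * cis t) <=
  expR (g * y%:~R + tk x y).
Proof.
move=> xy; apply: le_trans (nrmD _ _) _; rewrite nrmN !nrmM !nrm_cis !nrm_real ?expR_ge0 // !mulr1.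
have -> : g * x%:~R = g * y%:~R - g * `|x - y|%:~R :> R.
  have -> : `|x - y| = y - x by lia.
  by rewrite intrD mulrNz; ring.
rewrite expRD -/(tk x y) -{1}[expR _]mulr1 -mulrDr expRD ler_pM2l ?expR_gt0 //.
exact: expR_ge1Dx.
Qed.

(** The cross factors of [vand_cat] are bounded by [nrm_diff] uniformly in the angles; what is left
    is a product of two independent means. *)
Lemma Gx_cat xL xR : (forall x y, x \in xL -> y \in xR -> x <= y) ->
  Gx (xL ++ xR) <= expR (2 * p%:R * (g * (size xL)%:R * (isum xR)%:~R + Ix xL xR)) *
                   (Gx xL * Gx xR).
Proof.
move=> LR; pose Q := (p * (size xL + size xR)).+1.
have Q0 : (0 < Q)%N by [].
have QN : 0 < Q%:R ^+ (size xL + size xR) :> R by rewrite exprn_gt0.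
have h1 : (p * size (xL ++ xR) <= Q)%N by rewrite size_cat /Q.
have h2 : (p * size xL <= Q)%N by rewrite /Q mulnDr; lia.
have h3 : (p * size xR <= Q)%N by rewrite /Q mulnDr; lia.
rewrite -(ler_pM2l QN) -{1}size_cat -grid_parseval // mulrCA exprD.
rewrite [X in _ <= _ * X]mulrACA -!grid_parseval // size_cat sum_seqs_cat mulr_suml mulr_sumr.
rewrite big_seq [leRHS]big_seq; apply: ler_sum => a /size_seqs_mem sa.
rewrite mulr_sumr mulr_sumr big_seq [leRHS]big_seq; apply: ler_sum => b /size_seqs_mem sb.
have -> : wseq Q (xL ++ xR) (a ++ b) = wseq Q xL a ++ wseq Q xR b.
  by rewrite /wseq zip_cat ?map_cat.
rewrite vand_cat !nrmM exprMn mulrC exprMn; apply: ler_wpM2r.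
  by rewrite mulr_ge0 ?sqr_ge0.
have -> : expR (2 * p%:R * (g * (size xL)%:R * (isum xR)%:~R + Ix xL xR)) =
   (\prod_(x <- xL) \prod_(y <- xR) expR (g * y%:~R + tk x y)) ^+ (p * 2).
  under eq_bigr do rewrite -expR_sum.
  rewrite -expR_sum -expRM_natl; congr expR; rewrite natrM [p%:R * 2]mulrC; congr (_ * _).
  under [RHS]eq_bigr do rewrite big_split /=.
  rewrite big_split /= -/(Ix xL xR); congr (_ + _).
  rewrite -[in RHS]mulr_sumr big_const_seq count_predT iter_addr addr0.
  have -> : (isum xR)%:~R = \sum_(i <- xR) i%:~R :> R by rewrite /isum rmorph_sum.
  by rewrite -[in RHS]mulr_natr; ring.
rewrite exprM; apply: lerXn2r; rewrite ?nnegrE ?nrm_ge0 ?exprn_ge0 //.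
  by apply: prodr_ge0 => x _; apply: prodr_ge0 => y _; apply: expR_ge0.
have zl (xs : seq int) (ts : seq nat) (E : int -> R) : size ts = size xs ->
    \prod_(x <- xs) E x = \prod_(z <- zip xs ts) E z.1.
  by move=> e; rewrite -(big_map fst xpredT E) -/unzip1 unzip1_zip // e.
have zm (xs : seq int) (ts : seq nat) z : size ts = size xs -> z \in zip xs ts -> z.1 \in xs.
  by move=> e /(map_f fst); rewrite -/unzip1 unzip1_zip // e.
rewrite -prodrXl nrm_prod big_map (zl xL a) // big_seq [leRHS]big_seq.
apply: ler_prod => z /zm-/(_ sa) z1; rewrite nrm_ge0 /=.
rewrite nrm_prod big_map (zl xR b) // -prodrXl big_seq [leRHS]big_seq.
apply: ler_prod => z' /zm-/(_ sb) z1'; rewrite nrm_ge0 /= nrmX.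
by apply: lerXn2r; rewrite ?nnegrE ?nrm_ge0 ?expR_ge0 //; apply: nrm_diff; apply: LR.
Qed.

Lemma dot_shiftz s x c : size s = size x -> dot s (shiftz c x) = dot s x - c * isum s.
Proof.
elim: s x => [|a s IH] [|b x] //=; first by rewrite /dot /= !big_nil isum_nil mulr0.
by case=> e; rewrite !dot_cons IH // isum_cons; lia.
Qed.

Lemma Gx_shiftz c x :
  Gx (shiftz c x) = expR (- (2 * g * c%:~R * (tri p (size x))%:R)) * Gx x.
Proof.
rewrite /Gx size_shiftz mulr_sumr; apply: eq_big_seq => s /size_seqs_mem ss.
have [->|a0] := eqVneq (acoef s) 0; first by rewrite expr0n !mul0r mulr0.
rewrite mulrCA -expRD dot_shiftz // (acoef_total a0) ss; congr (_ * expR _).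
by rewrite intrD mulrNz intrM -pmulrn; ring.
Qed.

(** The radii of the right block leave a factor exp(2pg |xL| sum xR), which is exactly absorbed by
    shifting that block by p|xL|. The block then looks like one that starts at the origin. *)
Lemma fx_cat xL xR : (forall x y, x \in xL -> y \in xR -> x <= y) ->
  fx (xL ++ xR) <= expR (2 * p%:R * Ix xL xR) *
     (fx xL * fx (shiftz (p * size xL)%N%:Z xR)).
Proof.
move=> /Gx_cat h; rewrite !fxE Gx_shiftz size_shiftz sq2_shiftz size_cat sq2_cat root2D.
rewrite -pmulrn.
set k := size xL; set m := size xR.
apply: le_trans (ler_wpM2l (expR_ge0 _) h) _.
rewrite -/k le_eqVlt; apply/orP; left; apply/eqP.
rewrite [RHS](_ : _ = (expR (2 * p%:R * Ix xL xR) *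
   (expR (- g * (sq2 R xL + root2 R p k)) *
    (expR (- g * (sq2 R xR - 2 * (p * k)%:R * (isum xR)%:~R + (p * k)%:R ^+ 2 * m%:R +
          root2 R p m)) * expR (- (2 * g * (p * k)%:R * (tri p m)%:R))))) * (Gx xL * Gx xR)); last by ring.
rewrite [LHS]mulrA; congr (_ * _); rewrite -!expRD; congr expR.
by rewrite natrM; ring.
Qed.

Lemma fx_perm x y : perm_eq x y -> fx x = fx y.
Proof.
apply: perm_swap_inv => u a b v; rewrite /fx !size_cat /= !sum_seqs_cat.
apply: eq_big_seq => s /size_seqs_mem ss; rewrite !sum_seqsS.
under eq_bigr do rewrite sum_seqsS.
under [RHS]eq_bigr do rewrite sum_seqsS.
rewrite [RHS]exchange_big; apply: eq_bigr => i _; apply: eq_bigr => j _.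
apply: eq_bigr => t _; rewrite !zip_cat // !big_cat /= !big_cons /=.
rewrite (@wt_perm _ _ _ (s ++ i :: j :: t) (s ++ j :: i :: t)); first by ring.
by rewrite perm_cat2l (perm_catCA [:: i] [:: j] t).
Qed.

Lemma fx_seq1 x : fx [:: x] = gs x.
Proof.
have m0 : 0 \in orb 1 by rewrite mem_orb lexx /= muln1 ltz_nat.
rewrite /fx /= sum_seqsS (bigD1_seq _ m0 (uniq_orb _ _)) /= [X in _ + X]big1 ?addr0.
  rewrite sum_seqs0 /= big_seq1 /= subr0 /wt /bw acoef_seq1 eqxx mul1r /sq2 big_seq1 expr0n root2S root20.
  by rewrite muln0 expr0n addr0 subrr mulr0 expR0 expr1n mul1r.
by move=> i i0; rewrite sum_seqs0 /wt /bw acoef_seq1 (negbTE i0) mul0r expr0n mul0r.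
Qed.

Lemma fx_nil : fx [::] = 1.
Proof.
rewrite /fx /= sum_seqs0 big_nil mulr1 /wt /bw acoef_nil mul1r /sq2 big_nil root20 subrr mulr0.
by rewrite expR0 expr1n.
Qed.

Lemma sum_fx_le (theta : R) (r : seq int) N :
  (forall s : int, \sum_(x <- r) gs (x - s) <= theta) ->
  \sum_(x <- seqs r N) fx x <= N`!%:R * CN N * theta ^+ N.
Proof.
move=> th; rewrite -sum_wt mulr_suml.
rewrite (eq_big_seq (fun x => \sum_(s <- seqs (orb N) N) wt s * \prod_(z <- zip s x) gs (z.2 - z.1))); last first.
  by move=> x /size_seqs_mem xN; rewrite /fx xN.
rewrite exchange_big /= big_seq [leRHS]big_seq; apply: ler_sum => s /size_seqs_mem sN.
rewrite -mulr_sumr; apply: ler_wpM2l; first exact: wt_ge0.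
rewrite -{1}sN (sum_seqs_prod2 r s (fun a b => gs (b - a))) -sN.
elim: (s) => [|a s' IH]; first by rewrite big_nil expr0.
rewrite big_cons exprS; apply: ler_pM => //.
  by apply: sumr_ge0 => x _; apply: gs_ge0.
by apply: prodr_ge0 => b _; apply: sumr_ge0 => x _; apply: gs_ge0.
Qed.

End Plasma.

Lemma distnC_abs (i j : int) : absz (i - j) = absz (j - i).
Proof. by rewrite -abszN opprB. Qed.

(** * Ordered configurations and elementary lattice sums *)

Section OrderedSplit.
Variable R : realType.

Lemma sum_const_seq (A : Type) (s : seq A) (a : R) : \sum_(i <- s) a = a * (size s)%:R.
Proof. by rewrite big_const_seq count_predT iter_addr addr0 mulr_natr. Qed.

Lemma perm_cat_mask (T : eqType) (x u v : seq T) : perm_eq x (u ++ v) ->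
  exists b : bitseq, [/\ size b = size x, count id b = size u,
    perm_eq (mask b x) u & perm_eq (mask (map negb b) x) v].
Proof.
elim: x u v => [|a x IH] u v pe.
  have := perm_size pe; rewrite size_cat => /esym/eqP; rewrite addn_eq0 !size_eq0.
  by case/andP=> /eqP -> /eqP ->; exists [::].
have : a \in u ++ v by rewrite -(perm_mem pe) mem_head.
rewrite mem_cat => /orP[au|av].
  have pu := perm_to_rem au.
  have pe' : perm_eq x (rem a u ++ v).
    rewrite -(perm_cons a); apply: (perm_trans pe).
    by rewrite -cat_cons perm_cat2r.
  have [b [sb cb m1 m2]] := IH _ _ pe'.
  exists (true :: b); split=> //=; rewrite ?sb //.
  - by rewrite cb (perm_size pu).
  - by rewrite perm_sym; apply: (perm_trans pu); rewrite perm_cons perm_sym.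
have pv := perm_to_rem av.
have pe' : perm_eq x (u ++ rem a v).
  rewrite -(perm_cons a); apply: (perm_trans pe).
  rewrite perm_sym (perm_catCA [:: a] u (rem a v)) perm_cat2l /=.
  by rewrite perm_sym.
have [b [sb cb m1 m2]] := IH _ _ pe'.
exists (false :: b); split=> //=; rewrite ?sb //.
by rewrite perm_sym; apply: (perm_trans pv); rewrite perm_cons perm_sym.
Qed.

Definition srt (x : seq int) : seq int := sort <=%O x.

Lemma perm_srt x : perm_eq (srt x) x.
Proof. by rewrite perm_sort. Qed.

Lemma size_srt x : size (srt x) = size x.
Proof. by rewrite size_sort. Qed.

Lemma srt_sorted x : sorted <=%O (srt x).
Proof. exact: sort_le_sorted. Qed.

Lemma srt_id x : sorted <=%O x -> srt x = x.
Proof. exact: sort_le_id. Qed.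

Lemma srt_perm x y : perm_eq x y -> srt x = srt y.
Proof. by move=> xy; apply/perm_sort_leP. Qed.

Definition pinv (F : seq int -> R) := forall s t, perm_eq s t -> F s = F t.

(** The [k] smallest entries sit at one particular set of positions; summing over all sets of [k]
    positions instead decouples the two blocks. *)
Lemma ordered_split (F : seq int -> seq int -> R) (r : seq int) N k : (k <= N)%N ->
  (forall u v, 0 <= F u v) -> (forall v, pinv (F^~ v)) -> (forall u, pinv (F u)) ->
  \sum_(x <- seqs r N) F (take k (srt x)) (drop k (srt x)) <=
  'C(N, k)%:R * \sum_(u <- seqs r k) \sum_(v <- seqs r (N - k)) F u v.
Proof.
move=> kN F0 F1 F2; pose B := seqs [:: true; false] N.
have -> : 'C(N, k)%:R * \sum_(u <- seqs r k) \sum_(v <- seqs r (N - k)) F u v =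
   \sum_(b <- B | count id b == k) \sum_(x <- seqs r N) F (mask b x) (mask (map negb b) x).
  set S := \sum_(u <- _) _.
  transitivity (\sum_(b <- B | count id b == k) S).
    have := @sum_seqs_filter _ _ id [:: true; false] N k (fun _ _ => S) kN.
    rewrite /= => ->; rewrite mulr_natl; congr (_ *+ _).
    have one (c : bool) n (a : R) : \sum_(s <- seqs [:: c] n) a = a.
      by elim: n => [|n IH]; rewrite ?sum_seqs0 // sum_seqsS big_seq1.
    by rewrite !one.
  rewrite big_seq_cond [RHS]big_seq_cond; apply: eq_bigr => b /andP[/size_seqs_mem sb /eqP cb].
  have cnb : count negb b = (N - k)%N.
    have e : count negb b = count (predC id) b by apply: eq_count => -[].
    by rewrite e -sb -(count_predC id b) cb addKn.
  by rewrite -{1}sb sum_seqs_mask cb cnb.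
rewrite exchange_big /= big_seq [leRHS]big_seq; apply: ler_sum => x /size_seqs_mem sx.
have pe : perm_eq x (take k (srt x) ++ drop k (srt x)).
  by rewrite cat_take_drop perm_sym perm_srt.
have [b [sb cb m1 m2]] := perm_cat_mask pe.
rewrite (F1 _ _ _ (etrans (perm_sym _ _) m1)) (F2 _ _ _ (etrans (perm_sym _ _) m2)).
have bB : b \in B.
  rewrite mem_seqs sb sx eqxx /=; apply/allP => -[] _ //.
rewrite (big_rem b bB) /= cb size_take size_srt sx.
have -> : (if (k < N)%N then k else N) == k by move: kN; rewrite leq_eqVlt; case: ltngtP => //= ->; rewrite eqxx.
by rewrite lerDl sumr_ge0 // => b' _.
Qed.

(** A multiset has at most N! orderings; the induction extracts the minimum through [ordered_split]
    with k = 1. *)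
Lemma sum_sorted_le (F : seq int -> R) (r : seq int) N :
  (forall u, 0 <= F u) -> pinv F ->
  \sum_(x <- seqs r N) F x <=
  N`!%:R * \sum_(x <- seqs r N | sorted <=%O x) F x.
Proof.
elim: N F => [|N IH] F F0 Fp.
  by rewrite [in leRHS]big_mkcond !sum_seqs0 /= mul1r.
pose G (u v : seq int) : R :=
  if u is [:: a] then (all (fun y => (a <= y)%O) v)%:R * F (a :: v) else 0.
have G0 u v : 0 <= G u v by case: u => [|a []] //= ; rewrite mulr_ge0.
have GG := @ordered_split G r N.+1 1 isT G0 _ _.
apply: le_trans (le_trans (GG _ _) _).
- rewrite le_eqVlt; apply/orP; left; apply/eqP/eq_big_seq => x /size_seqs_mem sx.
  have pe := perm_srt x; have so := srt_sorted x.
  rewrite -(Fp _ _ pe); have := size_srt x; rewrite sx.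
  case: (srt x) so => // a y /= so _; rewrite take0 drop0.
  by rewrite (order_path_min le_trans so) mul1r.
- move=> v u u' pu; move: (pu) (perm_size pu); case: u {pu} => [|a [|b u]] pu; case: u' pu => [|a' [|b' u']] //= pu _.
  by have [->] := @perm_small_eq _ [:: a] [:: a'] isT pu.
- move=> [|a [|b u]] //= v v' pv; congr (_%:R * _); first by congr nat_of_bool; apply: perm_all.
  by apply: Fp; rewrite perm_cons.
rewrite bin1 factS natrM -mulrA; apply: ler_wpM2l => //.
rewrite sum_seqsS [in leRHS]big_mkcond sum_seqsS mulr_sumr; apply: ler_sum => a _.
rewrite sum_seqs0 subSS subn0 /=.
have := IH (fun v => (all (fun y => (a <= y)%O) v)%:R * F (a :: v)).
move=> /(_ _ _)/le_trans; apply.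
- by move=> u; rewrite mulr_ge0.
- move=> v v' pv; congr (_%:R * _); first by congr nat_of_bool; apply: perm_all.
  by apply: Fp; rewrite perm_cons.
rewrite ler_wpM2l // le_eqVlt; apply/orP; left; apply/eqP.
rewrite big_mkcond; apply: eq_bigr => v _.
rewrite (path_sortedE le_trans).
by case: (sorted _ v); rewrite ?andbF //= andbT; case: (all _ _); rewrite ?mul1r ?mul0r.
Qed.

Lemma sum_abs_le (phi : nat -> R) (B : R) (r : seq int) (s : int) :
  (forall m, 0 <= phi m) -> (forall M, \sum_(m <- iota 0 M) phi m <= B) -> uniq r ->
  \sum_(x <- r) phi (absz (x - s)) <= 2 * B.
Proof.
move=> p0 hB ur; pose M := (\max_(x <- r) absz (x - s)).+1.
have mM x : x \in r -> absz (x - s) \in iota 0 M.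
  by move=> xr; rewrite mem_iota add0n ltnS (big_rem x xr) /= leq_maxl.
rewrite (bigID (fun x => s <= x)) mulr_natl mulr2n; apply: lerD.
  rewrite -big_filter; apply: le_trans (hB M).
  apply: (@ler_sum_inj _ _ _ _ _ (fun x : int => absz (x - s))); rewrite ?iota_uniq ?filter_uniq //.
    by move=> x y; rewrite !mem_filter => /andP[? _] /andP[? _]; nlia.
  by move=> x; rewrite mem_filter => /andP[_ /mM].
rewrite -big_filter; apply: le_trans (hB M).
apply: (@ler_sum_inj _ _ _ _ _ (fun x : int => absz (x - s))); rewrite ?iota_uniq ?filter_uniq //.
  by move=> x y; rewrite !mem_filter => /andP[? _] /andP[? _]; nlia.
by move=> x; rewrite mem_filter => /andP[_ /mM].
Qed.

Lemma sum_iotaS (F : nat -> R) M :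
  \sum_(m <- iota 0 M.+1) F m = \sum_(m <- iota 0 M) F m + F M.
Proof. by rewrite -addn1 iotaD big_cat /= big_seq1. Qed.

Lemma sum_inv_sqr s0 M : (0 < s0)%N ->
  \sum_(m <- iota 0 M) (s0 <= m)%N%:R / m%:R ^+ 2 <= 2 / s0%:R :> R.
Proof.
move=> s00; have sp : 0 < s0%:R :> R by rewrite ltr0n.
case: (leqP s0 M) => [sM|Ms]; last first.
  rewrite big1_seq ?divr_ge0 // => m /andP[_]; rewrite mem_iota add0n => /andP[_ mM].
  by rewrite leqNgt (ltn_trans mM Ms) mul0r.
suff : \sum_(m <- iota 0 M) (s0 <= m)%N%:R / m%:R ^+ 2 <= 2 / s0%:R - 2 / M%:R :> R.
  by move/le_trans; apply; rewrite gerBl divr_ge0.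
elim: M sM => [|M IH] sM; first by move: s00; rewrite lt0n; move: sM; rewrite leqn0 => ->.
rewrite sum_iotaS; move: sM; rewrite leq_eqVlt ltnS => /orP[/eqP e|sM].
  rewrite e ltnn mul0r addr0 subrr big1_seq // => m /andP[_].
  by rewrite mem_iota add0n => /andP[_ mM]; rewrite ltnNge (ltnW mM) mul0r.
rewrite sM; apply: le_trans (lerD (IH sM) (lexx _)) _.
have Mp : 0 < M%:R :> R by rewrite ltr0n (leq_trans s00).
have -> : M.+1%:R = M%:R + 1 :> R by rewrite natr1.
rewrite mul1r; have : 1 <= M%:R :> R by rewrite ler1n (leq_trans s00).
set m := M%:R in Mp *; move=> m1.
suff : (m ^+ 2)^-1 <= 2 / m - 2 / (m + 1) by lra.
have -> : 2 / m - 2 / (m + 1) = 2 / (m * (m + 1)) :> R by field; rewrite !gt_eqF // addr_gt0.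
rewrite -[leLHS]div1r ler_pdivrMr ?exprn_gt0 // mulrAC ler_pdivlMr ?mulr_gt0 ?addr_gt0 //.
nra.
Qed.

Lemma expRN_le (v : R) : 0 < v -> expR (- v) <= 2 / v ^+ 2.
Proof.
move=> v0; have h := expR_ge1Dxn 1 (ltW v0).
rewrite expRN -div1r ler_pdivrMr ?expR_gt0 // mulrAC ler_pdivlMr ?exprn_gt0 // mul1r.
have : (2`!)%:R = 2 :> R by [].
move: h => /[swap] ->; lra.
Qed.

(** Off the centre, e^(-c m^2) <= 1/(c m^2) is summable. The bound depends neither on [s] nor on the
    range, hence later not on N. *)
Lemma gauss_sum (c : R) : 0 < c -> exists th : R, 1 <= th /\
  forall (r : seq int) (s : int), uniq r ->
    \sum_(x <- r) expR (- (c * (x - s)%:~R ^+ 2)) <= th.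
Proof.
move=> c0; pose phi (m : nat) : R := expR (- (c * m%:R ^+ 2)).
exists (2 * (1 + 2 / c)); split.
  have : 0 < 2 / c by rewrite divr_gt0.
  lra.
move=> r s ur.
rewrite (eq_bigr (fun x : int => phi (absz (x - s)))); last first.
  by move=> x _; rewrite /phi natr_absz intr_norm real_normK // num_real.
apply: sum_abs_le => // [m|M]; first exact: expR_ge0.
apply: (@le_trans _ _ (\sum_(m <- iota 0 M) ((m == 0%N)%:R + c^-1 * ((1 <= m)%N%:R / m%:R ^+ 2)))).
  apply: ler_sum => -[|m] _; rewrite /phi.
    by rewrite expr0n mulr0 oppr0 expR0 /= mul0r mulr0 addr0.
  rewrite /= add0r mul1r -invfM expRN lef_pV2 ?posrE ?expR_gt0 ?mulr_gt0 ?exprn_gt0 ?ltr0n //.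
  by apply: le_trans (expR_ge1Dx _); rewrite lerDr.
rewrite big_split /= -mulr_sumr; apply: lerD.
  case: M => [|M]; first by rewrite big_nil.
  rewrite /= big_cons big1_seq ?addr0 // => m /andP[_]; rewrite mem_iota => /andP[+ _].
  by case: m.
rewrite [leRHS]mulrC ler_pM2l ?invr_gt0 //.
by have := @sum_inv_sqr 1 M isT; rewrite divr1.
Qed.

End OrderedSplit.

(** * Exponential moments of the interaction energy *)

Section ExpBound.
Variables (R : realType) (p : nat) (g : R).
Hypothesis p0 : (0 < p)%N.
Hypothesis g0 : 0 < g.

Local Notation fx := (fx p g).
Local Notation Ix := (Ix g).
Local Notation tk := (tk g).

Definition Hx (x : seq int) : R := Ix x x.

(** Squared distance to the ideal lattice pc, p(c+1), ...; the offset [c] is the number of particles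
    already split off on the left. *)
Fixpoint D2 (c : nat) (x : seq int) : R :=
  if x is a :: x' then (a - (p * c)%N%:Z)%:~R ^+ 2 + D2 c.+1 x' else 0.

Lemma tkC x y : tk x y = tk y x.
Proof. by rewrite /tk distrC. Qed.

Lemma tkxx x : tk x x = 1.
Proof. by rewrite /tk subrr normr0 mulr0 oppr0 expR0. Qed.

Lemma tk_le1 x y : tk x y <= 1.
Proof. by rewrite /tk expR_le1 oppr_le0 mulr_ge0 ?(ltW g0) // ler0z. Qed.

Lemma Ix_catr x y z : Ix x (y ++ z) = Ix x y + Ix x z.
Proof. by rewrite /Ix -big_split; apply: eq_bigr => a _; rewrite big_cat. Qed.

Lemma Ix_catl x y z : Ix (x ++ y) z = Ix x z + Ix y z.
Proof. by rewrite /Ix big_cat. Qed.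

Lemma IxC x y : Ix x y = Ix y x.
Proof. by rewrite /Ix exchange_big; apply: eq_bigr => a _; apply: eq_bigr => b _; rewrite tkC. Qed.

Lemma tk_shift c a b : tk (a - c) (b - c) = tk a b.
Proof. by rewrite /tk (_ : a - c - (b - c) = a - b) //; ring. Qed.

Lemma Ix_shift c x y : Ix (shiftz c x) (shiftz c y) = Ix x y.
Proof.
rewrite /Ix big_map; apply: eq_bigr => a _; rewrite big_map; apply: eq_bigr => b _.
exact: tk_shift.
Qed.

Lemma Ix_perm x x' y y' : perm_eq x x' -> perm_eq y y' -> Ix x y = Ix x' y'.
Proof.
move=> px py; rewrite /Ix (perm_big _ px); apply: eq_bigr => a _; exact: perm_big.
Qed.

Lemma Hx_cons a x : Hx (a :: x) = 1 + 2 * Ix [:: a] x + Hx x.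
Proof.
rewrite /Hx -cat1s Ix_catl !Ix_catr (IxC x [:: a]).
have -> : Ix [:: a] [:: a] = 1 by rewrite /Ix !big_seq1 tkxx.
by ring.
Qed.

(** Split off the leftmost particle repeatedly with [fx_cat]: each one contributes its Gaussian
    deviation from the lattice and its interaction with the rest. *)
Lemma fx_sorted_le c x : sorted <=%O x ->
  fx (shiftz (p * c)%N%:Z x) <= expR (p%:R * Hx x - g * D2 c x).
Proof.
elim: x c => [|a x IH] c so /=.
  by rewrite fx_nil mulr0 subr0 /Hx /Ix big_nil mulr0 expR0.
have so' := path_sorted so; have al := order_path_min le_trans so.
have := @fx_cat _ p g p0 g0 [:: a - (p * c)%N%:Z] (shiftz (p * c)%N%:Z x).
rewrite /= muln1 shiftzD fx_seq1 // => /(_ _)/le_trans; apply.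
  move=> u v; rewrite inE => /eqP -> /mapP[b bx ->]; rewrite lerD2r.
  by move/allP: al => /(_ _ bx).
have -> : p%:Z + (p * c)%N%:Z = (p * c.+1)%N%:Z by lia.
have -> : Ix [:: a - (p * c)%N%:Z] (shiftz (p * c)%N%:Z x) = Ix [:: a] x.
  by rewrite -(Ix_shift (p * c)%N%:Z [:: a] x).
rewrite /gs Hx_cons; have {}IH := IH c.+1 so'.
apply: le_trans (_ : _ <= expR (2 * p%:R * Ix [:: a] x) *
  (expR (- (g * (a - (p * c)%N%:Z)%:~R ^+ 2)) * expR (p%:R * Hx x - g * D2 c.+1 x))) _.
  by rewrite !ler_pM2l ?expR_gt0.
rewrite -!expRD ler_expR; have pp : 0 <= p%:R :> R by [].
by rewrite -subr_ge0; apply: le_trans pp _; rewrite le_eqVlt; apply/orP; left; apply/eqP; ring.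
Qed.

Definition dev (x : seq int) (i : nat) : R := (nth 0 x i - (p * i)%N%:Z)%:~R.

Lemma D2_nth c x : D2 c x =
  \sum_(i <- iota 0 (size x)) (nth 0 x i - (p * (c + i))%N%:Z)%:~R ^+ 2.
Proof.
elim: x c => [|a x IH] c; first by rewrite big_nil.
rewrite [LHS]/= IH.
have -> : iota 0 (size (a :: x)) = 0%N :: map (addn 1) (iota 0 (size x)) by rewrite -iotaDl.
rewrite big_cons big_map /= addn0; congr (_ + _).
by apply: eq_bigr => i _; rewrite /= add1n addnS addSn.
Qed.

Lemma D2E x : D2 0 x = \sum_(i <- iota 0 (size x)) dev x i ^+ 2.
Proof. by rewrite D2_nth; apply: eq_bigr => i _; rewrite add0n. Qed.

Lemma HxE x : Hx x = \sum_(i <- iota 0 (size x)) \sum_(j <- iota 0 (size x))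
   tk (nth 0 x i) (nth 0 x j).
Proof.
rewrite /Hx /Ix (big_nth 0) /index_iota subn0; apply: eq_bigr => i _.
by rewrite (big_nth 0) /index_iota subn0.
Qed.

Definition c1 : R := 8 + 8 / g ^+ 2.

(** Let s = |i - j|. Either the particles are at least s/2 apart, and the exponential is at most
    8/(g s)^2; or their deviations differ by at least s/2, because the ideal distance p s is at
    least s. The constant [c1] covers both cases. *)
Lemma tk_bound x i j : (i != j) ->
  tk (nth 0 x i) (nth 0 x j) <=
  c1 / (absz (i%:Z - j%:Z))%:R ^+ 2 * (1 + dev x i ^+ 2 + dev x j ^+ 2).
Proof.
move=> ij; set s := (absz (i%:Z - j%:Z))%:R.
have s1 : 1 <= s :> R by rewrite /s ler1n lt0n absz_eq0 subr_eq0 eqz_nat.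
have s0 : 0 < s by lra.
have gg : 0 < g ^+ 2 by rewrite exprn_gt0.
have pr : 1 <= p%:R :> R by rewrite ler1n.
set a := nth 0 x i; set b := nth 0 x j.
pose u : R := `|a - b|%:~R.
have u0 : 0 <= u by rewrite /u ler0z.
have uE : u = `|a%:~R - b%:~R| by rewrite /u intr_norm intrD mulrNz.
have sE : s = `|i%:R - j%:R|.
  by rewrite /s natr_absz intr_norm intrD mulrNz -!pmulrn.
have dE : dev x i - dev x j = (a%:~R - b%:~R) - p%:R * (i%:R - j%:R).
  by rewrite /dev !intrD !mulrNz -!pmulrn !natrM -/a -/b; ring.
have c18 : 8 <= c1 by rewrite /c1 lerDl divr_ge0 // ltW.
have c1g : 8 / g ^+ 2 <= c1 by rewrite /c1 lerDr.
have dge : 0 <= dev x i ^+ 2 by rewrite sqr_ge0.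
have dge' : 0 <= dev x j ^+ 2 by rewrite sqr_ge0.
rewrite -/(tk a b); have [us|us] := leP (s / 2) u.
  have u00 : 0 < u by apply: lt_le_trans us; rewrite divr_gt0.
  apply: (@le_trans _ _ (8 / g ^+ 2 / s ^+ 2)).
    apply: le_trans (expRN_le (mulr_gt0 g0 u00)) _.
    rewrite ler_pdivrMr ?exprn_gt0 ?mulr_gt0 //.
    have -> : 8 / g ^+ 2 / s ^+ 2 * (g * u) ^+ 2 = 8 * u ^+ 2 / s ^+ 2.
      by field; rewrite !gt_eqF.
    by rewrite ler_pdivlMr ?exprn_gt0 //; nra.
  have h : 8 / g ^+ 2 / s ^+ 2 <= c1 / s ^+ 2 by rewrite ler_pM2r ?invr_gt0 ?exprn_gt0.
  have cs : 0 <= c1 / s ^+ 2 by rewrite divr_ge0 ?exprn_ge0 //; lra.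
  by apply: (le_trans h); apply: ler_peMr => //; lra.
apply: (le_trans (tk_le1 _ _)).
rewrite mulrAC ler_pdivlMr ?exprn_gt0 // mul1r.
have dd : s / 2 <= `|dev x i - dev x j|.
  have : p%:R * s <= u + `|dev x i - dev x j|.
    have -> : p%:R * s = `|(a%:~R - b%:~R) - (dev x i - dev x j)|.
      by rewrite dE opprB addrC subrK normrM ger0_norm // sE.
    by rewrite uE; apply: ler_normB.
  have : s <= p%:R * s by rewrite ler_peMl // ltW.
  lra.
have dd2 : s ^+ 2 <= 4 * (dev x i - dev x j) ^+ 2.
  rewrite -(real_normK (num_real (dev x i - dev x j))); move: dd; set e := `|_| => dd.
  nra.
have : s ^+ 2 <= 8 * (dev x i ^+ 2 + dev x j ^+ 2).
  apply: le_trans dd2 _; rewrite -subr_ge0.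
  have -> : 8 * (dev x i ^+ 2 + dev x j ^+ 2) - 4 * (dev x i - dev x j) ^+ 2 =
     4 * (dev x i + dev x j) ^+ 2 by ring.
  by rewrite mulr_ge0 ?sqr_ge0.
move=> h; apply: (le_trans h).
apply: (@le_trans _ _ (8 * (1 + dev x i ^+ 2 + dev x j ^+ 2))); first lra.
by apply: ler_wpM2r => //; lra.
Qed.

Lemma sum_absn (phi : nat -> R) (B : R) N i :
  (forall m, 0 <= phi m) -> (forall M, \sum_(m <- iota 0 M) phi m <= B) ->
  \sum_(j <- iota 0 N) phi (absz (i%:Z - j%:Z)) <= 2 * B.
Proof.
move=> h0 hB.
have ui : uniq [seq j%:Z | j <- iota 0 N] by rewrite map_inj_uniq ?iota_uniq // => a b [].
have := @sum_abs_le R phi B _ i%:Z h0 hB ui.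
rewrite big_map; apply: le_trans; rewrite le_eqVlt; apply/orP; left; apply/eqP.
by apply: eq_bigr => j _; rewrite distnC_abs.
Qed.

Lemma sum_lt_iota s0 M : \sum_(m <- iota 0 M) ((m < s0)%N%:R : R) <= s0%:R.
Proof.
have -> : \sum_(m <- iota 0 M) ((m < s0)%N%:R : R) = (minn s0 M)%:R.
  elim: M => [|M IH]; first by rewrite big_nil minn0.
  by rewrite sum_iotaS IH; case: (ltnP M s0) => h; rewrite -natrD; congr _%:R; lia.
by rewrite ler_nat geq_minl.
Qed.

(** Pairs with indices closer than [s0] cost a constant per particle. For the others the bounds of
    [tk_bound] sum to order 1/s0, so that for large [s0] half of the Gaussian absorbs them. *)
Lemma Hx_le (lam : R) : 0 < lam -> exists C : R, 0 <= C /\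
  forall x, lam * Hx x <= C * (size x)%:R + g / 2 * D2 0 x.
Proof.
move=> l0; have c10 : 0 < c1.
  by rewrite /c1 addr_gt0 // divr_gt0 // exprn_gt0.
(* This size of [s0] gives 8 lam c1 / s0 <= g / 2, the inequality [K1] below. *)
have [s0 s0P] : exists s0 : nat, 16 * lam * c1 / g <= s0%:R /\ (0 < s0)%N.
  have [n hn] : exists n : nat, 16 * lam * c1 / g <= n%:R.
    by exists (Num.bound (16 * lam * c1 / g)); apply/ltW/archi_boundP; rewrite divr_ge0 ?mulr_ge0 // ltW.
  by exists n.+1; split=> //; apply: le_trans hn _; rewrite ler_nat.
case: s0P => s0P s00; have sp : 0 < s0%:R :> R by rewrite ltr0n.
exists (lam * (2 * s0%:R + 4 * c1 / s0%:R)); split.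
  by rewrite mulr_ge0 ?addr_ge0 ?mulr_ge0 ?divr_ge0 // ?mulr_ge0 // ltW.
move=> x; set N := size x; set I := iota 0 N.
pose psi (m : nat) : R := (s0 <= m)%N%:R / m%:R ^+ 2.
have psi0 m : 0 <= psi m by rewrite /psi divr_ge0 ?exprn_ge0.
have S1 i : \sum_(j <- I) psi (absz (i%:Z - j%:Z)) <= 4 / s0%:R.
  have := @sum_absn psi (2 / s0%:R) N i psi0 (fun M => sum_inv_sqr R M s00).
  by rewrite mulrA -natrM.
have S2 i : \sum_(j <- I) ((absz (i%:Z - j%:Z) < s0)%N%:R : R) <= 2 * s0%:R.
  apply: (@sum_absn (fun m => (m < s0)%N%:R)) => // M; exact: sum_lt_iota.
have Hb : Hx x <= \sum_(i <- I) \sum_(j <- I) ((absz (i%:Z - j%:Z) < s0)%N%:R +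
    c1 * (psi (absz (i%:Z - j%:Z)) * (1 / 2 + dev x i ^+ 2) +
          psi (absz (i%:Z - j%:Z)) * (1 / 2 + dev x j ^+ 2))).
  rewrite HxE; apply: ler_sum => i _; apply: ler_sum => j _.
  have dge : 0 <= dev x i ^+ 2 by rewrite sqr_ge0.
  have dge' : 0 <= dev x j ^+ 2 by rewrite sqr_ge0.
  have [lt|ge] := ltnP (absz (i%:Z - j%:Z)) s0.
    apply: le_trans (tk_le1 _ _) _; rewrite lerDl mulr_ge0 ?(ltW c10) //.
    by rewrite addr_ge0 // mulr_ge0 // addr_ge0.
  rewrite add0r; have ij : i != j.
    by apply: contraTneq ge => ->; rewrite subrr -ltnNge.
  apply: le_trans (tk_bound x ij) _; rewrite /psi ge (_ : true%:R = 1 :> R) // le_eqVlt; apply/orP; left; apply/eqP.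
  by field; rewrite pnatr_eq0 absz_eq0 subr_eq0 eqz_nat.
have := ler_wpM2l (ltW l0) Hb; move/le_trans; apply.
have swap : \sum_(i <- I) \sum_(j <- I) psi (absz (i%:Z - j%:Z)) * (1 / 2 + dev x j ^+ 2) =
  \sum_(i <- I) \sum_(j <- I) psi (absz (i%:Z - j%:Z)) * (1 / 2 + dev x i ^+ 2).
  rewrite exchange_big; apply: eq_bigr => i _; apply: eq_bigr => j _.
  by rewrite distnC_abs.
have T1 : \sum_(i <- I) \sum_(j <- I) psi (absz (i%:Z - j%:Z)) * (1 / 2 + dev x i ^+ 2) <=
   4 / s0%:R * (N%:R / 2 + D2 0 x).
  rewrite D2E -/N -/I.
  have -> : N%:R / 2 + \sum_(i <- I) dev x i ^+ 2 = \sum_(i <- I) (1 / 2 + dev x i ^+ 2).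
    rewrite big_split /= big_const_seq count_predT iter_addr addr0 size_iota.
    by rewrite -[1 / 2 *+ N]mulr_natr; congr (_ + _); ring.
  rewrite mulr_sumr; apply: ler_sum => i _; rewrite -mulr_suml.
  by apply: ler_wpM2r; rewrite ?S1 // addr_ge0 ?sqr_ge0.
have T2 : \sum_(i <- I) \sum_(j <- I) ((absz (i%:Z - j%:Z) < s0)%N%:R : R) <= N%:R * (2 * s0%:R).
  apply: le_trans (ler_sum _ (fun i _ => S2 i)) _.
  by rewrite sum_const_seq size_iota mulrC.
have -> : \sum_(i <- I) \sum_(j <- I) ((absz (i%:Z - j%:Z) < s0)%N%:R +
    c1 * (psi (absz (i%:Z - j%:Z)) * (1 / 2 + dev x i ^+ 2) +
          psi (absz (i%:Z - j%:Z)) * (1 / 2 + dev x j ^+ 2))) =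
   \sum_(i <- I) \sum_(j <- I) ((absz (i%:Z - j%:Z) < s0)%N%:R : R) +
   c1 * (2 * \sum_(i <- I) \sum_(j <- I) psi (absz (i%:Z - j%:Z)) * (1 / 2 + dev x i ^+ 2)).
  rewrite mulr_natl [in RHS]mulr2n -{2}swap -!big_split mulr_sumr -big_split; apply: eq_bigr => i _ /=.
  by rewrite -big_split mulr_sumr -big_split.
move: T1 T2; set A := \sum_(i <- I) _; set B := \sum_(i <- I) _ => T1 T2.
have D0 : 0 <= D2 0 x by rewrite D2E sumr_ge0 // => i _; rewrite sqr_ge0.
have K1 : 8 * lam * c1 / s0%:R <= g / 2.
  rewrite ler_pdivrMr //; move: s0P; rewrite ler_pdivrMr //; lra.
apply: (@le_trans _ _ (lam * (N%:R * (2 * s0%:R) + c1 * (2 * (4 / s0%:R * (N%:R / 2 + D2 0 x)))))).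
  rewrite ler_pM2l // lerD // ler_pM2l // ler_pM2l //.
have K2 := ler_wpM2r D0 K1.
have -> : lam * (N%:R * (2 * s0%:R) + c1 * (2 * (4 / s0%:R * (N%:R / 2 + D2 0 x)))) =
  lam * (2 * s0%:R + 4 * c1 / s0%:R) * N%:R + 8 * lam * c1 / s0%:R * D2 0 x.
  by field; rewrite gt_eqF.
by rewrite lerD2l.
Qed.

(** An entropy bound: a constant factor per particle suffices even when energy is rewarded by e^(lam
    Hx). Half of the Gaussian pays for the energy, the other half makes the sum over positions
    converge. *)
Lemma exp_bound (lam : R) : 0 < lam -> exists C : R, 0 <= C /\
  forall (r : seq int) N, uniq r ->
    \sum_(x <- seqs r N) fx x * expR (lam * Hx x) <= N`!%:R * expR (C * N%:R).
Proof.
move=> l0; have pl : 0 < p%:R + lam by rewrite addr_gt0 // ltr0n.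
have [C [C0 HC]] := Hx_le pl.
have g2 : 0 < g / 2 by rewrite divr_gt0.
have [th [th1 Hth]] := gauss_sum g2.
have th0 : 0 < th by lra.
exists (C + ln th); split; first by rewrite addr_ge0 // ln_ge0.
move=> r N ur.
apply: le_trans (sum_sorted_le _ _ _ _) _.
- by move=> x; rewrite mulr_ge0 ?fx_ge0 ?expR_ge0.
- by move=> x y xy; rewrite (fx_perm _ _ xy) /Hx (Ix_perm xy xy).
apply: ler_wpM2l => //.
have S c : \sum_(x <- seqs r N) expR (- (g / 2 * D2 c x)) <= th ^+ N.
  elim: N c => [|N IH] c; first by rewrite sum_seqs0 /= mulr0 oppr0 expR0.
  rewrite sum_seqsS exprS.
  apply: (@le_trans _ _ (\sum_(a <- r) expR (- (g / 2 * (a - (p * c)%N%:Z)%:~R ^+ 2)) * th ^+ N)).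
    apply: ler_sum => a _.
    under eq_bigr do rewrite /= mulrDr opprD expRD.
    by rewrite -mulr_sumr ler_wpM2l ?expR_ge0.
  by rewrite -mulr_suml; apply: ler_wpM2r; [rewrite exprn_ge0 // ltW|apply: Hth].
apply: (@le_trans _ _ (\sum_(x <- seqs r N) expR (C * N%:R) * expR (- (g / 2 * D2 0 x)))).
  rewrite big_mkcond big_seq [leRHS]big_seq; apply: ler_sum => x /size_seqs_mem sx.
  case: ifP => so; last by rewrite mulr_ge0 ?expR_ge0.
  have := @fx_sorted_le 0 x so; rewrite muln0.
  have -> : shiftz 0 x = x by rewrite /shiftz -[RHS]map_id; apply: eq_map => a; rewrite subr0.
  move=> h; apply: le_trans (ler_wpM2r (expR_ge0 _) h) _.
  rewrite -!expRD ler_expR; have := HC x; rewrite sx mulrDl; lra.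
rewrite -mulr_sumr mulrDl expRD (expRM_natr N (ln th)) lnK ?posrE //.
by apply: ler_wpM2l; rewrite ?expR_ge0.
Qed.

End ExpBound.

(** * Runs of crowded particles *)

Section Runs.
Variables (R : realType) (p : nat) (g : R).
Hypothesis p0 : (0 < p)%N.
Hypothesis g0 : 0 < g.

Local Notation fx := (fx p g).
Local Notation Ix := (Ix g).
Local Notation tk := (tk g).
Local Notation Hx := (Hx g).
Local Notation CN := (CN p g).
Local Notation orb := (orb p).
Local Notation wt := (wt p g).
Local Notation gs := (gs g).

Lemma tk_mul a z b : a <= z -> z <= b -> tk a b = tk z a * tk z b.
Proof.
move=> az zb; rewrite /tk -expRD; congr expR.
have -> : `|a - b| = `|z - a| + `|z - b| by nlia.
by rewrite intrD; ring.
Qed.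

(** The exponential kernel is multiplicative along the line, so the interaction across a point is
    the product of the two fields at that point. *)
Lemma Ix_prod u v z : (forall a, a \in u -> a <= z) -> (forall b, b \in v -> z <= b) ->
  Ix u v = Ix [:: z] u * Ix [:: z] v.
Proof.
move=> uz zv; rewrite /Ix !big_seq1 mulr_suml; apply: eq_big_seq => a au.
by rewrite mulr_sumr; apply: eq_big_seq => b bv; apply: tk_mul; [apply: uz|apply: zv].
Qed.

Lemma Ix_take z y n : Ix [:: z] (take n y) <= Ix [:: z] y.
Proof. by rewrite -{2}(cat_take_drop n y) Ix_catr lerDl Ix_ge0. Qed.

Lemma Ix_drop z y n : Ix [:: z] (drop n y) <= Ix [:: z] y.
Proof. by rewrite -{2}(cat_take_drop n y) Ix_catr lerDr Ix_ge0. Qed.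

Lemma sorted_take_le (y : seq int) i (a : int) : sorted <=%O y -> (i < size y)%N -> a \in take i.+1 y -> a <= nth 0 y i.
Proof.
move=> so iy /(nthP 0)[j]; rewrite size_take => jl <-.
have ji : (j <= i)%N by move: jl; case: (ltnP i.+1 (size y)) => h; nlia.
rewrite nth_take //; apply: (sorted_leq_nth le_trans lexx) => //; rewrite inE; nlia.
Qed.

Lemma sorted_drop_ge (y : seq int) i (b : int) : sorted <=%O y -> (i < size y)%N -> b \in drop i y -> nth 0 y i <= b.
Proof.
move=> so iy /(nthP 0)[j]; rewrite size_drop => jl <-.
rewrite nth_drop; apply: (sorted_leq_nth le_trans lexx) => //; rewrite ?inE ?leq_addr //; nlia.
Qed.

Variable M : R.
Hypothesis M0 : 0 <= M.

(** By [Ix_prod], a small field at a particle bounds the interaction across it by M^2, so that the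
    weight may be split there. *)
Definition good (y : seq int) (i : nat) : bool := Ix [:: nth 0 y i] y <= M.

(** The flanking good indices make the run maximal and screen it from the rest of the list. *)
Definition brun (i j : nat) (y : seq int) : bool :=
  [&& all (fun t => ~~ good y t) (iota i (j - i)),
      (i == 0%N) || good y i.-1 & (j == size y) || good y j].

Lemma brun_exists y k L0 : (k + L0 <= size y)%N ->
  (exists2 i, (k <= i < k + L0)%N & good y i) \/
  (exists i j, [/\ (i <= k)%N, (k + L0 <= j)%N, (j <= size y)%N & brun i j y]).
Proof.
clear p0 g0 M0; move=> kL.
case: (boolP (has (good y) (iota k L0))) => [/hasP[i ii gi]|/hasPn hn].
  by left; exists i => //; move: ii; rewrite mem_iota.
right.
have [i [ik bi ci]] : exists i, [/\ (i <= k)%N,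
    forall t, (i <= t < k)%N -> ~~ good y t & (i == 0%N) || good y i.-1].
  elim: (k) => [|k' [i [ik bi ci]]]; first by exists 0%N; split=> // t; rewrite ltn0 andbF.
  have [gk|bk] := boolP (good y k'); first by exists k'.+1; split; [by []|move=> t; nlia|by rewrite /= gk].
  exists i; split=> //; first by rewrite leqW.
  move=> t /andP[it]; rewrite ltnS leq_eqVlt => /orP[/eqP -> //|tk].
  by apply: bi; rewrite it.
have [j [kj jy bj cj]] : exists j, [/\ (k + L0 <= j)%N, (j <= size y)%N,
    forall t, (k + L0 <= t < j)%N -> ~~ good y t & (j == size y) || good y j].
  move: (kL); rewrite -(subnK kL); move: (size y - (k + L0))%N => n.
  move: (k + L0)%N => m _; elim: n m => [|n IH] m.
    by exists m; split; rewrite ?eqxx // => t; nlia.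
  have [gk|bk] := boolP (good y m).
    by exists m; split; rewrite ?gk ?orbT //; [nlia|move=> t; nlia].
  have [j [mj jn bj cj]] := IH m.+1.
  exists j; split; [nlia|nlia| |by rewrite addSnnS].
  move=> t /andP[mt tj]; move: mt; rewrite leq_eqVlt => /orP[/eqP <- //|mt].
  by apply: bj; rewrite mt.
exists i, j; split=> //; apply/and3P; split=> //.
apply/allP => t; rewrite mem_iota => /andP[it tj].
have [tk|kt] := ltnP t k; first by apply: bi; rewrite it.
have [tk|kt'] := ltnP t (k + L0); first by apply: hn; rewrite mem_iota kt.
by apply: bj; rewrite kt' /=; nlia.
Qed.

Lemma good_split (y : seq int) i : sorted <=%O y -> (i < size y)%N -> good y i ->
  Ix (take i.+1 y) (drop i.+1 y) <= M ^+ 2.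
Proof.
move=> so iy gi; rewrite (@Ix_prod _ _ (nth 0 y i)).
- rewrite expr2; apply: ler_pM; rewrite ?Ix_ge0 //.
    exact: le_trans (Ix_take _ _ _) gi.
  exact: le_trans (Ix_drop _ _ _) gi.
- by move=> a; apply: sorted_take_le.
- move=> b bd; apply: sorted_drop_ge => //.
  by rewrite (drop_nth 0 iy) inE bd orbT.
Qed.

Lemma good_split' (y : seq int) i : sorted <=%O y -> (i < size y)%N -> good y i ->
  Ix (take i y) (drop i y) <= M ^+ 2.
Proof.
move=> so iy gi; rewrite (@Ix_prod _ _ (nth 0 y i)).
- rewrite expr2; apply: ler_pM; rewrite ?Ix_ge0 //.
    exact: le_trans (Ix_take _ _ _) gi.
  exact: le_trans (Ix_drop _ _ _) gi.
- move=> a au; apply: sorted_take_le => //.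
  by rewrite (take_nth 0) // mem_rcons inE au orbT.
- by move=> b bd; apply: sorted_drop_ge.
Qed.

Section OneRun.
Variables (y : seq int) (i j : nat).
Hypotheses (so : sorted <=%O y) (ij : (i <= j)%N) (jy : (j <= size y)%N) (br : brun i j y).

Let u := take i y.
Let B := take (j - i) (drop i y).
Let v := drop (j - i) (drop i y).

Lemma run_v : v = drop j y.
Proof. by rewrite /v drop_drop subnK. Qed.

Lemma run_cat : y = u ++ B ++ v.
Proof. by rewrite !cat_take_drop. Qed.

Lemma run_size_B : size B = (j - i)%N.
Proof. by rewrite /B size_take size_drop; case: ltnP; nlia. Qed.

Lemma run_left : Ix u (B ++ v) <= M ^+ 2.
Proof.
rewrite !cat_take_drop; case/and3P: br => _ /orP[/eqP i0|gi] _.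
  by rewrite /u i0 take0 /Ix big_nil sqr_ge0.
have [/eqP i0|i0] := boolP (i == 0%N); first by rewrite /u i0 take0 /Ix big_nil sqr_ge0.
have e : i.-1.+1 = i by rewrite prednK // lt0n.
have iy : (i.-1 < size y)%N by nlia.
by have := good_split so iy gi; rewrite e.
Qed.

Lemma run_right : Ix (u ++ B) v <= M ^+ 2.
Proof.
have -> : u ++ B = take j y.
  have : take j (u ++ B ++ v) = u ++ B.
    rewrite catA take_size_cat // size_cat run_size_B /u size_take.
    by case: ltnP; nlia.
  by rewrite -run_cat.
rewrite run_v; case/and3P: br => _ _ /orP[/eqP j0|gj].
  by rewrite IxC j0 drop_size /Ix big_nil sqr_ge0.
have [jl|jl] := ltnP j (size y); first exact: good_split'.
by rewrite IxC drop_oversize // /Ix big_nil sqr_ge0.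
Qed.

(** Each particle of the run feels a field above [M]. The two outsides contribute at most M^2 each
    to the total, so the run itself must carry the energy. *)
Lemma run_B : M * (j - i)%:R <= Hx B + 2 * M ^+ 2.
Proof.
have h : M * (j - i)%:R <= Ix B y.
  have -> : Ix B y = \sum_(t <- iota i (j - i)) Ix [:: nth 0 y t] y.
    rewrite /B -(map_nth_iota 0); last by nlia.
    by rewrite /Ix big_map; apply: eq_bigr => t _; rewrite big_seq1.
  have -> : M * (j - i)%:R = \sum_(t <- iota i (j - i)) M.
    by rewrite big_const_seq count_predT iter_addr addr0 size_iota mulr_natr.
  rewrite big_seq [leRHS]big_seq; apply: ler_sum => t ti.
  by case/and3P: br => /allP/(_ _ ti); rewrite /good -ltNge => /ltW.
apply: (le_trans h); rewrite {1}run_cat !Ix_catr.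
have h1 := run_left; have h2 := run_right.
rewrite Ix_catr in h1; rewrite Ix_catl in h2.
have h3 : Ix B u = Ix u B by rewrite IxC.
have h4 := Ix_ge0 g u v.
rewrite /Hx h3; lra.
Qed.

(** A particle of the run contributes at most 1; everything beyond a flanking good particle is
    screened by it and contributes at most [M]. *)
Lemma run_T t : (i <= t < j)%N -> Ix [:: nth 0 y t] y <= (j - i)%:R + 2 * M.
Proof.
move=> /andP[it tj]; have ty : (t < size y)%N by nlia.
rewrite {2}run_cat !Ix_catr.
have h1 : Ix [:: nth 0 y t] B <= (j - i)%:R.
  rewrite -run_size_B /Ix big_seq1; apply: le_trans (ler_sum _ (fun b _ => tk_le1 g0 _ b)) _.
  by rewrite big_const_seq count_predT iter_addr addr0.
have h2 : Ix [:: nth 0 y t] u <= M.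
  case/and3P: br => _ + _; have [/eqP i0 _|i0 /= gi] := boolP (i == 0%N).
    by rewrite IxC /u i0 take0 /Ix big_nil.
  have iy : (i.-1 < size y)%N by nlia.
  have e : i.-1.+1 = i by rewrite prednK // lt0n.
  rewrite IxC (@Ix_prod _ _ (nth 0 y i.-1)).
  - apply: (@le_trans _ _ (M * 1)); last by rewrite mulr1.
    apply: ler_pM; rewrite ?Ix_ge0 //; first exact: le_trans (Ix_take _ _ _) gi.
    by rewrite /Ix !big_seq1 tk_le1.
  - by move=> a au; apply: sorted_take_le => //; rewrite e.
  - move=> b; rewrite inE => /eqP ->.
    apply: (sorted_leq_nth le_trans lexx) => //; rewrite ?inE; nlia.
have h3 : Ix [:: nth 0 y t] v <= M.
  rewrite run_v; case/and3P: br => _ _; have [/eqP j0 _|j0 /= gj] := boolP (j == size y).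
    by rewrite IxC j0 drop_size /Ix big_nil.
  have jy' : (j < size y)%N by rewrite ltn_neqAle j0.
  rewrite (@Ix_prod _ _ (nth 0 y j)).
  - apply: (@le_trans _ _ (1 * M)); last by rewrite mul1r.
    apply: ler_pM; rewrite ?Ix_ge0 //; last exact: le_trans (Ix_drop _ _ _) gj.
    by rewrite /Ix !big_seq1 tk_le1.
  - move=> b; rewrite inE => /eqP ->.
    apply: (sorted_leq_nth le_trans lexx) => //; rewrite ?inE; nlia.
  - by move=> b; apply: sorted_drop_ge.
lra.
Qed.

End OneRun.

Variables (th C : R).
Hypothesis th1 : 1 <= th.
Hypothesis Hth : forall (r : seq int) (s : int), uniq r -> \sum_(x <- r) gs (x - s) <= th.
Hypothesis HC : forall (r : seq int) N, uniq r ->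
    \sum_(x <- seqs r N) fx x * expR (1 * Hx x) <= N`!%:R * expR (C * N%:R).

Lemma uniq_shiftz c r : uniq r -> uniq (shiftz c r).
Proof. by move=> ur; rewrite map_inj_uniq // => a b /addIr. Qed.

Lemma sum_fx_shift (r : seq int) N c : uniq r ->
  \sum_(x <- seqs r N) fx (shiftz c x) <= N`!%:R * CN N * th ^+ N.
Proof.
move=> ur; rewrite -(sum_seqs_map (fun x => x - c) r N fx).
apply: sum_fx_le => s; apply: Hth; exact: uniq_shiftz.
Qed.

Lemma shiftz_perm c x y : perm_eq x y -> perm_eq (shiftz c x) (shiftz c y).
Proof. exact: perm_map. Qed.

Lemma sorted_le_cross (y : seq int) n (a b : int) : sorted <=%O y -> a \in take n y -> b \in drop n y -> a <= b.
Proof.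
move=> so; have [ny|yn] := ltnP n (size y); last by rewrite drop_oversize.
move=> au bv; apply: (@le_trans _ _ (nth 0 y n)); last exact: sorted_drop_ge.
by apply: sorted_take_le => //; rewrite (take_nth 0) // mem_rcons inE au orbT.
Qed.

(** Split just after the good particle: [good_split] bounds the cost in [fx_cat], and summing out
    the noise costs at most [th] per particle. *)
Lemma good_weight (r : seq int) N i : uniq r -> (i < N)%N ->
  \sum_(x <- seqs r N) (good (srt x) i)%:R * fx x <=
  N`!%:R * (expR (2 * p%:R * M ^+ 2) * th ^+ N * (CN i.+1 * CN (N - i.+1))).
Proof.
move=> ur iN; set k := i.+1.
pose F (u v : seq int) := expR (2 * p%:R * M ^+ 2) * (fx u * fx (shiftz (p * k)%N%:Z v)).
have F0 u v : 0 <= F u v by rewrite /F !mulr_ge0 ?expR_ge0 ?fx_ge0.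
apply: (@le_trans _ _ (\sum_(x <- seqs r N) F (take k (srt x)) (drop k (srt x)))).
  rewrite big_seq [leRHS]big_seq; apply: ler_sum => x /size_seqs_mem sx.
  have [gi|_] := boolP (good _ _); last by rewrite mul0r.
  rewrite mul1r -(fx_perm p g (perm_srt x)).
  have so := srt_sorted x; have sy := size_srt x; rewrite sx in sy.
  move: gi so sy; set y := srt x => gi so sy.
  have sk : size (take k y) = k by rewrite size_take sy; move: iN; rewrite /k leq_eqVlt; case: ltngtP => // _; rewrite orbF => /eqP.
  rewrite -{1}(cat_take_drop k y); apply: le_trans (fx_cat p0 g0 _) _.
    by move=> a b; apply: sorted_le_cross.
  rewrite sk; apply: ler_wpM2r; first by rewrite mulr_ge0 ?fx_ge0.
  rewrite ler_expR ler_wpM2l // good_split // sy //.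
apply: le_trans (ordered_split _ _ _ _ _) _ => //.
- by move=> v u u' pu; rewrite /F (fx_perm p g pu).
- by move=> u v v' pv; rewrite /F (fx_perm p g (shiftz_perm _ pv)).
rewrite /F; under eq_bigr do rewrite -mulr_sumr -mulr_sumr.
rewrite -mulr_sumr -mulr_suml.
have := @sum_fx_shift r k 0 ur; have z x : shiftz 0 x = x.
  by rewrite /shiftz -[RHS]map_id; apply: eq_map => a; rewrite subr0.
under eq_bigr do rewrite z.
move=> h1; have h2 := @sum_fx_shift r (N - k) (p * k)%N%:Z ur.
have h := ler_pM (sumr_ge0 _ (fun x _ => fx_ge0 p g x)) (sumr_ge0 _ (fun x _ => fx_ge0 p g _)) h1 h2.
apply: le_trans (ler_wpM2l _ (ler_wpM2l _ h)) _; rewrite ?expR_ge0 //.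
have -> : th ^+ N = th ^+ k * th ^+ (N - k) by rewrite -exprD subnKC.
have -> : N`!%:R = 'C(N, k)%:R * (k`!%:R * (N - k)`!%:R) :> R by rewrite -!natrM bin_fact.
by rewrite le_eqVlt; apply/orP; left; apply/eqP; ring.
Qed.

Definition Krun : R := expR (6 * p%:R * M ^+ 2 + 2 * M ^+ 2).

(** Split at both ends of the run. By [run_B] the factor e^(Hx - M L) can be inserted at bounded
    cost, L being the length of the run; the entropy bound [HC] turns the sum of e^Hx into e^(C L).
    A large [M] beats the entropy. *)
Lemma run_weight (r : seq int) N i j : uniq r -> (i <= j)%N -> (j <= N)%N ->
  \sum_(x <- seqs r N) (brun i j (srt x))%:R * fx x <=
  N`!%:R * CN N * th ^+ N * (Krun * expR ((C - M) * (j - i)%:R)).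
Proof.
move=> ur ij jN; set L := (j - i)%N.
have iN : (i <= N)%N by nlia.
have LN : (L <= N - i)%N by rewrite /L; nlia.
pose kk := Krun * expR (- (M * L%:R)).
have kk0 : 0 <= kk by rewrite mulr_ge0 ?expR_ge0.
pose fB (B : seq int) := fx (shiftz (p * i)%N%:Z B) * expR (1 * Hx B).
pose F3 (u B v : seq int) := kk * (fx u * (fB B * fx (shiftz (p * j)%N%:Z v))).
have fB0 B : 0 <= fB B by rewrite mulr_ge0 ?fx_ge0 ?expR_ge0.
have F30 u B v : 0 <= F3 u B v by rewrite /F3 mulr_ge0 // mulr_ge0 ?fx_ge0 // mulr_ge0 ?fx_ge0.
have fBp B B' : perm_eq B B' -> fB B = fB B'.
  move=> pB; rewrite /fB (fx_perm p g (shiftz_perm _ pB)).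
  by rewrite /Hx (Ix_perm g pB pB).
pose F (u y : seq int) := F3 u (take L (srt y)) (drop L (srt y)).
apply: (@le_trans _ _ (\sum_(x <- seqs r N) F (take i (srt x)) (drop i (srt x)))).
  rewrite big_seq [leRHS]big_seq; apply: ler_sum => x /size_seqs_mem sx.
  have [bi|_] := boolP (brun _ _ _); last by rewrite mul0r F30.
  rewrite mul1r -(fx_perm p g (perm_srt x)).
  have so := srt_sorted x; have sy := size_srt x; rewrite sx in sy.
  move: bi so sy; set y := srt x => bi so sy.
  have jy : (j <= size y)%N by rewrite sy.
  rewrite /F (srt_id (drop_sorted i so)) -/L.
  have yE := run_cat y i j.
  have hl := run_left so ij jy bi; have hr := run_right so ij jy bi.
  have hB := run_B so ij jy bi; have sB : size (take (j - i) (drop i y)) = (j - i)%N.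
    by rewrite size_takel // size_drop leq_sub2r.
  have si : size (take i y) = i by rewrite size_takel // sy.
  move: yE hl hr hB sB; rewrite -/L; set u := take i y in si *; set B := take L _; set v := drop L _ => yE hl hr hB sB.
  have cr1 a b : a \in u -> b \in B ++ v -> a <= b.
    by rewrite /B /v cat_take_drop; apply: sorted_le_cross.
  have cr2 a b : a \in B -> b \in v -> a <= b.
    by apply: sorted_le_cross; apply: drop_sorted.
  rewrite yE; apply: le_trans (fx_cat p0 g0 cr1) _; rewrite si.
  have -> : shiftz (p * i)%N%:Z (B ++ v) = shiftz (p * i)%N%:Z B ++ shiftz (p * i)%N%:Z v.
    by rewrite /shiftz map_cat.
  have cr2' a b : a \in shiftz (p * i)%N%:Z B -> b \in shiftz (p * i)%N%:Z v -> a <= b.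
    by move=> /mapP[a' aB ->] /mapP[b' bv ->]; rewrite lerD2r; apply: cr2.
  have h2 := fx_cat p0 g0 cr2'.
  rewrite Ix_shift size_shiftz sB shiftzD in h2.
  have e : (p * L)%N%:Z + (p * i)%N%:Z = (p * j)%N%:Z by rewrite -PoszD -mulnDr subnK.
  rewrite e in h2.
  have uf := fx_ge0 p g u.
  apply: le_trans (ler_wpM2l (expR_ge0 _) (ler_wpM2l uf h2)) _.
  rewrite /F3 /fB /kk /Krun.
  set fb := fx (shiftz _ B); set fv := fx (shiftz _ v).
  have X0 : 0 <= fx u * (fb * fv) by rewrite !mulr_ge0 ?fx_ge0.
  rewrite [leLHS](_ : _ = expR (2 * p%:R * Ix u (B ++ v) + 2 * p%:R * Ix B v) * (fx u * (fb * fv))); last first.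
    by rewrite expRD; ring.
  rewrite [leRHS](_ : _ = expR (6 * p%:R * M ^+ 2 + 2 * M ^+ 2 - M * L%:R + 1 * Hx B) * (fx u * (fb * fv))); last first.
    by rewrite !expRD; ring.
  apply: ler_wpM2r => //; rewrite ler_expR.
  rewrite Ix_catl in hr; have h0 := Ix_ge0 g u v.
  have pp : 0 <= 2 * p%:R :> R by rewrite mulr_ge0.
  have hBv : Ix B v <= M ^+ 2 by lra.
  have k1 := ler_wpM2l pp hl; have k2 := ler_wpM2l pp hBv.
  have m2 := sqr_ge0 M.
  have k3 : 0 <= 2 * p%:R * M ^+ 2 by rewrite mulr_ge0.
  rewrite -/L in hB; lra.
apply: le_trans (ordered_split _ _ _ _ _) _ => //.
- by move=> u v; apply: F30.
- by move=> v u u' pu; rewrite /F /F3 (fx_perm p g pu).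
- by move=> u v v' pv; rewrite /F (srt_perm pv).
have S3 u : \sum_(y <- seqs r (N - i)) F u y <=
   'C(N - i, L)%:R * \sum_(B <- seqs r L) \sum_(v <- seqs r (N - i - L)) F3 u B v.
  apply: ordered_split => //.
  - by move=> v B B' pB; rewrite /F3 (fBp _ _ pB).
  - by move=> B v v' pv; rewrite /F3 (fx_perm p g (shiftz_perm _ pv)).
apply: le_trans (ler_wpM2l _ (ler_sum _ (fun u _ => S3 u))) _; first exact: ler0n.
rewrite -mulr_sumr /F3.
under eq_bigr do (under eq_bigr do rewrite -mulr_sumr -mulr_sumr -mulr_sumr).
under eq_bigr do rewrite -mulr_sumr -mulr_sumr -mulr_suml.
rewrite -mulr_sumr -mulr_suml.
have z x : shiftz 0 x = x.
  by rewrite /shiftz -[RHS]map_id; apply: eq_map => a; rewrite subr0.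
have h1 : \sum_(u <- seqs r i) fx u <= i`!%:R * CN i * th ^+ i.
  by have := @sum_fx_shift r i 0 ur; under eq_bigr do rewrite z.
have e1 : (N - i - L = N - j)%N by rewrite /L; nlia.
have h3 : \sum_(v <- seqs r (N - i - L)) fx (shiftz (p * j)%N%:Z v) <=
   (N - j)`!%:R * CN (N - j) * th ^+ (N - j) by rewrite e1; apply: sum_fx_shift.
have h2 : \sum_(B <- seqs r L) fB B <= L`!%:R * expR (C * L%:R).
  apply: le_trans (HC L (uniq_shiftz (p * i)%N%:Z ur)).
  rewrite sum_seqs_map le_eqVlt; apply/orP; left; apply/eqP; apply: eq_bigr => B _.
  by rewrite /fB -[map _ B]/(shiftz _ B) /Hx Ix_shift.
have h23 := ler_pM (sumr_ge0 _ (fun x _ => fB0 x)) (sumr_ge0 _ (fun x _ => fx_ge0 p g _)) h2 h3.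
have h := ler_pM (sumr_ge0 _ (fun x _ => fx_ge0 p g x)) (mulr_ge0 (sumr_ge0 _ (fun x _ => fB0 x)) (sumr_ge0 _ (fun x _ => fx_ge0 p g _))) h1 h23.
apply: le_trans (ler_wpM2l _ (ler_wpM2l _ (ler_wpM2l _ h))) _ => //.
have Nf : N`!%:R = 'C(N, i)%:R * 'C(N - i, L)%:R * (i`!%:R * L`!%:R * (N - j)`!%:R) :> R.
  by rewrite -(bin_fact iN) -(bin_fact LN) e1 !natrM; ring.
(* The particles of the run are dropped here, [CN] being monotone. *)
have CC : CN i * CN (N - j) <= CN N.
  have := @CN_super R p g p0 i (i + (N - j)) (leq_addr (N - j) i); rewrite addKn => /le_trans; apply.
  by apply: CN_mono_le => //; clear -ij jN; nlia.
have tt : th ^+ i * th ^+ (N - j) <= th ^+ N.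
  by rewrite -exprD ler_weXn2l //; clear -ij jN; nlia.
have t0 : 0 <= th by apply: le_trans th1.
rewrite [leLHS](_ : _ = N`!%:R * (kk * expR (C * L%:R)) * ((CN i * CN (N - j)) * (th ^+ i * th ^+ (N - j)))); last by rewrite Nf; ring.
rewrite [leRHS](_ : _ = N`!%:R * (kk * expR (C * L%:R)) * (CN N * th ^+ N)); last first.
  by rewrite /kk mulrBl expRD; ring.
apply: ler_wpM2l; first by rewrite !mulr_ge0 ?expR_ge0.
by apply: ler_pM; rewrite ?mulr_ge0 ?CN_ge0 ?exprn_ge0.
Qed.

End Runs.

(** * Submultiplicativity of the partition function and moments of occupation numbers *)

Section Noise.
Variables (R : realType) (p : nat) (g : R).
Hypothesis p0 : (0 < p)%N.
Hypothesis g0 : 0 < g.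

Local Notation fx := (fx p g).
Local Notation Ix := (Ix g).
Local Notation Hx := (Hx g).
Local Notation CN := (CN p g).
Local Notation orb := (orb p).
Local Notation wt := (wt p g).
Local Notation gs := (gs g).

Definition tr (X : nat) : seq int := [seq i%:Z - X%:Z | i <- iota 0 (2 * X).+1].
Definition thX (X : nat) : R := \sum_(t <- tr X) gs t.
(** The lattice sum of the noise as a supremum of truncated sums, so that every sum over
    configurations stays finite. *)
Definition theta : R := reals.sup (range thX).

Lemma mem_tr X (x : int) : (x \in tr X) = (absz x <= X)%N.
Proof.
apply/mapP/idP => [[i ir ->]|xX]; first by move: ir; rewrite mem_iota; nlia.
by exists (absz (x + X%:Z)); rewrite ?mem_iota; nlia.
Qed.

Lemma uniq_tr X : uniq (tr X).
Proof. by rewrite map_inj_uniq ?iota_uniq // => i j /addIr []. Qed.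

Lemma gs0 : gs 0 = 1.
Proof. by rewrite /gs expr0n mulr0 oppr0 expR0. Qed.

Lemma thX_has_sup : has_sup (range thX).
Proof.
split; first by exists (thX 0), 0%N.
have [th [_ h]] := gauss_sum g0; exists th => _ [X _ <-].
have := h (tr X) 0 (uniq_tr X).
by rewrite /thX; under eq_bigr do rewrite subr0.
Qed.

Lemma thX_le X : thX X <= theta.
Proof. by apply: sup_upper_bound thX_has_sup _ _; exists X. Qed.

Lemma thX_ge1 X : 1 <= thX X.
Proof.
rewrite /thX (bigD1_seq 0) ?uniq_tr ?mem_tr //= gs0 lerDl sumr_ge0 // => t _.
exact: gs_ge0.
Qed.

Lemma theta_ge1 : 1 <= theta.
Proof. exact: le_trans (thX_ge1 0) (thX_le 0). Qed.

Lemma theta_sum (r : seq int) (s : int) : uniq r -> \sum_(x <- r) gs (x - s) <= theta.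
Proof.
move=> ur; pose X := \max_(x <- r) absz (x - s).
apply: le_trans (thX_le X).
apply: (@ler_sum_inj _ _ _ _ _ (fun x : int => x - s)); rewrite ?uniq_tr //.
- by move=> a b _ _ /addIr.
- by move=> x xr; rewrite mem_tr /X (big_rem x xr) /= leq_maxl.
- exact: gs_ge0.
Qed.

Lemma bernoulli (h : R) n : 0 <= h <= 1 -> 1 - n%:R * h <= (1 - h) ^+ n.
Proof.
move=> /andP[h0 h1]; elim: n => [|n IH]; first by rewrite mul0r subr0.
rewrite exprS; apply: le_trans (ler_wpM2l _ IH); last by lra.
have : 0 <= n%:R * h ^+ 2 by rewrite mulr_ge0 ?sqr_ge0.
have e : n.+1%:R = n%:R + 1 :> R by rewrite natr1.
rewrite e; lra.
Qed.

(** Truncate where [thX] exceeds theta (1 - 1/(2N)); by Bernoulli's inequality the N-th power then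
    loses at most a factor 2. *)
Lemma theta_near N : exists X, theta ^+ N <= 2 * thX X ^+ N.
Proof.
have t1 := theta_ge1; have t0 : 0 < theta by lra.
case: N => [|N]; first by exists 0%N; rewrite !expr0 mulr1 ler1n.
pose h : R := (2 * N.+1%:R)^-1.
have Np : 0 < N.+1%:R :> R by rewrite ltr0n.
have h0 : 0 < h by rewrite invr_gt0 mulr_gt0.
have h1 : h <= 1 by rewrite invf_le1 ?mulr_gt0 // -natrM ler1n.
have [_ [X _ <-] hX] := sup_adherent (mulr_gt0 t0 h0) thX_has_sup.
exists X; rewrite -/theta in hX.
have : (theta * (1 - h)) ^+ N.+1 <= thX X ^+ N.+1.
  apply: lerXn2r; rewrite ?nnegrE; last 1 first.
  - by apply/ltW; rewrite mulrBr mulr1.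
  - by rewrite mulr_ge0 ?(ltW t0) // subr_ge0.
  - by have := thX_ge1 X; lra.
rewrite exprMn; have hb : 1 - N.+1%:R * h <= (1 - h) ^+ N.+1.
  by apply: bernoulli; rewrite (ltW h0) h1.
have e : N.+1%:R * h = 1 / 2 by rewrite /h; field; rewrite gt_eqF.
rewrite e in hb.
have T0 : 0 <= theta ^+ N.+1 by rewrite exprn_ge0 // ltW.
have := ler_wpM2l T0 hb; lra.
Qed.

Definition addz (s t : seq int) : seq int := [seq z.1 + z.2 | z <- zip s t].
Definition box (N X : nat) : seq int := [seq i%:Z - X%:Z | i <- iota 0 (p * N + 2 * X)].

(** For fixed [s], adding the noise is injective and lands in the box; hence truncated noise bounds
    the plasma from below. *)
Lemma noise N X (F : seq int -> R) : (forall x, 0 <= F x) ->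
  \sum_(s <- seqs (orb N) N) wt s *
     \sum_(t <- seqs (tr X) N) (\prod_(a <- t) gs a) * F (addz s t) <=
  \sum_(x <- seqs (box N X) N) fx x * F x.
Proof.
move=> F0.
have ub : uniq (box N X) by rewrite map_inj_uniq ?iota_uniq // => i j /addIr [].
rewrite [leRHS](_ : _ = \sum_(s <- seqs (orb N) N) wt s *
   \sum_(x <- seqs (box N X) N) (\prod_(z <- zip s x) gs (z.2 - z.1)) * F x); last first.
  under [RHS]eq_bigr do rewrite mulr_sumr.
  rewrite exchange_big; apply: eq_big_seq => x /size_seqs_mem sx.
  by rewrite /fx sx mulr_suml; apply: eq_bigr => s _; rewrite mulrA.
rewrite big_seq [leRHS]big_seq; apply: ler_sum => s; rewrite mem_seqs => /andP[/eqP ss al].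
apply: ler_wpM2l; first exact: wt_ge0.
pose G (x : seq int) := (\prod_(z <- zip s x) gs (z.2 - z.1)) * F x.
have -> : \sum_(t <- seqs (tr X) N) (\prod_(a <- t) gs a) * F (addz s t) =
   \sum_(t <- seqs (tr X) N) G (addz s t).
  apply: eq_big_seq => t /size_seqs_mem st; rewrite /G; congr (_ * _).
  move: ss st; rewrite /addz; move: {1 2}N; elim: (s) (t) => [|a s' IH] [|b t'] [|n] //=; first by rewrite !big_nil.
  by move=> [e1] [e2]; rewrite !big_cons /= (IH _ n) // [a + b]addrC addrK.
apply: ler_sum_inj; rewrite ?uniq_seqs ?uniq_tr //.
- move=> t t' /size_seqs_mem st /size_seqs_mem st'.
  move: ss st st'; rewrite /addz; move: {1 2 3}N; elim: (s) (t) (t') => [|a s' IH] [|b u] [|b' u'] [|n] //=.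
  by move=> [e1] [e2] [e3] [/addrI -> /(IH _ _ n e1 e2 e3) ->].
- move=> t; rewrite !mem_seqs => /andP[/eqP st alt].
  rewrite size_map size_zip ss st minnn eqxx /=.
  move: ss st al alt; rewrite /addz; move: {1 2}N.
  elim: (s) (t) => [|a s' IH] [|b u] [|n] //= [e1] [e2] /andP[/= ao al] /andP[/= bt alt].
  rewrite (IH _ n) // andbT; move: ao bt; rewrite mem_orb mem_tr => ao bt.
  apply/mapP; exists (absz (a + b + X%:Z)); rewrite ?mem_iota; nlia.
- by move=> x; rewrite /G mulr_ge0 // prodr_ge0 // => z _; apply: gs_ge0.
Qed.

Lemma sum_expN n : \sum_(m <- iota 0 n) expR (- m%:R) <= 2 :> R.
Proof.
suff : \sum_(m <- iota 0 n) expR (- m%:R) <= 2 - 2 * expR (- n%:R) :> R.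
  by have := expR_ge0 (- n%:R : R); lra.
elim: n => [|n IH]; first by rewrite big_nil oppr0 expR0; lra.
have e : n.+1%:R = n%:R + 1 :> R by rewrite natr1.
rewrite sum_iotaS e opprD expRD.
have h1 : expR (-1) <= 1 / 2 :> R.
  rewrite expRN -div1r ler_pM2l // lef_pV2 ?posrE ?expR_gt0 //.
  by have := @expR_ge1Dx R 1; lra.
have := ler_wpM2l (expR_ge0 (- n%:R : R)) h1; lra.
Qed.

Lemma sum_exp_pairs (k a b n : nat) : (k <= a)%N ->
  \sum_(i <- iota 0 k.+1) \sum_(j <- iota a n) expR (- (j - i)%N%:R) <= 4 :> R.
Proof.
move=> ka.
have -> : \sum_(i <- iota 0 k.+1) \sum_(j <- iota a n) expR (- (j - i)%N%:R) =
   (\sum_(i <- iota 0 k.+1) expR (- (k - i)%N%:R)) * (\sum_(j <- iota a n) expR (- (j - k)%N%:R)) :> R.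
  rewrite mulr_suml; apply: eq_big_seq => i; rewrite mem_iota => ik.
  rewrite mulr_sumr; apply: eq_big_seq => j; rewrite mem_iota => ja.
  rewrite -expRD -opprD -natrD; congr (expR (- _%:R)); nlia.
have h1 : \sum_(i <- iota 0 k.+1) expR (- (k - i)%N%:R) <= 2 :> R.
  apply: le_trans (sum_expN k.+1).
  apply: (@ler_sum_inj _ _ _ _ _ (fun i => (k - i)%N) (fun m => expR (- m%:R))); rewrite ?iota_uniq //.
  - by move=> x y; rewrite !mem_iota; nlia.
  - by move=> x; rewrite !mem_iota; nlia.
have h2 : \sum_(j <- iota a n) expR (- (j - k)%N%:R) <= 2 :> R.
  apply: le_trans (sum_expN (a + n)).
  apply: (@ler_sum_inj _ _ _ _ _ (fun j => (j - k)%N) (fun m => expR (- m%:R))); rewrite ?iota_uniq //.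
  - by move=> x y; rewrite !mem_iota; nlia.
  - by move=> x; rewrite !mem_iota; nlia.
have -> : 4 = 2 * 2 :> R by ring.
by apply: ler_pM => //; apply: sumr_ge0 => i _; apply: expR_ge0.
Qed.

(** With M = C + 2 a run of length L has weight e^(-2L): one factor e^(-L) makes the sum over runs
    converge, the other makes it small or pays for moments. *)
Lemma consts : exists C M : R, [/\ 0 <= M, C - M = -2 &
  forall (r : seq int) N, uniq r ->
    \sum_(x <- seqs r N) fx x * expR (1 * Hx x) <= N`!%:R * expR (C * N%:R)].
Proof.
have [C [C0 HC]] := exp_bound p0 g0 (@ltr01 R).
by exists C, (C + 2); split=> //; lra.
Qed.

(* If no good index lies in a window then a bad run covers it, and bad runs are exponentially
   unlikely: hence good indices, at which the partition function factorises, dominate. *)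
Lemma CN_local : exists (K0 : R) (L0 : nat), [/\ 0 <= K0, (0 < L0)%N &
  forall N k, (k + L0 <= N)%N ->
   CN N <= K0 * \sum_(i <- iota k L0) CN i.+1 * CN (N - i.+1)].
Proof.
have [C [M [M0 CM HC]]] := consts.
have th1 := theta_ge1.
pose Kr := Krun p M.
have Kr0 : 0 < Kr by apply: expR_gt0.
(* From 16 Kr <= L0 <= e^L0 one gets the bound 1/4 in [eL]; the 4 there is the sum over pairs of run
   ends from [sum_exp_pairs]. *)
have [L0 [L00 L0P]] : exists L0, (0 < L0)%N /\ 16 * Kr <= L0%:R.
  exists (Num.bound (16 * Kr)).+1; split=> //.
  apply/ltW; apply: lt_le_trans (archi_boundP _) _; first by rewrite mulr_ge0 // ltW.
  by rewrite ler_nat.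
have eL : Kr * expR (- L0%:R) * 4 <= 1 / 4.
  have := @expR_ge1Dx R L0%:R; rewrite expRN => h.
  have e0 := expR_gt0 (L0%:R : R).
  rewrite mulrAC ler_pdivrMr //; lra.
exists (4 * expR (2 * p%:R * M ^+ 2)), L0; split=> //.
move=> N k kN; have [X hX] := theta_near N.
have ub : uniq (box N X) by rewrite map_inj_uniq ?iota_uniq // => i j /addIr [].
set S := \sum_(i <- iota k L0) _.
pose J := iota (k + L0) (N.+1 - (k + L0)).
have step : N`!%:R * CN N * thX X ^+ N <= \sum_(x <- seqs (box N X) N) fx x *
   (\sum_(i <- iota k L0) (good g M (srt x) i)%:R +
    \sum_(i <- iota 0 k.+1) \sum_(j <- J) (brun g M i j (srt x))%:R).
  have -> : N`!%:R * CN N * thX X ^+ N = \sum_(s <- seqs (orb N) N) wt s *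
     \sum_(t <- seqs (tr X) N) (\prod_(a <- t) gs a) * 1.
    under [RHS]eq_bigr do (under eq_bigr do rewrite mulr1).
    under [RHS]eq_bigr do rewrite sum_seqs_prod.
    by rewrite -mulr_suml sum_wt.
  apply: le_trans (@noise N X (fun=> 1) _) _ => //.
  rewrite big_seq [leRHS]big_seq; apply: ler_sum => x /size_seqs_mem sx.
  apply: ler_wpM2l; first exact: fx_ge0.
  have bn (A : Type) (r : seq A) (P : A -> bool) : 0 <= \sum_(i <- r) ((P i)%:R : R).
    by apply: sumr_ge0 => i _.
  have sy : (k + L0 <= size (srt x))%N by rewrite size_srt sx.
  have [[i ki gi]|[i [j [ik kj jy bi]]]] := brun_exists g M sy.
    apply: ler_wpDr; first by apply: sumr_ge0 => i' _.
    have := @ler_sum_mem R nat (iota k L0) i (fun i => (good g M (srt x) i)%:R).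
    by rewrite gi; apply=> //; rewrite mem_iota.
  apply: ler_wpDl => //.
  apply: le_trans (@ler_sum_mem R nat (iota 0 k.+1) i (fun i => \sum_(j <- J) (brun g M i j (srt x))%:R) _ _) => //; last by rewrite mem_iota.
  have := @ler_sum_mem R nat J j (fun j => (brun g M i j (srt x))%:R).
  rewrite bi; apply=> //; rewrite mem_iota; rewrite size_srt sx in jy; clear -kj jy kN; nlia.
have up : \sum_(x <- seqs (box N X) N) fx x *
   (\sum_(i <- iota k L0) (good g M (srt x) i)%:R +
    \sum_(i <- iota 0 k.+1) \sum_(j <- J) (brun g M i j (srt x))%:R) <=
   N`!%:R * (theta ^+ N * (expR (2 * p%:R * M ^+ 2) * S + 1 / 4 * CN N)).
  under eq_bigr do rewrite mulrDr.
  rewrite big_split mulrDr mulrDr; apply: lerD.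
    under eq_bigr do rewrite mulr_sumr.
    rewrite exchange_big /S !mulr_sumr big_seq [leRHS]big_seq; apply: ler_sum => i.
    rewrite mem_iota => ki.
    under eq_bigr do rewrite mulrC.
    apply: le_trans (good_weight p0 g0 M theta_sum ub _) _; first by clear -ki kN; nlia.
    by rewrite le_eqVlt; apply/orP; left; apply/eqP; ring.
  have hx i j : i \in iota 0 k.+1 -> j \in J ->
     \sum_(x <- seqs (box N X) N) fx x * (brun g M i j (srt x))%:R <=
     N`!%:R * CN N * theta ^+ N * (Kr * expR (- L0%:R) * expR (- (j - i)%N%:R)).
    rewrite !mem_iota => ik kj.
    under eq_bigr do rewrite mulrC.
    apply: le_trans (run_weight p0 g0 M0 th1 theta_sum HC ub _ _) _; [clear -ik kj; nlia|clear -kj kN; nlia|].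
    apply: ler_wpM2l.
      by rewrite !mulr_ge0 ?CN_ge0 // exprn_ge0 //; lra.
    rewrite CM -mulrA ler_pM2l // -expRD ler_expR.
    have : L0%:R <= (j - i)%N%:R :> R by rewrite ler_nat; clear -ik kj; nlia.
    lra.
  under eq_bigr do rewrite mulr_sumr.
  rewrite exchange_big /=.
  under eq_bigr do (under eq_bigr do rewrite mulr_sumr).
  under eq_bigr do rewrite exchange_big /=.
  apply: (@le_trans _ _ (\sum_(i <- iota 0 k.+1) \sum_(j <- J)
     N`!%:R * CN N * theta ^+ N * (Kr * expR (- L0%:R) * expR (- (j - i)%N%:R)))).
    rewrite big_seq [leRHS]big_seq; apply: ler_sum => i ik.
    rewrite big_seq [leRHS]big_seq; apply: ler_sum => j jJ; exact: hx.
  under eq_bigr do (rewrite -mulr_sumr -mulr_sumr).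
  rewrite -!mulr_sumr.
  have h4 := @sum_exp_pairs k (k + L0) 0 (N.+1 - (k + L0)) (leq_addr _ _).
  rewrite -/J in h4.
  have Z0 : 0 <= N`!%:R * CN N * theta ^+ N.
    by rewrite !mulr_ge0 ?CN_ge0 // exprn_ge0 //; lra.
  have E0 : 0 <= Kr * expR (- L0%:R) by rewrite mulr_ge0 ?expR_ge0 // ltW.
  have := ler_wpM2l Z0 (le_trans (ler_wpM2l E0 h4) eL).
  by move/le_trans; apply; rewrite le_eqVlt; apply/orP; left; apply/eqP; ring.
have Nf : 0 < N`!%:R :> R by rewrite ltr0n fact_gt0.
have := le_trans step up; rewrite -mulrA ler_pM2l // => H.
have S0 : 0 <= expR (2 * p%:R * M ^+ 2) * S + 1 / 4 * CN N.
  rewrite addr_ge0 ?mulr_ge0 ?expR_ge0 ?CN_ge0 //.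
  by apply: sumr_ge0 => i _; rewrite mulr_ge0 ?CN_ge0.
have T0 : 0 < thX X ^+ N by rewrite exprn_gt0 //; have := thX_ge1 X; lra.
have h := le_trans H (ler_wpM2r S0 hX).
(* The 2 is the loss from truncating the noise; the quarter of [CN N] becomes one half and moves to
   the left side. *)
suff : CN N <= 2 * (expR (2 * p%:R * M ^+ 2) * S + 1 / 4 * CN N).
  by rewrite -[4 * _ * S]mulrA; set E := expR _ * S; clear; lra.
rewrite -(ler_pM2r T0); apply: (le_trans h).
by rewrite le_eqVlt; apply/orP; left; apply/eqP; ring.
Qed.

(** Apply [CN_local] to the last window: each term is [CN] of at most N particles times [CN] of a
    bounded number. *)
Lemma CN_step : exists K1 : R, 1 <= K1 /\ forall N, CN N.+1 <= K1 * CN N.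
Proof.
have [K0 [L0 [K00 L00 H]]] := CN_local.
pose A := K0 * L0%:R * CN L0.+1.
have A0 : 0 <= A by rewrite !mulr_ge0 ?CN_ge0.
exists (CN L0.+1 + A); split.
  by have := @CN_ge1 R p g p0 L0.+1; lra.
move=> N; rewrite mulrDl; have [NL|LN] := leqP N L0.
  apply: (@le_trans _ _ (CN L0.+1 * 1)).
    by rewrite mulr1; apply: CN_mono_le.
  apply: ler_wpDr; first by rewrite mulr_ge0 ?CN_ge0.
  by apply: ler_wpM2l; rewrite ?CN_ge0 ?CN_ge1.
apply: ler_wpDl; first by rewrite mulr_ge0 ?CN_ge0.
have kL : ((N - L0) + L0 <= N.+1)%N by nlia.
apply: le_trans (H _ _ kL) _; rewrite /A -!mulrA; apply: ler_wpM2l => //.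
rewrite mulrC (_ : L0%:R = (size (iota (N - L0) L0))%:R :> R); last by rewrite size_iota.
rewrite -sum_const_seq big_seq [leRHS]big_seq; apply: ler_sum => i.
rewrite mem_iota => iN; rewrite mulrC; apply: ler_pM; rewrite ?CN_ge0 //; apply: CN_mono_le => //; nlia.
Qed.

(** [CN_local] splits somewhere in a window of length [L0]; [CN_step] moves the splitting point to
    [k] at bounded cost. *)
Lemma CN_sub : exists K : R, 1 <= K /\
  forall N k, (k <= N)%N -> CN N <= K * (CN k * CN (N - k)).
Proof.
have [K0 [L0 [K00 L00 H]]] := CN_local; have [K1 [K11 H1]] := CN_step.
have K10 : 0 <= K1 by lra.
have pw n m : CN (n + m) <= K1 ^+ m * CN n.
  elim: m => [|m IH]; first by rewrite addn0 mul1r.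
  rewrite addnS exprS -mulrA; apply: le_trans (H1 _) _; exact: ler_wpM2l.
pose B := K1 ^+ L0.
have B1 : 1 <= B by rewrite exprn_ege1.
have A0 : 0 <= K0 * L0%:R * B by rewrite !mulr_ge0 //; lra.
exists (B + K0 * L0%:R * B); split; first by lra.
move=> N k kN; rewrite mulrDl.
have CC : 0 <= CN k * CN (N - k) by rewrite mulr_ge0 ?CN_ge0.
have [kL|Lk] := leqP (k + L0) N; last first.
  apply: ler_wpDr; first by rewrite mulr_ge0.
  rewrite -{1}(subnKC kN); apply: le_trans (pw _ _) _.
  apply: ler_pM; rewrite ?exprn_ge0 ?CN_ge0 //.
    by apply: ler_weXn2l => //; nlia.
  by rewrite -{1}[CN k]mulr1; apply: ler_wpM2l; rewrite ?CN_ge0 ?CN_ge1.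
apply: ler_wpDl; first by rewrite mulr_ge0 //; lra.
apply: le_trans (H _ _ kL) _; rewrite -!mulrA; apply: ler_wpM2l => //.
rewrite mulrC -[in leRHS](size_iota k L0) -sum_const_seq big_seq [leRHS]big_seq; apply: ler_sum => i.
rewrite mem_iota => ik; rewrite mulrA; apply: ler_pM; rewrite ?CN_ge0 //.
  have -> : i.+1 = (k + (i.+1 - k))%N by nlia.
  apply: le_trans (pw _ _) _; apply: ler_wpM2r; rewrite ?CN_ge0 //.
  by apply: ler_weXn2l => //; nlia.
by apply: CN_mono_le => //; nlia.
Qed.

Lemma tangent (y c : R) q : 0 <= y -> 0 <= c ->
  c ^+ q.+1 + q.+1%:R * c ^+ q * (y - c) <= y ^+ q.+1.
Proof.
move=> y0 c0; elim: q => [|q IH]; first by rewrite !expr1 expr0 mulr1 mul1r; lra.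
rewrite [leRHS]exprS; apply: le_trans (ler_wpM2l y0 IH).
have h : 0 <= q.+1%:R * c ^+ q * (y - c) ^+ 2 by rewrite mulr_ge0 ?sqr_ge0 // mulr_ge0 ?exprn_ge0.
have e : q.+2%:R = q.+1%:R + 1 :> R by rewrite natr1.
rewrite -subr_ge0; rewrite (_ : _ - _ = q.+1%:R * c ^+ q * (y - c) ^+ 2) // e !exprS.
by rewrite expr0; ring.
Qed.

(** Jensen's inequality, through the tangent of the power function. A particle at [l] stays there
    with noise probability 1/thX, so the mean noisy occupation is at least the occupation divided by
    [thX]. *)
Lemma noise_count X (s : seq int) l q :
  (count_mem l s)%:R ^+ q.+1 * thX X ^+ size s <=
  thX X ^+ q.+1 * \sum_(t <- seqs (tr X) (size s))
     (\prod_(a <- t) gs a) * (count_mem l (addz s t))%:R ^+ q.+1.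
Proof.
have T1 := thX_ge1 X; have T0 : 0 < thX X by lra.
have mean : (count_mem l s)%:R * thX X ^+ size s <=
   thX X * \sum_(t <- seqs (tr X) (size s)) (\prod_(a <- t) gs a) * (count_mem l (addz s t))%:R.
  elim: s => [|a s IH]; first by rewrite mul0r sum_seqs0 /= mulr0 mulr0.
  rewrite sum_seqsS [size _]/=.
  have e b : \sum_(t <- seqs (tr X) (size s)) (\prod_(c <- b :: t) gs c) * (count_mem l (addz (a :: s) (b :: t)))%:R =
    gs b * ((a + b == l)%:R * thX X ^+ size s +
     \sum_(t <- seqs (tr X) (size s)) (\prod_(c <- t) gs c) * (count_mem l (addz s t))%:R).
    rewrite -(sum_seqs_prod (tr X) (size s) gs) mulrDr mulr_sumr mulr_sumr mulr_sumr -big_split.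
    by apply: eq_bigr => t _; rewrite big_cons /= natrD; ring.
  rewrite (eq_bigr _ (fun b _ => e b)); set Z := \sum_(t <- seqs _ _) _ in IH e *.
  under eq_bigr do rewrite mulrDr.
  rewrite big_split -mulr_suml -/(thX X) [count_mem l _]/= natrD exprS mulrDl mulrDr.
  apply: lerD.
    rewrite mulrCA ler_pM2l // (bigD1_seq 0) ?uniq_tr ?mem_tr //= gs0 mul1r addr0 lerDl.
    by apply: sumr_ge0 => b _; rewrite !mulr_ge0 ?gs_ge0 // exprn_ge0 // ltW.
  by rewrite mulrCA ler_pM2l.
set N := size s in mean *; set W := seqs (tr X) N in mean *.
pose n : R := (count_mem l s)%:R; pose c := n / thX X.
have n0 : 0 <= n by rewrite ler0n.
have c0 : 0 <= c by rewrite divr_ge0 // ltW.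
have nc : n = thX X * c by rewrite /c mulrC divfK // gt_eqF.
have Ptot : \sum_(t <- W) (\prod_(a <- t) gs a) = thX X ^+ N by rewrite sum_seqs_prod.
rewrite -/n nc exprMn -mulrA ler_pM2l ?exprn_gt0 //.
apply: (@le_trans _ _ (\sum_(t <- W) (\prod_(a <- t) gs a) *
   (c ^+ q.+1 + q.+1%:R * c ^+ q * ((count_mem l (addz s t))%:R - c)))); last first.
  apply: ler_sum => t _; apply: ler_wpM2l; last exact: tangent.
  by apply: prodr_ge0 => a _; apply: gs_ge0.
have -> : \sum_(t <- W) (\prod_(a <- t) gs a) *
   (c ^+ q.+1 + q.+1%:R * c ^+ q * ((count_mem l (addz s t))%:R - c)) =
   c ^+ q.+1 * thX X ^+ N + q.+1%:R * c ^+ q *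
     (\sum_(t <- W) (\prod_(a <- t) gs a) * (count_mem l (addz s t))%:R - c * thX X ^+ N).
  rewrite -Ptot mulrBr !mulr_sumr -sumrB -big_split; apply: eq_bigr => t _ /=; ring.
rewrite lerDl !mulr_ge0 ?exprn_ge0 // subr_ge0.
by rewrite -(ler_pM2l T0) mulrA -nc.
Qed.

Lemma exp_pow (a : R) q : 0 <= a -> a ^+ q.+1 <= q.+1`!%:R * expR a.
Proof.
move=> a0; have h := expR_ge1Dxn q a0.
have f0 : 0 < q.+1`!%:R :> R by rewrite ltr0n fact_gt0.
rewrite -ler_pdivrMl //; apply: le_trans h; rewrite mulrC; lra.
Qed.

Lemma count_le_Ix (a : int) x : (count_mem a x)%:R <= Ix [:: a] x.
Proof.
rewrite /Ix big_seq1; elim: x => [|b x IH]; first by rewrite big_nil.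
rewrite big_cons /= natrD; apply: lerD => //.
by case: eqP => [->|_]; rewrite ?tkxx // tk_ge0.
Qed.

(** An occupation number is at most the field at its site. The field is at most [M] at a good
    particle and at most L + 2M in a run of length L, whose weight decays like e^(-2L). *)
Lemma moment_total q : exists A : R, 0 <= A /\ forall N,
  \sum_(s <- seqs (orb N) N) wt s * \sum_(l <- orb N) (count_mem l s)%:R ^+ q.+1 <=
  A * N%:R * (N`!%:R * CN N).
Proof.
have [C [M [M0 CM HC]]] := consts.
have th1 := theta_ge1; have th0 : 0 < theta by lra.
pose Kr := Krun p M.
have Kr0 : 0 < Kr by apply: expR_gt0.
pose A1 := M ^+ q.+1 + 4 * (Kr * (q.+1`!%:R * expR (2 * M))).
have A10 : 0 <= A1 by rewrite addr_ge0 ?exprn_ge0 ?mulr_ge0 ?expR_ge0 // ltW.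
exists (2 * theta ^+ q.+1 * A1); split; first by rewrite !mulr_ge0 ?exprn_ge0 // ltW.
move=> N; have [X hX] := theta_near N.
have ub : uniq (box N X) by rewrite map_inj_uniq ?iota_uniq // => i j /addIr [].
have T1 := thX_ge1 X; have T0 : 0 < thX X by lra.
rewrite -(@ler_pM2r _ (thX X ^+ N)) ?exprn_gt0 //.
pose Fq (x : seq int) : R := \sum_(l <- orb N) (count_mem l x)%:R ^+ q.+1.
have Fq0 x : 0 <= Fq x by apply: sumr_ge0 => l _; rewrite exprn_ge0.
have s1 : (\sum_(s <- seqs (orb N) N) wt s * Fq s) * thX X ^+ N <=
    theta ^+ q.+1 * \sum_(x <- seqs (box N X) N) fx x * Fq x.
  apply: le_trans (ler_wpM2l _ (noise N X Fq0)); last by rewrite exprn_ge0 // ltW.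
  rewrite mulr_suml mulr_sumr big_seq [leRHS]big_seq; apply: ler_sum => s /size_seqs_mem ss.
  rewrite -[leLHS]mulrA [leRHS]mulrCA; apply: ler_wpM2l; first exact: wt_ge0.
  rewrite mulr_suml.
  under [in leRHS]eq_bigr do rewrite mulr_sumr.
  rewrite exchange_big mulr_sumr; apply: ler_sum => l _; rewrite -ss.
  apply: le_trans (noise_count _ _ _ _) _; apply: ler_wpM2r.
    by apply: sumr_ge0 => t _; rewrite mulr_ge0 ?exprn_ge0 // prodr_ge0 // => a _; apply: gs_ge0.
  by rewrite lerXn2r ?nnegrE ?(ltW T0) ?(ltW th0) // thX_le.
apply: (le_trans s1).
pose I := iota 0 N.
pose Bq (i j : nat) : R := ((j - i)%N%:R + 2 * M) ^+ q.+1.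
have Bq0 i j : 0 <= Bq i j by rewrite exprn_ge0 // addr_ge0 // mulr_ge0.
have loc x : size x = N -> Fq x <= \sum_(b <- I) (M ^+ q.+1 +
   \sum_(i <- iota 0 b.+1) \sum_(j <- iota b.+1 (N - b)) (brun g M i j (srt x))%:R * Bq i j).
  move=> sx; set y := srt x; have sy : size y = N by rewrite size_srt.
  (* A site occupied n >= 1 times is counted by its n particles, each of which feels a field of at
     least n. *)
  have h1 : Fq x <= \sum_(a <- y) (Ix [:: a] y) ^+ q.+1.
    have -> : Fq x = Fq y.
      by apply: eq_bigr => l _; congr (_%:R ^+ _); apply/permP; rewrite perm_sym perm_srt.
    apply: (@le_trans _ _ (\sum_(l <- orb N) \sum_(a <- y) (a == l)%:R * Ix [:: a] y ^+ q.+1)).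
      apply: ler_sum => l _.
      have -> : \sum_(a <- y) (a == l)%:R * Ix [:: a] y ^+ q.+1 = (count_mem l y)%:R * Ix [:: l] y ^+ q.+1.
        rewrite -sum1_count natr_sum mulr_suml [RHS]big_mkcond; apply: eq_bigr => a _ /=.
        by case: eqP => [->|]; rewrite ?mul0r.
      have [c0|c1] := posnP (count_mem l y); first by rewrite c0 expr0n /= mul0r.
      apply: (@le_trans _ _ (Ix [:: l] y ^+ q.+1)).
        by rewrite lerXn2r ?nnegrE ?Ix_ge0 // count_le_Ix.
      by rewrite ler_peMl ?exprn_ge0 ?Ix_ge0 // ler1n.
    rewrite exchange_big; apply: ler_sum => a _; rewrite -mulr_suml.
    rewrite -[leRHS]mul1r; apply: ler_wpM2r; first by rewrite exprn_ge0 ?Ix_ge0.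
    have [ao|ao] := boolP (a \in orb N).
      rewrite (bigD1_seq a) ?uniq_orb //= eqxx big1 ?addr0 // => l.
      by rewrite eq_sym => /negbTE ->.
    rewrite big1_seq ?ler01 // => l /= lo; case: eqP => // al.
    by rewrite al lo in ao.
  apply: (le_trans h1).
  rewrite (big_nth 0) /index_iota subn0 sy -/I big_seq [leRHS]big_seq; apply: ler_sum => b.
  rewrite mem_iota => bN.
  have nn (i : nat) : 0 <= \sum_(j <- iota b.+1 (N - b)) (brun g M i j y)%:R * Bq i j.
    by apply: sumr_ge0 => j _; rewrite mulr_ge0.
  have sb : (b + 1 <= size y)%N by rewrite sy addn1; case/andP: bN.
  have [[i ki gi]|[i [j [ik kj jy bi]]]] := brun_exists g M sb.
    have -> : b = i by clear -ki; nlia.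
    apply: ler_wpDr.
      by apply: sumr_ge0 => i' _; apply: sumr_ge0 => j' _; rewrite mulr_ge0.
    by rewrite lerXn2r ?nnegrE ?Ix_ge0.
  apply: ler_wpDl; first by rewrite exprn_ge0.
  apply: le_trans (@ler_sum_mem R nat (iota 0 b.+1) i (fun i => \sum_(j <- iota b.+1 (N - b)) (brun g M i j y)%:R * Bq i j) _ _) => //; last by rewrite mem_iota.
  apply: le_trans (@ler_sum_mem R nat (iota b.+1 (N - b)) j (fun j => (brun g M i j y)%:R * Bq i j) _ _).
  2: by move=> j'; rewrite mulr_ge0.
  2: by rewrite mem_iota; move: jy; rewrite sy; clear -kj bN; nlia.
  rewrite bi mul1r /Bq lerXn2r ?nnegrE ?Ix_ge0 ?addr_ge0 ?mulr_ge0 //.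
  apply: (run_T p0 g0 M0 (srt_sorted x) _ jy bi); clear -ik kj; nlia.
set Z := N`!%:R * CN N * theta ^+ N.
have Z0 : 0 <= Z by rewrite !mulr_ge0 ?CN_ge0 // exprn_ge0 // ltW.
have s2 : \sum_(x <- seqs (box N X) N) fx x * Fq x <= Z * (N%:R * A1).
  apply: (@le_trans _ _ (\sum_(x <- seqs (box N X) N) fx x * \sum_(b <- I) (M ^+ q.+1 +
   \sum_(i <- iota 0 b.+1) \sum_(j <- iota b.+1 (N - b)) (brun g M i j (srt x))%:R * Bq i j))).
    rewrite big_seq [leRHS]big_seq; apply: ler_sum => x /size_seqs_mem sx.
    by apply: ler_wpM2l; [apply: fx_ge0|apply: loc].
  under eq_bigr do rewrite mulr_sumr.
  rewrite exchange_big /=.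
  have -> : Z * (N%:R * A1) = \sum_(b <- I) Z * A1 by rewrite sum_const_seq size_iota; ring.
  rewrite big_seq [leRHS]big_seq; apply: ler_sum => b; rewrite mem_iota => bN.
  have [J0 J0E] : exists J0, J0 = iota 0 b.+1 by exists (iota 0 b.+1).
  rewrite -[0%N :: iota 1 b]/(iota 0 b.+1) -J0E; under eq_bigr do rewrite mulrDr.
  rewrite big_split /A1 mulrDr; apply: lerD.
    rewrite -mulr_suml; apply: ler_wpM2r; first by rewrite exprn_ge0.
    by apply: sum_fx_le => s; apply: theta_sum.
  under eq_bigr do rewrite mulr_sumr.
  rewrite exchange_big.
  under eq_bigr do (under eq_bigr do rewrite mulr_sumr).
  under eq_bigr do rewrite exchange_big.
  apply: (@le_trans _ _ (\sum_(i <- J0) \sum_(j <- iota b.+1 (N - b))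
     Z * (Kr * (q.+1`!%:R * expR (2 * M))) * expR (- (j - i)%N%:R))).
    rewrite big_seq [leRHS]big_seq; apply: ler_sum => i; rewrite J0E mem_iota => ib.
    rewrite big_seq [leRHS]big_seq; apply: ler_sum => j; rewrite mem_iota => jb.
    rewrite (eq_bigr (fun x => ((brun g M i j (srt x))%:R * fx x) * Bq i j)); last first.
      by move=> x _; rewrite [RHS]mulrAC mulrC.
    rewrite -mulr_suml.
    have := run_weight p0 g0 M0 th1 theta_sum HC ub (i := i) (j := j) (N := N).
    move=> /(_ (ltac:(clear -ib jb; nlia)) (ltac:(clear -jb bN; nlia))) /(ler_wpM2r (Bq0 i j)) h.
    apply: (le_trans h).
    rewrite -/Z CM -/Kr -[leLHS]mulrA -[leRHS]mulrA; apply: ler_wpM2l => //.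
    rewrite -[leLHS]mulrA -[leRHS]mulrA ler_pM2l // -[leRHS]mulrA.
    (* The power of the run length is swallowed by e^L, and e^(-L) remains for the sum over runs. *)
    have hb : Bq i j <= q.+1`!%:R * expR ((j - i)%N%:R + 2 * M).
      by apply: exp_pow; rewrite addr_ge0 // mulr_ge0.
    apply: le_trans (ler_wpM2l (expR_ge0 _) hb) _.
    rewrite mulrCA; apply: ler_wpM2l => //.
    rewrite -!expRD ler_expR; lra.
  under eq_bigr do rewrite -mulr_sumr.
  rewrite -mulr_sumr.
  have h4 := @sum_exp_pairs b b.+1 0 (N - b) (leqnSn _).
  rewrite -J0E in h4.
  have E0 : 0 <= Z * (Kr * (q.+1`!%:R * expR (2 * M))).
    by rewrite mulr_ge0 // mulr_ge0 ?mulr_ge0 ?expR_ge0 // ltW.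
  apply: le_trans (ler_wpM2l E0 h4) _.
  by rewrite le_eqVlt; apply/orP; left; apply/eqP; ring.
apply: le_trans (ler_wpM2l _ s2) _; first by rewrite exprn_ge0 // ltW.
have U0 : 0 <= theta ^+ q.+1 * A1 * N%:R * (N`!%:R * CN N).
  by rewrite !mulr_ge0 ?CN_ge0 ?exprn_ge0 // ltW.
have := ler_wpM2l U0 hX; rewrite /Z => h.
apply: le_trans (le_trans _ h) _; rewrite le_eqVlt; apply/orP; left; apply/eqP; ring.
Qed.

(** Not normalised: the constant 1 has the value [CN N], and cuts then give exact products. *)
Definition EE (N : nat) (F : seq int -> R) : R :=
  (\sum_(s <- seqs (orb N) N) wt s * F s) / N`!%:R.

Lemma le_EE N F G : (forall s, F s <= G s) -> EE N F <= EE N G.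
Proof.
move=> FG; rewrite /EE; apply: ler_wpM2r; first by rewrite invr_ge0.
by apply: ler_sum => s _; apply: ler_wpM2l; rewrite ?wt_ge0.
Qed.

Lemma EE1 N : EE N (fun=> 1) = CN N.
Proof. by rewrite /EE CNE; under eq_bigr do rewrite mulr1. Qed.

Lemma EE_cut k N F G : (k <= N)%N ->
  EE N (fun s => (cut p k s)%:R * (F (leftk p k s) * G (rightk p k s))) = EE k F * EE (N - k) G.
Proof.
move=> kN; rewrite /EE; under eq_bigr do rewrite mulrCA.
rewrite (@cut_sum0 R p g p0 k N (fun s t => F s * G t) kN).
rewrite invfM [RHS]mulrACA; congr (_ * _); rewrite mulr_suml.
by apply: eq_bigr => s _; rewrite mulr_sumr; apply: eq_bigr => t _; ring.
Qed.

Lemma EE_right k N F G : (k <= N)%N -> (forall s, 0 <= F s) -> (forall s, G (rightk p k s) <= F s) ->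
  CN k * EE (N - k) G <= EE N F.
Proof.
move=> kN F0 GF; rewrite -EE1 -EE_cut //; apply: le_EE => s.
by case: (cut _ _ _); rewrite ?mul0r ?mul1r.
Qed.

Lemma EE_left k N F G : (k <= N)%N -> (forall s, 0 <= F s) -> (forall s, G (leftk p k s) <= F s) ->
  EE k G * CN (N - k) <= EE N F.
Proof.
move=> kN F0 GF; rewrite -EE1 -EE_cut //; apply: le_EE => s.
by case: (cut _ _ _); rewrite ?mul0r ?mul1r ?mulr1.
Qed.

Lemma count_leftk (l : int) k s : (count_mem l (leftk p k s) <= count_mem l s)%N.
Proof. exact/leq_count_subseq/filter_subseq. Qed.

Lemma count_rightk (l : int) k s :
  (count_mem l (rightk p k s) <= count_mem (l + (p * k)%N%:Z)%R s)%N.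
Proof.
rewrite count_map (eq_count (a2 := pred1 (l + (p * k)%N%:Z))).
  exact/leq_count_subseq/filter_subseq.
by move=> x /=; rewrite subr_eq.
Qed.

(* A system of 3N particles contains a translate of the N-particle system at each of 2N
   positions, so that the moment at one site is controlled by the average over sites. *)
Lemma moment_site q : exists A : R, 0 <= A /\ forall N (l : int),
  EE N (fun s => (count_mem l s)%:R ^+ q.+1) <= A * CN N.
Proof.
have [A [A0 HA]] := moment_total q; have [K [K1 HK]] := CN_sub.
exists (2 * A * K ^+ 2); have K0 : 0 <= K by lra.
split; first by rewrite !mulr_ge0 ?exprn_ge0.
move=> N l; have rhs0 : 0 <= 2 * A * K ^+ 2 * CN N by rewrite !mulr_ge0 ?exprn_ge0 ?CN_ge0.
have [lo|lo] := boolP (l \in orb N); last first.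
  rewrite /EE big1_seq ?mul0r // => s /=; rewrite mem_seqs => /andP[_ /allP al].
  rewrite (_ : count_mem l s = 0%N) ?expr0n ?mulr0 //; apply/count_memPn.
  by apply: contra lo => /al.
case: (posnP N) => [N0|N0].
  by move: lo; rewrite mem_orb N0 muln0; case/andP => l0 /(le_lt_trans l0); rewrite ltxx.
set X := EE N _; pose T := (3 * N)%N.
have step i : i \in iota 0 (2 * N) ->
   CN T * X <= K ^+ 2 * CN N * EE T (fun s => (count_mem (l + (p * i)%N%:Z)%R s)%:R ^+ q.+1).
  rewrite mem_iota => iN.
  have iT : (i <= T)%N by rewrite /T; clear -iN; nlia.
  have NT : (N <= T - i)%N by rewrite /T; clear -iN; nlia.
  have e1 : EE (T - i) (fun s => (count_mem l s)%:R ^+ q.+1) >= X * CN (T - i - N).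
    apply: EE_left => // x; by rewrite lerXn2r ?nnegrE // ler_nat count_leftk.
  have e2 : EE T (fun s => (count_mem (l + (p * i)%N%:Z)%R s)%:R ^+ q.+1) >=
      CN i * EE (T - i) (fun s => (count_mem l s)%:R ^+ q.+1).
    apply: EE_right => // x; by rewrite lerXn2r ?nnegrE // ler_nat count_rightk.
  have C0 n : 0 <= CN n by apply: CN_ge0.
  have X0 : 0 <= X by rewrite divr_ge0 // sumr_ge0 // => s _; rewrite mulr_ge0 ?wt_ge0 ?exprn_ge0.
  have k1 := HK _ _ iT; have k2 := HK _ _ NT.
  have k3 : CN T <= K ^+ 2 * (CN i * (CN N * CN (T - i - N))).
    apply: (le_trans k1); rewrite expr2 -mulrA ler_wpM2l //.
    by rewrite [leRHS]mulrCA ler_wpM2l.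
  apply: (le_trans (ler_wpM2r X0 k3)).
  have e3 : CN i * (X * CN (T - i - N)) <=
     EE T (fun s => (count_mem (l + (p * i)%N%:Z)%R s)%:R ^+ q.+1).
    by apply: le_trans e2; apply: ler_wpM2l.
  have KC : 0 <= K ^+ 2 * CN N by rewrite mulr_ge0 ?exprn_ge0.
  have := ler_wpM2l KC e3.
  by apply: le_trans; rewrite le_eqVlt; apply/orP; left; apply/eqP; ring.
have tot : \sum_(i <- iota 0 (2 * N)) EE T (fun s => (count_mem (l + (p * i)%N%:Z)%R s)%:R ^+ q.+1) <=
    A * T%:R * CN T.
  apply: (@le_trans _ _ ((\sum_(s <- seqs (orb T) T) wt s * \sum_(l' <- orb T) (count_mem l' s)%:R ^+ q.+1) / T`!%:R)).
    rewrite /EE -mulr_suml; apply: ler_wpM2r; first by rewrite invr_ge0.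
    rewrite exchange_big; apply: ler_sum => s _; rewrite -mulr_sumr.
    apply: ler_wpM2l; first exact: wt_ge0.
    apply: (@ler_sum_inj _ _ _ _ _ (fun i => l + (p * i)%N%:Z) (fun l' => (count_mem l' s)%:R ^+ q.+1)).
    - exact: iota_uniq.
    - exact: uniq_orb.
    - move=> i j _ _ /addrI [] /eqP; rewrite eqn_pmul2l // => /eqP //.
    - move=> i; rewrite mem_iota => iN; move: lo; rewrite !mem_orb => /andP[l0 lN].
      have h : (p * i + p * N <= p * T)%N.
        by rewrite -mulnDr leq_pmul2l // /T; clear -iN; nlia.
      by apply/andP; split; clear -l0 lN h; nlia.
    - by move=> t; apply: exprn_ge0.
  by rewrite ler_pdivrMr ?ltr0n ?fact_gt0 // -[leRHS]mulrA [CN T * _]mulrC; apply: HA.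
have : \sum_(i <- iota 0 (2 * N)) CN T * X <= K ^+ 2 * CN N * (A * T%:R * CN T).
  apply: le_trans (ler_wpM2l _ tot); last by rewrite mulr_ge0 ?exprn_ge0 ?CN_ge0.
  by rewrite mulr_sumr big_seq [leRHS]big_seq; apply: ler_sum.
rewrite sum_const_seq size_iota /T !natrM => h.
have CT : 0 < CN T by apply: CN_gt0.
have NR : 0 < N%:R :> R by rewrite ltr0n.
have pos : 0 < CN T * N%:R by rewrite mulr_gt0.
rewrite -(ler_pM2l pos).
have z0 : 0 <= CN T * N%:R * (A * K ^+ 2 * CN N) by rewrite !mulr_ge0 ?exprn_ge0 ?CN_ge0.
by rewrite /T in z0 h *; lra.
Qed.

End Noise.

(** * Renewal of common cuts *)

Section Renewal.
Variables (R : realType) (p : nat) (g : R).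
Hypothesis p0 : (0 < p)%N.
Hypothesis g0 : 0 < g.

Local Notation CN := (CN p g).
Local Notation orb := (orb p).
Local Notation wt := (wt p g).
Local Notation cut := (cut p).
Local Notation leftk := (leftk p).
Local Notation rightk := (rightk p).

(** Two independent copies with the normalisation of [EE], so that a common cut factorises exactly,
    see [UU_cut]. *)
Definition UU (N : nat) (F : seq int -> seq int -> R) : R :=
  (\sum_(s <- seqs (orb N) N) \sum_(t <- seqs (orb N) N) wt s * wt t * F s t) / N`!%:R ^+ 2.

Lemma le_UU N F G : (forall s t, size s = N -> size t = N -> bw p g s != 0 -> bw p g t != 0 -> F s t <= G s t) ->
  UU N F <= UU N G.
Proof.
move=> FG; apply: ler_wpM2r; first by rewrite invr_ge0 exprn_ge0.
rewrite big_seq [leRHS]big_seq; apply: ler_sum => s /size_seqs_mem ss.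
rewrite big_seq [leRHS]big_seq; apply: ler_sum => t /size_seqs_mem st.
have [->|s0] := eqVneq (wt s) 0; first by rewrite !mul0r.
have [->|t0] := eqVneq (wt t) 0; first by rewrite mulr0 !mul0r.
by apply: ler_wpM2l; [rewrite mulr_ge0 ?wt_ge0|apply: FG; rewrite -?wt_neq0].
Qed.

Lemma UU_ge0 N F : (forall s t, 0 <= F s t) -> 0 <= UU N F.
Proof.
move=> F0; rewrite divr_ge0 ?exprn_ge0 // sumr_ge0 // => s _; rewrite sumr_ge0 // => t _.
by rewrite mulr_ge0 // mulr_ge0 ?wt_ge0.
Qed.

Lemma UU_prod N F G : UU N (fun s t => F s * G t) = EE p g N F * EE p g N G.
Proof.
rewrite /UU /EE [RHS]mulrACA -invfM -expr2; congr (_ / _); rewrite mulr_suml.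
by apply: eq_bigr => s _; rewrite mulr_sumr; apply: eq_bigr => t _; ring.
Qed.

Lemma UU1 N : UU N (fun _ _ => 1) = CN N ^+ 2.
Proof.
rewrite -[RHS]/(CN N * CN N) -EE1 -UU_prod; congr (_ / _).
by apply: eq_bigr => s _; apply: eq_bigr => t _; rewrite !mulr1.
Qed.

Lemma eq_UU N F G : (forall s t, F s t = G s t) -> UU N F = UU N G.
Proof.
by move=> FG; congr (_ / _); apply: eq_bigr => s _; apply: eq_bigr => t _; rewrite FG.
Qed.

Definition cut2 (k : nat) (s t : seq int) : bool := cut k s && cut k t.

Lemma UU_cut k N F G : (k <= N)%N ->
  UU N (fun s t => (cut2 k s t)%:R * (F (leftk k s) (leftk k t) * G (rightk k s) (rightk k t))) =
  UU k F * UU (N - k) G.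
Proof.
move=> kN.
have nz m : m`!%:R != 0 :> R by rewrite pnatr_eq0 -lt0n fact_gt0.
have inner s : (\sum_(t <- seqs (orb N) N) wt s * wt t *
      ((cut2 k s t)%:R * (F (leftk k s) (leftk k t) * G (rightk k s) (rightk k t)))) / N`!%:R =
   (cut k s)%:R * (wt s * ((\sum_(a <- seqs (orb k) k) \sum_(b <- seqs (orb (N - k)) (N - k))
      wt a * wt b * (F (leftk k s) a * G (rightk k s) b)) / (k`!%:R * (N - k)`!%:R))).
  rewrite -(@cut_sum0 R p g p0 k N (fun a b => F (leftk k s) a * G (rightk k s) b) kN).
  rewrite mulrA mulrA; congr (_ / _); rewrite mulr_sumr; apply: eq_bigr => t _.
  by rewrite /cut2 -mulnb natrM; ring.
rewrite /UU [_ ^+ 2]expr2 invfM [LHS]mulrA [X in X / _ = _]mulr_suml (eq_bigr _ (fun s _ => inner s)).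
rewrite (@cut_sum0 R p g p0 k N (fun x y => (\sum_(a <- seqs (orb k) k) \sum_(b <- seqs (orb (N - k)) (N - k))
      wt a * wt b * (F x a * G y b)) / (k`!%:R * (N - k)`!%:R)) kN).
rewrite [RHS]mulrACA -[in RHS]invfM -exprMn [_ ^+ 2]expr2.
set X := k`!%:R * _; rewrite [in RHS]invfM [RHS]mulrA; congr (_ / _).
rewrite !mulr_suml; apply: eq_bigr => s _.
rewrite mulr_sumr mulr_suml; apply: eq_bigr => t _.
rewrite mulrA; congr (_ / _); rewrite mulr_sumr mulr_suml; apply: eq_bigr => a _.
by rewrite !mulr_sumr; apply: eq_bigr => b _; ring.
Qed.

Definition nc (i j : nat) (s t : seq int) : bool :=
  all (fun k => ~~ cut2 k s t) (iota i.+1 (j - i.+1)).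
Definition Aev (i j : nat) (s t : seq int) : bool :=
  [&& cut2 i s t, cut2 j s t & nc i j s t].
Definition UUn (n : nat) : R := UU n (fun s t => (nc 0 n s t)%:R).
(** Up to bounded factors, the probability that two sites at distance [n] are consecutive common
    cuts; see [UU_Aev_le] and [UU_Aev_ge]. *)
Definition ppi (n : nat) : R := UUn n / CN n ^+ 2.

Lemma ppi_ge0 n : 0 <= ppi n.
Proof. by rewrite divr_ge0 ?exprn_ge0 ?CN_ge0 // UU_ge0. Qed.

Lemma nc_left i j s t : nc i j (leftk j s) (leftk j t) = nc i j s t.
Proof.
by apply: eq_in_all => k; rewrite mem_iota => kj; rewrite /cut2 !cut_left //; nlia.
Qed.

Lemma nc_right i j s t : (i < j)%N -> cut2 i s t -> nc 0 (j - i) (rightk i s) (rightk i t) = nc i j s t.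
Proof.
move=> ij /andP[cs ct]; rewrite /nc -subnDA -[in iota i.+1 _](addn1 i) iotaDl all_map addn1.
apply: eq_in_all => k; rewrite mem_iota /= => kj.
have h : (i <= i + k)%N by apply: leq_addr.
have := @cut_right p p0 (i + k) i s h cs; have := @cut_right p p0 (i + k) i t h ct.
by rewrite !addKn /cut2 addnC => -> ->.
Qed.

Lemma UU_Aev i j N : (i < j)%N -> (j <= N)%N ->
  UU N (fun s t => (Aev i j s t)%:R) = CN i ^+ 2 * UUn (j - i) * CN (N - j) ^+ 2.
Proof.
move=> ij jN; have ij' := ltnW ij.
have -> : UU N (fun s t => (Aev i j s t)%:R) = UU N (fun s t => (cut2 j s t)%:R *
   ((cut2 i (leftk j s) (leftk j t) && nc i j (leftk j s) (leftk j t))%:R * 1)).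
  apply: eq_UU => s t; rewrite nc_left {2}/cut2 !cut_left // -/(cut2 i s t) mulr1 -natrM mulnb.
  by rewrite /Aev; case: (cut2 i s t); case: (cut2 j s t).
rewrite (@UU_cut j N (fun s t => (cut2 i s t && nc i j s t)%:R) (fun _ _ => 1)) // UU1; congr (_ * _).
have -> : UU j (fun s t => (cut2 i s t && nc i j s t)%:R) = UU j (fun s t => (cut2 i s t)%:R *
   (1 * (nc 0 (j - i) (rightk i s) (rightk i t))%:R)).
  apply: eq_UU => s t; rewrite mul1r -natrM mulnb; congr (nat_of_bool _)%:R.
  by apply: andb_id2l => c; rewrite nc_right.
by rewrite (@UU_cut i j (fun _ _ => 1) (fun s t => (nc 0 (j - i) s t)%:R)) // UU1.
Qed.

Lemma UU_Aev_le i j N : (i < j)%N -> (j <= N)%N ->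
  UU N (fun s t => (Aev i j s t)%:R) <= ppi (j - i) * CN N ^+ 2.
Proof.
move=> ij jN; have ij' := ltnW ij; rewrite UU_Aev // /ppi.
have c0 n : 0 <= CN n by apply: CN_ge0.
have h1 := @CN_super R p g p0 _ _ jN; have h2 := @CN_super R p g p0 _ _ ij'.
have h : CN i * CN (j - i) * CN (N - j) <= CN N by apply: le_trans h1; apply: ler_wpM2r.
have h3 : (CN i * CN (j - i) * CN (N - j)) ^+ 2 <= CN N ^+ 2.
  by rewrite lerXn2r ?nnegrE ?mulr_ge0.
have nz : CN (j - i) != 0 by rewrite gt_eqF ?CN_gt0.
have := ler_wpM2l (ppi_ge0 (j - i)) h3; rewrite /ppi; apply: le_trans.
by rewrite le_eqVlt; apply/orP; left; apply/eqP; field.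
Qed.

Lemma UU_Aev_ge K i j N : 0 <= K -> (forall N k, (k <= N)%N -> CN N <= K * (CN k * CN (N - k))) ->
  (i < j)%N -> (j <= N)%N ->
  ppi (j - i) * CN N ^+ 2 <= K ^+ 4 * UU N (fun s t => (Aev i j s t)%:R).
Proof.
move=> K0 HK ij jN; have ij' := ltnW ij; rewrite UU_Aev // /ppi.
have c0 n : 0 <= CN n by apply: CN_ge0.
have h1 := HK _ _ jN; have h2 := HK _ _ ij'.
have h : CN N <= K ^+ 2 * (CN i * CN (j - i) * CN (N - j)).
  apply: (le_trans h1); rewrite expr2 -mulrA ler_wpM2l // mulrA; exact: ler_wpM2r.
have h3 : CN N ^+ 2 <= (K ^+ 2 * (CN i * CN (j - i) * CN (N - j))) ^+ 2.
  by rewrite lerXn2r ?nnegrE ?mulr_ge0 ?exprn_ge0.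
have nz : CN (j - i) != 0 by rewrite gt_eqF ?CN_gt0.
have := ler_wpM2l (ppi_ge0 (j - i)) h3; rewrite /ppi => /le_trans; apply.
by rewrite le_eqVlt; apply/orP; left; apply/eqP; field.
Qed.

Lemma sum_excl (T : eqType) (r : seq T) (P : pred T) : uniq r ->
  (forall x y, P x -> P y -> x = y) -> \sum_(x <- r) (P x)%:R <= 1 :> R.
Proof.
move=> ur Pxy; have [/hasP[x xr Px]|/hasPn np] := boolP (has P r); last first.
  by rewrite big1_seq // => x /andP[_ /np /negbTE ->].
rewrite (bigD1_seq x) //= Px big1 ?addr0 // => y yx; case: (boolP (P y)) => // Py.
by rewrite (Pxy _ _ Py Px) eqxx in yx.
Qed.

Lemma UU_sum N (I : Type) (r : seq I) (F : I -> seq int -> seq int -> R) :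
  UU N (fun s t => \sum_(i <- r) F i s t) = \sum_(i <- r) UU N (F i).
Proof.
rewrite /UU -mulr_suml; congr (_ / _); rewrite [RHS]exchange_big; apply: eq_bigr => s _.
by rewrite [RHS]exchange_big; apply: eq_bigr => t _; rewrite mulr_sumr.
Qed.

Lemma Aev_excl k i j i' j' s t : (i < k < j)%N -> (i' < k < j')%N ->
  Aev i j s t -> Aev i' j' s t -> i = i' /\ j = j'.
Proof.
move=> ik ik' /and3P[ci cj /allP n] /and3P[ci' cj' /allP n'].
have z a b c : (a < c < b)%N -> c \in iota a.+1 (b - a.+1) by rewrite mem_iota; nlia.
split; apply/eqP; rewrite eqn_leq; apply/andP; split; rewrite leqNgt; apply/negP => h.
- by have /n' := z i' j' i (ltac:(clear -h ik ik'; nlia)); rewrite ci.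
- by have /n := z i j i' (ltac:(clear -h ik ik'; nlia)); rewrite ci'.
- by have /n := z i j j' (ltac:(clear -h ik ik'; nlia)); rewrite cj'.
- by have /n' := z i' j' j (ltac:(clear -h ik ik'; nlia)); rewrite cj.
Qed.

(** Sums over the gaps that straddle a fixed site. A gap of length l appears for l - 1 pairs (a, b),
    so boundedness means a finite mean gap. *)
Definition Wp (n : nat) : R := \sum_(a <- iota 0 n) \sum_(b <- iota 0 n) ppi (a + b).+2.

(** Among 2n particles, the events that the common cuts next to site n are n - a - 1 and n + b + 1
    exclude each other, so their probabilities sum to at most 1; each is at least [ppi] divided by
    K^4. *)
Lemma Wp_bound : exists B : R, forall n, Wp n <= B.
Proof.
have [K [K1 HK]] := CN_sub p0 g0; have K0 : 0 <= K by lra.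
exists (K ^+ 4) => n; pose N := (2 * n)%N.
have CN2 : 0 < CN N ^+ 2 by rewrite exprn_gt0 // CN_gt0.
rewrite -(ler_pM2r CN2).
apply: (@le_trans _ _ (K ^+ 4 * UU N (fun s t => \sum_(z <- [seq (a, b) | a <- iota 0 n, b <- iota 0 n])
   (Aev (n - z.1.+1) (n + z.2.+1) s t)%:R))).
  rewrite UU_sum mulr_sumr big_allpairs_dep /Wp mulr_suml big_seq [leRHS]big_seq; apply: ler_sum => a.
  rewrite mem_iota => an; rewrite mulr_suml big_seq [leRHS]big_seq; apply: ler_sum => b; rewrite mem_iota => bn /=.
  have := @UU_Aev_ge K (n - a.+1) (n + b.+1) N K0 HK.
  have -> : (n + b.+1 - (n - a.+1) = (a + b).+2)%N by clear -an bn; nlia.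
  by apply; rewrite /N; clear -an bn; nlia.
rewrite ler_wpM2l ?exprn_ge0 // -UU1; apply: le_UU => s t _ _ _ _.
have ur : uniq [seq (a, b) | a <- iota 0 n, b <- iota 0 n].
  by apply: allpairs_uniq; rewrite ?iota_uniq // => -[a b] [c d] _ _ [-> ->].
rewrite big_seq big_mkcond /=.
apply: le_trans (sum_excl (P := fun z => (z \in [seq (a, b) | a <- iota 0 n, b <- iota 0 n]) &&
   Aev (n - z.1.+1) (n + z.2.+1) s t) ur _).
  by apply: ler_sum => z _; case: (z \in _).
move=> [a b] [c d] /andP[/allpairsP[[a1 b1] /= [h1 h2 [-> ->]]] A1] /andP[/allpairsP[[c1 d1] /= [h3 h4 [-> ->]]] A2].
move: h1 h2 h3 h4; rewrite !mem_iota => h1 h2 h3 h4.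
have [e1 e2] := @Aev_excl n (n - a1.+1) (n + b1.+1) (n - c1.+1) (n + d1.+1) s t (ltac:(clear -h1; nlia)) (ltac:(clear -h3; nlia)) A1 A2.
by congr (_, _); clear -e1 e2 h1 h2 h3 h4; nlia.
Qed.

(** A bounded monotone sequence is close to its supremum from some L on. Nothing is known about the
    size of L: here the rate of decay is lost. *)
Lemma Wp_tail (e : R) : 0 < e -> exists L, forall n,
  \sum_(a <- iota 0 n) \sum_(b <- iota L n) ppi (a + b).+2 <= e.
Proof.
move=> e0; have [B HB] := Wp_bound.
have hs : has_sup (range Wp) by split; [exists (Wp 0), 0%N|exists B => _ [n _ <-]].
have [_ [L _ <-] hL] := sup_adherent e0 hs.
exists L => n.
have ub : Wp (L + n) <= reals.sup (range Wp) by apply: (sup_upper_bound hs); exists (L + n)%N.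
suff : Wp L + \sum_(a <- iota 0 n) \sum_(b <- iota L n) ppi (a + b).+2 <= Wp (L + n) by lra.
have pp (r r' : seq nat) : 0 <= \sum_(a <- r) \sum_(b <- r') ppi (a + b).+2.
  by apply: sumr_ge0 => a _; apply: sumr_ge0 => b _; apply: ppi_ge0.
rewrite {2}/Wp.
have e1 a : \sum_(b <- iota 0 (L + n)) ppi (a + b).+2 =
   \sum_(b <- iota 0 L) ppi (a + b).+2 + \sum_(b <- iota L n) ppi (a + b).+2.
  by rewrite iotaD big_cat.
rewrite (eq_bigr _ (fun a _ => e1 a)) big_split /=; apply: lerD.
  by rewrite iotaD big_cat /= /Wp; apply: ler_wpDr.
by rewrite addnC iotaD big_cat /=; apply: ler_wpDr.
Qed.

Definition nocut (k L : nat) (s t : seq int) : bool :=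
  all (fun k => ~~ cut2 k s t) (iota k L.+1).

(** As 0 and N are common cuts, there is a last one before the window and a first one after it, and
    these are consecutive. *)
Lemma nocut_Aev k L N s t : (k + L <= N)%N -> cut2 0 s t -> cut2 N s t -> nocut k L s t ->
  exists a b, [/\ (a < k)%N, (b < N - (k + L))%N & Aev (k - a.+1) (k + L + b.+1) s t].
Proof.
move=> kN c0 cN /allP n.
have nn x : (k <= x <= k + L)%N -> ~~ cut2 x s t.
  by move=> h; apply: n; rewrite mem_iota; nlia.
have [i [ik ci bi]] : exists i, [/\ (i < k)%N, cut2 i s t &
    forall x, (i < x < k)%N -> ~~ cut2 x s t].
  have k0 : (0 < k)%N.
    by rewrite lt0n; apply/eqP => k0; have := nn 0%N; rewrite c0 k0 /=; move/(_ isT).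
  elim: k k0 {n kN nn} => // k IH _; case: (boolP (cut2 k s t)) => ck.
    by exists k; split=> // x; clear; nlia.
  case: (posnP k) => [k0|k0]; first by rewrite k0 c0 in ck.
  have [i [ik ci bi]] := IH k0; exists i; split=> //; first exact: leqW.
  move=> x /andP[ix]; rewrite ltnS leq_eqVlt => /orP[/eqP -> //|xk].
  by apply: bi; rewrite ix.
have [j [kj jN cj bj]] : exists j, [/\ (k + L < j)%N, (j <= N)%N, cut2 j s t &
    forall x, (k + L < x < j)%N -> ~~ cut2 x s t].
  have kN' : (k + L < N)%N.
    rewrite ltn_neqAle kN andbT; apply/eqP => e; have := nn N; rewrite cN -e leqnn leq_addr.
    by move/(_ isT).
  move: (k + L)%N kN' => m; have [d dE] : exists d, (N - m)%N = d by exists (N - m)%N.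
  elim: d m dE => [|d IH] m dE mN; first by clear -dE mN; nlia.
  case: (boolP (cut2 m.+1 s t)) => ck; first by exists m.+1; split=> // x; clear; nlia.
  have mN' : (m.+1 < N)%N.
    by rewrite ltn_neqAle mN andbT; apply/eqP => e; rewrite e cN in ck.
  have [j [mj jN cj bj]] := IH m.+1 (ltac:(clear -dE; nlia)) mN'.
  exists j; split=> //; first exact: ltnW.
  move=> x /andP[mx xj]; move: mx; rewrite leq_eqVlt => /orP[/eqP <- //|mx].
  by apply: bj; rewrite mx.
exists (k - i.+1)%N, (j - (k + L).+1)%N.
have e1 : (k - (k - i.+1).+1 = i)%N by clear -ik; nlia.
have e2 : (k + L + (j - (k + L).+1).+1 = j)%N by clear -kj; nlia.
split; [clear -ik; nlia|clear -kj jN; nlia|].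
rewrite e1 e2 /Aev ci cj /=; apply/allP => x; rewrite mem_iota => xj.
have [xk|kx] := ltnP x k; first by apply: bi; clear -xk xj; nlia.
have [xk|kx'] := leqP x (k + L); first by apply: nn; rewrite kx.
by apply: bj; clear -kx' xj kj; nlia.
Qed.

(** Without a common cut in the window, a gap of length at least L + 2 straddles it; the
    probabilities of these gaps form a tail of [Wp], uniformly in [N] and [k]. *)
Lemma renewal (e : R) : 0 < e -> exists L, forall N k, (k + L <= N)%N ->
  UU N (fun s t => (nocut k L s t)%:R) <= e * CN N ^+ 2.
Proof.
move=> e0; have [L HL] := Wp_tail e0; exists L => N k kN.
apply: (@le_trans _ _ (UU N (fun s t => \sum_(a <- iota 0 k) \sum_(b <- iota 0 (N - (k + L)))
   (Aev (k - a.+1) (k + L + b.+1) s t)%:R))).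
  apply: le_UU => s t ss st s0 t0; case: (boolP (nocut _ _ _ _)) => // nk; last first.
    by apply: sumr_ge0 => a _; apply: sumr_ge0 => b _.
  have c0 : cut2 0 s t by rewrite /cut2 !(@cut_0 R p g).
  have cN : cut2 N s t by rewrite /cut2 -{1}ss -st !(@cut_size R p g).
  have [a [b [ak bN A]]] := nocut_Aev kN c0 cN nk.
  apply: le_trans (@ler_sum_mem R nat (iota 0 k) a (fun a => \sum_(b <- iota 0 (N - (k + L)))
    (Aev (k - a.+1) (k + L + b.+1) s t)%:R) _ _).
  - have := @ler_sum_mem R nat (iota 0 (N - (k + L))) b (fun b => (Aev (k - a.+1) (k + L + b.+1) s t)%:R).
    by rewrite A; apply=> //; rewrite mem_iota.
  - by move=> x; apply: sumr_ge0.
  - by rewrite mem_iota.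
rewrite UU_sum.
apply: (@le_trans _ _ (\sum_(a <- iota 0 k) \sum_(b <- iota 0 (N - (k + L))) ppi (a + (L + b)).+2 * CN N ^+ 2)).
  rewrite big_seq [leRHS]big_seq; apply: ler_sum => a; rewrite mem_iota => ak.
  rewrite UU_sum big_seq [leRHS]big_seq; apply: ler_sum => b; rewrite mem_iota => bN.
  have := @UU_Aev_le (k - a.+1) (k + L + b.+1) N.
  have -> : (k + L + b.+1 - (k - a.+1) = (a + (L + b)).+2)%N by clear -ak; nlia.
  by apply; clear -ak bN kN; nlia.
under eq_bigr do rewrite -mulr_suml.
rewrite -mulr_suml; apply: ler_wpM2r; first by rewrite exprn_ge0 ?CN_ge0.
apply: le_trans (HL (k + N)%N); rewrite iotaD big_cat /=; apply: ler_wpDr.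
  by apply: sumr_ge0 => a _; apply: sumr_ge0 => b _; apply: ppi_ge0.
apply: ler_sum => a _.
have -> : iota L (k + N) = [seq (L + b)%N | b <- iota 0 (k + N)] by rewrite -iotaDl addn0.
rewrite big_map; have -> : (k + N = (N - (k + L)) + (k + (k + L)))%N by clear -kN; nlia.
by rewrite iotaD big_cat /=; apply: ler_wpDr => //; apply: sumr_ge0 => b _; apply: ppi_ge0.
Qed.

End Renewal.

(** * Correlations on the lattice *)

Section Lattice.
Variables (R : realType) (p : nat) (g : R).
Hypothesis p0 : (0 < p)%N.
Hypothesis g0 : 0 < g.

Local Notation CN := (CN p g).
Local Notation orb := (orb p).
Local Notation wt := (wt p g).
Local Notation bw := (bw p g).
Local Notation cut := (cut p).
Local Notation cut2 := (cut2 p).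
Local Notation nocut := (nocut p).
Local Notation leftk := (leftk p).
Local Notation rightk := (rightk p).
Local Notation ltk := (ltk p).
Local Notation tri := (tri p).
Local Notation EE := (EE p g).
Local Notation UU := (UU p g).

Definition cprod (j : nat) (m s : seq int) : R := \prod_(l <- m) (count_mem l s)%:R ^+ j.

Lemma cprod_ge0 j m s : 0 <= cprod j m s.
Proof. by apply: prodr_ge0 => l _; rewrite exprn_ge0. Qed.

Lemma cprod_perm j m s t : perm_eq s t -> cprod j m s = cprod j m t.
Proof. by move=> /permP st; apply: eq_bigr => l _; rewrite st. Qed.

(** One mark at a time through [sum_count_mem]. Only an inequality holds, because a mark placed
    earlier adds to the occupation seen by later ones. *)
Lemma count_prod (r m : seq int) M (F : seq int -> R) : uniq r -> all (mem r) m ->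
  (forall s, 0 <= F s) -> (forall s t, perm_eq s t -> F s = F t) ->
  (\sum_(n <- seqs r M) F (m ++ n)) / M`!%:R <=
  (\sum_(s <- seqs r (M + size m)) F s * cprod 1 m s) / (M + size m)`!%:R.
Proof.
move=> ur; elim: m F => [|l m IH] F.
  rewrite addn0 => _ F0 _; apply: ler_wpM2r; first by rewrite invr_ge0.
  by apply: ler_sum => s _; rewrite /cprod big_nil mulr1.
move=> /= /andP[lr mr] F0 Fp.
apply: le_trans (IH (fun s => F (l :: s)) mr _ _) _ => // [s t st|].
  by apply: Fp; rewrite perm_cons.
have Gp s t : perm_eq s t -> F s * cprod 1 m s = F t * cprod 1 m t.
  by move=> st; rewrite (Fp _ _ st) (cprod_perm _ _ st).
have h := @sum_count_mem _ R r (M + size m) (fun s => F s * cprod 1 m s) l ur lr Gp.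
have -> : \sum_(s <- seqs r (M + (size m).+1)) F s * cprod 1 (l :: m) s =
   (M + size m).+1%:R * \sum_(n <- seqs r (M + size m)) F (l :: n) * cprod 1 m (l :: n).
  rewrite -h addnS; apply: eq_bigr => s _; rewrite /cprod big_cons expr1.
  by rewrite [_%:R * _]mulrC mulrA.
rewrite addnS factS natrM -mulf_div mulfV ?pnatr_eq0 // mul1r.
apply: ler_wpM2r; first by rewrite invr_ge0.
apply: ler_sum => s _; apply: ler_wpM2l => //.
rewrite /cprod; elim: (m) => [|x m' IHm]; first by rewrite !big_nil.
rewrite !big_cons; apply: ler_pM => //; first exact: cprod_ge0.
by rewrite !expr1 /= ler_nat leq_addl.
Qed.

Lemma ex_max (m : seq int) (f : int -> R) : m != [::] ->
  exists2 x, x \in m & forall y, y \in m -> f y <= f x.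
Proof.
elim: m => // a [|b m] IH _.
  by exists a; rewrite ?inE // => y; rewrite inE => /eqP ->.
have [//|x xm hx] := IH; have [ax|xa] := leP (f a) (f x).
  by exists x; rewrite 1?inE ?xm ?orbT // => y; rewrite inE => /orP[/eqP ->//|/hx].
exists a; rewrite ?inE ?eqxx // => y; rewrite inE => /orP[/eqP ->//|/hx h].
exact: le_trans h (ltW xa).
Qed.

Lemma prod_le_sum (m : seq int) (f : int -> R) : m != [::] -> (forall x, 0 <= f x) ->
  \prod_(l <- m) f l <= \sum_(l <- m) f l ^+ size m.
Proof.
move=> m0 f0; have [x xm hx] := ex_max f m0.
apply: (@le_trans _ _ (f x ^+ size m)).
  have : {subset m <= m} by []. move: {1 3 4}m => m'; elim: m' => [|a m' IH] sm; first by rewrite big_nil.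
  rewrite big_cons exprS; apply: ler_pM => //; rewrite ?prodr_ge0 //.
    by apply: hx; apply: sm; rewrite inE eqxx.
  by apply: IH => y ym; apply: sm; rewrite inE ym orbT.
by apply: (@ler_sum_mem R int m x (fun l => f l ^+ size m)) => // y; rewrite exprn_ge0.
Qed.

Lemma EE_sum N (m : seq int) (F : int -> seq int -> R) :
  EE N (fun s => \sum_(l <- m) F l s) = \sum_(l <- m) EE N (F l).
Proof.
rewrite /EE -mulr_suml; congr (_ / _); rewrite [RHS]exchange_big; apply: eq_bigr => s _.
by rewrite mulr_sumr.
Qed.

(** A product of [a] factors is at most the sum of their [a]-th powers, which leaves single-site
    moments. *)
Lemma prod_moment a j : (0 < j)%N -> exists B : R, 0 <= B /\ forall N m, size m = a ->
  EE N (cprod j m) <= B * CN N.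
Proof.
move=> j0; case: (posnP a) => [->|a0].
  exists 1; split=> // N m /eqP; rewrite size_eq0 => /eqP ->; rewrite mul1r -EE1.
  by apply: le_EE => s; rewrite /cprod big_nil.
have [A [A0 HA]] := moment_site p0 g0 (j * a).-1.
have ja : ((j * a).-1.+1 = j * a)%N by rewrite prednK // muln_gt0 j0.
rewrite ja in HA.
exists (a%:R * A); split; first by rewrite mulr_ge0.
move=> N m ma; have m0 : m != [::] by rewrite -size_eq0 ma -lt0n.
apply: (@le_trans _ _ (EE N (fun s => \sum_(l <- m) (count_mem l s)%:R ^+ (j * a)))).
  apply: le_EE => s; apply: le_trans (prod_le_sum m0 _) _.
    by move=> x; rewrite exprn_ge0.
  by apply: ler_sum => l _; rewrite ma exprM.
rewrite EE_sum (_ : a%:R * A * CN N = \sum_(l <- m) A * CN N); last by rewrite sum_const_seq ma; ring.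
by apply: ler_sum => l _; apply: HA.
Qed.

(** A reduced density matrix of the lattice gas: bra and ket share the unmarked particles and differ
    in the marks. *)
Definition RR N (m m' : seq int) : R :=
  (\sum_(n <- seqs (orb N) (N - size m)) bw (m ++ n) * bw (m' ++ n)) / (N - size m)`!%:R.
Definition QQ N m m' : R := RR N m m' / CN N.
Definition DD N (m : seq int) : R :=
  (\sum_(n <- seqs (orb N) (N - size m)) wt (m ++ n)) / (N - size m)`!%:R.

Lemma DD_le N m : (size m <= N)%N -> all (mem (orb N)) m -> DD N m <= EE N (cprod 1 m).
Proof.
move=> mN mo; rewrite /DD /EE; have := @count_prod (orb N) m (N - size m) wt (uniq_orb _ _) mo.
by rewrite subnK //; apply; [move=> s; apply: wt_ge0|move=> s t; apply: wt_perm].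
Qed.

Lemma DD_bound a : exists B : R, 0 <= B /\ forall N m, size m = a -> (a <= N)%N ->
  all (mem (orb N)) m -> DD N m <= B * CN N.
Proof.
have [B [B0 HB]] := prod_moment a (ltn0Sn 0); exists B; split=> // N m ma aN mo.
by apply: le_trans (DD_le _ mo) (HB _ _ ma); rewrite ma.
Qed.

Lemma DD_ge0 N m : 0 <= DD N m.
Proof. by rewrite divr_ge0 // sumr_ge0 // => n _; apply: wt_ge0. Qed.

Lemma RR_le N m m' : size m = size m' -> `|RR N m m'| <= (DD N m + DD N m') / 2.
Proof.
move=> mm; rewrite /RR /DD -mm normrM normfV (ger0_norm (ler0n _ _)) -mulrDl [leRHS]mulrAC.
apply: ler_wpM2r; first by rewrite invr_ge0.
rewrite -big_split mulr_suml; apply: le_trans (ler_norm_sum _ _ _) _; apply: ler_sum => n _.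
rewrite normrM /wt -[bw _ ^+ 2]real_normK ?num_real // -[bw (m' ++ n) ^+ 2]real_normK ?num_real //=.
have := sqr_ge0 (`|bw (m ++ n)| - `|bw (m' ++ n)|); lra.
Qed.

Lemma QQ_bound a : exists B : R, 0 <= B /\ forall N m m', size m = a -> size m' = a -> (a <= N)%N ->
  all (mem (orb N)) m -> all (mem (orb N)) m' -> `|QQ N m m'| <= B.
Proof.
have [B [B0 HB]] := DD_bound a; exists B; split=> // N m m' ma ma' aN mo mo'.
rewrite normrM normfV (ger0_norm (CN_ge0 p g N)) ler_pdivrMr ?CN_gt0 //.
apply: le_trans (RR_le _ _) _; first by rewrite ma ma'.
have := HB _ _ ma aN mo; have := HB _ _ ma' aN mo'; lra.
Qed.

Lemma RR0 N : RR N [::] [::] = CN N.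
Proof.
by rewrite /RR subn0 CNE; congr (_ / _); apply: eq_bigr => n _; rewrite /= -expr2.
Qed.

Lemma QQ0 N : QQ N [::] [::] = 1.
Proof. by rewrite /QQ RR0 mulfV // gt_eqF ?CN_gt0. Qed.

Definition QD N m1 m1' m2 m2' (H : seq int -> seq int -> seq int -> seq int -> R) : R :=
  (\sum_(n1 <- seqs (orb N) (N - size m1)) \sum_(n2 <- seqs (orb N) (N - size m2))
    bw (m1 ++ n1) * bw (m1' ++ n1) * (bw (m2 ++ n2) * bw (m2' ++ n2)) *
    H (m1 ++ n1) (m1' ++ n1) (m2 ++ n2) (m2' ++ n2)) /
  ((N - size m1)`!%:R * (N - size m2)`!%:R).

(** The event is tested on the unprimed lists only; after Cauchy-Schwarz the primed amplitudes are
    bounded by [DD_bound]. *)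
Definition QA N m1 m1' m2 m2' (e : seq int -> seq int -> bool) : R :=
  (\sum_(n1 <- seqs (orb N) (N - size m1)) \sum_(n2 <- seqs (orb N) (N - size m2))
    `|bw (m1 ++ n1) * bw (m1' ++ n1) * (bw (m2 ++ n2) * bw (m2' ++ n2))| *
    (e (m1 ++ n1) (m2 ++ n2))%:R) /
  ((N - size m1)`!%:R * (N - size m2)`!%:R).

Lemma RR_prod N m1 m1' m2 m2' : RR N m1 m1' * RR N m2 m2' = QD N m1 m1' m2 m2' (fun _ _ _ _ => 1).
Proof.
rewrite /RR /QD mulrACA -invfM; congr (_ / _); rewrite mulr_suml; apply: eq_bigr => n1 _.
by rewrite mulr_sumr; apply: eq_bigr => n2 _; rewrite mulr1.
Qed.

Definition pinv2 (e : seq int -> seq int -> bool) : Prop :=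
  forall s s' t t', perm_eq s s' -> perm_eq t t' -> e s t = e s' t'.

Lemma pair_count N m1 m2 e : pinv2 e -> (size m1 <= N)%N -> (size m2 <= N)%N ->
  all (mem (orb N)) m1 -> all (mem (orb N)) m2 ->
  (\sum_(n1 <- seqs (orb N) (N - size m1)) \sum_(n2 <- seqs (orb N) (N - size m2))
     wt (m1 ++ n1) * wt (m2 ++ n2) * (e (m1 ++ n1) (m2 ++ n2))%:R) /
   ((N - size m1)`!%:R * (N - size m2)`!%:R) <=
  UU N (fun s t => (e s t)%:R * (cprod 1 m1 s * cprod 1 m2 t)).
Proof.
move=> ep m1N m2N o1 o2.
pose F s := wt s * ((\sum_(n2 <- seqs (orb N) (N - size m2)) wt (m2 ++ n2) * (e s (m2 ++ n2))%:R) / (N - size m2)`!%:R).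
have F0 s : 0 <= F s.
  rewrite /F mulr_ge0 ?wt_ge0 // divr_ge0 // sumr_ge0 // => n _.
  by rewrite mulr_ge0 ?wt_ge0.
have Fp s t : perm_eq s t -> F s = F t.
  move=> st; rewrite /F (wt_perm p g st); congr (_ * (_ / _)); apply: eq_bigr => n _.
  by rewrite (ep _ _ _ _ st (perm_refl _)).
have := @count_prod (orb N) m1 (N - size m1) F (uniq_orb _ _) o1 F0 Fp.
rewrite subnK // => h1.
apply: le_trans (le_trans _ h1) _.
  rewrite le_eqVlt; apply/orP; left; apply/eqP.
  rewrite invfM [X in _ * X = _]mulrC mulrA; congr (_ / _); rewrite mulr_suml; apply: eq_bigr => n1 _.
  rewrite /F mulrA; congr (_ / _); rewrite mulr_sumr; apply: eq_bigr => n2 _; ring.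
rewrite /UU [_ ^+ 2]expr2 invfM [leRHS]mulrA; apply: ler_wpM2r; first by rewrite invr_ge0.
rewrite mulr_suml; apply: ler_sum => s _.
have e0 t : 0 <= wt t * (e s t)%:R by rewrite mulr_ge0 ?wt_ge0.
have ep' t t' : perm_eq t t' -> wt t * (e s t)%:R = wt t' * (e s t')%:R.
  by move=> tt; rewrite (wt_perm p g tt) (ep _ _ _ _ (perm_refl s) tt).
have := @count_prod (orb N) m2 (N - size m2) _ (uniq_orb _ _) o2 e0 ep'.
rewrite subnK // => h2.
rewrite /F mulrAC.
have w0 : 0 <= wt s * cprod 1 m1 s by rewrite mulr_ge0 ?wt_ge0 ?cprod_ge0.
apply: le_trans (ler_wpM2l w0 h2) _.
rewrite mulrA; apply: ler_wpM2r; first by rewrite invr_ge0.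
rewrite mulr_sumr; apply: ler_sum => t _; rewrite le_eqVlt; apply/orP; left; apply/eqP; ring.
Qed.

Lemma amgm (t x y : R) : 0 < t -> `|x * y| <= (t * y ^+ 2 + t^-1 * x ^+ 2) / 2.
Proof.
move=> t0; rewrite normrM -[y ^+ 2]real_normK ?num_real // -[x ^+ 2]real_normK ?num_real //.
have h := sqr_ge0 (t * `|y| - `|x|); rewrite ler_pdivlMr // -(@ler_pM2l _ t) //.
rewrite (_ : t * (t * `|y| ^+ 2 + _) = t ^+ 2 * `|y| ^+ 2 + `|x| ^+ 2); last first.
  by field; rewrite gt_eqF.
lra.
Qed.

(** Cauchy-Schwarz twice, in the form [amgm]: first to separate primed from unprimed amplitudes,
    keeping the event with the latter; then to separate the event from the occupation numbers, whose
    second moments are bounded. *)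
Lemma bad_bound a1 a2 (eps : R) : 0 < eps -> exists2 d : R, 0 < d &
  forall N m1 m1' m2 m2' e, pinv2 e -> size m1 = a1 -> size m1' = a1 -> size m2 = a2 -> size m2' = a2 ->
   (a1 <= N)%N -> (a2 <= N)%N -> all (mem (orb N)) m1 -> all (mem (orb N)) m1' ->
   all (mem (orb N)) m2 -> all (mem (orb N)) m2' ->
   UU N (fun s t => (e s t)%:R) <= d * CN N ^+ 2 ->
   QA N m1 m1' m2 m2' e <= eps * CN N ^+ 2.
Proof.
move=> e0.
have [B1 [B10 H1]] := DD_bound a1; have [B2 [B20 H2]] := DD_bound a2.
have [D1 [D10 G1]] := prod_moment a1 (ltn0Sn 1); have [D2 [D20 G2]] := prod_moment a2 (ltn0Sn 1).
(* In each use of [amgm] the bounded moments may consume half of the budget, which fixes [t] and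
   [u]; the choice d = u t eps fits the event into the other half. *)
pose t := eps / (B1 * B2 + 1); pose u := t * eps / (D1 * D2 + 1).
have bp : 0 < B1 * B2 + 1 by have := mulr_ge0 B10 B20; lra.
have dp : 0 < D1 * D2 + 1 by have := mulr_ge0 D10 D20; lra.
have t0 : 0 < t by rewrite divr_gt0.
have u0 : 0 < u by rewrite divr_gt0 // mulr_gt0.
have c1 : t * (B1 * B2) <= eps.
  by rewrite /t mulrAC ler_pdivrMr // mulrDr mulr1 lerDl ltW.
have c2 : u * (D1 * D2) <= t * eps.
  by rewrite /u mulrAC ler_pdivrMr // mulrDr mulr1 lerDl mulr_ge0 // ltW.
clearbody u; clearbody t.
exists (u * t * eps); first by rewrite mulr_gt0 // mulr_gt0.
move=> N m1 m1' m2 m2' e ep s1 s1' s2 s2' a1N a2N o1 o1' o2 o2' he.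
have C2 : 0 <= CN N ^+ 2 by rewrite exprn_ge0 ?CN_ge0.
pose W := (\sum_(n1 <- seqs (orb N) (N - size m1)) \sum_(n2 <- seqs (orb N) (N - size m2))
     wt (m1 ++ n1) * wt (m2 ++ n2) * (e (m1 ++ n1) (m2 ++ n2))%:R) /
   ((N - size m1)`!%:R * (N - size m2)`!%:R).
have hW : W <= UU N (fun s t => (e s t)%:R * (cprod 1 m1 s * cprod 1 m2 t)).
  by apply: pair_count; rewrite ?s1 ?s2.
have hU : UU N (fun s t => (e s t)%:R * (cprod 1 m1 s * cprod 1 m2 t)) <=
    (u * (D1 * D2) / 2 + t * eps / 2) * CN N ^+ 2.
  apply: (@le_trans _ _ (u / 2 * UU N (fun s t => cprod 2 m1 s * cprod 2 m2 t) + (2 * u)^-1 * UU N (fun s t => (e s t)%:R))).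
    rewrite /UU mulrA [_^-1 * _]mulrA -mulrDl; apply: ler_wpM2r; first by rewrite invr_ge0 exprn_ge0.
    rewrite !mulr_sumr -big_split; apply: ler_sum => s _.
    rewrite !mulr_sumr -big_split; apply: ler_sum => r _ /=.
    have sq m x : cprod 2 m x = cprod 1 m x ^+ 2.
      by rewrite /cprod -prodrXl; apply: eq_bigr => l _; rewrite expr1.
    have w0 : 0 <= wt s * wt r by rewrite mulr_ge0 ?wt_ge0.
    rewrite [X in _ <= X + _]mulrCA [X in _ <= _ + X]mulrCA -mulrDr; apply: ler_wpM2l => //.
    rewrite !sq -exprMn; set X := cprod 1 m1 s * cprod 1 m2 r.
    have := amgm (e s r)%:R X u0; rewrite -natrX; set b : nat := e s r.
    have -> : (b ^ 2)%N = b by rewrite /b; case: (e s r).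
    have := ler_norm (b%:R * X); rewrite invfM; lra.
  rewrite [leRHS]mulrDl; apply: lerD.
    rewrite UU_prod; have := ler_pM (divr_ge0 _ _) (divr_ge0 _ _) (G1 N m1 s1) (G2 N m2 s2).
    have nn m : 0 <= \sum_(s <- seqs (orb N) N) wt s * cprod 2 m s.
      by rewrite sumr_ge0 // => s _; rewrite mulr_ge0 ?wt_ge0 ?cprod_ge0.
    move=> /(_ (nn _) (ler0n _ _) (nn _) (ler0n _ _)) h.
    apply: le_trans (ler_wpM2l _ h) _; first by rewrite divr_ge0 // ltW.
    by rewrite le_eqVlt; apply/orP; left; apply/eqP; ring.
  apply: le_trans (ler_wpM2l _ he) _; first by rewrite invr_ge0 mulr_ge0 // ltW.
  by rewrite le_eqVlt; apply/orP; left; apply/eqP; field; rewrite gt_eqF.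
have hQ : QA N m1 m1' m2 m2' e <= t / 2 * (DD N m1' * DD N m2') + (2 * t)^-1 * W.
  rewrite /QA /DD /W s1' s2' -s1 -s2 [(_ / _) * (_ / _)]mulrACA -invfM !mulrA -mulrDl.
  apply: ler_wpM2r; first by rewrite invr_ge0 mulr_ge0.
  rewrite -mulrA mulr_suml !mulr_sumr -big_split; apply: ler_sum => n1 _.
  rewrite !mulr_sumr -big_split; apply: ler_sum => n2 _ /=.
  rewrite mulrACA; set x := bw (m1 ++ n1) * _; set y := bw (m1' ++ n1) * _.
  have := amgm x y t0; rewrite /wt -!exprMn -/x -/y invfM => h.
  have p1 : 0 <= t * y ^+ 2 by rewrite mulr_ge0 ?sqr_ge0 // ltW.
  by case: (e _ _); rewrite ?mulr1 ?mulr0; lra.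
apply: (le_trans hQ).
have h1 := H1 N m1' s1' a1N o1'; have h2 := H2 N m2' s2' a2N o2'.
have h12 := ler_pM (DD_ge0 N m1') (DD_ge0 N m2') h1 h2.
have k1 := ler_wpM2l (ltW (divr_gt0 t0 (@ltr0n R 2))) h12.
have ti : 0 <= (2 * t)^-1 by rewrite invr_ge0 mulr_ge0 // ltW.
have k2 := ler_wpM2l ti (le_trans hW hU).
apply: le_trans (lerD k1 k2) _.
have c3 : (2 * t)^-1 * (u * (D1 * D2) / 2 + t * eps / 2) <= eps / 2.
  rewrite mulrC ler_pdivrMr ?mulr_gt0 //; lra.
have := ler_wpM2r C2 c3; have := ler_wpM2r C2 c1.
rewrite mulrA; lra.
Qed.

End Lattice.

(** * Exchange of tails and clustering on the lattice *)

Section Cluster.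
Variables (R : realType) (p : nat) (g : R).
Hypothesis p0 : (0 < p)%N.
Hypothesis g0 : 0 < g.

Local Notation CN := (CN p g).
Local Notation orb := (orb p).
Local Notation bw := (bw p g).
Local Notation cut := (cut p).
Local Notation cut2 := (cut2 p).
Local Notation nocut := (nocut p).
Local Notation leftk := (leftk p).
Local Notation rightk := (rightk p).
Local Notation ltk := (ltk p).
Local Notation tri := (tri p).
Local Notation UU := (UU p g).
Local Notation RR := (RR p g).
Local Notation QQ := (QQ p g).
Local Notation QD := (QD p g).
Local Notation QA := (QA p g).

Lemma left_dominance t s : bw s != 0 -> (tri (count (ltk t) s))%:Z <= isum (leftk t s).
Proof.
rewrite bw_neq0 => a0; have := @dominance R p s (map (ltk t) s) a0.
by rewrite size_map count_id_map -filter_mask; apply.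
Qed.

Section OneCopy.
Variables (k0 L : nat) (a c a' c' n : seq int).
Hypotheses (ha : all (ltk k0) a) (ha' : all (ltk k0) a')
  (hc : all (predC (ltk (k0 + L))) c) (hc' : all (predC (ltk (k0 + L))) c').

Lemma win_left t (x y : seq int) : all (ltk k0) x -> all (predC (ltk (k0 + L))) y ->
  (k0 <= t <= k0 + L)%N -> all (ltk t) x /\ all (predC (ltk t)) y.
Proof.
move=> hx hy /andP[kt tk]; split; first by apply: sub_all hx => z; apply: ltk_leq.
by apply: sub_all hy => z /=; apply: contra => /(ltk_leq tk).
Qed.

Lemma win_isum t x y : all (ltk k0) x -> all (predC (ltk (k0 + L))) y ->
  (k0 <= t <= k0 + L)%N ->
  count (ltk t) (x ++ y ++ n) = (size x + count (ltk t) n)%N /\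
  isum (leftk t (x ++ y ++ n)) = isum x + isum (leftk t n).
Proof.
move=> hx hy ht; have [h1 h2] := win_left hx hy ht; split; first exact: count_lt.
by rewrite !leftk_cat (leftk_lt h1) (leftk_ge h2) /isum big_cat.
Qed.

Let K := a ++ c ++ n.
Let K' := a' ++ c' ++ n.
Hypotheses (b0 : bw K != 0) (b0' : bw K' != 0).

(* If [K] has a cut at [k] and [K'] at [k'], convexity of [tri] orders the two cuts
   according to the sign of [size a - size a']. *)
Lemma cut_order k k' : (k0 <= k <= k0 + L)%N -> (k0 <= k' <= k0 + L)%N -> cut k K -> cut k' K' ->
  exists x y, [/\ k = (size a + x)%N, k' = (size a' + y)%N,
    (size a * y + size a' * x <= size a * x + size a' * y)%N,
    (tri (size a' + x))%:Z + isum a <= (tri k)%:Z + isum a' &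
    (tri (size a + y))%:Z + isum a' <= (tri k')%:Z + isum a].
Proof.
move=> hk hk' /andP[/eqP c1 /eqP c2] /andP[/eqP c1' /eqP c2'].
have [e1 e2] := win_isum ha hc hk; have [e1' e2'] := win_isum ha' hc' hk'.
have [f1 f2] := win_isum ha' hc' hk; have [f1' f2'] := win_isum ha hc hk'.
have d1 := left_dominance k b0'; have d2 := left_dominance k' b0.
rewrite -/K in e1 e2 f1' f2'; rewrite -/K' in e1' e2' f1 f2.
exists (count (ltk k) n), (count (ltk k') n).
move: e1 e2 e1' e2' f1 f2 f1' f2' d1 d2; rewrite c1 c2 c1' c2'.
set x := count _ n; set y := count _ n; set Sx := isum _; set Sy := isum (leftk k' n).
move=> -> e2 -> e2' -> -> -> -> d1 d2.
have h1 : (tri (size a' + x))%:Z + isum a <= (tri (size a + x))%:Z + isum a'.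
  by clear -e2 d1; lia.
have h2 : (tri (size a + y))%:Z + isum a' <= (tri (size a' + y))%:Z + isum a.
  by clear -e2' d2; lia.
split=> //; rewrite -(leq_pmul2l p0) !mulnDr.
by move: h1 h2; rewrite !triD; clear; lia.
Qed.

(** If [a] were longer than [a'], [cut_order] would place the cut [j'] of K' left of the cut [k] of
    K; if shorter, [j] left of [k']. With equal lengths the momenta of [a] and [a'] agree as well,
    and then so do all cuts in the window. *)
Lemma same_cuts k j k' j' : (k0 <= k)%N -> (k < j')%N -> (j' <= k0 + L)%N ->
  (k0 <= k')%N -> (k' < j)%N -> (j <= k0 + L)%N ->
  cut k K -> cut j K -> cut k' K' -> cut j' K' ->
  size a = size a' /\ forall t, (k0 <= t <= k0 + L)%N -> cut t K = cut t K'.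
Proof.
move=> h1 h2 h3 h4 h5 h6 ck cj ck' cj'.
have hk : (k0 <= k <= k0 + L)%N by clear -h1 h2 h3; lia.
have hj : (k0 <= j <= k0 + L)%N by clear -h4 h5 h6; lia.
have hk' : (k0 <= k' <= k0 + L)%N by clear -h4 h5 h6; lia.
have hj' : (k0 <= j' <= k0 + L)%N by clear -h1 h2 h3; lia.
have [x [y [e1 e2 q s1 s2]]] := cut_order hk hj' ck cj'.
have [x' [y' [e1' e2' q' s1' s2']]] := cut_order hj hk' cj ck'.
have sz : size a = size a'.
  apply/eqP; rewrite eqn_leq; apply/andP; split; rewrite leqNgt; apply/negP => lt.
    have yx : (y <= x)%N.
      have : (0 < size a - size a')%N by rewrite subn_gt0.
      by move=> dp; rewrite -(leq_pmul2l dp) !mulnBl; clear -q lt; lia.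
    by clear -yx lt e1 e2 h2; lia.
  have xy : (x' <= y')%N.
    have : (0 < size a' - size a)%N by rewrite subn_gt0.
    by move=> dp; rewrite -(leq_pmul2l dp) !mulnBl; clear -q' lt; lia.
  by clear -xy lt e1' e2' h5; lia.
split=> // t ht.
have S : isum a = isum a'.
  by move: s1 s2; rewrite e1 e2 sz; clear; lia.
have [f1 f2] := win_isum ha hc ht; have [f1' f2'] := win_isum ha' hc' ht.
by rewrite /cut f1 f2 f1' f2' sz S.
Qed.

End OneCopy.

Lemma sum_sep (I J : Type) (r : seq I) (r' : seq J) (x z : I -> R) (y : J -> R) :
  \sum_(s <- r) \sum_(t <- r') x s * y t * z s = (\sum_(s <- r) x s * z s) * \sum_(t <- r') y t.
Proof.
rewrite mulr_suml; apply: eq_bigr => s _; rewrite mulr_sumr; apply: eq_bigr => t _.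
by rewrite mulrAC.
Qed.

Definition cut4 k (s s' t t' : seq int) : bool := (cut k s && cut k s') && (cut k t && cut k t').
Definition good4 k0 n s s' t t' : bool := has (fun k => cut4 k s s' t t') (iota k0 n).
Definition first4 k0 k s s' t t' : bool := all (fun j => ~~ cut4 j s s' t t') (iota k0 (k - k0)).

Lemma has_first (P : pred nat) k0 n : (has P (iota k0 n))%:R =
  \sum_(k <- iota k0 n) (P k && all (predC P) (iota k0 (k - k0)))%:R :> R.
Proof.
elim: n => [|n IH]; first by rewrite /= big_nil.
rewrite -addn1 iotaD has_cat big_cat /= big_seq1 orbF -IH addKn all_predC.
by case: (has _ _) => /=; rewrite ?andbF ?andbT ?addr0 ?add0r.
Qed.

(** On the left the two copies remain coupled by [first4]; on the right ([Rpart]) they are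
    independent, and this is what permits the exchange of tails. *)
Definition Lpart k0 k a1 a1' a2 a2' : R :=
  ((size a1 <= k) && (size a2 <= k))%N%:R *
  ((\sum_(s1 <- seqs (orb k) (k - size a1)) \sum_(s2 <- seqs (orb k) (k - size a2))
     bw (a1 ++ s1) * bw (a1' ++ s1) * (bw (a2 ++ s2) * bw (a2' ++ s2)) *
     (first4 k0 k (a1 ++ s1) (a1' ++ s1) (a2 ++ s2) (a2' ++ s2))%:R) /
   ((k - size a1)`!%:R * (k - size a2)`!%:R)).

Definition Rpart N k c c' : R :=
  (size c <= N - k)%N%:R *
  ((\sum_(t <- seqs (orb (N - k)) (N - k - size c))
     bw (shiftz (p * k)%N%:Z c ++ t) * bw (shiftz (p * k)%N%:Z c' ++ t)) / (N - k - size c)`!%:R).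

(** Whether [k] is the first common cut is decided by what lies left of [k], so the condition does
    not tie the right parts together. *)
Lemma quad_cut k0 k N a1 a1' c1 c1' a2 a2' c2 c2' : (k <= N)%N -> (k0 <= k)%N ->
  size a1 = size a1' -> size c1 = size c1' -> size a2 = size a2' -> size c2 = size c2' ->
  (size (a1 ++ c1) <= N)%N -> (size (a2 ++ c2) <= N)%N ->
  all (ltk k0) a1 -> all (ltk k0) a1' -> all (ltk k0) a2 -> all (ltk k0) a2' ->
  all (predC (ltk k)) c1 -> all (predC (ltk k)) c1' ->
  all (predC (ltk k)) c2 -> all (predC (ltk k)) c2' ->
  QD N (a1 ++ c1) (a1' ++ c1') (a2 ++ c2) (a2' ++ c2')
     (fun s s' t t' => (cut4 k s s' t t' && first4 k0 k s s' t t')%:R) =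
  Lpart k0 k a1 a1' a2 a2' * (Rpart N k c1 c1' * Rpart N k c2 c2').
Proof.
move=> kN kk sa1 sc1 sa2 sc2 N1 N2 l1 l1' l2 l2' r1 r1' r2 r2'.
have up x : all (ltk k0) x -> all (ltk k) x by apply: sub_all => z; apply: ltk_leq.
have {}l1 := up _ l1; have {}l1' := up _ l1'; have {}l2 := up _ l2; have {}l2' := up _ l2'.
have M1 : (size a1 + size c1 + (N - size (a1 ++ c1)) = N)%N by rewrite -size_cat subnKC.
have M2 : (size a2 + size c2 + (N - size (a2 ++ c2)) = N)%N by rewrite -size_cat subnKC.
have lk a c n : all (ltk k) a -> all (predC (ltk k)) c -> leftk k (a ++ c ++ n) = a ++ leftk k n.
  by move=> h h'; rewrite !leftk_cat (leftk_lt h) (leftk_ge h').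
pose F (s1 s2 : seq int) : R := (first4 k0 k (a1 ++ s1) (a1' ++ s1) (a2 ++ s2) (a2' ++ s2))%:R.
have FE n1 n2 : (first4 k0 k (a1 ++ c1 ++ n1) (a1' ++ c1' ++ n1) (a2 ++ c2 ++ n2) (a2' ++ c2' ++ n2))%:R =
   F (leftk k n1) (leftk k n2).
  congr (nat_of_bool _)%:R; apply: eq_in_all => j; rewrite mem_iota => jk.
  have jk' : (j <= k)%N by clear -jk kk; nlia.
  have ce a c n : all (ltk k) a -> all (predC (ltk k)) c -> cut j (a ++ c ++ n) = cut j (a ++ leftk k n).
    by move=> h h'; rewrite -(lk a c n) // cut_left.
  by rewrite /cut4 !ce.
rewrite /QD.
pose A1 s1 := bw (a1 ++ s1) * bw (a1' ++ s1); pose A2 s2 := bw (a2 ++ s2) * bw (a2' ++ s2).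
pose B1 t := bw (shiftz (p * k)%N%:Z c1 ++ t) * bw (shiftz (p * k)%N%:Z c1' ++ t).
pose B2 t := bw (shiftz (p * k)%N%:Z c2 ++ t) * bw (shiftz (p * k)%N%:Z c2' ++ t).
pose b2 := ((size a2 <= k) && (size c2 <= N - k))%N%:R : R.
pose f2 := (k - size a2)`!%:R : R; pose g2 := (N - k - size c2)`!%:R : R.
pose R2 (s1 : seq int) := b2 *
  ((\sum_(s <- seqs (orb k) (k - size a2)) \sum_(t <- seqs (orb (N - k)) (N - k - size c2))
     (A2 s * B2 t * F s1 s)) / (f2 * g2)).
have inner n1 : (\sum_(n2 <- seqs (orb N) (N - size (a2 ++ c2)))
    bw ((a1 ++ c1) ++ n1) * bw ((a1' ++ c1') ++ n1) * (bw ((a2 ++ c2) ++ n2) * bw ((a2' ++ c2') ++ n2)) *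
    (cut4 k ((a1 ++ c1) ++ n1) ((a1' ++ c1') ++ n1) ((a2 ++ c2) ++ n2) ((a2' ++ c2') ++ n2) &&
     first4 k0 k ((a1 ++ c1) ++ n1) ((a1' ++ c1') ++ n1) ((a2 ++ c2) ++ n2) ((a2' ++ c2') ++ n2))%:R) / (N - size (a2 ++ c2))`!%:R =
   (cut k (a1 ++ c1 ++ n1) && cut k (a1' ++ c1' ++ n1))%:R *
   (bw (a1 ++ c1 ++ n1) * bw (a1' ++ c1' ++ n1) * R2 (leftk k n1)).
  rewrite /R2 -(@cut_sum R p g p0 k N _ a2 c2 a2' c2' (fun x _ => F (leftk k n1) x) kN M2 sa2 sc2 l2 l2' r2 r2').
  rewrite [RHS]mulrA [RHS]mulrA; congr (_ / _); rewrite mulr_sumr; apply: eq_bigr => n2 _.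
  by rewrite -!catA -mulnb natrM FE /cut4 -mulnb natrM; ring.
transitivity ((\sum_(n1 <- seqs (orb N) (N - size (a1 ++ c1)))
   (cut k (a1 ++ c1 ++ n1) && cut k (a1' ++ c1' ++ n1))%:R *
   (bw (a1 ++ c1 ++ n1) * bw (a1' ++ c1' ++ n1) * R2 (leftk k n1))) / (N - size (a1 ++ c1))`!%:R).
  rewrite invfM mulrCA [_ * (_ * _)]mulrC; congr (_ / _); rewrite mulr_suml.
  by apply: eq_bigr => n1 _; rewrite inner.
rewrite (@cut_sum R p g p0 k N _ a1 c1 a1' c1' (fun x _ => R2 x) kN M1 sa1 sc1 l1 l1' r1 r1').
rewrite (sum_sep _ _ A1 R2 B1).
have -> : \sum_(s <- seqs (orb k) (k - size a1)) A1 s * R2 s =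
  b2 * ((\sum_(t <- seqs (orb (N - k)) (N - k - size c2)) B2 t) / (f2 * g2)) *
  \sum_(s1 <- seqs (orb k) (k - size a1)) \sum_(s2 <- seqs (orb k) (k - size a2)) A1 s1 * A2 s2 * F s1 s2.
  rewrite [RHS]mulr_sumr; apply: eq_bigr => s1 _; rewrite /R2 (sum_sep _ _ A2 (F s1) B2).
  rewrite mulrCA -[RHS]mulrA; congr (_ * _).
  have -> : \sum_(s2 <- seqs (orb k) (k - size a2)) A1 s1 * A2 s2 * F s1 s2 =
     A1 s1 * \sum_(s2 <- seqs (orb k) (k - size a2)) A2 s2 * F s1 s2.
    by rewrite mulr_sumr; apply: eq_bigr => s2 _; rewrite mulrA.
  by ring.
rewrite /Lpart /Rpart -/f2 -/g2.
set S := \sum_(s1 <- _) \sum_(s2 <- _) _; set T1 := \sum_(t <- _) B1 t; set T2 := \sum_(t <- _) B2 t.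
rewrite /b2; case: (size a1 <= k)%N; case: (size a2 <= k)%N;
  case: (size c1 <= N - k)%N; case: (size c2 <= N - k)%N; rewrite /= !invfM; ring.
Qed.

Lemma eq_QD N m1 m1' m2 m2' H H' : (forall s s' t t', H s s' t t' = H' s s' t t') ->
  QD N m1 m1' m2 m2' H = QD N m1 m1' m2 m2' H'.
Proof.
by move=> HH; congr (_ / _); apply: eq_bigr => n1 _; apply: eq_bigr => n2 _; rewrite HH.
Qed.

Lemma QD_sum N m1 m1' m2 m2' (I : Type) (r : seq I) H :
  QD N m1 m1' m2 m2' (fun s s' t t' => \sum_(i <- r) H i s s' t t') =
  \sum_(i <- r) QD N m1 m1' m2 m2' (H i).
Proof.
rewrite /QD -mulr_suml; congr (_ / _); rewrite [RHS]exchange_big; apply: eq_bigr => n1 _.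
by rewrite [RHS]exchange_big; apply: eq_bigr => n2 _; rewrite mulr_sumr.
Qed.

Lemma QD_good k0 L N a1 a1' c1 c1' a2 a2' c2 c2' : (k0 + L <= N)%N ->
  size a1 = size a1' -> size c1 = size c1' -> size a2 = size a2' -> size c2 = size c2' ->
  (size (a1 ++ c1) <= N)%N -> (size (a2 ++ c2) <= N)%N ->
  all (ltk k0) a1 -> all (ltk k0) a1' -> all (ltk k0) a2 -> all (ltk k0) a2' ->
  all (predC (ltk (k0 + L))) c1 -> all (predC (ltk (k0 + L))) c1' ->
  all (predC (ltk (k0 + L))) c2 -> all (predC (ltk (k0 + L))) c2' ->
  QD N (a1 ++ c1) (a1' ++ c1') (a2 ++ c2) (a2' ++ c2')
     (fun s s' t t' => (good4 k0 L.+1 s s' t t')%:R) =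
  \sum_(k <- iota k0 L.+1) Lpart k0 k a1 a1' a2 a2' * (Rpart N k c1 c1' * Rpart N k c2 c2').
Proof.
move=> kN sa1 sc1 sa2 sc2 N1 N2 l1 l1' l2 l2' r1 r1' r2 r2'.
rewrite (eq_QD _ _ _ _ _ (fun s s' t t' => has_first (fun k => cut4 k s s' t t') k0 L.+1)) QD_sum.
apply: eq_big_seq => k; rewrite mem_iota => hk.
have up x : all (predC (ltk (k0 + L))) x -> all (predC (ltk k)) x.
  by apply: sub_all => z /=; apply: contra; apply: ltk_leq; clear -hk; nlia.
by rewrite -quad_cut //; try (by apply: up); clear -hk kN; nlia.
Qed.

(* Right of the first common cut the two copies may exchange their tails, which moves the
   marks [c], [c'] from one copy to the other. *)
Lemma good_swap k0 L N a a' c c' : (k0 + L <= N)%N ->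
  size a = size a' -> size c = size c' -> (size (a ++ c) <= N)%N ->
  all (ltk k0) a -> all (ltk k0) a' ->
  all (predC (ltk (k0 + L))) c -> all (predC (ltk (k0 + L))) c' ->
  QD N (a ++ c) (a' ++ c') [::] [::] (fun s s' t t' => (good4 k0 L.+1 s s' t t')%:R) =
  QD N a a' c c' (fun s s' t t' => (good4 k0 L.+1 s s' t t')%:R).
Proof.
move=> kN sa sc sN la la' rc rc'.
have := @QD_good k0 L N a a' c c' [::] [::] [::] [::] kN sa sc erefl erefl sN isT la la' isT isT rc rc' isT isT.
rewrite cats0 => ->.
have aN : (size (a ++ [::]) <= N)%N by move: sN; rewrite cats0 size_cat; lia.
have cN : (size c <= N)%N by move: sN; rewrite size_cat; lia.
have := @QD_good k0 L N a a' [::] [::] [::] [::] c c' kN sa erefl erefl sc aN cN la la' isT isT isT isT rc rc'.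
rewrite !cats0 /= => ->; apply: eq_bigr => k _; congr (_ * _); exact: mulrC.
Qed.

(** Two consecutive windows are tested for each of the pairs (s, t) and (s', t'): a cut of one pair
    in the first window then precedes a cut of the other pair in the second, as [same_cuts]
    demands. *)
Definition bad4 k0 l s s' t t' : bool :=
  [|| nocut k0 l s t, nocut (k0 + l.+1) l s t, nocut k0 l s' t' | nocut (k0 + l.+1) l s' t'].

Definition QE N k0 l m1 m1' m2 m2' : R :=
  (\sum_(n1 <- seqs (orb N) (N - size m1)) \sum_(n2 <- seqs (orb N) (N - size m2))
    `|bw (m1 ++ n1) * bw (m1' ++ n1) * (bw (m2 ++ n2) * bw (m2' ++ n2))| *
    (bad4 k0 l (m1 ++ n1) (m1' ++ n1) (m2 ++ n2) (m2' ++ n2))%:R) /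
  ((N - size m1)`!%:R * (N - size m2)`!%:R).

Lemma nocut_perm k l : pinv2 (nocut k l).
Proof.
move=> s s' t t' ss tt; apply: eq_all => j; rewrite /cut2.
by rewrite (cut_perm p j ss) (cut_perm p j tt).
Qed.

(** Events on the primed lists become events on unprimed ones after bra and ket exchange roles. *)
Lemma QE_split N k0 l m1 m1' m2 m2' : size m1 = size m1' -> size m2 = size m2' ->
  QE N k0 l m1 m1' m2 m2' <=
  QA N m1 m1' m2 m2' (nocut k0 l) + QA N m1 m1' m2 m2' (nocut (k0 + l.+1) l) +
  QA N m1' m1 m2' m2 (nocut k0 l) + QA N m1' m1 m2' m2 (nocut (k0 + l.+1) l).
Proof.
move=> e1 e2; rewrite /QE /QA -e1 -e2 -!mulrDl; apply: ler_wpM2r; first by rewrite invr_ge0 mulr_ge0.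
rewrite -!big_split; apply: ler_sum => n1 _; rewrite -!big_split; apply: ler_sum => n2 _ /=.
rewrite [X in _ <= _ + _ + `|X| * _ + _](_ : _ = bw (m1 ++ n1) * bw (m1' ++ n1) * (bw (m2 ++ n2) * bw (m2' ++ n2))); last by ring.
rewrite [X in _ <= _ + _ + _ + `|X| * _](_ : _ = bw (m1 ++ n1) * bw (m1' ++ n1) * (bw (m2 ++ n2) * bw (m2' ++ n2))); last by ring.
rewrite -!mulrDr; apply: ler_wpM2l => //; rewrite /bad4 -!natrD ler_nat.
by do 4 case: (nocut _ _ _ _).
Qed.

Lemma renewal_ge (e : R) : 0 < e -> exists L0, forall L, (L0 <= L)%N -> forall N k, (k + L <= N)%N ->
  UU N (fun s t => (nocut k L s t)%:R) <= e * CN N ^+ 2.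
Proof.
move=> e0; have [L0 H] := renewal p0 g0 e0; exists L0 => L LL N k kN.
apply: le_trans (H N k _); last by clear -LL kN; lia.
apply: le_UU => s t _ _ _ _; rewrite ler_nat; case: (boolP (nocut k L s t)) => // /allP h.
rewrite (_ : nocut k L0 s t) //; apply/allP => j jk; apply: h; move: jk; rewrite !mem_iota.
by clear -LL; nlia.
Qed.

Lemma QE_bound s1 s2 (eps : R) : 0 < eps -> exists l0, forall l, (l0 <= l)%N -> forall N k0 m1 m1' m2 m2',
  size m1 = s1 -> size m1' = s1 -> size m2 = s2 -> size m2' = s2 ->
  (s1 <= N)%N -> (s2 <= N)%N -> all (mem (orb N)) m1 -> all (mem (orb N)) m1' ->
  all (mem (orb N)) m2 -> all (mem (orb N)) m2' -> (k0 + (l + l.+1) <= N)%N ->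
  QE N k0 l m1 m1' m2 m2' <= eps * CN N ^+ 2.
Proof.
move=> e0; have e4 : 0 < eps / 4 by rewrite divr_gt0.
have [d d0 Hd] := bad_bound p0 g0 s1 s2 e4; have [l0 Hl] := renewal_ge d0.
exists l0 => l /Hl {}Hl N k0 m1 m1' m2 m2' z1 z1' z2 z2' N1 N2 o1 o1' o2 o2' kN.
apply: le_trans (QE_split _ _ _ _ _) _; rewrite ?z1 ?z2 //.
have r1 := Hl N k0 (ltac:(clear -kN; nlia)); have r2 := Hl N (k0 + l.+1)%N (ltac:(clear -kN; nlia)).
have h1 := Hd N m1 m1' m2 m2' _ (@nocut_perm k0 l) z1 z1' z2 z2' N1 N2 o1 o1' o2 o2' r1.
have h2 := Hd N m1 m1' m2 m2' _ (@nocut_perm _ l) z1 z1' z2 z2' N1 N2 o1 o1' o2 o2' r2.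
have h3 := Hd N m1' m1 m2' m2 _ (@nocut_perm k0 l) z1' z1 z2' z2 N1 N2 o1' o1 o2' o2 r1.
have h4 := Hd N m1' m1 m2' m2 _ (@nocut_perm _ l) z1' z1 z2' z2 N1 N2 o1' o1 o2' o2 r2.
lra.
Qed.

Lemma nocutN k l s t : ~~ nocut k l s t -> exists2 j, (k <= j <= k + l)%N & cut j s && cut j t.
Proof.
move=> /allPn[j]; rewrite mem_iota negbK => jk c; exists j => //; clear -jk; nlia.
Qed.

Section Quad.
Variables (k0 l : nat) (a1 a1' c1 c1' a2 a2' c2 c2' n1 n2 : seq int).
(** The windows are [k0, k0 + l] and [k0 + l + 1, k0 + L]. *)
Let L := (l + l.+1)%N.
Hypotheses (l1 : all (ltk k0) a1) (l1' : all (ltk k0) a1') (l2 : all (ltk k0) a2) (l2' : all (ltk k0) a2')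
  (r1 : all (predC (ltk (k0 + L))) c1) (r1' : all (predC (ltk (k0 + L))) c1')
  (r2 : all (predC (ltk (k0 + L))) c2) (r2' : all (predC (ltk (k0 + L))) c2').
Let K := a1 ++ c1 ++ n1.
Let K' := a1' ++ c1' ++ n1.
Let M := a2 ++ c2 ++ n2.
Let M' := a2' ++ c2' ++ n2.

Lemma quad_good : bw K != 0 -> bw K' != 0 -> bw M != 0 -> bw M' != 0 ->
  ~~ bad4 k0 l K K' M M' ->
  size a1 = size a1' /\ good4 k0 L.+1 K K' M M'.
Proof.
move=> b1 b1' b2 b2'; rewrite !negb_or => /and4P[].
move=> /nocutN[k hk /andP[kK kM]] /nocutN[j hj /andP[jK jM]].
move=> /nocutN[k' hk' /andP[kK' kM']] /nocutN[j' hj' /andP[jK' jM']].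
have q1 : (k0 <= k)%N by clear -hk; lia.
have q2 : (k < j')%N by clear -hk hj'; lia.
have q3 : (j' <= k0 + L)%N by rewrite /L; clear -hj'; lia.
have q4 : (k0 <= k')%N by clear -hk'; lia.
have q5 : (k' < j)%N by clear -hk' hj; lia.
have q6 : (j <= k0 + L)%N by rewrite /L; clear -hj; lia.
have [sz cK] := same_cuts l1 l1' r1 r1' b1 b1' q1 q2 q3 q4 q5 q6 kK jK kK' jK'.
have [_ cM] := same_cuts l2 l2' r2 r2' b2 b2' q1 q2 q3 q4 q5 q6 kM jM kM' jM'.
split=> //; apply/hasP; exists k; first by rewrite mem_iota /L; clear -hk; lia.
have hk2 : (k0 <= k <= k0 + L)%N by rewrite /L; clear -hk; lia.
by rewrite /cut4 kK kM -(cK k hk2) kK -(cM k hk2) kM.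
Qed.

End Quad.

Lemma bw4_neq0 (x y z w : R) : `|x * y * (z * w)| != 0 -> [/\ x != 0, y != 0, z != 0 & w != 0].
Proof. by rewrite normr_eq0 !mulf_eq0 !negb_or => /andP[/andP[-> ->] /andP[-> ->]]. Qed.

Lemma QD_le_QE N k0 l m1 m1' m2 m2' H :
  (forall n1 n2, bw (m1 ++ n1) != 0 -> bw (m1' ++ n1) != 0 -> bw (m2 ++ n2) != 0 -> bw (m2' ++ n2) != 0 ->
    `|H (m1 ++ n1) (m1' ++ n1) (m2 ++ n2) (m2' ++ n2)| <=
     (bad4 k0 l (m1 ++ n1) (m1' ++ n1) (m2 ++ n2) (m2' ++ n2))%:R) ->
  `|QD N m1 m1' m2 m2' H| <= QE N k0 l m1 m1' m2 m2'.
Proof.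
move=> HH; rewrite /QD /QE normrM [`|_^-1|]ger0_norm ?invr_ge0 ?mulr_ge0 //.
apply: ler_wpM2r; first by rewrite invr_ge0 mulr_ge0.
apply: le_trans (ler_norm_sum _ _ _) _; apply: ler_sum => n1 _.
apply: le_trans (ler_norm_sum _ _ _) _; apply: ler_sum => n2 _.
rewrite normrM; set b := `|_ * _ * (_ * _)|.
have [->|/bw4_neq0[h1 h2 h3 h4]] := eqVneq b 0; first by rewrite !mul0r.
by apply: ler_wpM2l; [apply: normr_ge0|apply: HH].
Qed.

Lemma QDB N m1 m1' m2 m2' H H' : QD N m1 m1' m2 m2' H - QD N m1 m1' m2 m2' H' =
  QD N m1 m1' m2 m2' (fun s s' t t' => H s s' t t' - H' s s' t t').
Proof.
rewrite /QD -mulrBl; congr (_ / _); rewrite -sumrB; apply: eq_bigr => n1 _.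
by rewrite -sumrB; apply: eq_bigr => n2 _; rewrite mulrBr.
Qed.

(** Disposes of windows that reach beyond the system, where clustering is trivial. *)
Lemma big_window N k (c : seq int) : (N < k)%N -> all (mem (orb N)) c -> all (predC (ltk k)) c -> c = [::].
Proof.
move=> Nk; case: c => // x c /= /andP[xo _] /andP[xk _]; exfalso; move: xk.
rewrite /ltk; move: xo; rewrite mem_orb => /andP[_ xN] /negP; apply.
apply: lt_le_trans xN _; rewrite lez_nat leq_mul2l; apply/orP; right; exact: ltnW.
Qed.

Lemma QD_good_QE k0 l N a1 a1' c1 c1' a2 a2' c2 c2' :
  all (ltk k0) a1 -> all (ltk k0) a1' -> all (ltk k0) a2 -> all (ltk k0) a2' ->
  all (predC (ltk (k0 + (l + l.+1)))) c1 -> all (predC (ltk (k0 + (l + l.+1)))) c1' ->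
  all (predC (ltk (k0 + (l + l.+1)))) c2 -> all (predC (ltk (k0 + (l + l.+1)))) c2' ->
  `|QD N (a1 ++ c1) (a1' ++ c1') (a2 ++ c2) (a2' ++ c2') (fun _ _ _ _ => 1) -
    QD N (a1 ++ c1) (a1' ++ c1') (a2 ++ c2) (a2' ++ c2')
     (fun s s' t t' => (good4 k0 (l + l.+1).+1 s s' t t')%:R)| <=
  QE N k0 l (a1 ++ c1) (a1' ++ c1') (a2 ++ c2) (a2' ++ c2').
Proof.
move=> l1 l1' l2 l2' r1 r1' r2 r2'; rewrite QDB; apply: QD_le_QE => n1 n2.
rewrite -!catA => b1 b1' b2 b2'.
have := quad_good l1 l1' l2 l2' r1 r1' r2 r2' b1 b1' b2 b2'.
case: (bad4 _ _ _ _ _ _) => [_|/(_ isT)[_ ->]]; last by rewrite subrr normr0.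
by case: (good4 _ _ _ _ _ _); rewrite ?subrr ?subr0 ?normr0 ?normr1.
Qed.

(** After multiplication by the square of [CN N] both terms are sums over two copies: with all marks
    on one copy, or with [a] and [c] on different copies. They agree on the event of a common cut by
    [good_swap]; the complement is bounded by [QE]. *)
Lemma QQ_cluster sa sc (eps : R) : 0 < eps -> exists L, forall N k0 a a' c c',
  size a = sa -> size a' = sa -> size c = sc -> size c' = sc -> (sa + sc <= N)%N ->
  all (mem (orb N)) a -> all (mem (orb N)) a' -> all (mem (orb N)) c -> all (mem (orb N)) c' ->
  all (ltk k0) a -> all (ltk k0) a' ->
  all (predC (ltk (k0 + L))) c -> all (predC (ltk (k0 + L))) c' ->
  `|QQ N (a ++ c) (a' ++ c') - QQ N a a' * QQ N c c'| <= eps.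
Proof.
move=> e0; have e2 : 0 < eps / 2 by rewrite divr_gt0.
have [lA HA] := QE_bound (sa + sc) 0 e2; have [lB HB] := QE_bound sa sc e2.
pose l := maxn lA lB; exists (l + l.+1)%N => N k0 a a' c c' za za' zc zc' sN oa oa' oc oc' la la' rc rc'.
have C0 : 0 < CN N by apply: CN_gt0.
have [kN|Nk] := leqP (k0 + (l + l.+1)) N; last first.
  rewrite (big_window Nk oc rc) (big_window Nk oc' rc') !cats0 QQ0 // mulr1 subrr normr0.
  exact: ltW.
have C2 : 0 < CN N ^+ 2 by rewrite exprn_gt0.
rewrite -(ler_pM2r C2) -{1}(gtr0_norm C2) -normrM.
have -> : (QQ N (a ++ c) (a' ++ c') - QQ N a a' * QQ N c c') * CN N ^+ 2 =
   RR N (a ++ c) (a' ++ c') * RR N [::] [::] - RR N a a' * RR N c c'.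
  by rewrite RR0 /QQ; field; rewrite gt_eqF.
rewrite !RR_prod.
have zz : size (a ++ c) = (sa + sc)%N by rewrite size_cat za zc.
have zz' : size (a' ++ c') = (sa + sc)%N by rewrite size_cat za' zc'.
have gs := @good_swap k0 (l + l.+1) N a a' c c' kN (etrans za (esym za')) (etrans zc (esym zc'))
  (ltac:(by rewrite zz)) la la' rc rc'.
have h1 := @QD_good_QE k0 l N a a' c c' [::] [::] [::] [::] la la' isT isT rc rc' isT isT.
have h2 := @QD_good_QE k0 l N a a' [::] [::] [::] [::] c c' la la' isT isT isT isT rc rc'.
rewrite !cats0 in h1 h2; rewrite /= in h1 h2; rewrite -gs in h2.
have k1 := HA l (leq_maxl _ _) N k0 (a ++ c) (a' ++ c') [::] [::] zz zz' erefl erefl sN (leq0n _)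
   (ltac:(by rewrite all_cat oa)) (ltac:(by rewrite all_cat oa')) isT isT kN.
have k2 := HB l (leq_maxr _ _) N k0 a a' c c' za za' zc zc' (leq_trans (leq_addr _ _) sN)
   (leq_trans (leq_addl _ _) sN) oa oa' oc oc' kN.
have t1 := le_trans h1 k1; have t2 := le_trans h2 k2.
set X := QD N (a ++ c) _ _ _ (fun _ _ _ _ => 1) in t1 *; set Y := QD N a _ _ _ (fun _ _ _ _ => 1) in t2 *.
move: t1 t2; set G := QD N _ _ _ _ _ => t1 t2.
have -> : X - Y = (X - G) - (Y - G) by ring.
by apply: le_trans (ler_normB _ _) _; lra.
Qed.

(** Outside the bad event [quad_good] forces equally many left marks in bra and ket, so the whole
    sum is carried by the bad event. *)
Lemma QQ_unbal s sa sa' (eps : R) : sa != sa' -> 0 < eps -> exists L, forall N k0 a a' c c',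
  size a = sa -> size a' = sa' -> (sa + size c)%N = s -> (sa' + size c')%N = s -> (s <= N)%N ->
  all (mem (orb N)) a -> all (mem (orb N)) a' -> all (mem (orb N)) c -> all (mem (orb N)) c' ->
  all (ltk k0) a -> all (ltk k0) a' ->
  all (predC (ltk (k0 + L))) c -> all (predC (ltk (k0 + L))) c' ->
  `|QQ N (a ++ c) (a' ++ c')| <= eps.
Proof.
move=> aa e0; have [l HA] := QE_bound s 0 e0.
exists (l + l.+1)%N => N k0 a a' c c' za za' zc zc' sN oa oa' oc oc' la la' rc rc'.
have C0 : 0 < CN N by apply: CN_gt0.
have [kN|Nk] := leqP (k0 + (l + l.+1)) N; last first.
  move: zc zc'; rewrite (big_window Nk oc rc) (big_window Nk oc' rc') /= !addn0 => e1 e2.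
  by rewrite e1 e2 eqxx in aa.
have C2 : 0 < CN N ^+ 2 by rewrite exprn_gt0.
rewrite -(ler_pM2r C2) -{1}(gtr0_norm C2) -normrM.
have -> : QQ N (a ++ c) (a' ++ c') * CN N ^+ 2 = RR N (a ++ c) (a' ++ c') * RR N [::] [::].
  by rewrite RR0 /QQ; field; rewrite gt_eqF.
rewrite !RR_prod.
have zz : size (a ++ c) = s by rewrite size_cat za zc.
have zz' : size (a' ++ c') = s by rewrite size_cat za' zc'.
apply: le_trans (HA l (leqnn _) N k0 (a ++ c) (a' ++ c') [::] [::] zz zz' erefl erefl sN (leq0n _)
   (ltac:(by rewrite all_cat oa)) (ltac:(by rewrite all_cat oa')) isT isT kN).
apply: QD_le_QE => n1 n2; rewrite -!catA => b1 b1' b2 b2'; rewrite normr1.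
have := @quad_good k0 l a a' c c' [::] [::] [::] [::] n1 n2 la la' isT isT rc rc' isT isT b1 b1' b2 b2'.
case: (bad4 _ _ _ _ _ _) => // /(_ isT)[e _].
by rewrite -za -za' e eqxx in aa.
Qed.

End Cluster.

(** * Integration on the cylinder *)

Section CylinderIntegral.
Variable R : realType.
Local Notation mu := (@lebesgue_measure R).
Local Notation leb2 := (@leb2 R).
Let T1 : measurableType _ := measurableTypeR R.
Let T2 : measurableType _ := (T1 * T1)%type.

Lemma prod_integral (E h : R -> R) :
  mu.-integrable setT (EFin \o E) -> mu.-integrable setT (EFin \o h) ->
  leb2.-integrable setT (EFin \o (fun z : R * R => E z.1 * h z.2)) /\
  Rintegral leb2 setT (fun z : R * R => E z.1 * h z.2) = Rintegral mu setT E * Rintegral mu setT h.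
Proof.
move=> iE ih.
have mE : measurable_fun (T := T1) setT E by apply/measurable_EFinP; case/integrableP: iE.
have mh : measurable_fun (T := T1) setT h by apply/measurable_EFinP; case/integrableP: ih.
have mf : measurable_fun (T := T2) setT (EFin \o (fun z : R * R => E z.1 * h z.2)).
  apply/measurable_EFinP; apply: measurable_funM.
    exact: (measurableT_comp mE (@measurable_fst _ _ T1 T1)).
  exact: (measurableT_comp mh (@measurable_snd _ _ T1 T1)).
have int : leb2.-integrable setT (EFin \o (fun z : R * R => E z.1 * h z.2)).
  apply: (proj2 (@integrable12ltyP _ _ T1 T1 R _ _ _ mf)) => /=.
  have e x : (\int[mu]_y `|E x * h y|%:E = `|E x|%:E * \int[mu]_y `|h y|%:E)%E.
    under eq_integral do rewrite normrM EFinM.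
    rewrite ge0_integralZl_EFin //.
    by apply/measurable_EFinP; apply: measurableT_comp.
  under eq_integral do rewrite e.
  have fh : (\int[mu]_y `|h y|%:E < +oo)%E by case/integrableP: ih.
  have fE : (\int[mu]_y `|E y|%:E < +oo)%E by case/integrableP: iE.
  have h0 : (0 <= \int[mu]_y `|h y|%:E)%E by apply: integral_ge0.
  have E0 : (0 <= \int[mu]_y `|E y|%:E)%E by apply: integral_ge0.
  have -> : (\int[mu]_x (`|E x|%:E * \int[mu]_y `|h y|%:E) =
      \int[mu]_x `|E x|%:E * \int[mu]_y `|h y|%:E)%E.
    by apply: ge0_integralZr => //; apply/measurable_EFinP; apply: measurableT_comp.
  by apply: lte_mul_pinfty => //; rewrite ge0_fin_numE.
split=> //; rewrite /Rintegral -(@integral12_prod_meas1 _ _ _ _ _ _ _ _ int) /fubini_F /=.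
have e x : (\int[mu]_y (E x * h y)%:E = (E x)%:E * \int[mu]_y (h y)%:E)%E.
  by under eq_integral do rewrite EFinM; rewrite integralZl.
under eq_integral do rewrite e.
have fh : (\int[mu]_y (h y)%:E)%E \is a fin_num by apply: integrable_fin_num ih.
have fE : (\int[mu]_y (E y)%:E)%E \is a fin_num by apply: integrable_fin_num iE.
rewrite -(fineK fh) integralZr // fineM //.
Qed.

Variable Rc : R.
Hypothesis Rc0 : 0 < Rc.

Lemma cylZE : cylZ Rc = setT `*` [set` `[0, 2 * pi * Rc]].
Proof.
apply/seteqP; split => -[x y] /=; rewrite /cylZ /= in_itv /=.
  by move=> [-> ->].
by move=> [_ /andP[-> ->]].
Qed.

Lemma measurable_cylZ : @measurable _ T2 (cylZ Rc).
Proof. by rewrite cylZE; apply: (@measurableX _ _ T1 T1) => //; apply: measurable_itv. Qed.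

Lemma cyl_prod_integral (E H : R -> R) : mu.-integrable setT (EFin \o E) -> continuous H ->
  leb2.-integrable (cylZ Rc) (EFin \o (fun z : R * R => E z.1 * H z.2)) /\
  Rintegral leb2 (cylZ Rc) (fun z : R * R => E z.1 * H z.2) =
    Rintegral mu setT E * Rintegral mu [set` `[0, 2 * pi * Rc]] H.
Proof.
move=> iE cH; pose D := [set` `[0, 2 * pi * Rc]] : set R.
have iH : mu.-integrable D (EFin \o H).
  apply: continuous_compact_integrable; first exact: segment_compact.
  by apply: continuous_subspaceT => x; apply: cH.
have iH' : mu.-integrable setT (EFin \o (H \_ D)).
  by rewrite -restrict_EFin; apply/(integrable_mkcond _ _).1 => //; apply: measurable_itv.
have pE : (fun z : R * R => E z.1 * H z.2) \_ (cylZ Rc) = (fun z => E z.1 * (H \_ D) z.2).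
  apply/funext => -[x y]; rewrite /patch cylZE /D.
  have -> : ((x, y) \in setT `*` [set` `[0, 2 * pi * Rc]]) = (y \in [set` `[0, 2 * pi * Rc]]).
    by apply/idP/idP; rewrite !inE /= => // -[].
  by case: ifP => //= _; rewrite mulr0.
have [i1 i2] := prod_integral iE iH'; split.
  apply/(integrable_mkcond _ measurable_cylZ).2.
  by rewrite restrict_EFin pE.
transitivity (Rintegral leb2 setT (fun z : R * R => E z.1 * (H \_ D) z.2)).
  by rewrite Rintegral_mkcond; congr (Rintegral _ _ _); exact: pE.
by rewrite i2; congr (_ * _); rewrite [RHS]Rintegral_mkcond.
Qed.

Lemma continuous_cosM (w : R) : continuous (fun y => cos (w * y)).
Proof. by move=> x; apply: continuous_comp; [apply: mulrl_continuous|apply: continuous_cos]. Qed.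

Lemma continuous_sinM (w : R) : continuous (fun y => sin (w * y)).
Proof. by move=> x; apply: continuous_comp; [apply: mulrl_continuous|apply: continuous_sin]. Qed.

Lemma Rint_FTC (f F : R -> R) (b : R) : 0 < b -> continuous f ->
  (forall x : R, is_derive x 1 F (f x)) ->
  Rintegral mu [set` `[0, b]] f = F b - F 0.
Proof.
move=> b0 cf dF.
have cF : continuous F by move=> x; apply/differentiable_continuous/derivable1_diffP; case: (dF x).
rewrite /Rintegral (@continuous_FTC2 _ f F) //.
- by apply: continuous_subspaceT => x; apply: cf.
- split; first by move=> x _; case: (dF x).
  + by apply: cvg_at_right_filter; apply: cF.
  + by apply: cvg_at_left_filter; apply: cF.
- by move=> x _; rewrite derive1E; apply: derive_val.
Qed.

Lemma trig_integral (n : int) :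
  Rintegral mu [set` `[0, 2 * pi * Rc]] (fun y => cos (n%:~R / Rc * y)) = (n == 0)%:R * (2 * pi * Rc) /\
  Rintegral mu [set` `[0, 2 * pi * Rc]] (fun y => sin (n%:~R / Rc * y)) = 0.
Proof.
have b0 : 0 < 2 * pi * Rc by rewrite !mulr_gt0 // pi_gt0.
have [->|n0] := eqVneq n 0.
  rewrite mul1r; split.
    have d (x : R) : is_derive x (1 : R) (fun x => x : R) (cos (0%:~R / Rc * x)).
      by rewrite mul0r mul0r cos0; apply: is_derive_id.
    by rewrite (Rint_FTC b0 (@continuous_cosM _) d) subr0.
  have d (x : R) : is_derive x (1 : R) (fun=> 0 : R) (sin (0%:~R / Rc * x)).
    by rewrite mul0r mul0r sin0; apply: is_derive_cst.
  by rewrite (Rint_FTC b0 (@continuous_sinM _) d) subr0.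
set w := n%:~R / Rc; have w0 : w != 0.
  by rewrite mulf_neq0 ?intr_eq0 // invr_neq0 // gt_eqF.
have wE : w * (2 * pi * Rc) = 2 * pi * n%:~R by rewrite /w; field; rewrite gt_eqF.
have := cis2piz R n; rewrite /cis -wE => -[c1 s0].
have h (x : R) : is_derive x (1 : R) (fun y => w * y) w.
  by have := is_deriveZ w (is_derive_id x (1 : R)); rewrite scaler1.
split.
  have d (x : R) : is_derive x (1 : R) (fun y => w^-1 * sin (w * y)) (cos (w * x)).
    have := is_deriveZ w^-1 (is_derive1_comp (is_derive_sin (w * x)) (h x)).
    by rewrite /GRing.scale /= mulrCA mulVf // mulr1.
  by rewrite mul0r (Rint_FTC b0 (@continuous_cosM _) d) s0 !mulr0 sin0 mulr0 subrr.
have d (x : R) : is_derive x (1 : R) (fun y => - w^-1 * cos (w * y)) (sin (w * x)).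
  have := is_deriveZ (- w^-1) (is_derive1_comp (is_derive_cos (w * x)) (h x)).
  by rewrite /GRing.scale /= mulNr mulNr mulrN opprK mulrCA mulVf // mulr1.
by rewrite (Rint_FTC b0 (@continuous_sinM _) d) c1 mulr0 cos0 subrr.
Qed.

Definition cint (F : R * R -> R[i]) : R[i] :=
  Complex (Rintegral leb2 (cylZ Rc) (fun z => complex.Re (F z)))
          (Rintegral leb2 (cylZ Rc) (fun z => complex.Im (F z))).

Definition cI (F : R * R -> R[i]) : Prop :=
  leb2.-integrable (cylZ Rc) (EFin \o (fun z => complex.Re (F z))) /\
  leb2.-integrable (cylZ Rc) (EFin \o (fun z => complex.Im (F z))).

(** [intZ] is an iterated integral, so real and imaginary parts recombine one variable at a time;
    this gives the form needed for [iterL_parseval]. *)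
Lemma intZc_iter M F : intZc Rc M F = iterL cint M F.
Proof.
elim: M F => [|M IH] F; first by rewrite /intZc /=; case: (F [::]).
rewrite /= -[LHS]/(cint (fun w => intZc Rc M (fun ws => F (w :: ws)))).
by congr cint; apply/funext => w; apply: IH.
Qed.

Lemma integrableZ_fin (f : R * R -> R) (k : R) : leb2.-integrable (cylZ Rc) (EFin \o f) ->
  leb2.-integrable (cylZ Rc) (EFin \o (fun z => k * f z)).
Proof.
move=> h; have := integrableZl measurable_cylZ k h.
by congr (_.-integrable _ _); apply/funext => z /=; rewrite EFinM.
Qed.

Lemma integrableD_fin (f h : R * R -> R) : leb2.-integrable (cylZ Rc) (EFin \o f) ->
  leb2.-integrable (cylZ Rc) (EFin \o h) -> leb2.-integrable (cylZ Rc) (EFin \o (fun z => f z + h z)).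
Proof.
move=> i1 i2; have := integrableD measurable_cylZ i1 i2.
by congr (_.-integrable _ _); apply/funext => z /=; rewrite EFinD.
Qed.

Lemma cintD F G : cI F -> cI G ->
  cI (fun z => F z + G z) /\ cint (fun z => F z + G z) = cint F + cint G.
Proof.
move=> [F1 F2] [G1 G2].
have re z : complex.Re (F z + G z) = complex.Re (F z) + complex.Re (G z) by case: (F z) (G z) => a b [].
have im z : complex.Im (F z + G z) = complex.Im (F z) + complex.Im (G z) by case: (F z) (G z) => a b [].
rewrite /cI /cint (funext re) (funext im); split; first by split; apply: integrableD_fin.
by rewrite !RintegralD //; exact: measurable_cylZ.
Qed.

Lemma cintZ (b : R[i]) F : cI F -> cI (fun z => b * F z) /\ cint (fun z => b * F z) = b * cint F.
Proof.
case: b => b1 b2 [F1 F2].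
have re z : complex.Re (Complex b1 b2 * F z) = b1 * complex.Re (F z) + (- b2) * complex.Im (F z).
  by case: (F z) => x y /=; rewrite mulNr.
have im z : complex.Im (Complex b1 b2 * F z) = b1 * complex.Im (F z) + b2 * complex.Re (F z).
  by case: (F z) => x y /=.
rewrite /cI /cint (funext re) (funext im).
have m := measurable_cylZ; split.
  by split; apply: integrableD_fin; apply: integrableZ_fin.
rewrite !RintegralD ?RintegralZl //; try exact: integrableZ_fin.
by apply/eqP; rewrite eq_complex /= mulNr !eqxx.
Qed.

Lemma cint_sum (I : Type) (r : seq I) (F : I -> R * R -> R[i]) : (forall i, cI (F i)) ->
  cI (fun z => \sum_(i <- r) F i z) /\ cint (fun z => \sum_(i <- r) F i z) = \sum_(i <- r) cint (F i).
Proof.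
move=> h; elim: r => [|i r [IH1 IH2]].
  have -> : (fun z => \sum_(i <- [::]) F i z) = (fun=> 0) by apply/funext => z; rewrite big_nil.
  rewrite big_nil /cI /cint /=.
  have z : leb2.-integrable (cylZ Rc) (EFin \o (fun _ : R * R => 0 : R)) by apply: integrable0.
  split=> //; apply/eqP; rewrite eq_complex /=.
  by rewrite Rintegral_cst ?mul0r ?eqxx //; apply: measurable_cylZ.
have -> : (fun z => \sum_(j <- i :: r) F j z) = (fun z => F i z + \sum_(j <- r) F j z).
  by apply/funext => z; rewrite big_cons.
by rewrite big_cons -IH2; apply: cintD.
Qed.

Variable ell : R.
Hypothesis ell0 : 0 < ell.

(** The Landau orbital of angular momentum [m], centred at m ell^2 / Rc along the axis; not
    normalised, its squared norm is [c0]. *)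
Definition phi (m : int) (z : R * R) : R[i] :=
  (expR (- (z.1 - m%:~R * (ell ^+ 2 / Rc)) ^+ 2 / (2 * ell ^+ 2)))%:C%C * cis (m%:~R / Rc * z.2).

(** Equal to sqrt(pi) ell times 2 pi Rc: the inverse peak of the normal density of deviation ell /
    sqrt 2 is the Gaussian integral. *)
Definition c0 : R := (normal_peak (ell / Num.sqrt 2))^-1 * (2 * pi * Rc).

Lemma c0_gt0 : 0 < c0.
Proof.
have s0 : ell / Num.sqrt 2 != 0 by rewrite mulf_neq0 ?gt_eqF // ?invr_gt0 ?sqrtr_gt0.
rewrite /c0; apply: mulr_gt0; first by rewrite invr_gt0 normal_peak_gt0.
by apply: mulr_gt0 => //; apply: mulr_gt0 => //; apply: pi_gt0.
Qed.

(** The product of two Gaussians is a constant times a Gaussian about the midpoint of their centres;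
    the angular integral vanishes for distinct [i] and [j]. *)
Lemma phi_orth i j : cI (fun z => phi i z * ((phi j z)^*)%C) /\
  cint (fun z => phi i z * ((phi j z)^*)%C) = if i == j then c0%:C%C else 0.
Proof.
pose s := ell / Num.sqrt 2; pose d := ell ^+ 2 / Rc.
have q2 : Num.sqrt 2 ^+ 2 = 2 :> R by rewrite sqr_sqrtr.
have q0 : Num.sqrt 2 != 0 :> R by rewrite gt_eqF // sqrtr_gt0.
have l0 : ell != 0 by rewrite gt_eqF.
have s0 : s != 0 by rewrite mulf_neq0 // invr_neq0.
pose ce := (i%:~R + j%:~R) * d / 2 : R.
pose k := expR (- ((i%:~R - j%:~R) * d) ^+ 2 / (4 * ell ^+ 2)) / normal_peak s.
pose E x := k * normal_pdf ce s x.
have iE : mu.-integrable setT (EFin \o E).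
  have := integrableZl measurableT k (integrable_normal_pdf ce s).
  by congr (_.-integrable _ _); apply/funext => z /=; rewrite EFinM.
have RE : Rintegral mu setT E = k.
  by rewrite RintegralZl //; [rewrite /Rintegral integral_normal_pdf mulr1|exact: integrable_normal_pdf].
have pE z : phi i z * ((phi j z)^*)%C = Complex (E z.1 * cos ((i - j)%:~R / Rc * z.2)) (E z.1 * sin ((i - j)%:~R / Rc * z.2)).
  rewrite /phi conjM conj_real conj_cis mulrACA -realM -expRD -cisD.
  rewrite [X in cis X](_ : _ = (i - j)%:~R / Rc * z.2); last by rewrite intrD mulrNz; ring.
  rewrite [X in (expR X)%:C%C](_ : _ = - ((i%:~R - j%:~R) * d) ^+ 2 / (4 * ell ^+ 2) + - (z.1 - ce) ^+ 2 / (s ^+ 2 *+ 2)); last first.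
    by rewrite /ce /s /d expr_div_n q2 -mulr_natr; field; rewrite l0 gt_eqF.
  rewrite expRD.
  have -> : E z.1 = expR (- ((i%:~R - j%:~R) * d) ^+ 2 / (4 * ell ^+ 2)) * expR (- (z.1 - ce) ^+ 2 / (s ^+ 2 *+ 2)).
    rewrite /E normal_pdfE // /k /normal_fun; field.
    by rewrite gt_eqF // normal_peak_gt0.
  by apply/eqP; rewrite eq_complex /= !mul0r subr0 addr0 !eqxx.
rewrite (funext pE) /cI /cint /=.
have [c1 c2] := cyl_prod_integral iE (@continuous_cosM ((i - j)%:~R / Rc)).
have [d1 d2] := cyl_prod_integral iE (@continuous_sinM ((i - j)%:~R / Rc)).
have [t1 t2] := trig_integral (i - j).
split=> //; rewrite c2 d2 t1 t2 RE subr_eq0 mulr0.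
case: eqP => [ij|_]; last by rewrite mul0r mulr0.
rewrite mul1r /c0 -/s /k ij subrr mul0r expr0n oppr0 mul0r expR0 mul1r.
by [].
Qed.

Lemma sum_delta (T : eqType) (V : nmodType) (r : seq T) i (G : T -> V) : uniq r -> i \in r ->
  (forall j, j != i -> G j = 0) -> \sum_(j <- r) G j = G i.
Proof. by move=> ur ir G0; rewrite (bigD1_seq i) //= big1 ?addr0. Qed.

Lemma cint_parseval (r : seq int) (B : int -> int -> R[i]) : uniq r ->
  cint (fun z => \sum_(i <- r) \sum_(j <- r) B i j * (phi i z * ((phi j z)^*)%C)) =
  c0%:C%C * \sum_(i <- r) B i i.
Proof.
move=> ur.
have hj i j := cintZ (B i j) (phi_orth i j).1.
have hi i := cint_sum r (fun j => (hj i j).1).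
rewrite (cint_sum r (fun i => (hi i).1)).2 mulr_sumr; apply: eq_big_seq => i ir.
rewrite (hi i).2 (sum_delta (i := i) ur ir) => [|j ji].
  by rewrite (hj i i).2 (phi_orth i i).2 eqxx mulrC.
by rewrite (hj i j).2 (phi_orth i j).2 eq_sym (negbTE ji) mulr0.
Qed.

End CylinderIntegral.

(** * Correlation functions as sums over Landau orbitals *)

Section Expansion.
Variables (R : realType) (Rc ell : R) (p : nat) (kappa : nat -> R).
Hypotheses (Rc0 : 0 < Rc) (ell0 : 0 < ell) (p0 : (0 < p)%N) (kappa0 : forall N, 0 < kappa N).

(** Completing the square in e^(m x / Rc) e^(-x^2 / (2 ell^2)) moves the centre to m ell^2 / Rc and
    leaves the factor e^(g m^2 / 2) with this g. *)
Definition gg : R := (ell / Rc) ^+ 2.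
Local Notation g := gg.
Local Notation phi := (phi Rc ell).
Local Notation phic := (fun m z => ((phi m z)^*)%C).
Local Notation c0 := (c0 Rc ell).
Local Notation bw := (bw p g).
Local Notation orb := (orb p).
Local Notation laughlin := (laughlin Rc ell p kappa).
Local Notation rho := (rho Rc ell p kappa).

Lemma gg_gt0 : 0 < g.
Proof. by rewrite exprn_gt0 // divr_gt0. Qed.

Lemma laughlin_vand (e : R * R -> R[i]) zs :
  \prod_(k < size zs) \prod_(j < k) (e (nth (0, 0) zs k) - e (nth (0, 0) zs j)) ^+ p =
  vand p (map e zs).
Proof.
elim: zs => [|z zs IH]; first by rewrite big_ord0.
rewrite /= big_ord_recl big_ord0 mul1r -IH big_map.
rewrite (big_nth (0, 0)) big_mkord -big_split; apply: eq_bigr => k _ /=.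
by rewrite big_ord_recl.
Qed.

Lemma expzE z : expz Rc z = (expR (z.1 / Rc))%:C%C * cis (z.2 / Rc).
Proof. by apply/eqP; rewrite eq_complex /= !mul0r subr0 addr0 !eqxx. Qed.

Lemma expz_neq0 z : expz Rc z != 0.
Proof.
rewrite expzE mulf_neq0 ?cis_neq0 //.
by rewrite eq_complex /= negb_and gt_eqF ?expR_gt0.
Qed.

Lemma expz_phi (m : nat) z : expz Rc z ^+ m * (expR (- (z.1 ^+ 2) / (2 * ell ^+ 2)))%:C%C =
  (expR (g / 2 * m%:R ^+ 2))%:C%C * phi m%:Z z.
Proof.
rewrite expzE exprMn /phi -cisMn -rmorphXn -expRM_natr mulrAC -!realM mulrA -realM -!expRD.
congr ((expR _)%:C%C * cis _); last by rewrite -pmulrn; ring.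
by rewrite /g -pmulrn; field; rewrite !gt_eqF.
Qed.

Lemma monz_phi (zs : seq (R * R)) s N : size s = size zs -> all (mem (orb N)) s ->
  monz (map (expz Rc) zs) s * (expR (- (1 / (2 * ell ^+ 2)) * \sum_(z <- zs) z.1 ^+ 2))%:C%C =
  (expR (g / 2 * sq2 R s))%:C%C * prodphi phi s zs.
Proof.
elim: zs s => [|z zs IH] [|m s] //=.
  by move=> _ _; rewrite /monz /prodphi /sq2 /= !big_nil !mulr0 mul1r mulr1.
case=> ss /andP[mo al]; rewrite /monz /prodphi /= !big_cons /=.
have [n _ ->] := mapP mo.
rewrite mulrDr expRD realM mulrACA.
have -> : - (1 / (2 * ell ^+ 2)) * z.1 ^+ 2 = - (z.1 ^+ 2) / (2 * ell ^+ 2) by ring.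
rewrite -[expz Rc z ^ n]/(expz Rc z ^+ n) expz_phi IH // /sq2 big_cons mulrDr expRD realM.
by rewrite /prodphi /sq2 -[n%:~R]/(n%:R : R); ring.
Qed.

Definition pref N : R := kappa N * expR (g / 2 * root2 R p N).

Lemma pref_gt0 N : 0 < pref N.
Proof. by rewrite mulr_gt0 ?expR_gt0. Qed.

Lemma laughlin_expand zs : laughlin zs =
  (pref (size zs))%:C%C * \sum_(s <- seqs (orb (size zs)) (size zs)) (bw s)%:C%C * prodphi phi s zs.
Proof.
rewrite /laughlin laughlin_vand; set N := size zs.
have -> : \sum_(k < N) (nth (0, 0) zs k).1 ^+ 2 = \sum_(z <- zs) z.1 ^+ 2.
  by rewrite (big_nth (0, 0)) big_mkord.
rewrite (@vand_expand R p _ (real_complex R)) //; last first.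
  by apply/allP => x /mapP[z _ ->]; apply: expz_neq0.
rewrite size_map -/N -mulrA mulr_suml [RHS]mulr_sumr [LHS]mulr_sumr; apply: eq_big_seq => s.
rewrite mem_seqs => /andP[/eqP ss al].
rewrite -[_ * monz _ _ * _]mulrA (monz_phi _ al) //.
rewrite /pref /bw ss mulrBr expRD expRN !realM.
have e0 : (expR (g / 2 * root2 R p N))%:C%C * ((expR (g / 2 * root2 R p N))^-1)%:C%C = 1.
  by rewrite -realM mulfV // gt_eqF ?expR_gt0.
set A := (expR (g / 2 * root2 R p N))%:C%C in e0 *; set B := (_^-1)%:C%C in e0 *.
by rewrite -[LHS]mulr1 -e0; ring.
Qed.

Lemma prodphi_cat (f : int -> R * R -> R[i]) m n zs ws : size m = size zs ->
  prodphi f (m ++ n) (zs ++ ws) = prodphi f m zs * prodphi f n ws.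
Proof. by move=> mz; rewrite /prodphi zip_cat // big_cat. Qed.

Lemma conj_prodphi m zs : ((prodphi phi m zs)^*)%C = prodphi phic m zs.
Proof. by rewrite /prodphi conj_prod. Qed.

Lemma iterL_ext (T : Type) (K : comNzRingType) (L : (T -> K) -> K) M F G :
  (forall ws, size ws = M -> F ws = G ws) -> iterL L M F = iterL L M G.
Proof.
elim: M F G => [|M IH] F G FG /=; first exact: FG.
by congr L; apply/funext => z; apply: IH => ws ws_; apply: FG; rewrite /= ws_.
Qed.

(** Integrating out a variable forces its orbitals in bra and ket to coincide; this yields the
    shared particles [n] in [RR]. *)
Lemma laughlin_integral N zs zs' : size zs' = size zs -> (size zs <= N)%N ->
  intZc Rc (N - size zs) (fun ws => laughlin (zs ++ ws) * ((laughlin (zs' ++ ws))^*)%C) =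
  ((pref N) ^+ 2 * c0 ^+ (N - size zs) * (N - size zs)`!%:R)%:C%C *
  \sum_(m <- seqs (orb N) (size zs)) \sum_(m' <- seqs (orb N) (size zs))
    (RR p g N m m')%:C%C * (prodphi phi m zs * ((prodphi phi m' zs')^*)%C).
Proof.
move=> ss sN; set k := size zs; set M := (N - k)%N.
have kM : (k + M)%N = N by rewrite subnKC.
pose A (n n' : seq int) : R[i] := ((pref N) ^+ 2)%:C%C *
  \sum_(m <- seqs (orb N) k) \sum_(m' <- seqs (orb N) k)
    (bw (m ++ n) * bw (m' ++ n'))%:C%C * (prodphi phi m zs * ((prodphi phi m' zs')^*)%C).
have ex zs1 ws : size zs1 = k -> size ws = M -> laughlin (zs1 ++ ws) = (pref N)%:C%C *
   \sum_(n <- seqs (orb N) M) (\sum_(m <- seqs (orb N) k) (bw (m ++ n))%:C%C * prodphi phi m zs1) * prodphi phi n ws.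
  move=> z1 w1; rewrite laughlin_expand size_cat z1 w1 kM; congr (_ * _).
  rewrite -{2}kM sum_seqs_cat exchange_big; apply: eq_bigr => n _; rewrite mulr_suml.
  apply: eq_big_seq => m /size_seqs_mem mk.
  by rewrite prodphi_cat ?mk ?z1 // mulrA.
rewrite intZc_iter.
rewrite (@iterL_ext _ _ _ _ _ (fun ws => \sum_(n <- seqs (orb N) M) \sum_(n' <- seqs (orb N) M)
     A n n' * (prodphi phi n ws * prodphi phic n' ws))); last first.
  move=> ws w1; rewrite !ex // conjM conj_real mulrACA -realM -expr2 conj_sum mulr_suml mulr_sumr.
  apply: eq_bigr => n _; rewrite !mulr_sumr; apply: eq_bigr => n' _.
  rewrite conjM conj_prodphi mulrACA mulrA; congr (_ * _); rewrite /A; congr (_ * _).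
  rewrite conj_sum mulr_suml; apply: eq_bigr => m _; rewrite mulr_sumr; apply: eq_bigr => m' _.
  by rewrite conjM conj_real mulrACA -realM.
rewrite (@iterL_parseval _ _ _ _ _ _ c0%:C%C); last first.
  by move=> B; apply: cint_parseval => //; apply: uniq_orb.
rewrite /A -mulr_sumr exchange_big /=.
have -> : \sum_(m <- seqs (orb N) k) \sum_(n <- seqs (orb N) M) \sum_(m' <- seqs (orb N) k)
     (bw (m ++ n) * bw (m' ++ n))%:C%C * (prodphi phi m zs * (prodphi phi m' zs')^*%C) =
   (M`!%:R)%:C%C * \sum_(m <- seqs (orb N) k) \sum_(m' <- seqs (orb N) k)
    (RR p g N m m')%:C%C * (prodphi phi m zs * ((prodphi phi m' zs')^*)%C).
  rewrite mulr_sumr; apply: eq_big_seq => m /size_seqs_mem mk.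
  rewrite exchange_big mulr_sumr; apply: eq_bigr => m' _.
  rewrite -mulr_suml mulrA; congr (_ * _).
  rewrite -realM /RR mk -/M mulrC divfK ?pnatr_eq0 -?lt0n ?fact_gt0 //.
  by rewrite -[LHS](rmorph_sum (real_complex R)).
have -> : c0%:C%C ^+ M = (c0 ^+ M)%:C%C by rewrite (rmorphXn (real_complex R)).
by rewrite !realM; ring.
Qed.

Lemma laughlin_norm2E N : laughlin_norm2 Rc ell p kappa N =
  (pref N) ^+ 2 * c0 ^+ N * N`!%:R * CN p g N.
Proof.
have := @laughlin_integral N [::] [::] erefl (leq0n _); rewrite subn0 !sum_seqs0 /prodphi /= !big_nil RR0.
rewrite conjc1 !mulr1 -realM => /(congr1 (@complex.Re R)) /= <-.
rewrite /laughlin_norm2; congr (intZ _ _ _); apply/funext => ws.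
by have /(congr1 (@complex.Re R)) /= := nrm_sqr (laughlin ws).
Qed.

(** The constants [kappa] and [pref] cancel against the norm; one factor [c0] survives for each
    point that is not integrated. *)
Lemma rho_expand N zs zs' : size zs' = size zs -> (size zs <= N)%N ->
  rho N zs zs' = ((c0 ^+ size zs)^-1)%:C%C *
  \sum_(m <- seqs (orb N) (size zs)) \sum_(m' <- seqs (orb N) (size zs))
    (QQ p g N m m')%:C%C * (prodphi phi m zs * ((prodphi phi m' zs')^*)%C).
Proof.
move=> ss sN; rewrite /rho laughlin_integral // laughlin_norm2E mulrA -realM.
have -> : \sum_(m <- seqs (orb N) (size zs)) \sum_(m' <- seqs (orb N) (size zs))
    (RR p g N m m')%:C%C * (prodphi phi m zs * ((prodphi phi m' zs')^*)%C) =
  (CN p g N)%:C%C * \sum_(m <- seqs (orb N) (size zs)) \sum_(m' <- seqs (orb N) (size zs))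
    (QQ p g N m m')%:C%C * (prodphi phi m zs * ((prodphi phi m' zs')^*)%C).
  rewrite mulr_sumr; apply: eq_bigr => m _; rewrite mulr_sumr; apply: eq_bigr => m' _.
  by rewrite [RHS]mulrA -realM /QQ [CN p g N * _]mulrC divfK // gt_eqF // CN_gt0.
rewrite mulrA -realM; congr (_%:C%C * _).
have nz n : n`!%:R != 0 :> R by rewrite pnatr_eq0 -lt0n fact_gt0.
have C0 : CN p g N != 0 by rewrite gt_eqF // CN_gt0.
have q0 : pref N != 0 by rewrite gt_eqF // pref_gt0.
have cc : c0 != 0 by rewrite gt_eqF // c0_gt0.
have -> : c0 ^+ N = c0 ^+ size zs * c0 ^+ (N - size zs) by rewrite -exprD subnKC.
by field; rewrite !nz C0 q0 !expf_neq0.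
Qed.

End Expansion.

(** * Clustering on the cylinder *)

Section Weighted.
Variables (R : realType) (T : eqType) (G : T -> int -> R) (near : T -> int -> bool) (C tau : R).
Hypotheses (G0 : forall z i, 0 <= G z i) (C1 : 1 <= C) (t0 : 0 <= tau).
Hypothesis GC : forall z (r : seq int), uniq r -> \sum_(i <- r) G z i <= C.
Hypothesis Gt : forall z (r : seq int), uniq r -> \sum_(i <- r) (~~ near z i)%:R * G z i <= tau.

Definition PG (Z : seq T) (M : seq int) : R := \prod_(x <- zip Z M) G x.1 x.2.
Definition nearL (Z : seq T) (M : seq int) : bool := all (fun x => near x.1 x.2) (zip Z M).

Lemma nearL_cat Z1 Z2 M1 M2 : size Z1 = size M1 ->
  nearL (Z1 ++ Z2) (M1 ++ M2) = nearL Z1 M1 && nearL Z2 M2.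
Proof. by move=> h; rewrite /nearL zip_cat // all_cat. Qed.

Lemma nearL_all (P : pred int) Z M : size M = size Z -> nearL Z M ->
  (forall z i, z \in Z -> i \in M -> near z i -> P i) -> all P M.
Proof.
elim: Z M => [|z Z IH] [|i M] //= [sz] /andP[ni nM] h; apply/andP; split.
  by apply: (h z) => //; rewrite inE eqxx.
by apply: IH => // z' i' zZ iM; apply: h; rewrite inE ?zZ ?iM orbT.
Qed.

Lemma PG_ge0 Z M : 0 <= PG Z M.
Proof. by apply: prodr_ge0. Qed.

Lemma sum_PG (r : seq int) Z : uniq r -> \sum_(M <- seqs r (size Z)) PG Z M <= C ^+ size Z.
Proof.
move=> ur; rewrite (sum_seqs_prod2 r Z G); elim: Z => [|z Z IH]; first by rewrite big_nil.
rewrite big_cons exprS; apply: ler_pM => //; first exact: sumr_ge0.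
  by apply: prodr_ge0 => a _; apply: sumr_ge0.
exact: GC.
Qed.

Lemma sum_far (r : seq int) Z : uniq r ->
  \sum_(M <- seqs r (size Z)) (~~ nearL Z M)%:R * PG Z M <= (size Z)%:R * tau * C ^+ size Z.
Proof.
move=> ur; have C0 : 0 <= C by apply: le_trans C1.
elim: Z => [|z Z IH]; first by rewrite sum_seqs0 /= !mul0r.
rewrite [size _]/= sum_seqsS.
apply: (@le_trans _ _ (\sum_(i <- r) \sum_(M <- seqs r (size Z))
   (((~~ near z i)%:R * G z i) * PG Z M + G z i * ((~~ nearL Z M)%:R * PG Z M)))).
  apply: ler_sum => i _; apply: ler_sum => M _; rewrite /nearL /PG /= big_cons /=.
  rewrite -/(PG Z M) -/(nearL Z M).
  have P0 := PG_ge0 Z M; have G1 := G0 z i; have GP := mulr_ge0 G1 P0.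
  by case: (near z i); case: (nearL Z M); rewrite /= ?mul0r ?mul1r ?mulr0 ?add0r ?addr0 // lerDl.
under eq_bigr do rewrite big_split -!mulr_sumr.
rewrite big_split -!mulr_suml /=.
have h1 := ler_pM (sumr_ge0 _ (fun i _ => mulr_ge0 (ler0n _ _) (G0 z i)))
  (sumr_ge0 _ (fun M _ => PG_ge0 Z M)) (Gt z ur) (sum_PG Z ur).
have h2 := ler_pM (sumr_ge0 _ (fun i _ => G0 z i))
  (sumr_ge0 _ (fun M _ => mulr_ge0 (ler0n _ _) (PG_ge0 Z M))) (GC z ur) IH.
apply: le_trans (lerD h1 h2) _.
have e : (size Z).+1%:R = (size Z)%:R + 1 :> R by rewrite natr1.
have : tau * C ^+ size Z <= tau * (C * C ^+ size Z).
  by apply: ler_wpM2l => //; rewrite ler_peMl ?exprn_ge0.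
rewrite exprS e; lra.
Qed.

(** Meant for [tau] so small that the crude bound [B] on the far indices costs no more than [e] on
    the near ones. *)
Lemma sum_weighted (r : seq int) Z (F : seq int -> R) (e B : R) : uniq r -> 0 <= e -> 0 <= B ->
  (forall M, M \in seqs r (size Z) -> F M <= B) ->
  (forall M, M \in seqs r (size Z) -> nearL Z M -> F M <= e) ->
  \sum_(M <- seqs r (size Z)) F M * PG Z M <= (e + B * ((size Z)%:R * tau)) * C ^+ size Z.
Proof.
move=> ur e0 B0 FB Fe.
apply: (@le_trans _ _ (e * \sum_(M <- seqs r (size Z)) PG Z M +
   B * \sum_(M <- seqs r (size Z)) (~~ nearL Z M)%:R * PG Z M)).
  rewrite !mulr_sumr -big_split big_seq [leRHS]big_seq; apply: ler_sum => M MS /=.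
  have P0 := PG_ge0 Z M; have := FB _ MS; have := Fe _ MS.
  case: (nearL Z M) => /= [/(_ isT) h _|_ h]; rewrite ?mul0r ?mulr0 ?addr0 ?mul1r; first exact: ler_wpM2r.
  have := ler_wpM2r P0 h; have := mulr_ge0 e0 P0; lra.
have h1 := ler_wpM2l e0 (sum_PG Z ur); have h2 := ler_wpM2l B0 (sum_far Z ur).
apply: le_trans (lerD h1 h2) _; rewrite le_eqVlt; apply/orP; left; apply/eqP; ring.
Qed.

End Weighted.

(** * Gaussian sums over orbital centres *)

Section Gaussian.
Variables (R : realType) (Rc ell : R).
Hypotheses (Rc0 : 0 < Rc) (ell0 : 0 < ell).

(** A real centre u is replaced by its integer part f: (x - f)^2 <= 2(u - x)^2 + 2 halves the rate
    and costs a factor e^b. *)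
Lemma gauss_real (b : R) : 0 < b -> exists C : R, 1 <= C /\ forall (r : seq int) (u : R), uniq r ->
  \sum_(m <- r) expR (- (b * (u - m%:~R) ^+ 2)) <= C.
Proof.
move=> b0; have b2 : 0 < b / 2 by rewrite divr_gt0.
have [th [th0 H]] := gauss_sum b2.
exists (1 + expR b * th); split; first by rewrite lerDl mulr_ge0 ?expR_ge0 //; lra.
move=> r u ur; apply: ler_wpDl => //; apply: le_trans (ler_wpM2l (expR_ge0 _) (H r (Num.floor u) ur)).
rewrite mulr_sumr; apply: ler_sum => m _; rewrite /gs -expRD ler_expR intrD mulrNz.
have f1 : (Num.floor u)%:~R <= u by apply: ge_floor.
have f2 : u < (Num.floor u)%:~R + 1 by have := lt_succ_floor u; rewrite intrD.
set f : R := (Num.floor u)%:~R in f1 f2 *; set x : R := m%:~R.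
have h : (x - f) ^+ 2 <= 2 * (u - x) ^+ 2 + 2.
  have := sqr_ge0 (2 * u - x - f).
  have : 0 <= (1 - (u - f)) * (1 + (u - f)) by rewrite mulr_ge0 //; lra.
  lra.
have := ler_wpM2l (ltW b2) h; lra.
Qed.

Definition dl : R := ell ^+ 2 / Rc.

Lemma dl_gt0 : 0 < dl.
Proof. by rewrite divr_gt0 // exprn_gt0. Qed.

Definition Gz (z : R * R) (m : int) : R := expR (- (z.1 - m%:~R * dl) ^+ 2 / (2 * ell ^+ 2)).

Lemma Gz_ge0 z m : 0 <= Gz z m. Proof. exact: expR_ge0. Qed.

Lemma nrm_phi m z : nrm (phi Rc ell m z) = Gz z m.
Proof. by rewrite /phi nrmM nrm_cis mulr1 nrm_real ?expR_ge0. Qed.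

Lemma gauss_scaled (c : R) : 0 < c -> exists C : R, 1 <= C /\ forall (r : seq int) (z : R * R), uniq r ->
  \sum_(m <- r) expR (- (z.1 - m%:~R * dl) ^+ 2 / c) <= C.
Proof.
move=> c0; have d0 := dl_gt0.
have b0 : 0 < dl ^+ 2 / c by rewrite divr_gt0 // exprn_gt0.
have [C [C1 H]] := gauss_real b0; exists C; split=> // r z ur.
apply: le_trans (H r (z.1 / dl) ur); rewrite le_eqVlt; apply/orP; left; apply/eqP; apply: eq_bigr => m _.
by congr expR; field; rewrite !gt_eqF.
Qed.

Definition nearT (T : R) (z : R * R) (m : int) : bool := `|z.1 - m%:~R * dl| <= T.

Lemma Gz_sum : exists C : R, 1 <= C /\ forall z (r : seq int), uniq r -> \sum_(m <- r) Gz z m <= C.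
Proof.
have l0 : 0 < 2 * ell ^+ 2 by rewrite mulr_gt0 // exprn_gt0.
by have [C [C1 H]] := gauss_scaled l0; exists C; split=> // z r ur; apply: H.
Qed.

(** Half of the exponent yields the small factor e^(-T^2 / (4 ell^2)), the other half keeps the sum
    bounded. *)
Lemma Gz_tail (tau : R) : 0 < tau -> exists T : R, forall z (r : seq int), uniq r ->
  \sum_(m <- r) (~~ nearT T z m)%:R * Gz z m <= tau.
Proof.
move=> t0; have l0 : 0 < 4 * ell ^+ 2 by rewrite mulr_gt0 // exprn_gt0.
have [C [C1 H]] := gauss_scaled l0.
(* The summand 1 ensures T <= T^2, hence T^2 / (4 ell^2) >= C / tau, and 1 + v <= e^v concludes. *)
pose T := 1 + 4 * ell ^+ 2 * C / tau.
have q0 : 0 <= 4 * ell ^+ 2 * C / tau by rewrite divr_ge0 ?(ltW t0) // mulr_ge0 ?(ltW l0) //; lra.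
have T1 : 1 <= T by rewrite /T; lra.
exists T => z r ur.
apply: (@le_trans _ _ (expR (- (T ^+ 2 / (4 * ell ^+ 2))) * \sum_(m <- r) expR (- (z.1 - m%:~R * dl) ^+ 2 / (4 * ell ^+ 2)))).
  rewrite mulr_sumr; apply: ler_sum => m _; rewrite /nearT -ltNge.
  have [h|h] := ltP T _; last by rewrite mul0r mulr_ge0 ?expR_ge0.
  rewrite mul1r -expRD ler_expR; set y := z.1 - _ in h *.
  have yT : T ^+ 2 <= y ^+ 2.
    by rewrite -[y ^+ 2]real_normK ?num_real // lerXn2r ?nnegrE ?normr_ge0 //; [lra|apply: ltW].
  rewrite -subr_ge0 (_ : _ - _ = (y ^+ 2 - T ^+ 2) / (4 * ell ^+ 2)); last by field; rewrite gt_eqF.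
  by rewrite divr_ge0 ?subr_ge0 // ltW.
apply: le_trans (ler_wpM2l (expR_ge0 _) (H r z ur)) _.
rewrite expRN mulrC ler_pdivrMr ?expR_gt0 //.
apply: le_trans (ler_wpM2l (ltW t0) (expR_ge1Dx _)); rewrite mulrDr mulr1; apply: ler_wpDl; first exact: ltW.
rewrite mulrA ler_pdivlMr //.
have : T <= T ^+ 2 by rewrite expr2 ler_peMr //; lra.
have e : tau * T = tau + 4 * ell ^+ 2 * C by rewrite /T; field; rewrite gt_eqF.
move=> /(ler_wpM2l (ltW t0)); lra.
Qed.

End Gaussian.

(** * From bounds on lattice correlations to bounds on the cylinder *)

Section Kernel.
Variables (R : realType) (Rc ell : R).
Hypotheses (Rc0 : 0 < Rc) (ell0 : 0 < ell).
Local Notation phi := (phi Rc ell).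
Local Notation Gz := (Gz Rc ell).
Local Notation nearL T := (nearL (nearT Rc ell T)).

Definition kern (r : seq int) (zs zs' : seq (R * R)) (H : seq int -> seq int -> R) : R[i] :=
  \sum_(m <- seqs r (size zs)) \sum_(m' <- seqs r (size zs'))
    (H m m')%:C%C * (prodphi phi m zs * ((prodphi phi m' zs')^*)%C).

Lemma nrm_conj (z : R[i]) : nrm (z^*)%C = nrm z.
Proof. by case: z => a b; rewrite /nrm /= sqrrN. Qed.

Lemma nrm_realE (a : R) : nrm a%:C%C = `|a|.
Proof. by rewrite /nrm /= expr0n addr0 sqrtr_sqr. Qed.

Lemma nrm_prodphi m zs : nrm (prodphi phi m zs) = PG Gz zs m.
Proof.
rewrite /prodphi /PG nrm_prod; elim: zs m => [|z zs IH] [|i m]; try by rewrite /= !big_nil.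
rewrite -[zip (i :: m) _]/((i, z) :: zip m zs) -[zip (z :: zs) _]/((z, i) :: zip zs m) !big_cons IH.
by rewrite nrm_phi.
Qed.

(** Neither [K] nor [T] depends on the index set [r] or on the points, so the bounds are uniform in
    N and under translations along the axis. *)
Lemma kernel_bound n (B : R) : 0 <= B -> exists K : R, [/\ 0 < K,
  (forall r zs zs' (H : seq int -> seq int -> R), uniq r -> (size zs + size zs')%N = n ->
    (forall m m', m \in seqs r (size zs) -> m' \in seqs r (size zs') -> `|H m m'| <= B) ->
    nrm (kern r zs zs' H) <= B * K) &
  forall e : R, 0 < e -> exists2 T : R, 0 <= T &
   (forall r zs zs' (H : seq int -> seq int -> R), uniq r -> (size zs + size zs')%N = n ->
    (forall m m', m \in seqs r (size zs) -> m' \in seqs r (size zs') -> `|H m m'| <= B) ->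
    (forall m m', m \in seqs r (size zs) -> m' \in seqs r (size zs') ->
       nearL T zs m -> nearL T zs' m' -> `|H m m'| <= e) ->
    nrm (kern r zs zs' H) <= e * K)].
Proof.
move=> B0; have [C [C1 HC]] := Gz_sum Rc0 ell0.
have C0 : 0 <= C by lra.
have kb r zs zs' H : nrm (kern r zs zs' H) <= \sum_(M <- seqs r (size (zs ++ zs')))
    `|H (take (size zs) M) (drop (size zs) M)| * PG Gz (zs ++ zs') M.
  rewrite size_cat sum_seqs_cat; apply: le_trans (nrm_sum _ _ _) _.
  rewrite big_seq [leRHS]big_seq; apply: ler_sum => m /size_seqs_mem sm.
  apply: le_trans (nrm_sum _ _ _) _; apply: ler_sum => m' _.
  rewrite !nrmM nrm_realE nrm_conj !nrm_prodphi -sm take_size_cat // drop_size_cat //.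
  by rewrite /PG zip_cat // big_cat.
have mem r (zs zs' : seq (R * R)) M : M \in seqs r (size (zs ++ zs')) ->
    take (size zs) M \in seqs r (size zs) /\ drop (size zs) M \in seqs r (size zs').
  rewrite size_cat !mem_seqs => /andP[/eqP sM al].
  rewrite size_takel ?sM ?leq_addr // size_drop sM addKn !eqxx /=.
  by move: al; rewrite -{1}(cat_take_drop (size zs) M) all_cat => /andP[].
exists (2 * C ^+ n); split; first by rewrite mulr_gt0 // exprn_gt0 //; lra.
  move=> r zs zs' H ur sn HB; apply: (le_trans (kb _ _ _ _)).
  have sn' : size (zs ++ zs') = n by rewrite size_cat.
  have := @sum_PG R _ Gz C (@Gz_ge0 R Rc ell) HC r (zs ++ zs') ur; rewrite sn' => h.
  apply: (@le_trans _ _ (B * \sum_(M <- seqs r n) PG Gz (zs ++ zs') M)).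
    rewrite mulr_sumr big_seq [leRHS]big_seq; apply: ler_sum => M; rewrite -sn' => /mem[h1 h2].
    by apply: ler_wpM2r; [apply: PG_ge0 => z i; apply: Gz_ge0|apply: HB].
  have := ler_wpM2l B0 h; have : 0 <= B * C ^+ n by rewrite mulr_ge0 ?exprn_ge0.
  lra.
(* Makes the far contribution B n tau at most [e], which accounts for the 2 in the constant. *)
move=> e e0; pose tau := e / (B * n%:R + 1).
have d0 : 0 < B * n%:R + 1 by have : 0 <= B * n%:R := mulr_ge0 B0 (ler0n _ _); lra.
have t0 : 0 < tau by rewrite divr_gt0.
have [T HT] := Gz_tail Rc0 ell0 t0.
have tB : B * (n%:R * tau) <= e.
  by rewrite mulrA /tau mulrCA ler_piMr ?(ltW e0) // ler_pdivrMr // mul1r lerDl.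
have near0 z m : nearT Rc ell T z m -> nearT Rc ell (Num.max T 0) z m.
  by rewrite /nearT => h; rewrite le_max h.
exists (Num.max T 0); first by rewrite le_max lexx orbT.
move=> r zs zs' H ur sn HB He; apply: (le_trans (kb _ _ _ _)).
have sn' : size (zs ++ zs') = n by rewrite size_cat.
have := @sum_weighted R _ Gz (nearT Rc ell T) C tau (@Gz_ge0 R Rc ell) C1 (ltW t0) HC HT r (zs ++ zs')
  (fun M => `|H (take (size zs) M) (drop (size zs) M)|) e B ur (ltW e0) B0.
rewrite sn' => h; apply: le_trans (h _ _) _.
- by move=> M; rewrite -sn' => /mem[h1 h2]; apply: HB.
- move=> M; rewrite -sn' => MS; have [h1 h2] := mem _ _ _ _ _ MS => nM.
  have := nM; rewrite -(cat_take_drop (size zs) M) nearL_cat ?(size_seqs_mem h1) // => /andP[n1 n2].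
  rewrite cat_take_drop; apply: He => //.
    by apply: sub_all (n1) => x; apply: near0.
  by apply: sub_all (n2) => x; apply: near0.
have : (e + B * (n%:R * tau)) * C ^+ n <= (e + e) * C ^+ n.
  by apply: ler_wpM2r; rewrite ?exprn_ge0 // lerD2l.
lra.
Qed.

End Kernel.

(** * Clouds on either side of a gap; exchange statistics *)

Section CylinderClusters.
Variables (R : realType) (Rc ell : R) (p : nat) (kappa : nat -> R).
Hypotheses (Rc0 : 0 < Rc) (ell0 : 0 < ell) (p0 : (0 < p)%N) (kappa0 : forall N, 0 < kappa N).

Local Notation g := (gg Rc ell).
Local Notation phi := (phi Rc ell).
Local Notation c0 := (c0 Rc ell).
Local Notation orb := (orb p).
Local Notation ltk := (ltk p).
Local Notation QQ := (QQ p g).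
Local Notation kern := (kern Rc ell).
Local Notation rho := (rho Rc ell p kappa).
Local Notation dl := (dl Rc ell).
Local Notation nearT := (nearT Rc ell).
Local Notation pt := (R * R)%type.

Definition sgn (j : nat) : R[i] := (-1) ^+ j.

Lemma sgnD i j : sgn (i + j)%N = sgn i * sgn j.
Proof. exact: exprD. Qed.

Lemma sgn0 : sgn 0 = 1.
Proof. by []. Qed.

Lemma rhoE N zs zs' : size zs' = size zs -> (size zs <= N)%N ->
  rho N zs zs' = ((c0 ^+ size zs)^-1)%:C%C * kern (orb N) zs zs' (QQ N).
Proof. by move=> ss sN; rewrite rho_expand // /kern ss. Qed.

Lemma c0X_gt0 k : 0 < c0 ^+ k.
Proof. by rewrite exprn_gt0 // c0_gt0. Qed.

Lemma rho0 N : rho N [::] [::] = 1.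
Proof.
rewrite rhoE //= /kern !sum_seqs0 QQ0 // /prodphi /= !big_nil expr0 invr1 conjc1 !mulr1.
by [].
Qed.

Lemma QQ_bound_seqs k : exists B : R, 0 <= B /\ forall N m m',
  (k <= N)%N -> m \in seqs (orb N) k -> m' \in seqs (orb N) k -> `|QQ N m m'| <= B.
Proof.
have [B [B0 H]] := QQ_bound p0 (gg_gt0 Rc0 ell0) k; exists B; split=> // N m m' kN.
by rewrite !mem_seqs => /andP[/eqP h1 h2] /andP[/eqP h3 h4]; apply: H.
Qed.

Lemma rho_bound k : exists B : R, 0 <= B /\ forall N zs zs',
  size zs = k -> size zs' = k -> (k <= N)%N -> nrm (rho N zs zs') <= B.
Proof.
have [B [B0 H]] := QQ_bound_seqs k; have [K [K0 HK _]] := kernel_bound Rc0 ell0 (k + k) B0.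
exists ((c0 ^+ k)^-1 * (B * K)); split.
  by rewrite mulr_ge0 ?invr_ge0 ?(ltW (c0X_gt0 k)) // mulr_ge0 // ltW.
move=> N zs zs' s1 s2 kN; rewrite rhoE ?s1 ?s2 // nrmM nrm_realE ger0_norm ?invr_ge0 ?(ltW (c0X_gt0 k)) //.
apply: ler_wpM2l; first by rewrite invr_ge0 (ltW (c0X_gt0 k)).
by apply: HK; rewrite ?s1 ?s2 ?uniq_orb // => m m'; apply: H.
Qed.

(** One site occupies the length p dl, and [k0] is the first site strictly beyond X + T. The
    distance D leaves room for two margins T and for L + 1 sites. *)
Lemma near_cut (T : R) L : exists D : R, forall X, 0 <= X + T -> exists k0, 
  (forall m : int, m%:~R * dl <= X + T -> ltk k0 m) /\
  (forall m : int, X + D - T <= m%:~R * dl -> ~~ ltk (k0 + L) m).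
Proof.
have d0 := dl_gt0 Rc0 ell0; have pp : 0 < p%:R :> R by rewrite ltr0n.
exists (2 * T + dl * (p%:R * L.+1%:R)) => X XT.
set D := 2 * T + _; pose q := (X + T) / dl; have q0 : 0 <= q by rewrite divr_ge0 // ltW.
have qE : q * dl = X + T by rewrite divfK // gt_eqF.
have f0 : 0 <= q / p%:R by rewrite divr_ge0.
pose f := Num.floor (q / p%:R); have fn : 0 <= f by rewrite floor_ge0.
have fE : f%:~R = (absz f)%:R :> R by rewrite -{1}(gez0_abs fn).
have f1 : (absz f)%:R <= q / p%:R by rewrite -fE ge_floor.
have f2 : q / p%:R < (absz f)%:R + 1 by rewrite -fE; have := lt_succ_floor (q / p%:R); rewrite intrD.
rewrite ler_pdivlMr // in f1; rewrite ltr_pdivrMr // in f2.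
have zE (n : nat) : (p * n)%N%:Z%:~R = p%:R * n%:R :> R by rewrite -natrM.
exists (absz f).+1; split=> m h; rewrite /ltk.
  rewrite -(ltr_int R) zE; rewrite -qE ler_pM2r // in h; apply: le_lt_trans h _.
  by rewrite -[(absz f).+1%:R]natr1 mulrC.
rewrite -leNgt -(ler_int R) zE -(ler_pM2r d0); apply: le_trans h.
have e : ((absz f).+1 + L)%N%:R = (absz f)%:R + L.+1%:R :> R by rewrite addSnnS natrD.
rewrite e; have -> : X + D - T = (q + p%:R * L.+1%:R) * dl by rewrite mulrDl qE /D; ring.
by rewrite ler_pM2r // mulrDr lerD2r mulrC.
Qed.

Lemma kern_prod r A A' B B' H1 H2 :
  kern r A A' H1 * kern r B B' H2 =
  kern r (A ++ B) (A' ++ B') (fun m m' =>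
    H1 (take (size A) m) (take (size A') m') * H2 (drop (size A) m) (drop (size A') m')).
Proof.
rewrite /kern !size_cat sum_seqs_cat mulr_suml; apply: eq_big_seq => mA /size_seqs_mem sA.
rewrite mulr_sumr; apply: eq_bigr => mB _.
rewrite sum_seqs_cat mulr_suml; apply: eq_big_seq => mA' /size_seqs_mem sA'.
rewrite mulr_sumr; apply: eq_bigr => mB' _.
rewrite -sA -sA' !take_size_cat // !drop_size_cat // !prodphi_cat //.
by rewrite conjM realM; ring.
Qed.

Lemma kernB r A A' H1 H2 : kern r A A' H1 - kern r A A' H2 = kern r A A' (fun m m' => H1 m m' - H2 m m').
Proof.
rewrite /kern -sumrB; apply: eq_bigr => m _; rewrite -sumrB; apply: eq_bigr => m' _.
by rewrite -mulrBl -(rmorphB (real_complex R)).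
Qed.

Lemma orb_ge0 N (m : int) : m \in orb N -> 0 <= m%:~R * dl.
Proof. by rewrite mem_orb => /andP[h _]; rewrite mulr_ge0 ?ler0z // ltW // dl_gt0. Qed.

Lemma near_le (T X : R) (z : pt) m : nearT T z m -> z.1 <= X -> m%:~R * dl <= X + T.
Proof. by rewrite /nearT ler_norml => /andP[h _] zX; lra. Qed.

Lemma near_ge (T Y : R) (z : pt) m : nearT T z m -> Y <= z.1 -> Y - T <= m%:~R * dl.
Proof. by rewrite /nearT ler_norml => /andP[_ h] zX; lra. Qed.

(* Indices near a cloud lying left of [X] are below the window, those near a cloud right of
   [X + D] are above it; if [X + T < 0] no orbital is near the left cloud. *)
Lemma window (T D X : R) L N (A A' B B' : seq pt) m m' :
  (forall X, 0 <= X + T -> exists k0, (forall m : int, m%:~R * dl <= X + T -> ltk k0 m) /\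
     (forall m : int, X + D - T <= m%:~R * dl -> ~~ ltk (k0 + L) m)) ->
  A ++ A' <> [::] ->
  (forall z, z \in A ++ A' -> z.1 <= X) -> (forall z, z \in B ++ B' -> X + D <= z.1) ->
  m \in seqs (orb N) (size (A ++ B)) -> m' \in seqs (orb N) (size (A' ++ B')) ->
  nearL (nearT T) (A ++ B) m -> nearL (nearT T) (A' ++ B') m' ->
  exists k0, [/\ all (ltk k0) (take (size A) m), all (ltk k0) (take (size A') m'),
    all (predC (ltk (k0 + L))) (drop (size A) m) & all (predC (ltk (k0 + L))) (drop (size A') m')].
Proof.
move=> HD AA hA hB; rewrite !mem_seqs => /andP[/eqP sm om] /andP[/eqP sm' om'].
have st : size (take (size A) m) = size A by rewrite size_takel // sm size_cat leq_addr.
have st' : size (take (size A') m') = size A' by rewrite size_takel // sm' size_cat leq_addr.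
have sd : size (drop (size A) m) = size B by rewrite size_drop sm size_cat addKn.
have sd' : size (drop (size A') m') = size B' by rewrite size_drop sm' size_cat addKn.
move: om om'; rewrite -{1}(cat_take_drop (size A) m) -{1}(cat_take_drop (size A') m') !all_cat.
move=> /andP[ o1 o2] /andP[ o1' o2'].
rewrite -{1}(cat_take_drop (size A) m) -{1}(cat_take_drop (size A') m') !nearL_cat //.
move=> /andP[n1 n2] /andP[n1' n2'].
have XT : 0 <= X + T.
  case EA: A AA => [|z A0] AA.
    case EA' : A' AA => [//|z A0] _; rewrite EA' in n1' st' o1' hA.
    case: (take _ m') n1' st' o1' => // i s /= /andP[ni _] _ /andP[io _].
    by apply: le_trans (orb_ge0 io) (near_le ni _); apply: hA; rewrite EA /= inE eqxx.
  rewrite EA in n1 st o1 hA; case: (take _ m) n1 st o1 => // i s /= /andP[ni _] _ /andP[io _].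
  by apply: le_trans (orb_ge0 io) (near_le ni _); apply: hA; rewrite /= inE eqxx.
have [k0 [l r]] := HD X XT; exists k0; split.
- by apply: (nearL_all st n1) => z i zA _ ni; apply: l; apply: near_le ni _; apply: hA; rewrite mem_cat zA.
- by apply: (nearL_all st' n1') => z i zA _ ni; apply: l; apply: near_le ni _; apply: hA; rewrite mem_cat zA orbT.
- by apply: (nearL_all sd n2) => z i zA _ ni; apply: r; apply: near_ge ni _; apply: hB; rewrite mem_cat zA.
- by apply: (nearL_all sd' n2') => z i zA _ ni; apply: r; apply: near_ge ni _; apply: hB; rewrite mem_cat zA orbT.
Qed.

Lemma seqs_take (r : seq int) (k l : nat) m : m \in seqs r (k + l) -> take k m \in seqs r k /\ drop k m \in seqs r l.
Proof.
rewrite !mem_seqs => /andP[/eqP sm]; rewrite -{1}(cat_take_drop k m) all_cat => /andP[-> ->].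
by rewrite size_takel ?sm ?leq_addr // size_drop sm addKn !eqxx.
Qed.

(** Orbitals near their points lie on the two sides of a window, where [QQ_cluster] applies; all
    others have small Gaussian weight and a bounded coefficient. *)
Lemma rho_split a b (eps : R) : 0 < eps -> exists D : R, forall N (A A' B B' : seq pt) (X : R),
  size A = a -> size A' = a -> size B = b -> size B' = b -> (a + b <= N)%N ->
  (forall z, z \in A ++ A' -> z.1 <= X) -> (forall z, z \in B ++ B' -> X + D <= z.1) ->
  nrm (rho N (A ++ B) (A' ++ B') - rho N A A' * rho N B B') <= eps.
Proof.
move=> e0; have cp := c0X_gt0 (a + b).
have [B1 [B10 H1]] := QQ_bound_seqs (a + b); have [B2 [B20 H2]] := QQ_bound_seqs a.
have [B3 [B30 H3]] := QQ_bound_seqs b.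
have BB : 0 <= B1 + B2 * B3 by rewrite addr_ge0 // mulr_ge0.
have [K [K0 _ HK]] := kernel_bound Rc0 ell0 (a + b + (a + b)) BB.
pose e := eps * c0 ^+ (a + b) / K; have ep : 0 < e by rewrite divr_gt0 // mulr_gt0.
have [T T0 HT] := HK e ep.
have [L HL] := QQ_cluster p0 (gg_gt0 Rc0 ell0) a b ep.
have [D HD] := near_cut T L.
exists D => N A A' B B' X sA sA' sB sB' sN hA hB.
have aN : (a <= N)%N := leq_trans (leq_addr _ _) sN; have bN : (b <= N)%N := leq_trans (leq_addl _ _) sN.
have [a0|a0] := eqVneq a 0%N.
  move: sA sA'; rewrite a0 => /eqP; rewrite size_eq0 => /eqP -> /eqP; rewrite size_eq0 => /eqP ->.
  by rewrite rho0 mul1r subrr nrm0 ltW.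
rewrite !rhoE ?size_cat ?sA ?sA' ?sB ?sB' //.
have -> : (c0 ^- a)%:C%C * kern (orb N) A A' (QQ N) * ((c0 ^- b)%:C%C * kern (orb N) B B' (QQ N)) =
  (c0 ^- (a + b))%:C%C * (kern (orb N) A A' (QQ N) * kern (orb N) B B' (QQ N)).
  by rewrite exprD invfM realM; ring.
rewrite kern_prod -mulrBr kernB nrmM nrm_realE ger0_norm ?invr_ge0 ?(ltW cp) //.
rewrite mulrC ler_pdivrMr //.
have -> : eps * c0 ^+ (a + b) = e * K by rewrite /e divfK // gt_eqF.
apply: HT; rewrite ?uniq_orb ?size_cat ?sA ?sA' ?sB ?sB' //.
  move=> m m' hm hm'; have [t1 d1] := seqs_take hm; have [t2 d2] := seqs_take hm'.
  apply: le_trans (ler_normB _ _) _; apply: lerD; first exact: H1.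
  by rewrite normrM; apply: ler_pM => //; [apply: H2|apply: H3].
move=> m m' hm hm' nm nm'; have [t1 d1] := seqs_take hm; have [t2 d2] := seqs_take hm'.
have AA : A ++ A' <> [::].
  by move=> /(congr1 size); rewrite size_cat sA sA' /= => h; clear -h a0; lia.
have hm2 : m \in seqs (orb N) (size (A ++ B)) by rewrite size_cat sA sB.
have hm2' : m' \in seqs (orb N) (size (A' ++ B')) by rewrite size_cat sA' sB'.
have [k0 [w1 w2 w3 w4]] := window HD AA hA hB hm2 hm2' nm nm'.
rewrite sA sA' in w1 w2 w3 w4.
move: t1 t2 d1 d2; rewrite !mem_seqs => /andP[/eqP s1 o1] /andP[/eqP s2 o2] /andP[/eqP s3 o3] /andP[/eqP s4 o4].
by have := HL N k0 _ _ _ _ s1 s2 s3 s4 sN o1 o2 o3 o4 w1 w2 w3 w4; rewrite !cat_take_drop.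
Qed.

Lemma rho_unbal s a a' (eps : R) : a != a' -> 0 < eps -> exists D : R, forall N (A A' B B' : seq pt) (X : R),
  size A = a -> size A' = a' -> (a + size B)%N = s -> (a' + size B')%N = s -> (s <= N)%N ->
  (forall z, z \in A ++ A' -> z.1 <= X) -> (forall z, z \in B ++ B' -> X + D <= z.1) ->
  nrm (rho N (A ++ B) (A' ++ B')) <= eps.
Proof.
move=> aa e0; have cp := c0X_gt0 s.
have [B1 [B10 H1]] := QQ_bound_seqs s.
have [K [K0 _ HK]] := kernel_bound Rc0 ell0 (s + s) B10.
pose e := eps * c0 ^+ s / K; have ep : 0 < e by rewrite divr_gt0 // mulr_gt0.
have [T T0 HT] := HK e ep.
have [L HL] := QQ_unbal p0 (gg_gt0 Rc0 ell0) s aa ep.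
have [D HD] := near_cut T L.
exists D => N A A' B B' X sA sA' sB sB' sN hA hB.
have z1 : size (A ++ B) = s by rewrite size_cat sA.
have z2 : size (A' ++ B') = s by rewrite size_cat sA'.
rewrite rhoE ?z1 ?z2 // nrmM nrm_realE ger0_norm ?invr_ge0 ?(ltW cp) // mulrC ler_pdivrMr //.
have -> : eps * c0 ^+ s = e * K by rewrite /e divfK // gt_eqF.
apply: HT; rewrite ?uniq_orb ?z1 ?z2 //; first by move=> m m'; apply: H1.
move=> m m' hm hm' nm nm'.
have AA : A ++ A' <> [::].
  move=> /(congr1 size); rewrite size_cat sA sA' /= => h; move/eqP: aa; apply; clear -h; lia.
have hm2 : m \in seqs (orb N) (size (A ++ B)) by rewrite z1.
have hm2' : m' \in seqs (orb N) (size (A' ++ B')) by rewrite z2.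
have [k0 [w1 w2 w3 w4]] := window HD AA hA hB hm2 hm2' nm nm'.
rewrite size_cat in hm2; rewrite size_cat in hm2'.
have [t1 d1] := seqs_take hm2; have [t2 d2] := seqs_take hm2'.
move: t1 t2 d1 d2; rewrite !mem_seqs => /andP[/eqP s1 o1] /andP[/eqP s2 o2] /andP[/eqP s3 o3] /andP[/eqP s4 o4].
rewrite sA in s1 o1 o3 w1 w3 s3; rewrite sA' in s2 o2 o4 w2 w4 s4.
have := HL N k0 _ _ _ _ s1 s2 _ _ sN o1 o2 o3 o4 w1 w2 w3 w4; rewrite !cat_take_drop; apply.
  by rewrite s3.
by rewrite s4.
Qed.

Lemma bw_swap u x y v : bw p g (u ++ x :: y :: v) = (-1) ^+ p * bw p g (u ++ y :: x :: v).
Proof.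
rewrite /bw acoef_swap -!mulrA; congr (_ * (_ * expR _)).
have -> : sq2 R (u ++ [:: x, y & v]) = sq2 R (u ++ [:: y, x & v]).
  by apply: sq2_perm; rewrite perm_cat2l (perm_catCA [:: x] [:: y] v).
by rewrite !size_cat.
Qed.

Lemma QQ_swap N u x y v m' : QQ N (u ++ x :: y :: v) m' = (-1) ^+ p * QQ N (u ++ y :: x :: v) m'.
Proof.
rewrite /QQ /RR !size_cat /= !mulrA; congr (_ / _ / _); rewrite mulr_sumr; apply: eq_bigr => n _.
by rewrite -!catA !cat_cons bw_swap -mulrA.
Qed.

Lemma sum_swap (r : seq int) u x y v (s : R[i]) (f : seq int -> R[i]) :
  (forall m1 i j m2, f (m1 ++ i :: j :: m2) = s * f (m1 ++ j :: i :: m2)) ->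
  \sum_(m <- seqs r (size (u ++ x :: y :: v))) f m * prodphi phi m (u ++ x :: y :: v) =
  s * \sum_(m <- seqs r (size (u ++ y :: x :: v))) f m * prodphi phi m (u ++ y :: x :: v).
Proof.
move=> fs.
have dec a b : \sum_(m <- seqs r (size (u ++ a :: b :: v))) f m * prodphi phi m (u ++ a :: b :: v) =
  \sum_(m1 <- seqs r (size u)) \sum_(i <- r) \sum_(j <- r) \sum_(m2 <- seqs r (size v))
    f (m1 ++ i :: j :: m2) * (prodphi phi m1 u * (phi i a * (phi j b * prodphi phi m2 v))).
  rewrite size_cat sum_seqs_cat; apply: eq_big_seq => m1 /size_seqs_mem s1.
  rewrite sum_seqsS; apply: eq_bigr => i _; rewrite sum_seqsS; apply: eq_bigr => j _.
  apply: eq_bigr => m2 _; rewrite prodphi_cat //.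
  by rewrite -[prodphi phi (i :: _) _]/(\prod_(x <- (i, a) :: (j, b) :: zip m2 v) _) !big_cons.
rewrite !dec mulr_sumr; apply: eq_bigr => m1 _; rewrite exchange_big mulr_sumr.
apply: eq_bigr => j _; rewrite mulr_sumr; apply: eq_bigr => i _; rewrite mulr_sumr.
by apply: eq_bigr => m2 _; rewrite fs; ring.
Qed.

Lemma rho_swap N u x y v Z : size Z = size (u ++ x :: y :: v) -> (size Z <= N)%N ->
  rho N (u ++ x :: y :: v) Z = sgn p * rho N (u ++ y :: x :: v) Z.
Proof.
move=> sZ ZN; have sE : size (u ++ x :: y :: v) = size (u ++ y :: x :: v) by rewrite !size_cat.
rewrite !rhoE -?sE -?sZ //.
have kE w : kern (orb N) w Z (QQ N) = \sum_(m <- seqs (orb N) (size w))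
   (\sum_(m' <- seqs (orb N) (size Z)) (QQ N m m')%:C%C * ((prodphi phi m' Z)^*)%C) * prodphi phi m w.
  apply: eq_bigr => m _; rewrite mulr_suml; apply: eq_bigr => m' _.
  by rewrite -mulrA [X in _ = _ * X]mulrC.
rewrite !kE (@sum_swap _ u x y v (sgn p)); first by rewrite mulrCA.
move=> m1 i j m2; rewrite mulr_sumr; apply: eq_bigr => m' _.
rewrite QQ_swap realM mulrA; congr (_ * _ * _).
by rewrite (rmorphXn (real_complex R)) (rmorphN (real_complex R)) (rmorph1 (real_complex R)).
Qed.

Lemma sgn_sqr j : sgn j * sgn j = 1.
Proof. by rewrite -sgnD addnn -mul2n /sgn exprM sqrrN !expr1n. Qed.

Lemma nrm_sgn j : nrm (sgn j) = 1.
Proof. by rewrite /sgn nrmX nrmN nrm1 expr1n. Qed.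

Lemma conj_sgn j : ((sgn j)^*)%C = sgn j.
Proof.
elim: j => [|j IH]; first by rewrite sgn0 conjc1.
have -> : sgn j.+1 = sgn 1 * sgn j by rewrite -sgnD.
have e : sgn 1 = (-1)%:C%C by rewrite (rmorphN (real_complex R)) (rmorph1 (real_complex R)).
by rewrite conjM IH e conj_real.
Qed.

(** The sign is chosen before [N], [ws] and [Z]: reordering a cloud multiplies every correlation
    that contains it by the same factor. As a proposition about lists this is stable under adjacent
    swaps. *)
Lemma rho_perm (zs zs1 : seq pt) : perm_eq zs zs1 -> exists j, forall N ws Z,
  size Z = size (zs ++ ws) -> (size Z <= N)%N ->
  rho N (zs1 ++ ws) Z = sgn j * rho N (zs ++ ws) Z.
Proof.
move=> pz; pose F (w : seq pt) : Prop := exists j, forall N ws Z,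
  size Z = size (w ++ ws) -> (size Z <= N)%N ->
  rho N (w ++ ws) Z = sgn j * rho N (zs ++ ws) Z.
have Fz : F zs by exists 0%N => N ws Z _ _; rewrite sgn0 mul1r.
have half u x y v : F (u ++ x :: y :: v) -> F (u ++ y :: x :: v).
  move=> [j h]; exists (p + j)%N => N ws Z sZ ZN.
  have sZ' : size Z = size ((u ++ x :: y :: v) ++ ws) by rewrite sZ !size_cat.
  have := h N ws Z sZ' ZN; rewrite -!catA !cat_cons => h'.
  rewrite rho_swap ?h' ?sgnD ?mulrA //.
  by rewrite sZ -catA !cat_cons.
have inv u x y v : F (u ++ x :: y :: v) = F (u ++ y :: x :: v).
  by apply/propext; split; apply: half.
have [j h] : F zs1 by rewrite -(perm_swap_inv inv pz).
by exists j => N ws Z sZ; apply: h; rewrite sZ !size_cat (perm_size pz).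
Qed.

Lemma rho_move N u x ys w Z : size Z = size (u ++ x :: ys ++ w) -> (size Z <= N)%N ->
  rho N (u ++ x :: ys ++ w) Z = sgn (p * size ys)%N * rho N (u ++ ys ++ x :: w) Z.
Proof.
elim: ys u => [|y ys IH] u sZ ZN; first by rewrite muln0 sgn0 mul1r.
rewrite [(y :: ys) ++ w]cat_cons (rho_swap (u := u) (v := ys ++ w) sZ ZN).
have e1 : u ++ y :: x :: ys ++ w = rcons u y ++ x :: ys ++ w by rewrite cat_rcons.
have e2 : u ++ (y :: ys) ++ x :: w = rcons u y ++ ys ++ x :: w by rewrite cat_rcons.
rewrite e1 e2 IH //; first by rewrite mulrA -sgnD -mulnS.
by rewrite sZ -e1 !size_cat /= !size_cat.
Qed.

Lemma rho_block N u A B Z : size Z = size (u ++ A ++ B) -> (size Z <= N)%N ->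
  rho N (u ++ A ++ B) Z = sgn (p * (size A * size B))%N * rho N (u ++ B ++ A) Z.
Proof.
elim: A u => [|x A IH] u sZ ZN; first by rewrite mul0n muln0 sgn0 mul1r cats0.
have e1 : u ++ (x :: A) ++ B = rcons u x ++ A ++ B by rewrite cat_rcons.
rewrite e1 IH //; last by rewrite -e1.
rewrite cat_rcons rho_move //; last by rewrite sZ e1 cat_rcons !size_cat /= !size_cat; lia.
by rewrite mulrA -sgnD -mulnDr [size (x :: A)]/= mulSn addnC.
Qed.

Lemma RR_sym N m m' : size m = size m' -> RR p g N m m' = RR p g N m' m.
Proof. by move=> e; rewrite /RR e; congr (_ / _); apply: eq_bigr => n _; rewrite mulrC. Qed.

Lemma rho_conj N zs zs' : size zs' = size zs -> (size zs <= N)%N ->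
  rho N zs' zs = ((rho N zs zs')^*)%C.
Proof.
move=> ss sN; rewrite !rhoE ?ss // conjM conj_real; congr (_ * _).
rewrite /kern conj_sum exchange_big; apply: eq_big_seq => m /size_seqs_mem sm.
rewrite conj_sum; apply: eq_big_seq => m' /size_seqs_mem sm'.
rewrite conjM conj_real conjM conjcK [X in _ = _ * X]mulrC; congr (_%:C%C * _).
by rewrite /QQ RR_sym // sm sm' ss.
Qed.

(** Moving one block past the other costs the same sign in the primed and in the unprimed
    arguments. *)
Lemma rho_blocks N (A A' B B' : seq pt) : size A = size A' -> size B = size B' -> (size A + size B <= N)%N ->
  rho N (A ++ B) (A' ++ B') = rho N (B ++ A) (B' ++ A').
Proof.
move=> sA sB sN.
have z1 : size (A ++ B) = (size A + size B)%N by rewrite size_cat.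
have z2 : size (A' ++ B') = (size A + size B)%N by rewrite size_cat sA sB.
have z3 : size (B ++ A) = (size A + size B)%N by rewrite size_cat addnC.
have z4 : size (B' ++ A') = (size A + size B)%N by rewrite size_cat sA sB addnC.
rewrite (@rho_block N [::] A B (A' ++ B')) /= ?z1 ?z2 //.
rewrite (@rho_conj N (A' ++ B') (B ++ A)) ?z2 ?z3 //.
rewrite (@rho_block N [::] A' B' (B ++ A)) /= ?z2 ?z3 //.
rewrite conjM conj_sgn -(@rho_conj N (B' ++ A') (B ++ A)) ?z3 ?z4 //.
by rewrite mulrA -sA -sB sgn_sqr mul1r.
Qed.

(** The factor is the same with and without the second cloud, so it drops out of the modulus of the
    truncated correlation. *)
Lemma rho_perms (A A1 A' A1' : seq pt) : perm_eq A A1 -> perm_eq A' A1' -> size A = size A' ->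
  exists s : R[i], nrm s = 1 /\ forall N B B', size B = size B' -> (size A + size B <= N)%N ->
    rho N (A1 ++ B) (A1' ++ B') = s * rho N (A ++ B) (A' ++ B').
Proof.
move=> pA pA' sA; have [j hj] := rho_perm pA; have [j' hj'] := rho_perm pA'.
exists (sgn j * sgn j'); split; first by rewrite nrmM !nrm_sgn mulr1.
move=> N B B' sB sN; have s1 := perm_size pA; have s1' := perm_size pA'.
rewrite hj; first last.
- by rewrite size_cat -s1' -sA -sB.
- by rewrite !size_cat -s1' -sA -sB.
rewrite (@rho_conj N (A1' ++ B') (A ++ B)); first last.
- by rewrite size_cat -s1' -sA -sB.
- by rewrite !size_cat -s1' -sA -sB.
rewrite hj'; first last.
- by rewrite size_cat.
- by rewrite !size_cat -sA -sB.
rewrite conjM conj_sgn -(@rho_conj N (A' ++ B') (A ++ B)) ?mulrA //.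
- by rewrite !size_cat -sA -sB.
- by rewrite size_cat -sA -sB.
Qed.

End CylinderClusters.

(** * Interleaved clouds and the geodesic distance *)

Section Interleaved.
Variables (R : realType) (Rc ell : R) (p : nat) (kappa : nat -> R).
Hypotheses (Rc0 : 0 < Rc) (ell0 : 0 < ell) (p0 : (0 < p)%N) (kappa0 : forall N, 0 < kappa N).
Local Notation rho := (rho Rc ell p kappa).
Local Notation pt := (R * R)%type.

(** Only the distance along the axis counts, in either direction, so the two clouds may
    alternate. *)
Definition sep (D : R) (A B : seq pt) : Prop := forall z w, z \in A -> w \in B -> D <= `|z.1 - w.1|.

Definition Pcl (a b : nat) : Prop := forall eps : R, 0 < eps -> exists D : R,
  forall N (A A' B B' : seq pt), size A = a -> size A' = a -> size B = b -> size B' = b ->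
    (a + b <= N)%N -> sep D (A ++ A') (B ++ B') ->
    nrm (rho N (A ++ B) (A' ++ B') - rho N A A' * rho N B B') <= eps.

Lemma Pcl0 b : Pcl 0 b.
Proof.
move=> eps e0; exists 0 => N A A' B B' /eqP; rewrite size_eq0 => /eqP -> /eqP; rewrite size_eq0 => /eqP ->.
by move=> *; rewrite !cat0s (rho0 Rc0 ell0 p0 kappa0) mul1r subrr nrm0 ltW.
Qed.

Lemma Pcl_sym a b : Pcl a b -> Pcl b a.
Proof.
move=> H eps e0; have [D HD] := H eps e0; exists D => N A A' B B' sA sA' sB sB' sN sp.
rewrite (rho_blocks Rc0 ell0 p0 kappa0) ?sA ?sA' ?sB ?sB' // mulrC.
apply: HD => //; first by rewrite addnC.
by move=> z w zB wA; rewrite distrC; apply: sp.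
Qed.

(** The bound 1 <= D makes weak inequalities between axial coordinates strict in [peel]. *)
Lemma fin_max (I : eqType) (r : seq I) (Q : I -> R -> Prop) :
  (forall i, i \in r -> exists D, Q i D) ->
  exists D : R, 1 <= D /\ forall i, i \in r -> exists2 D0, D0 <= D & Q i D0.
Proof.
elim: r => [|i r IH] h; first by exists 1.
have [j jr|D [D1 HD]] := IH; first by apply: h; rewrite inE jr orbT.
have [D' Q'] := h i (mem_head _ _); exists (Num.max D D'); split; first by rewrite le_max D1.
move=> j; rewrite inE => /orP[/eqP ->|/HD[D0 h0 q]]; first by exists D'; rewrite ?le_max ?lexx ?orbT.
by exists D0; rewrite ?le_max ?h0.
Qed.

Definition lefts (D t : R) (A B : seq pt) : Prop :=
  (forall z, z \in A -> z.1 <= t - D) /\ (forall z, z \in B -> t <= z.1).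

(** The leftmost group is split off from all points and from the first cloud alone; what remains of
    the first cloud is separated from the second by hypothesis. *)
Lemma peel_bal a1 a2 b (eps : R) : Pcl a2 b -> 0 < eps -> exists D : R,
  forall N (A1 A1' A2 A2' B B' : seq pt) t,
    size A1 = a1 -> size A1' = a1 -> size A2 = a2 -> size A2' = a2 -> size B = b -> size B' = b ->
    (a1 + a2 + b <= N)%N -> lefts D t (A1 ++ A1') ((A2 ++ A2') ++ (B ++ B')) ->
    sep D (A2 ++ A2') (B ++ B') ->
    nrm (rho N (A1 ++ A2 ++ B) (A1' ++ A2' ++ B') - rho N (A1 ++ A2) (A1' ++ A2') * rho N B B') <= eps.
Proof.
move=> H e0; have [K1 [K10 H1]] := rho_bound Rc0 ell0 p0 kappa0 a1; have [K2 [K20 H2]] := rho_bound Rc0 ell0 p0 kappa0 b.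
pose e := eps / (1 + K1 + K2); have q0 : 0 < 1 + K1 + K2 by lra.
have ep : 0 < e by rewrite divr_gt0.
have [D1 HD1] := rho_split Rc0 ell0 p0 kappa0 a1 (a2 + b) ep.
have [D2 HD2] := rho_split Rc0 ell0 p0 kappa0 a1 a2 ep.
have [D3 HD3] := H e ep.
exists (Num.max D1 (Num.max D2 D3)); set D := Num.max D1 _.
have d1 : D1 <= D by rewrite le_max lexx.
have d2 : D2 <= D by rewrite !le_max lexx orbT.
have d3 : D3 <= D by rewrite !le_max lexx !orbT.
move=> N A1 A1' A2 A2' B B' t s1 s1' s2 s2' sB sB' sN [lA lB] sp.
have N1 : (a1 + a2 <= N)%N := leq_trans (leq_addr _ _) sN.
have lA0 D0 : D0 <= D -> forall z, z \in A1 ++ A1' -> z.1 <= t - D0.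
  by move=> dd z /lA h; apply: le_trans h _; rewrite lerD2l lerN2.
set r1 := rho N A1 A1'; set r2 := rho N A2 A2'; set r3 := rho N B B'.
set r23 := rho N (A2 ++ B) (A2' ++ B'); set r12 := rho N (A1 ++ A2) _; set r123 := rho N _ _.
have b1 : nrm (r123 - r1 * r23) <= e.
  apply: (HD1 N A1 A1' (A2 ++ B) (A2' ++ B') (t - D1)) => //.
  - by rewrite size_cat s2 sB.
  - by rewrite size_cat s2' sB'.
  - by rewrite addnA.
  - exact: lA0.
  - move=> z; rewrite subrK !mem_cat => h; apply: lB; rewrite !mem_cat.
    by case/orP: h => /orP[] ->; rewrite ?orbT.
have b2 : nrm (r12 - r1 * r2) <= e.
  apply: (HD2 N A1 A1' A2 A2' (t - D2)) => //; first exact: lA0.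
  by move=> z; rewrite subrK => h; apply: lB; rewrite mem_cat h.
have b3 : nrm (r23 - r2 * r3) <= e.
  apply: HD3 => //; first by apply: leq_trans sN; rewrite -addnA leq_addl.
  by move=> z w zA wB; apply: le_trans d3 (sp _ _ zA wB).
have k1 : nrm r1 <= K1 by apply: H1 => //; apply: leq_trans N1; apply: leq_addr.
have k3 : nrm r3 <= K2 by apply: H2 => //; apply: leq_trans sN; apply: leq_addl.
(* Each bracket is one of the three errors, and [r1], [r3] are bounded by [K1], [K2]; hence e = eps
   / (1 + K1 + K2). *)
have -> : r123 - r12 * r3 = (r123 - r1 * r23) + r1 * (r23 - r2 * r3) - (r12 - r1 * r2) * r3 by ring.
apply: le_trans (nrmD _ _) _; rewrite nrmN nrmM.
apply: le_trans (lerD (nrmD _ _) (lexx _)) _; rewrite nrmM.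
have m1 : nrm r1 * nrm (r23 - r2 * r3) <= K1 * e by apply: ler_pM; rewrite ?nrm_ge0.
have m2 : nrm (r12 - r1 * r2) * nrm r3 <= e * K2 by apply: ler_pM; rewrite ?nrm_ge0.
have -> : eps = e + K1 * e + e * K2 by rewrite /e; field; rewrite gt_eqF.
exact: (lerD (lerD b1 m1) m2).
Qed.

Lemma ex_min (s : seq pt) : s <> [::] -> exists2 w, w \in s & forall z, z \in s -> w.1 <= z.1.
Proof.
elim: s => // a [|b s] IH _; first by exists a; rewrite ?inE // => z; rewrite inE => /eqP ->.
have [//|w ws hw] := IH; have [wa|aw] := leP w.1 a.1.
  by exists w; rewrite 1?inE ?ws ?orbT // => z; rewrite inE => /orP[/eqP ->|/hw].
exists a; rewrite ?inE ?eqxx // => z; rewrite inE => /orP[/eqP ->|/hw h] //.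
exact: le_trans (ltW aw) h.
Qed.

(* The points of the first cloud left of the whole second cloud are split off; if the numbers of
   primed and unprimed ones differ, both terms of the difference are small. *)
Lemma peel a b (eps : R) : (0 < b)%N -> (forall a2, (a2 < a)%N -> Pcl a2 b) -> 0 < eps ->
  exists D : R, 1 <= D /\ forall N (A A' B B' : seq pt),
    size A = a -> size A' = a -> size B = b -> size B' = b -> (a + b <= N)%N ->
    sep D (A ++ A') (B ++ B') ->
    (exists2 z, z \in A ++ A' & forall w, w \in B ++ B' -> z.1 <= w.1) ->
    nrm (rho N (A ++ B) (A' ++ B') - rho N A A' * rho N B B') <= eps.
Proof.
move=> b0 IH e0; have [K2 [K20 H2]] := rho_bound Rc0 ell0 p0 kappa0 b.
pose e := eps / (1 + K2); have q0 : 0 < 1 + K2 by lra.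
have ep : 0 < e by rewrite divr_gt0.
(* How many points will be split off depends on the clouds, so the distance is made to serve all the
   finitely many possibilities. *)
have [Db [Db1 HDb]] := @fin_max _ (iota 1 a) (fun a1 D => forall N (A1 A1' A2 A2' B B' : seq pt) t,
    size A1 = a1 -> size A1' = a1 -> size A2 = (a - a1)%N -> size A2' = (a - a1)%N -> size B = b -> size B' = b ->
    (a1 + (a - a1) + b <= N)%N -> lefts D t (A1 ++ A1') ((A2 ++ A2') ++ (B ++ B')) ->
    sep D (A2 ++ A2') (B ++ B') ->
    nrm (rho N (A1 ++ A2 ++ B) (A1' ++ A2' ++ B') - rho N (A1 ++ A2) (A1' ++ A2') * rho N B B') <= eps)
  (ltac:(move=> a1; rewrite mem_iota => h; apply: peel_bal => //; apply: IH; clear -h; nlia)).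
have un s : exists D : R, 1 <= D /\ forall q, q \in [seq (i, j) | i <- iota 0 a.+1, j <- iota 0 a.+1] ->
   exists2 D0, D0 <= D & q.1 != q.2 -> forall N (A A' B B' : seq pt) (X : R),
  size A = q.1 -> size A' = q.2 -> (q.1 + size B)%N = s -> (q.2 + size B')%N = s -> (s <= N)%N ->
  (forall z, z \in A ++ A' -> z.1 <= X) -> (forall z, z \in B ++ B' -> X + D0 <= z.1) ->
  nrm (rho N (A ++ B) (A' ++ B')) <= e.
  apply: fin_max => -[i j] _ /=; have [ij|ij] := boolP (i != j); last by exists 0.
  by have [D HD] := rho_unbal Rc0 ell0 p0 kappa0 s ij ep; exists D.
have [Du1 [Du11 Hu1]] := un (a + b)%N; have [Du2 [Du21 Hu2]] := un a.
exists (Num.max Db (Num.max Du1 Du2)); set D := Num.max Db _.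
have d1 : Db <= D by rewrite le_max lexx.
have d2 : Du1 <= D by rewrite !le_max lexx orbT.
have d3 : Du2 <= D by rewrite !le_max lexx !orbT.
have D1 : 1 <= D by apply: le_trans d1.
split=> // N A A' B B' sA sA' sB sB' sN sp [z0 z0A z0B].
have Bn : B ++ B' <> [::] by move=> /(congr1 size); rewrite size_cat sB sB' /= => h; clear -h b0; lia.
have [w0 w0B w0m] := ex_min Bn; pose t := w0.1.
pose f (z : pt) := z.1 < t.
pose A1 := seq.filter f A; pose A2 := seq.filter (predC f) A.
pose A1' := seq.filter f A'; pose A2' := seq.filter (predC f) A'.
have pA : perm_eq A (A1 ++ A2) by rewrite perm_sym perm_filterC.
have pA' : perm_eq A' (A1' ++ A2') by rewrite perm_sym perm_filterC.
have l1 z : z \in A1 ++ A1' -> z.1 <= t - D.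
  rewrite mem_cat !mem_filter => h.
  have [fz zA] : f z /\ z \in A ++ A' by rewrite mem_cat; case/orP: h => /andP[-> ->]; rewrite ?orbT.
  have := sp _ _ zA w0B; rewrite ler0_norm; last by rewrite subr_le0 ltW.
  by rewrite /f /t in fz *; lra.
have l2 z : z \in (A2 ++ A2') ++ (B ++ B') -> t <= z.1.
  rewrite mem_cat => /orP[|/w0m //]; rewrite mem_cat !mem_filter /= /f -leNgt.
  by case/orP => /andP[].
have ne : A1 ++ A1' <> [::].
  move=> h; have : z0 \in A1 ++ A1'.
    have fz : f z0.
      have := sp _ _ z0A w0B; have := z0B _ w0B; rewrite /f /t => h1 h2.
      rewrite lt_neqAle h1 andbT; apply/eqP => h3; move: h2; rewrite h3 subrr normr0 => h2.
      by have := le_trans D1 h2; rewrite ler10.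
    by rewrite mem_cat !mem_filter fz -mem_cat.
  by rewrite h.
have s1 : (size A1 + size A2)%N = a by rewrite -size_cat -(perm_size pA).
have s1' : (size A1' + size A2')%N = a by rewrite -size_cat -(perm_size pA').
have [s [ns hs]] := rho_perms Rc0 ell0 p0 kappa0 pA pA' (etrans sA (esym sA')).
have hAB : rho N ((A1 ++ A2) ++ B) ((A1' ++ A2') ++ B') = s * rho N (A ++ B) (A' ++ B').
  by apply: hs; rewrite ?sA ?sB ?sB'.
have hA : rho N (A1 ++ A2) (A1' ++ A2') = s * rho N A A'.
  have := hs N [::] [::] erefl; rewrite !cats0; apply; rewrite addn0 sA.
  by apply: leq_trans sN; apply: leq_addr.
have -> : nrm (rho N (A ++ B) (A' ++ B') - rho N A A' * rho N B B') =
   nrm (rho N ((A1 ++ A2) ++ B) ((A1' ++ A2') ++ B') - rho N (A1 ++ A2) (A1' ++ A2') * rho N B B').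
  by rewrite hAB hA -mulrA -mulrBr nrmM ns mul1r.
have [e1|e1] := eqVneq (size A1) (size A1').
  have a1p : size A1 \in iota 1 a.
    rewrite mem_iota; have : size (A1 ++ A1') <> 0%N by move/eqP; rewrite size_eq0 => /eqP.
    by rewrite size_cat -e1 => h; clear -h s1; lia.
  have [D0 D0D h] := HDb _ a1p; rewrite -!catA; apply: (h N A1 A1' A2 A2' B B' t) => //.
  - by clear -s1; lia.
  - by clear -s1' e1; lia.
  - by rewrite subnKC // -s1 leq_addr.
  - split=> // z /l1 zt; apply: le_trans zt _; rewrite lerD2l lerN2; exact: le_trans d1.
  - move=> z w zA wB; apply: le_trans (le_trans D0D d1) (sp _ _ _ wB).
    by move: zA; rewrite !mem_cat !mem_filter => /orP[] /andP[_ ->]; rewrite ?orbT.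
have qm : (size A1, size A1') \in [seq (i, j) | i <- iota 0 a.+1, j <- iota 0 a.+1].
  have i1 : size A1 \in iota 0 a.+1 by rewrite mem_iota; clear -s1; lia.
  have i1' : size A1' \in iota 0 a.+1 by rewrite mem_iota; clear -s1'; lia.
  by apply/allpairsP; exists (size A1, size A1').
have [E1 E1D h1] := Hu1 _ qm; have [E2 E2D h2] := Hu2 _ qm.
have lE E : E <= D -> forall z, z \in A1 ++ A1' -> z.1 <= t - E.
  by move=> dd z /l1 h; apply: le_trans h _; rewrite lerD2l lerN2.
have u1 : nrm (rho N ((A1 ++ A2) ++ B) ((A1' ++ A2') ++ B')) <= e.
  rewrite -!catA; apply: (h1 e1 N A1 A1' (A2 ++ B) (A2' ++ B') (t - E1)) => //.
  - by rewrite size_cat addnA s1 sB.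
  - by rewrite size_cat addnA s1' sB'.
  - by apply: lE; apply: le_trans d2.
  - move=> z; rewrite subrK !mem_cat => h; apply: l2; rewrite !mem_cat.
    by case/orP: h => /orP[] ->; rewrite ?orbT.
have u2 : nrm (rho N (A1 ++ A2) (A1' ++ A2')) <= e.
  apply: (h2 e1 N A1 A1' A2 A2' (t - E2)) => //.
  - by apply: leq_trans sN; apply: leq_addr.
  - by apply: lE; apply: le_trans d3.
  - by move=> z; rewrite subrK => h; apply: l2; rewrite mem_cat h.
apply: le_trans (nrmD _ _) _; rewrite nrmN nrmM.
have u3 : nrm (rho N B B') <= K2 by apply: H2 => //; apply: leq_trans sN; apply: leq_addl.
have m : nrm (rho N (A1 ++ A2) (A1' ++ A2')) * nrm (rho N B B') <= e * K2.
  by apply: ler_pM; rewrite ?nrm_ge0.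
have -> : eps = e + e * K2 by rewrite /e; field; rewrite gt_eqF.
exact: lerD.
Qed.

(** Induction on the number of points. The cloud that owns the leftmost point is peeled;
    [rho_blocks] exchanges the clouds if that is the second one. *)
Lemma Pcl_all a b : Pcl a b.
Proof.
have [n ab] : exists n, (a + b <= n)%N by exists (a + b)%N.
elim: n a b ab => [|n IH] a b ab.
  have -> : a = 0%N by clear -ab; lia.
  exact: Pcl0.
case: (posnP a) => [->|a0]; first exact: Pcl0.
case: (posnP b) => [->|b0]; first exact/Pcl_sym/Pcl0.
move=> eps e0.
have I1 a2 : (a2 < a)%N -> Pcl a2 b by move=> h; apply: IH; clear -h ab; lia.
have I2 b2 : (b2 < b)%N -> Pcl b2 a by move=> h; apply: IH; clear -h ab; lia.
have [D1 [D11 H1]] := peel b0 I1 e0; have [D2 [D21 H2]] := peel a0 I2 e0.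
exists (Num.max D1 D2) => N A A' B B' sA sA' sB sB' sN sp.
have ne : (A ++ A') ++ (B ++ B') <> [::].
  by move=> /(congr1 size); rewrite !size_cat sA sA' /= => h; clear -h a0; lia.
have [w wm wmin] := ex_min ne.
move: wm; rewrite mem_cat => /orP[wA|wB].
  apply: H1 => //.
    by move=> z y zA yB; apply: le_trans (sp _ _ zA yB); rewrite le_max lexx.
  by exists w => // y yB; apply: wmin; rewrite mem_cat yB orbT.
rewrite (rho_blocks Rc0 ell0 p0 kappa0) ?sA ?sA' ?sB ?sB' // mulrC.
apply: H2 => //; first by rewrite addnC.
  by move=> z y zA yB; rewrite distrC; apply: le_trans (sp _ _ yB zA); rewrite le_max lexx orbT.
by exists w => // y yB; apply: wmin; rewrite mem_cat yB.
Qed.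

(** The angular part of the geodesic distance is at most half the circumference, pi Rc. *)
Lemma dcyl_x (D d : R) (z w : pt) : cylZ Rc z -> cylZ Rc w -> 0 <= D -> D + pi * Rc <= d ->
  d <= dcyl Rc z w -> D <= `|z.1 - w.1|.
Proof.
move=> [z1 z2] [w1 w2] D0 Dd; rewrite /dcyl; set m := Num.min _ _ => dm.
have pp : 0 <= pi * Rc by rewrite mulr_ge0 ?pi_ge0 // ltW.
have m0 : 0 <= m.
  rewrite le_min normr_ge0 subr_ge0 ler_norml; apply/andP; split; lra.
have mp : m <= pi * Rc.
  rewrite ge_min; case: (leP `|z.2 - w.2| (pi * Rc)) => //= h; lra.
have S0 : 0 <= (z.1 - w.1) ^+ 2 + m ^+ 2 by rewrite addr_ge0 ?sqr_ge0.
have h : (D + pi * Rc) ^+ 2 <= (z.1 - w.1) ^+ 2 + m ^+ 2.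
  rewrite -[leRHS]sqr_sqrtr // lerXn2r ?nnegrE ?sqrtr_ge0 ?addr_ge0 //.
  exact: le_trans Dd dm.
have mm : m ^+ 2 <= (pi * Rc) ^+ 2 by rewrite lerXn2r ?nnegrE.
have Dp := mulr_ge0 D0 pp.
rewrite -(@ler_pXn2r _ 2) ?nnegrE // real_normK ?num_real //; lra.
Qed.

End Interleaved.

Lemma mem_pts (R : realType) (z : nat -> R * R) a k (x : R * R) :
  x \in pts z a k -> exists2 i, (a <= i < a + k)%N & x = z i.
Proof. by case/mapP => i; rewrite mem_iota => ik ->; exists i. Qed.

(* Points z_1..z_{m+n} are z 0, ..., z (m+n-1); likewise z'. *)
Theorem theorem2p3 (R : realType) (Rc ell : R) (p m n : nat)
    (kappa : nat -> R) :
  0 < Rc -> 0 < ell -> (0 < p)%N -> (forall N, 0 < kappa N) ->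
  exists (eps : R -> R) (K : R),
    eps x @[x --> +oo] --> 0 /\
    forall (N : nat) (d : R) (z z' : nat -> R * R),
      (m + n <= N)%N -> 0 < d ->
      (forall j, (j < m + n)%N -> cylZ Rc (z j) /\ cylZ Rc (z' j)) ->
      (forall i j, (i < m)%N -> (m <= j)%N -> (j < m + n)%N ->
         [/\ d <= dcyl Rc (z i) (z j), d <= dcyl Rc (z i) (z' j),
             d <= dcyl Rc (z' i) (z j) & d <= dcyl Rc (z' i) (z' j)]) ->
      ComplexField.Normc.normc
        (rho Rc ell p kappa N (pts z 0 (m + n)) (pts z' 0 (m + n))
         - rho Rc ell p kappa N (pts z 0 m) (pts z' 0 m)
           * rho Rc ell p kappa N (pts z m n) (pts z' m n))
      <= K * eps d.
Proof.
move=> Rc0 ell0 p0 kappa0.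
pose diff N z z' : R := nrm (rho Rc ell p kappa N (pts z 0 (m + n)) (pts z' 0 (m + n))
         - rho Rc ell p kappa N (pts z 0 m) (pts z' 0 m)
           * rho Rc ell p kappa N (pts z m n) (pts z' m n)).
pose adm d N (z z' : nat -> R * R) := [/\ (m + n <= N)%N,
   (forall j, (j < m + n)%N -> cylZ Rc (z j) /\ cylZ Rc (z' j)) &
   (forall i j, (i < m)%N -> (m <= j)%N -> (j < m + n)%N ->
         [/\ d <= dcyl Rc (z i) (z j), d <= dcyl Rc (z i) (z' j),
             d <= dcyl Rc (z' i) (z j) & d <= dcyl Rc (z' i) (z' j)])].
(* The rate at d will be the supremum of the deviations over all admissible data, every N included;
   independence of N is then automatic and K = 1 will do. *)
pose S d := [set v : R | exists N z z', adm d N z z' /\ v = diff N z z'].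
have szp z a k : size (pts (R := R) z a k) = k by rewrite size_map size_iota.
have [B1 [_ H1]] := rho_bound Rc0 ell0 p0 kappa0 (m + n).
have [B2 [B20 H2]] := rho_bound Rc0 ell0 p0 kappa0 m.
have [B3 [B30 H3]] := rho_bound Rc0 ell0 p0 kappa0 n.
(* Boundedness of the correlation functions, uniform in N and in the points, makes the supremum
   meaningful. *)
have ubS d : ubound (S d) (B1 + B2 * B3).
  move=> v [N [z [z' [[mnN _ _] ->]]]]; apply: le_trans (nrmD _ _) _; rewrite nrmN nrmM.
  have mN := leq_trans (leq_addr n m) mnN; have nN := leq_trans (leq_addl m n) mnN.
  apply: lerD; first by apply: H1; rewrite ?szp.
  by apply: ler_pM; rewrite ?nrm_ge0 //; [apply: H2|apply: H3]; rewrite ?szp.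
exists (fun d => reals.sup (S d)), 1; split; last first.
  move=> N d z z' mnN d0 hc hd; rewrite mul1r; apply: ub_le_sup; first by exists (B1 + B2 * B3).
  by exists N, z, z'.
apply/cvgrPdist_le => e e0.
have [D HD] := Pcl_all Rc0 ell0 p0 kappa0 m n e0.
(* Beyond this geodesic distance the distance along the axis is at least [D], by [dcyl_x]. *)
exists (Num.max D 0 + pi * Rc); split; first exact: num_real.
move=> d Dd; rewrite sub0r normrN.
have Se v : S d v -> 0 <= v <= e.
  move=> [N [z [z' [[mnN hc hd] ->]]]]; rewrite nrm_ge0 /=.
  have pE w : pts w 0 (m + n) = pts w 0 m ++ pts w m n by rewrite /pts iotaD map_cat.
  rewrite /diff !pE; apply: HD; rewrite ?szp //.
  have sx x y : cylZ Rc x -> cylZ Rc y -> d <= dcyl Rc x y -> D <= `|x.1 - y.1|.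
    move=> cx cy dd; apply: (@le_trans _ _ (Num.max D 0)); first by rewrite le_max lexx.
    apply: (dcyl_x Rc0 cx cy _ _ dd); first by rewrite le_max lexx orbT.
    exact: ltW.
  move=> x y; rewrite !mem_cat => xA yB.
  have [i im xi] : exists2 i, (i < m)%N & x = z i \/ x = z' i.
    by case/orP: xA => /mem_pts[i im ->]; exists i => //; [left|right].
  have [j jm yj] : exists2 j, (m <= j < m + n)%N & y = z j \/ y = z' j.
    by case/orP: yB => /mem_pts[j jm ->]; exists j => //; [left|right].
  case/andP: jm => mj jn; have [q1 q2 q3 q4] := hd i j im mj jn.
  have [c1 c2] := hc i (leq_trans im (leq_addr _ _)); have [c3 c4] := hc j jn.
  by case: xi yj => -> [] ->; apply: sx.
(* Without admissible data at distance d the supremum takes its default value 0. *)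
have [->|/set0P[v Sv]] := eqVneq (S d) set0; first by rewrite sup0 normr0 ltW.
have hs : has_sup (S d) by split; [exists v|exists (B1 + B2 * B3)].
rewrite ger0_norm; last first.
  by case/andP: (Se _ Sv) => v0 _; apply: le_trans v0 _; apply: ub_le_sup; [case: hs|].
by apply: ge_sup; [exists v|move=> w /Se /andP[]].
Qed.
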